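(* Let $m\ge 3$ and let $Q$ be a positive definite symmetric $m\times m$ integer matrix with even diagonal entries such that the quadratic form $q(x)=\tfrac12 x^TQx$ is primitive, and let $N$ be the level of $Q$. Let $f(z)=\theta(Q,z)-\theta(\operatorname{gen}Q,z)$. Then for every $\varepsilon>0$, \[ \langle f,f\rangle \ll_{\varepsilon} \begin{cases} \dfrac{N^{1+\varepsilon}}{(\det Q)^{1/3}} & \text{if } m=3,\\[2mm] \dfrac{N^{2+\varepsilon}}{F(Q,2)}+\dfrac{N^{1+\varepsilon}}{(\det Q)^{1/4}} & \text{if } m=4,\\[2mm] \dfrac{N^{m/2+\varepsilon}}{F\big(Q,\frac{m-1}{2}-\frac1m\big)} & \text{if } m\ge 5.\end{cases} \] Moreover, the same bounds hold for $\langle g,g\rangle$, where $g(z)=\theta(Q,z)-\theta(Q',z)$ and $Q'$ is any matrix in the same genus as $Q$.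
   Context: The level $N$ of $Q$ is the smallest positive integer such that $NQ^{-1}$ is integral with even diagonal entries. For such a matrix $R$ put $r(R,n)=\#\{x\in\mathbb Z^m: \tfrac12x^TRx=n\}$ and $\theta(R,z)=\sum_{x\in\mathbb Z^m}e(\tfrac12 x^TRxz)=\sum_{n\ge0}r(R,n)e(nz)$, $e(w)=e^{2\pi i w}$, $z$ in the upper half plane. Two such matrices are in the same genus if they are equivalent over $\mathbb Z_p$ for every prime $p$ (and over $\mathbb R$); a class is an orbit under $R\mapsto U^TRU$, $U\in GL_m(\mathbb Z)$; $o(R)=\{U\in GL_m(\mathbb Z):U^TRU=R\}$. The genus theta series is $\theta(\operatorname{gen}Q,z)=\big(\sum_{R}\frac{1}{\#o(R)}\big)^{-1}\sum_R\frac{\theta(R,z)}{\#o(R)}$, sums over a set of representatives $R$ of the classes in the genus of $Q$. The inner product is $\langle f,g\rangle=\int_{\Gamma_0(N)\backslash\mathbb H}f(z)\overline{g(z)}y^{m/2-2}\,dx\,dy$. Definition of $F(Q,s)$ for real $s\ge1$: for odd $p$, $q$ is equivalent over $\mathbb Z_p$ to $\sum_{i=1}^m p^{\nu_i(p)}u_ix_i^2$ with $u_i\in\mathbb Z_p^\times$, $\nu_i(p)\ge0$; over $\mathbb Z_2$, $q$ is equivalent to $\sum_{i=1}^{r_1}2^{\tilde\nu_i}(x_{2i-1}^2+x_{2i-1}x_{2i}+x_{2i}^2)+\sum_{i=r_1+1}^{r_2}2^{\tilde\nu_i}x_{2i-1}x_{2i}+\sum_{i=2r_2+1}^m2^{\nu_i(2)}u_ix_i^2$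 with $u_i\in\mathbb Z_2^\times$, $0\le 2r_1\le 2r_2\le m$, nonnegative integers $\tilde\nu_i,\nu_i(2)$; set $\nu_{2j}(2)=\nu_{2j-1}(2)=\tilde\nu_j$ for $j\le r_2$. Let $v_p(j)=\#\{1\le i\le m:\nu_i(p)\ge j\}$, $\mu_p(s)=\sum_{j=1}^{\operatorname{ord}_p(N)}\min(v_p(j),s)$ (with $\operatorname{ord}_p$ the $p$-adic valuation), and $F(Q,s)=2^{\min(m-2r_2,s)}\prod_{p\mid N}p^{\mu_p(s)}$. *)

(* Defs.v *)
From HB Require Import structures.
From mathcomp Require Import all_boot all_order all_algebra finmap.
From mathcomp Require Import all_classical all_reals all_analysis.
From mathcomp Require Import complex.
From mathcomp Require summability.

Set Implicit Arguments.
Unset Strict Implicit.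
Unset Printing Implicit Defensive.

Import Order.TTheory GRing.Theory Num.Theory.
Import numFieldNormedType.Exports.

Local Open Scope classical_set_scope.
Local Open Scope ring_scope.

(* Z_p as the inverse limit of the rings Z/p^k: a coherent sequence stores, for
   every k, the canonical representative of its residue modulo p^k. *)
Section PadicInt.
Variable p : nat.

Definition coherent (f : nat -> int) : Prop :=
  forall k, f k = (f k.+1 %% (p ^ k)%:Z)%Z.

Record padic_int := PadicInt { residue :> nat -> int; _ : coherent residue }.

HB.instance Definition _ := gen_eqMixin padic_int.
HB.instance Definition _ := gen_choiceMixin padic_int.

Lemma padic_int_eq (a b : padic_int) : (forall k, a k = b k) -> a = b.
Proof.
case: a b => [f Hf] [g Hg] /= /funext fg.
by subst g; congr PadicInt; exact: Prop_irrelevance.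
Qed.

Lemma residue_mod (a : padic_int) k : (a k %% (p ^ k)%:Z)%Z = a k.
Proof. by case: a => f Hf /=; rewrite Hf modz_mod. Qed.

Lemma residueS (a : padic_int) k : (a k.+1 %% (p ^ k)%:Z)%Z = a k.
Proof. by case: a => f Hf /=; rewrite [RHS]Hf. Qed.

Lemma modz_expS (x : int) k :
  ((x %% (p ^ k.+1)%:Z)%Z %% (p ^ k)%:Z)%Z = (x %% (p ^ k)%:Z)%Z.
Proof.
rewrite [in RHS](divz_eq x (p ^ k.+1)%:Z) expnS PoszM mulrA.
by rewrite modzMDl.
Qed.

Lemma coherent_of (f : nat -> int) :
  (forall k, (f k.+1 %% (p ^ k)%:Z)%Z = (f k %% (p ^ k)%:Z)%Z) ->
  coherent (fun k => (f k %% (p ^ k)%:Z)%Z).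
Proof. by move=> H k /=; rewrite modz_expS H. Qed.

Definition padic_cst (n : int) : padic_int :=
  PadicInt (@coherent_of (fun=> n) (fun=> erefl)).

Lemma padic_add_subproof (a b : padic_int) k :
  ((a k.+1 + b k.+1) %% (p ^ k)%:Z)%Z = ((a k + b k) %% (p ^ k)%:Z)%Z.
Proof. by rewrite -modzDml -modzDmr !residueS. Qed.

Definition padic_add (a b : padic_int) : padic_int :=
  PadicInt (@coherent_of (fun k => a k + b k) (padic_add_subproof a b)).

Lemma padic_opp_subproof (a : padic_int) k :
  ((- a k.+1) %% (p ^ k)%:Z)%Z = ((- a k) %% (p ^ k)%:Z)%Z.
Proof. by rewrite -modzNm residueS. Qed.

Definition padic_opp (a : padic_int) : padic_int :=
  PadicInt (@coherent_of (fun k => - a k) (padic_opp_subproof a)).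

Lemma padic_mul_subproof (a b : padic_int) k :
  ((a k.+1 * b k.+1) %% (p ^ k)%:Z)%Z = ((a k * b k) %% (p ^ k)%:Z)%Z.
Proof. by rewrite -modzMml -modzMmr !residueS. Qed.

Definition padic_mul (a b : padic_int) : padic_int :=
  PadicInt (@coherent_of (fun k => a k * b k) (padic_mul_subproof a b)).

Lemma padic_addA : associative padic_add.
Proof. by move=> a b c; apply: padic_int_eq => k /=; rewrite modzDmr modzDml addrA. Qed.

Lemma padic_addC : commutative padic_add.
Proof. by move=> a b; apply: padic_int_eq => k /=; rewrite addrC. Qed.

Lemma padic_add0 : left_id (padic_cst 0) padic_add.
Proof. by move=> a; apply: padic_int_eq => k /=; rewrite modzDml add0r residue_mod. Qed.

Lemma padic_addN : left_inverse (padic_cst 0) padic_opp padic_add.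
Proof. by move=> a; apply: padic_int_eq => k /=; rewrite modzDml addNr. Qed.

HB.instance Definition _ :=
  GRing.isZmodule.Build padic_int padic_addA padic_addC padic_add0 padic_addN.

Lemma padic_mulA : associative padic_mul.
Proof. by move=> a b c; apply: padic_int_eq => k /=; rewrite modzMmr modzMml mulrA. Qed.

Lemma padic_mulC : commutative padic_mul.
Proof. by move=> a b; apply: padic_int_eq => k /=; rewrite mulrC. Qed.

Lemma padic_mul1 : left_id (padic_cst 1) padic_mul.
Proof. by move=> a; apply: padic_int_eq => k /=; rewrite modzMml mul1r residue_mod. Qed.

Lemma padic_mulDl : left_distributive padic_mul padic_add.
Proof.
by move=> a b c; apply: padic_int_eq => k /=; rewrite modzMml modzDml modzDmr mulrDl.
Qed.

HB.instance Definition _ := GRing.Zmodule_isComPzRing.Build padic_int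
  padic_mulA padic_mulC padic_mul1 padic_mulDl.

End PadicInt.

Section IntegralForms.
Variable m : nat.
Implicit Types (Q S : 'M[int]_m).

Definition invertible_mx (A : comPzRingType) (U : 'M[A]_m) : Prop :=
  exists V : 'M[A]_m, U *m V = 1%:M /\ V *m U = 1%:M.

Definition even_posdef (R : realType) Q : Prop :=
  [/\ Q^T = Q,
      (forall i, (2 %| Q i i)%Z) &
      forall x : 'cV[R]_m, x != 0 -> 0 < (x^T *m map_mx intr Q *m x) 0 0].

(* 1/2 x^T Q x, written as a polynomial with integer coefficients so that it
   makes sense over any commutative ring; see qform_double. *)
Definition qform (A : comPzRingType) Q (x : 'cV[A]_m) : A :=
  \sum_(i < m) (Q i i %/ 2)%Z%:~R * x i 0 ^+ 2 +
  \sum_(i < m) \sum_(j < m | (i < j)%N) (Q i j)%:~R * (x i 0 * x j 0).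

Lemma qform_double (A : comPzRingType) Q (x : 'cV[A]_m) :
  Q^T = Q -> (forall i, (2 %| Q i i)%Z) ->
  qform Q x *+ 2 = (x^T *m map_mx intr Q *m x) 0 0.
Proof.
move=> symQ evQ.
pose F i j := (Q i j)%:~R * (x i 0 * x j 0).
have FC i j : F i j = F j i by rewrite /F -{1}symQ mxE [x i 0 * _]mulrC.
transitivity (\sum_(i < m) \sum_(j < m) F i j); last first.
  rewrite mxE exchange_big /=; apply: eq_bigr => j _; rewrite mxE mulr_suml.
  by apply: eq_bigr => i _; rewrite !mxE /F mulrA [x i 0 * _]mulrC.
have -> : \sum_(i < m) \sum_(j < m) F i j =
    \sum_(i < m) F i i + (\sum_(i < m) \sum_(j < m | (i < j)%N) F i j) *+ 2.
  have -> : \sum_(i < m) \sum_(j < m) F i j = \sum_(i < m) (F i i +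
      (\sum_(j < m | (i < j)%N) F i j + \sum_(j < m | (j < i)%N) F i j)).
    apply: eq_bigr => i _; rewrite (bigD1 i) //=; congr (_ + _).
    rewrite (bigID (fun j : 'I_m => (i < j)%N)) /=; congr (_ + _);
      apply: eq_bigl => j; rewrite -(inj_eq val_inj) /=; case: ltngtP => //.
  rewrite !big_split /= mulr2n; congr (_ + (_ + _)).
  rewrite (exchange_big_dep predT) //=; apply: eq_bigr => i _.
  by apply: eq_bigr => j _; rewrite FC.
rewrite /qform mulrnDl; congr (_ + _).
rewrite -sumrMnl; apply: eq_bigr => i _.
rewrite /F -{2}(divzK (evQ i)) intrM -expr2 -mulrnAl mulr_natr.
by [].
Qed.

Definition primitive_form Q : Prop := forall d : nat,
  (forall i, (d%:Z %| (Q i i %/ 2)%Z)%Z) ->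
  (forall i j : 'I_m, (i < j)%N -> (d%:Z %| Q i j)%Z) -> d = 1%N.

Definition level_multiple Q (N : nat) : Prop :=
  exists B : 'M[int]_m,
    N%:R *: invmx (map_mx intr Q : 'M[rat]_m) = map_mx intr B /\
    (forall i, (2 %| B i i)%Z).

Definition is_level Q (N : nat) : Prop :=
  [/\ (0 < N)%N, level_multiple Q N &
      forall M, (0 < M)%N -> level_multiple Q M -> (N <= M)%N].

Definition equiv_over (A : comPzRingType) Q S : Prop :=
  exists U : 'M[A]_m,
    invertible_mx U /\ U^T *m map_mx intr Q *m U = map_mx intr S.

Definition genus (R : realType) Q : set 'M[int]_m :=
  [set S | [/\ even_posdef R S,
               (forall p, prime p -> equiv_over (padic_int p) Q S) &
               equiv_over R Q S]].

Definition genus_representatives (R : realType) Q (s : {fset 'M[int]_m}) : Prop :=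
  (forall S, S \in s -> genus R Q S) /\
  (forall S, genus R Q S -> exists! T, T \in s /\ equiv_over int S T).

(* finite as soon as S is positive definite *)
Definition automorphs S : {fset 'M[int]_m} :=
  fset_set [set U | invertible_mx U /\ U^T *m S *m U = S].

Section Jordan.
(* Coordinates are numbered from 0: x_k is coordn x (k - 1), and nu_k is nu (k - 1). *)

Definition coordn (A : comPzRingType) (x : 'cV[A]_m) (k : nat) : A :=
  oapp (fun i : 'I_m => x i 0) 0 (insub k).

Definition unit_elt (A : comPzRingType) (u : A) : Prop := exists v, u * v = 1.

Definition jordan_odd (p : nat) Q (nu : nat -> nat) : Prop :=
  exists (U : 'M[padic_int p]_m) (u : nat -> padic_int p),
    [/\ invertible_mx U,
        (forall i, (i < m)%N -> unit_elt (u i)) &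
        forall x, qform Q (U *m x) =
          \sum_(0 <= i < m) (p ^ nu i)%:R * u i * coordn x i ^+ 2].

Definition jordan_two Q (nu : nat -> nat) (r2 : nat) : Prop :=
  exists (r1 : nat) (nut : nat -> nat)
    (U : 'M[padic_int 2]_m) (u : nat -> padic_int 2),
    [/\ (r1 <= r2)%N && (r2.*2 <= m)%N,
        (forall j, (j < r2)%N -> nu j.*2 = nut j /\ nu j.*2.+1 = nut j),
        invertible_mx U,
        (forall i, (r2.*2 <= i < m)%N -> unit_elt (u i)) &
        forall x, let c := coordn x in
          qform Q (U *m x) =
            \sum_(0 <= i < r1)
               (2 ^ nut i)%:R *
               (c i.*2 ^+ 2 + c i.*2 * c i.*2.+1 + c i.*2.+1 ^+ 2) +
            \sum_(r1 <= i < r2) (2 ^ nut i)%:R * (c i.*2 * c i.*2.+1) +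
            \sum_(r2.*2 <= i < m) (2 ^ nu i)%:R * u i * c i ^+ 2].

(* nu p are the exponents at p.  At 2 neither nu 2 nor r2 is determined by Q
   (three odd terms at one scale can be traded for one odd term and a binary
   block), so they are kept as data instead of being hidden behind a choice. *)
Definition local_exponents Q (nu : nat -> nat -> nat) (r2 : nat) : Prop :=
  (forall p, prime p -> odd p -> jordan_odd p Q (nu p)) /\ jordan_two Q (nu 2) r2.

Variable R : realType.
Variables (nu : nat -> nat -> nat) (r2 N : nat).

Definition vcount (p j : nat) : nat := #|[set i : 'I_m | (j <= nu p i)%N]%SET|.

Definition mu (p : nat) (s : R) : R :=
  \sum_(1 <= j < (logn p N).+1) Num.min (vcount p j)%:R s.

Definition Ffactor (s : R) : R :=
  2 `^ Num.min (m - r2.*2)%:R s * \prod_(p <- primes N) p%:R `^ mu p s.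

End Jordan.

Section Theta.
Variable R : realType.
Local Open Scope complex_scope.

Definition expi (w : R[i]) : R[i] :=
  (expR (- (2 * pi * complex.Im w)))%:C *
  (cos (2 * pi * complex.Re w) +i* sin (2 * pi * complex.Re w)).

Definition csum (I : choiceType) (u : I -> R[i]) : R[i] :=
  summability.sum (fun i => complex.Re (u i) : R) +i*
  summability.sum (fun i => complex.Im (u i) : R).

Definition theta S (z : R[i]) : R[i] :=
  csum (fun x : 'cV[int]_m => expi ((qform S x)%:~R * z)).

Definition theta_genus (s : {fset 'M[int]_m}) (z : R[i]) : R[i] :=
  (\sum_(S <- s) (#|` automorphs S|)%:R^-1)^-1 *
  \sum_(S <- s) theta S z / (#|` automorphs S|)%:R.

End Theta.
End IntegralForms.

Section Petersson.
Variable R : realType.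
Local Open Scope complex_scope.

Definition Gamma0 (N : nat) : set 'M[int]_2 :=
  [set g : 'M[int]_2 | \det g = 1 /\ (N%:Z %| (g 1 0)%R)%Z].

Definition to_complex (z : R * R) : R[i] := z.1 +i* z.2.

Definition moebius (g : 'M[int]_2) (z : R[i]) : R[i] :=
  ((g 0 0)%:~R * z + (g 0 1)%:~R) / ((g 1 0)%:~R * z + (g 1 1)%:~R).

Definition upper_half_plane : set (R * R) := [set z | 0 < z.2].

(* a measurable set containing exactly one point of each orbit of Gamma0(N) on
   the upper half plane; integrating over the quotient is integrating over it *)
Definition fundamental_domain (N : nat) (D : set (R * R)) : Prop :=
  [/\ measurable D, D `<=` upper_half_plane &
      forall z, upper_half_plane z ->
        exists! w, D w /\ exists2 g, Gamma0 N g &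
          to_complex w = moebius g (to_complex z)].

Definition petersson_integrand (k : R) (f g : R[i] -> R[i]) (z : R * R) : R[i] :=
  f (to_complex z) * conjc (g (to_complex z)) * (z.2 `^ (k - 2))%:C.

Definition lebesgue2 := (@lebesgue_measure R \x @lebesgue_measure R)%E.

Definition petersson_integrable (D : set (R * R)) (k : R) (f g : R[i] -> R[i]) : Prop :=
  lebesgue2.-integrable D
    (fun z => (complex.Re (petersson_integrand k f g z))%:E) /\
  lebesgue2.-integrable D
    (fun z => (complex.Im (petersson_integrand k f g z))%:E).

Definition petersson (D : set (R * R)) (k : R) (f g : R[i] -> R[i]) : R[i] :=
  Rintegral lebesgue2 D (fun z => complex.Re (petersson_integrand k f g z)) +i*
  Rintegral lebesgue2 D (fun z => complex.Im (petersson_integrand k f g z)).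

(* Rintegral is 0 on divergent integrals, hence the first conjunct *)
Definition petersson_norm_le (D : set (R * R)) (k : R) (f : R[i] -> R[i]) (B : R) : Prop :=
  petersson_integrable D k f f /\ petersson D k f f <= B%:C.

End Petersson.

Definition norm_bound (R : realType) (m N : nat) (d : R) (F : R -> R) (eps : R) : R :=
  if m == 3%N then N%:R `^ (1 + eps) / d `^ (1 / 3)
  else if m == 4%N then
    N%:R `^ (2 + eps) / F 2 + N%:R `^ (1 + eps) / d `^ (1 / 4)
  else N%:R `^ (m%:R / 2 + eps) / F ((m%:R - 1) / 2 - 1 / m%:R).

(* Main.v *)
(* It suffices to bound f = theta(Q) - theta(S) for one S in the genus of Q, by
   Jensen's inequality.  Let z -> |f(z)|^2 Im(z)^(m/2) be summed over the coset
   representatives g = (a b; c d) of Gamma_0(N) \ SL_2(Z), at a point w of a Siegel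
   set; only c | N and d mod N/c matter.  Poisson summation expands theta(Q, g w) as
   a series over the dual lattice, with Gauss sums G(y) as coefficients, and G(0)
   depends only on the genus, so the constant term of f vanishes.  By the Smith form
   Q = A diag(e) B, with gcd(e_i, c) f_i = e_i, the y with G(y) <> 0 lie in a coset
   of a lattice whose Gram matrix for Q^-1 is diag(1/f) times an integer matrix, and
   |G(y)|^2 is constant there.  Averaging over w + j, j < N, is a discrete Parseval
   formula: it leaves sum_r |B_r|^2 <= max |B_r| sum |B_r|, where B_r collects the y
   with N q*(y) = r mod N.  In a reduced basis with orthogonalized squared lengths
   d_i, the number of representations by the first two coordinates is O(N^eps),
   which saves a factor (1 + (Y d_i)^(-1/2)) for i = 1, 2 in the maximum, while the
   product of the first a of the d_i is at least 1 / (product of the a largest f_i).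
   What remains is an inequality between products of the e_i, with
   F(Q, s) <= 2^m prod e_i^(w_i), w_i = min(max(s - i, 0), 1) for decreasing e_i,
   and the integral of Y^(-1-eps) over the Siegel set. *)
Require Import Defs.
From HB Require Import structures.
From mathcomp Require Import all_boot all_order all_algebra finmap.
From mathcomp Require Import all_classical all_reals all_analysis.
From mathcomp Require Import complex measurable_realfun.
From mathcomp Require summability.
From mathcomp Require Import ring lra zify.

Set Implicit Arguments.
Unset Strict Implicit.
Unset Printing Implicit Defensive.

Import Order.TTheory GRing.Theory Num.Theory.
Import numFieldNormedType.Exports.

Local Open Scope classical_set_scope.
Local Open Scope ring_scope.

(** Only $|f|^2\operatorname{Im}(z)^{m/2}$ enters, so no square root and no character is ever
    computed. The Poisson constant of the Gaussian $e^{-\pi t x^2}$ stays abstract, and its modulus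
    $|t|^{-1/2}$ is forced by its behaviour under $t \mapsto td$, $\bar t$ and $1/t$. Poisson
    summation is proved from Riemann sums and finite Fourier analysis, hence at rational shifts
    only; the forms are integral, so these suffice. Invariance under $\Gamma_0(N)$ comes from the
    same transformation formula in the case $N \mid c$. The support of $G$ is a coset that may miss
    0, so its short vectors cannot be compared with the lattice directly; but $2y$ lies in the
    lattice, which yields the decay $e^{-Yd_1/8}$ needed when all $Yd_i$ are large. The exponent
    $\kappa$ of [kappa] serves two needs: it dominates the average weight of the $d_i$, and it
    brings $Y^{m/2}$ down to the first power. The remaining saving $Y^{-\varepsilon}$ comes from
    $e^{-Y/N}$. The invariance of $dx\,dy/y^2$ under $z \mapsto -1/(cz)$ is reduced to that of
    $dy/y$ along the rays $x = ky$. *)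

HB.lock Definition cabs (R : realType) (z : complex R) : R := ComplexField.Normc.normc z.
HB.lock Definition tsum (R : realType) (I : choiceType) (u : I -> complex R) : complex R :=
  csum u.

(** * The modulus of a complex number *)

Section Cabs.
Variable R : realType.
Local Open Scope complex_scope.
Implicit Types (z w : R[i]).

Lemma cabsE z : cabs z = Num.sqrt (complex.Re z ^+ 2 + complex.Im z ^+ 2).
Proof. by rewrite cabs.unlock; case: z. Qed.

Lemma cabs0 : cabs (0 : R[i]) = 0. Proof. rewrite cabs.unlock; exact: ComplexField.Normc.normc0. Qed.
Lemma cabs1 : cabs (1 : R[i]) = 1. Proof. rewrite cabs.unlock; exact: ComplexField.Normc.normc1. Qed.
Lemma cabsM z w : cabs (z * w) = cabs z * cabs w.
Proof. rewrite cabs.unlock; exact: ComplexField.Normc.normcM. Qed.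
Lemma cabsV z : cabs z^-1 = (cabs z)^-1.
Proof. rewrite cabs.unlock; exact: ComplexField.Normc.normcV. Qed.
Lemma cabsN z : cabs (- z) = cabs z. Proof. rewrite cabs.unlock; exact: normcN. Qed.
Lemma cabsD z w : cabs (z + w) <= cabs z + cabs w. Proof. rewrite cabs.unlock; exact: le_normcD. Qed.
Lemma cabs_ge0 z : 0 <= cabs z. Proof. by rewrite cabsE sqrtr_ge0. Qed.
Lemma cabs_eq0 z : cabs z = 0 -> z = 0.
Proof. rewrite cabs.unlock; exact: ComplexField.Normc.eq0_normc. Qed.
Lemma cabs_gt0 z : z != 0 -> 0 < cabs z.
Proof.
move=> z0; rewrite lt_neqAle cabs_ge0 andbT eq_sym.
by apply: contra z0 => /eqP /cabs_eq0 ->.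
Qed.
Lemma cabsB z w : cabs (z - w) <= cabs z + cabs w.
Proof. by rewrite -(cabsN w) cabsD. Qed.
Lemma cabsX z n : cabs (z ^+ n) = cabs z ^+ n.
Proof. by elim: n => [|n IH]; rewrite ?expr0 ?cabs1 // !exprS cabsM IH. Qed.
Lemma cabs_real (x : R) : cabs (x%:C : R[i]) = `|x|.
Proof. by rewrite cabsE /= expr0n addr0 sqrtr_sqr. Qed.
Lemma cabs_sqr z : cabs z ^+ 2 = complex.Re z ^+ 2 + complex.Im z ^+ 2.
Proof. by rewrite cabsE sqr_sqrtr // addr_ge0 ?sqr_ge0. Qed.
Lemma cabs_conj z : cabs (conjc z) = cabs z.
Proof. by case: z => a b; rewrite !cabsE /= sqrrN. Qed.
Lemma cabs_Re z : `|complex.Re z| <= cabs z.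
Proof. by rewrite -sqrtr_sqr cabsE ler_sqrt ?addr_ge0 ?sqr_ge0 // lerDl sqr_ge0. Qed.
Lemma cabs_Im z : `|complex.Im z| <= cabs z.
Proof. by rewrite -sqrtr_sqr cabsE ler_sqrt ?addr_ge0 ?sqr_ge0 // lerDr sqr_ge0. Qed.
Lemma cabs_i : cabs ('i : R[i]) = 1. Proof. by rewrite cabsE /= expr0n add0r expr1n sqrtr1. Qed.
Lemma complexRI z : z = (complex.Re z)%:C + 'i * (complex.Im z)%:C.
Proof. exact: complexE. Qed.
Lemma cabs_nat n : cabs (n%:R : R[i]) = n%:R.
Proof. by rewrite -[n%:R](rmorph_nat (real_complex R)) cabs_real ger0_norm. Qed.

Lemma cabs_sum (I : Type) (r : seq I) (P : pred I) (F : I -> R[i]) :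
  cabs (\sum_(i <- r | P i) F i) <= \sum_(i <- r | P i) cabs (F i).
Proof.
elim/big_ind2: _ => [|x a y b xa yb|//]; first by rewrite cabs0.
by rewrite (le_trans (cabsD _ _)) // lerD.
Qed.

Lemma Re_sum (I : Type) (r : seq I) (P : pred I) (F : I -> R[i]) :
  complex.Re (\sum_(i <- r | P i) F i) = \sum_(i <- r | P i) complex.Re (F i).
Proof. by apply: (big_morph (@complex.Re R)) => // -[a b] [c d]. Qed.
Lemma Im_sum (I : Type) (r : seq I) (P : pred I) (F : I -> R[i]) :
  complex.Im (\sum_(i <- r | P i) F i) = \sum_(i <- r | P i) complex.Im (F i).
Proof. by apply: (big_morph (@complex.Im R)) => // -[a b] [c d]. Qed.

End Cabs.

Lemma uniq_fset_sum (I : choiceType) (V : nmodType) (s : seq I) (F : I -> V) :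
  uniq s -> \sum_(i <- s) F i = \sum_(i <- [fset i in s]%fset) F i.
Proof.
move=> us; apply: perm_big; rewrite perm_sym.
by apply: uniq_perm => // i; rewrite in_fset_/=.
Qed.

(** * Absolutely convergent sums *)

Section Hsum.
Variable R : realType.
Local Open Scope complex_scope.
Local Open Scope fset_scope.
Local Open Scope ring_scope.

(** Unconditional convergence, along the directed set of finite subsets, stated with the complex
    modulus. *)
Definition hsum (I : choiceType) (u : I -> R[i]) (l : R[i]) : Prop :=
  forall e : R, 0 < e -> exists A : {fset I}, forall B : {fset I}, A `<=` B ->
    cabs (\sum_(i <- B) u i - l) <= e.

(** Carries a bound instead of a value: for nonnegative terms the later estimates only track one
    number that dominates every finite partial sum. *)
Definition asum (I : choiceType) (u : I -> R) (M : R) : Prop :=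
  (forall i, 0 <= u i) /\ forall A : {fset I}, \sum_(i <- A) u i <= M.

Definition summ (I : choiceType) (u : I -> R[i]) : Prop :=
  exists M, asum (fun i => cabs (u i)) M.

Lemma hsum_tsum (I : choiceType) (u : I -> R[i]) l : hsum u l -> tsum u = l.
Proof.
have FF := @summability.totally_filter I.
move=> h; case: l h => a b h; rewrite tsum.unlock /csum; congr (_ +i* _).
- apply: cvg_lim => //; apply/cvgrPdist_le => e e0.
  have [A hA] := h e e0; exists A => // B AB /=.
  rewrite /summability.partial_sum -(big_seq_fsetE _ _ predT (fun i => complex.Re (u i))) /=.
  rewrite distrC (le_trans _ (hA B AB)) //; rewrite (le_trans _ (cabs_Re _)) //.
  by rewrite -Re_sum; case: (\sum_(i <- B) u i).
- apply: cvg_lim => //; apply/cvgrPdist_le => e e0.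
  have [A hA] := h e e0; exists A => // B AB /=.
  rewrite /summability.partial_sum -(big_seq_fsetE _ _ predT (fun i => complex.Im (u i))) /=.
  rewrite distrC (le_trans _ (hA B AB)) //; rewrite (le_trans _ (cabs_Im _)) //.
  by rewrite -Im_sum; case: (\sum_(i <- B) u i).
Qed.

Lemma fset_sumU (I : choiceType) (V : nmodType) (A B : {fset I}) (F : I -> V) :
  A `<=` B -> \sum_(i <- B) F i = \sum_(i <- A) F i + \sum_(i <- B `\` A) F i.
Proof.
move=> AB; rewrite (big_fsetID _ (mem A)) /=; congr (_ + _); apply: eq_fbigl => i.
  by rewrite !inE /= andb_idl // => /(fsubsetP AB).
by rewrite !inE /= andbC.
Qed.

Lemma ler_fset_sum (I : choiceType) (A B : {fset I}) (F : I -> R) :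
  A `<=` B -> (forall i, 0 <= F i) -> \sum_(i <- A) F i <= \sum_(i <- B) F i.
Proof. by move=> AB F0; rewrite (fset_sumU _ AB) lerDl sumr_ge0. Qed.

Lemma sum_const_fset (I : choiceType) (A : {fset I}) (e : R) : 0 <= e ->
  \sum_(i <- A) (e / (1 + #|` A|%:R)) <= e.
Proof.
move=> e0; have -> : \sum_(i <- A) (e / (1 + #|` A|%:R)) = (e / (1 + #|` A|%:R)) *+ #|` A|.
  by rewrite big_const_seq count_predT iter_addr_0.
rewrite -mulr_natr -mulrA ler_piMr // mulrC.
by rewrite ler_pdivrMr ?ltr_pwDl // mul1r lerDr.
Qed.

Lemma asum_le (I : choiceType) (u v : I -> R) M :
  (forall i, 0 <= u i <= v i) -> asum v M -> asum u M.
Proof.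
move=> uv [v0 hv]; split=> [i|A]; first by case/andP: (uv i).
by rewrite (le_trans _ (hv A)) // ler_sum // => i _; case/andP: (uv i).
Qed.

Lemma asum_leM (I : choiceType) (u : I -> R) M M' : M <= M' -> asum u M -> asum u M'.
Proof. by move=> MM [u0 hu]; split=> // A; rewrite (le_trans (hu A)). Qed.

Lemma asum_ge0 (I : choiceType) (u : I -> R) M : asum u M -> 0 <= M.
Proof. by case=> _ /(_ fset0); rewrite big_seq_fset0. Qed.

Lemma asumD (I : choiceType) (u v : I -> R) M M' :
  asum u M -> asum v M' -> asum (fun i => u i + v i) (M + M').
Proof.
move=> [u0 hu] [v0 hv]; split=> [i|A]; first by rewrite addr_ge0.
by rewrite big_split lerD.
Qed.

Lemma asumZ (I : choiceType) (u : I -> R) M k : 0 <= k ->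
  asum u M -> asum (fun i => k * u i) (k * M).
Proof.
move=> k0 [u0 hu]; split=> [i|A]; first by rewrite mulr_ge0.
by rewrite -mulr_sumr ler_wpM2l.
Qed.

Lemma asum_inj (I J : choiceType) (h : J -> I) (u : I -> R) M :
  injective h -> asum u M -> asum (u \o h) M.
Proof.
move=> hi [u0 hu]; split=> [j|A] /=; first exact: u0.
rewrite (le_trans _ (hu [fset h j | j in A])) // big_imfset //=.
by move=> x y _ _ /hi.
Qed.

Definition fprod (I J : choiceType) (A : {fset I}) (B : {fset J}) : {fset (I * J)%type} :=
  [fset x in [seq (i, j) | i <- A, j <- B]].

Lemma in_fprod (I J : choiceType) (A : {fset I}) (B : {fset J}) x :
  (x \in fprod A B) = (x.1 \in A) && (x.2 \in B).
Proof.
rewrite in_fset_/=; apply/allpairsP/andP => [[[a b] /= [aA bB ->]] //|[xA xB]].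
by exists x; split=> //; case: x {xA xB}.
Qed.

Lemma sum_fprod (I J : choiceType) (V : nmodType) (A : {fset I}) (B : {fset J})
    (F : I * J -> V) :
  \sum_(x <- fprod A B) F x = \sum_(i <- A) \sum_(j <- B) F (i, j).
Proof.
rewrite /fprod -uniq_fset_sum; first by rewrite big_allpairs_dep.
by apply: allpairs_uniq => // -[a b] [c d].
Qed.

Lemma fprod_sup (I J : choiceType) (A : {fset (I * J)%type}) :
  A `<=` fprod [fset x.1 | x in A] [fset x.2 | x in A].
Proof.
apply/fsubsetP => x xA; rewrite in_fprod.
by apply/andP; split; apply/imfsetP; exists x.
Qed.

Lemma asum_prod (I J : choiceType) (u : (I * J)%type -> R) (v : I -> R) M :
  (forall i, asum (fun j => u (i, j)) (v i)) -> asum v M -> asum u M.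
Proof.
move=> hu [v0 hv].
have u0 x : 0 <= u x by case: x => i j; case: (hu i) => /(_ j).
split=> // A.
rewrite (le_trans (ler_fset_sum (fprod_sup A) u0)) // sum_fprod.
rewrite (le_trans _ (hv [fset x.1 | x in A])) // ler_sum // => i _.
by case: (hu i) => _; apply.
Qed.

Lemma asum_row (I J : choiceType) (u : (I * J)%type -> R) M i :
  asum u M -> asum (fun j => u (i, j)) M.
Proof. by move=> h; apply: (asum_inj (h := fun j => (i, j)) _ h) => x y []. Qed.

Lemma hsumD (I : choiceType) (u v : I -> R[i]) l l' :
  hsum u l -> hsum v l' -> hsum (fun i => u i + v i) (l + l').
Proof.
move=> h h' e e0; have e2 : 0 < e / 2 by rewrite divr_gt0.
have [A hA] := h _ e2; have [B hB] := h' _ e2.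
exists (A `|` B) => D; rewrite fsubUset => /andP[AD BD].
rewrite big_split /= opprD addrACA (le_trans (cabsD _ _)) // (splitr e) lerD //.
  exact: hA.
exact: hB.
Qed.

Lemma hsumZ (I : choiceType) (u : I -> R[i]) l k :
  hsum u l -> hsum (fun i => k * u i) (k * l).
Proof.
move=> h e e0; have e2 : 0 < e / (1 + cabs k).
  by rewrite divr_gt0 // ltr_pwDl // cabs_ge0.
have [A hA] := h _ e2; exists A => B /hA hB.
rewrite -mulr_sumr -mulrBr cabsM.
rewrite (le_trans (ler_wpM2l (cabs_ge0 _) hB)) // mulrCA ger_pMr //.
by rewrite ler_pdivrMr ?mul1r ?lerDr // ltr_pwDl // cabs_ge0.
Qed.

Lemma hsumB (I : choiceType) (u v : I -> R[i]) l l' :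
  hsum u l -> hsum v l' -> hsum (fun i => u i - v i) (l - l').
Proof.
move=> h /(hsumZ (-1)) h'; have := hsumD h h'; rewrite mulN1r.
by congr hsum; apply/funext => i; rewrite mulN1r.
Qed.

Lemma hsum_pos (I : choiceType) (y : I -> R) M : asum y M ->
  exists l, hsum (fun i => (y i)%:C) l%:C.
Proof.
move=> [y0 hy]; pose E := [set \sum_(i <- A) y i | A in [set: {fset I}]].
have hE : has_sup E.
  split; first by exists (\sum_(i <- (fset0 : {fset I})) y i), fset0.
  by exists M => _ [A _ <-].
exists (sup E) => e e0.
have [_ [A _ <-] hA] := sup_adherent e0 hE.
exists A => B AB; rewrite -rmorph_sum -rmorphB cabs_real /=.
have hB : \sum_(i <- B) y i <= sup E by apply: ub_le_sup; [exact: hE.2|exists B].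
rewrite distrC ger0_norm ?subr_ge0 // lerBlDr -lerBlDl.
by rewrite (le_trans (ltW hA)) // ler_fset_sum.
Qed.

(** Reduced to nonnegative terms: $|u| + \operatorname{Re} u$, $|u| + \operatorname{Im} u$ and $|u|$
    converge to the suprema of their partial sums, and $|u|$ is then subtracted. *)
Lemma summ_hsum (I : choiceType) (u : I -> R[i]) : summ u -> hsum u (tsum u).
Proof.
move=> [M hM]; suff [l hl] : exists l, hsum u l by rewrite (hsum_tsum hl).
have hR : asum (fun i => cabs (u i) + complex.Re (u i)) (M + M).
  split=> [i|A].
    by have := cabs_Re (u i); rewrite ler_norml -lerBlDl sub0r => /andP[].
  rewrite big_split /= lerD //; first by case: hM.
  rewrite (le_trans _ (hM.2 A)) // ler_sum // => i _.
  by rewrite (le_trans (ler_norm _)) // cabs_Re.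
have hI : asum (fun i => cabs (u i) + complex.Im (u i)) (M + M).
  split=> [i|A].
    by have := cabs_Im (u i); rewrite ler_norml -lerBlDl sub0r => /andP[].
  rewrite big_split /= lerD //; first by case: hM.
  rewrite (le_trans _ (hM.2 A)) // ler_sum // => i _.
  by rewrite (le_trans (ler_norm _)) // cabs_Im.
have [l1 h1] := hsum_pos hR; have [l2 h2] := hsum_pos hI; have [l3 h3] := hsum_pos hM.
exists ((l1%:C - l3%:C) + 'i * (l2%:C - l3%:C)).
have -> : u = fun i => ((cabs (u i) + complex.Re (u i))%:C - (cabs (u i))%:C) +
    'i * ((cabs (u i) + complex.Im (u i))%:C - (cabs (u i))%:C).
  apply/funext => i; rewrite {1}(complexRI (u i)).
  by move: (complex.Re _) (complex.Im _) (cabs _) => x y z; ring.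
exact: hsumD (hsumB h1 h3) (hsumZ 'i (hsumB h2 h3)).
Qed.

Lemma tsum_eq (I : choiceType) (u v : I -> R[i]) : (forall i, u i = v i) -> tsum u = tsum v.
Proof. by move=> /funext ->. Qed.

Lemma hsum_cabs_le (I : choiceType) (u : I -> R[i]) l M :
  asum (fun i => cabs (u i)) M -> hsum u l -> cabs l <= M.
Proof.
move=> [u0 hM] h; apply/ler_addgt0Pl => e e0; have [A hA] := h e e0.
have {hA} := hA A (fsubset_refl _); set s := \sum_(i <- A) _ => hs.
have -> : l = (l - s) + s by rewrite subrK.
rewrite (le_trans (cabsD _ _)) // lerD //; first by rewrite -cabsN opprB.
by rewrite (le_trans (cabs_sum _ _ _)).
Qed.

Lemma tsum_le (I : choiceType) (u : I -> R[i]) M :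
  asum (fun i => cabs (u i)) M -> cabs (tsum u) <= M.
Proof. by move=> h; apply: (hsum_cabs_le h); apply: summ_hsum; exists M. Qed.

Lemma summD (I : choiceType) (u v : I -> R[i]) :
  summ u -> summ v -> summ (fun i => u i + v i).
Proof.
move=> [M hM] [M' hM']; exists (M + M'); apply: asum_le (asumD hM hM') => i.
by rewrite cabs_ge0 cabsD.
Qed.

Lemma summZ (I : choiceType) (u : I -> R[i]) k : summ u -> summ (fun i => k * u i).
Proof.
move=> [M hM]; exists (cabs k * M).
apply: asum_le (asumZ (cabs_ge0 k) hM) => i.
by rewrite cabsM lexx mulr_ge0 ?cabs_ge0.
Qed.

Lemma summ_le (I : choiceType) (u : I -> R[i]) (v : I -> R) M :
  (forall i, cabs (u i) <= v i) -> asum v M -> summ u.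
Proof. by move=> uv h; exists M; apply: asum_le h => i; rewrite cabs_ge0 uv. Qed.

Lemma tsumD (I : choiceType) (u v : I -> R[i]) :
  summ u -> summ v -> tsum (fun i => u i + v i) = tsum u + tsum v.
Proof. by move=> hu hv; apply: hsum_tsum; apply: hsumD; exact: summ_hsum. Qed.

Lemma tsumB (I : choiceType) (u v : I -> R[i]) :
  summ u -> summ v -> tsum (fun i => u i - v i) = tsum u - tsum v.
Proof. by move=> hu hv; apply: hsum_tsum; apply: hsumB; exact: summ_hsum. Qed.

Lemma tsumZ (I : choiceType) (u : I -> R[i]) k :
  summ u -> tsum (fun i => k * u i) = k * tsum u.
Proof. by move=> hu; apply: hsum_tsum; apply: hsumZ; exact: summ_hsum. Qed.

Lemma hsum_inj (I J : choiceType) (h : J -> I) (u : I -> R[i]) l :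
  injective h -> (forall i, (forall j, h j <> i) -> u i = 0) ->
  hsum (u \o h) l -> hsum u l.
Proof.
move=> hi hz hu e e0; have [A hA] := hu e e0.
exists [fset h j | j in A] => B AB.
(* [B'] is the preimage of [B], obtained by choice because [h] comes without an inverse. *)
pose B' := [fset j in pmap (fun i => if pselect (exists j, h j = i) is left e
   then Some (projT1 (cid e)) else None) B].
have memB j : (j \in B') = (h j \in B).
  rewrite in_fset mem_pmap; apply/mapP/idP => [[i iB]|hB].
    by case: pselect => // ex [->]; case: (cid ex) => /= x ->.
  exists (h j) => //; case: pselect => [ex|[]]; last by exists j.
  by case: (cid ex) => /= x /hi ->.
have AB' : A `<=` B'.
  apply/fsubsetP => j jA; rewrite memB; apply: (fsubsetP AB).
  by rewrite in_imfset.
have -> : \sum_(i <- B) u i = \sum_(j <- B') (u \o h) j; last exact: hA.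
have BB : [fset h j | j in B'] `<=` B.
  by apply/fsubsetP => _ /imfsetP[j /= jB ->]; rewrite -memB.
transitivity (\sum_(i <- [fset h j | j in B']) u i); last first.
  by rewrite big_imfset //= => x y _ _ /hi.
symmetry; apply: big_fset_incl => // i iB /negP hn; apply: hz => j hj; apply: hn.
by apply/imfsetP; exists j => //=; rewrite memB hj.
Qed.

Lemma summ_inj (I J : choiceType) (h : J -> I) (u : I -> R[i]) :
  injective h -> summ u -> summ (u \o h).
Proof. by move=> hi [M hM]; exists M; exact: (asum_inj hi hM). Qed.

Lemma tsum_inj (I J : choiceType) (h : J -> I) (u : I -> R[i]) :
  injective h -> (forall i, (forall j, h j <> i) -> u i = 0) ->
  summ u -> tsum u = tsum (u \o h).
Proof.
move=> hi hz hs; apply: hsum_tsum; apply: (hsum_inj hi hz).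
exact/summ_hsum/summ_inj.
Qed.

Lemma tsum_bij (I J : choiceType) (h : J -> I) (g : I -> J) (u : I -> R[i]) :
  cancel h g -> cancel g h -> summ u -> tsum u = tsum (u \o h).
Proof.
move=> hg gh; apply: tsum_inj; first exact: can_inj hg.
by move=> i /(_ (g i)); rewrite gh.
Qed.

(** A finite set of pairs that settles the double sum is enlarged to a box [B] times [E], with [E]
    also large enough to settle the finitely many rows over [B]; each of the two errors is at most
    [e / 2]. *)
Lemma hsum_prod (I J : choiceType) (u : (I * J)%type -> R[i]) (s : I -> R[i]) l :
  hsum u l -> (forall i, hsum (fun j => u (i, j)) (s i)) -> hsum s l.
Proof.
move=> hu hs e e0; have e2 : 0 < e / 2 by rewrite divr_gt0.
have [A hA] := hu _ e2.
exists [fset x.1 | x in A] => B AB.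
(* Every row over [B] gets an equal share of the error; the added 1 covers an empty [B]. *)
pose d := e / 2 / (1 + #|` B|%:R).
have d0 : 0 < d by rewrite divr_gt0 // ltr_pwDl.
have /choice[G hG] : forall i, exists D : {fset J}, forall E, D `<=` E ->
   cabs (\sum_(j <- E) u (i, j) - s i) <= d by move=> i; exact: hs.
pose E := [fset x.2 | x in A] `|` \bigcup_(i <- B) G i.
have hE i : i \in B -> cabs (\sum_(j <- E) u (i, j) - s i) <= d.
  move=> iB; apply: hG; rewrite (fsubset_trans _ (fsubsetUr _ _)) //.
  exact: (bigfcup_sup _ (P := predT)).
have AE : A `<=` fprod B E.
  apply/fsubsetP => x xA; rewrite in_fprod; apply/andP; split.
    by apply: (fsubsetP AB); apply/imfsetP; exists x.
  by rewrite in_fsetU; apply/orP; left; apply/imfsetP; exists x.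
have {hA} := hA _ AE; rewrite sum_fprod.
set T := \sum_(i <- _) _ => hT.
have -> : \sum_(i <- B) s i - l = (T - l) - (T - \sum_(i <- B) s i).
  by ring.
rewrite (le_trans (cabsB _ _)) // (splitr e) lerD //.
rewrite /T -sumrB (le_trans (cabs_sum _ _ _)) //.
have : \sum_(i <- B) cabs (\sum_(j <- E) u (i, j) - s i) <= \sum_(i <- B) d.
  by rewrite big_seq [leRHS]big_seq ler_sum.
by move/le_trans; apply; rewrite /d sum_const_fset // ltW.
Qed.

Lemma tsum_prod (I J : choiceType) (u : (I * J)%type -> R[i]) :
  summ u -> tsum u = tsum (fun i => tsum (fun j => u (i, j))).
Proof.
move=> hs; symmetry; apply: hsum_tsum; apply: hsum_prod (summ_hsum hs) _ => i.
apply: summ_hsum; case: hs => M hM; exists M.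
exact: (asum_row (u := fun x => cabs (u x)) i hM).
Qed.

Lemma summ_prod_swap (I J : choiceType) (u : (I * J)%type -> R[i]) :
  summ u -> summ (fun x : (J * I)%type => u (x.2, x.1)).
Proof. by apply: (summ_inj (h := fun x : (J * I)%type => (x.2, x.1))) => -[a b] [c d] [-> ->]. Qed.

Lemma tsum_exchange (I J : choiceType) (u : (I * J)%type -> R[i]) :
  summ u -> tsum (fun i => tsum (fun j => u (i, j))) = tsum (fun j => tsum (fun i => u (i, j))).
Proof.
move=> hs; rewrite -tsum_prod //.
rewrite (tsum_bij (h := fun x : (J * I)%type => (x.2, x.1)) (g := fun x => (x.2, x.1))) //.
- by rewrite tsum_prod //; exact: summ_prod_swap.
- by case.
- by case.
Qed.

Lemma summ_row (I J : choiceType) (u : (I * J)%type -> R[i]) :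
  summ u -> summ (fun i => tsum (fun j => u (i, j))).
Proof.
move=> [M [hM0 hM]]; exists M; split=> [i|A]; first exact: cabs_ge0.
have hr i : summ (fun j => u (i, j)).
  by exists M; apply: (asum_row (u := fun x => cabs (u x)) i).
apply/ler_addgt0Pl => e e0; pose d := e / (1 + #|` A|%:R).
have d0 : 0 < d by rewrite divr_gt0 // ltr_pwDl.
have /choice[G hG] : forall i, exists D : {fset J}, forall E, D `<=` E ->
   cabs (\sum_(j <- E) u (i, j) - tsum (fun j => u (i, j))) <= d.
   by move=> i; exact: summ_hsum.
pose E := \bigcup_(i <- A) G i.
apply: (@le_trans _ _ (\sum_(i <- A) (d + \sum_(j <- E) cabs (u (i, j))))).
  rewrite big_seq [leRHS]big_seq ler_sum // => i iA.
  have hE : G i `<=` E by exact: (bigfcup_sup _ (P := predT)).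
  rewrite -[X in cabs X](subrK (\sum_(j <- E) u (i, j))) (le_trans (cabsD _ _)) // lerD //.
    by rewrite -cabsN opprB; exact: hG.
  exact: cabs_sum.
rewrite big_split /= lerD //.
  by rewrite /d sum_const_fset // ltW // divr_gt0.
by have := hM (fprod A E); rewrite sum_fprod.
Qed.

Lemma hsum_fin (I : finType) (u : I -> R[i]) : hsum u (\sum_i u i).
Proof.
move=> e e0; exists [fset i | i in I] => B hB.
have -> : B = [fset i | i in I].
  by apply/eqP; rewrite eqEfsubset hB andbT; apply/fsubsetP => i _; rewrite in_imfset.
rewrite big_imfset //= big_enum /= (eq_bigl predT) // subrr cabs0 //.
exact: ltW.
Qed.

Lemma tsum_fin (I : finType) (u : I -> R[i]) : tsum u = \sum_i u i.
Proof. exact/hsum_tsum/hsum_fin. Qed.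

Lemma tsum_finprod (I : finType) (J : choiceType) (u : (I * J)%type -> R[i]) :
  summ u -> tsum u = \sum_i tsum (fun j => u (i, j)).
Proof. by move=> h; rewrite tsum_prod // tsum_fin. Qed.

Lemma asum_tail (I : choiceType) (u : I -> R) M e : asum u M -> 0 < e ->
  exists A : {fset I}, forall B : {fset I}, [disjoint A & B]%fset ->
    \sum_(i <- B) u i <= e.
Proof.
move=> [u0 hM] e0; have [l hl] := hsum_pos (conj u0 hM).
have [A hA] := hl _ (divr_gt0 e0 (ltr0n R 2)).
exists A => B AB.
have {hl}h1 := hA _ (fsubset_refl A); have {hA}h2 := hA _ (fsubsetUl A B).
have E : \sum_(i <- A `|` B) (u i)%:C = \sum_(i <- A) (u i)%:C + (\sum_(i <- B) u i)%:C.
  rewrite (fset_sumU _ (fsubsetUl A B)) rmorph_sum; congr (_ + _).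
  apply: eq_fbigl => i; rewrite !inE /=; case iA: (i \in A) => //=.
  by apply/esym/negbTE; apply: (fdisjointP AB).
rewrite E in h2; set s := \sum_(i <- B) u i in h2 *.
rewrite (le_trans (ler_norm _)) // -cabs_real (splitr e).
set a := \sum_(i <- A) _ in h1 h2.
have -> : s%:C = (a + s%:C - l%:C) - (a - l%:C) by ring.
by rewrite (le_trans (cabsB _ _)) // lerD.
Qed.

(** Dominated convergence for series: outside a finite set the majorant is negligible, inside it
    finitely many pointwise limits are used. It lets the mesh of the Riemann sums tend to 0 in the
    Poisson formula. *)
Lemma tannery (I : choiceType) (u : nat -> I -> R[i]) (v : I -> R[i]) (w : I -> R) W :
  asum w W -> (forall n i, cabs (u n i) <= w i) ->
  (forall i e, 0 < e -> exists n0, forall n, (n0 <= n)%N -> cabs (u n i - v i) <= e) ->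
  forall e, 0 < e -> exists n0, forall n, (n0 <= n)%N ->
    cabs (tsum (u n) - tsum v) <= e.
Proof.
move=> hw uw uv e e0.
have vw i : cabs (v i) <= w i.
  apply/ler_addgt0Pl => d d0; have [n0 /(_ n0 (leqnn _)) h] := uv i d d0.
  rewrite -[X in cabs X](subrK (u n0 i)) (le_trans (cabsD _ _)) // lerD //.
  by rewrite -cabsN opprB.
have e3 : 0 < e / 2 by rewrite divr_gt0.
have e4 : 0 < e / 4 by rewrite divr_gt0.
have [A hA] := asum_tail hw e4.
pose d := e / 2 / (1 + #|` A|%:R).
have d0 : 0 < d by rewrite divr_gt0 // ltr_pwDl.
have /choice[G hG] : forall i, exists n0, forall n, (n0 <= n)%N -> cabs (u n i - v i) <= d.
  by move=> i; exact: uv.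
exists (\max_(i <- A) G i)%N => n hn.
have su m : summ (u m) by exact: summ_le hw.
have sv : summ v by exact: summ_le hw.
rewrite -tsumB //; apply: tsum_le; split=> [i|B]; first exact: cabs_ge0.
rewrite (big_fsetID _ (mem A)) /= (splitr e) lerD //.
  apply: (@le_trans _ _ (\sum_(i <- A) d)).
    apply: (@le_trans _ _ (\sum_(i <- [fset x in B | x \in A]) d)).
      rewrite big_seq [leRHS]big_seq ler_sum // => i; rewrite !inE /= => /andP[_ iA].
      apply: hG; apply: leq_trans hn; exact: (leq_bigmax_seq (F := G)).
    apply: (@ler_fset_sum _ _ _ (fun=> d)) => [|i]; last exact: ltW.
    by apply/fsubsetP => i; rewrite !inE /= => /andP[].
  by rewrite /d sum_const_fset // ltW // divr_gt0.
apply: (@le_trans _ _ (\sum_(i <- [fset x in B | x \notin A]) (w i + w i))).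
  by rewrite ler_sum // => i _; rewrite (le_trans (cabsB _ _)) // lerD.
have h : \sum_(i <- [fset x in B | x \notin A]) w i <= e / 4.
  apply: hA; apply/fdisjointP => i iA; rewrite !inE /= iA andbF //.
by rewrite big_split /=; lra.
Qed.

End Hsum.

HB.lock Definition cexp (R : realType) (z : complex R) : complex R :=
  ((expR (complex.Re z))%:C * (cos (complex.Im z) +i* sin (complex.Im z)))%C.
HB.lock Definition ee (R : realType) (z : complex R) : complex R := expi z.

(** * The complex exponential and elementary bounds *)

Section Cexp.
Variable R : realType.
Local Open Scope complex_scope.

Lemma cexpD (z w : R[i]) : cexp (z + w) = cexp z * cexp w.
Proof.
case: z w => [a b] [c d]; rewrite !cexp.unlock /= expRD cosD sinD rmorphM /= /real_complex_def.
by apply/eqP; rewrite eq_complex /=; apply/andP; split; apply/eqP; ring.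
Qed.

Lemma cexp0 : cexp (0 : R[i]) = 1.
Proof. by rewrite !cexp.unlock /= expR0 cos0 sin0 mul1r. Qed.

Lemma cabs_cexp (z : R[i]) : cabs (cexp z) = expR (complex.Re z).
Proof.
by rewrite !cexp.unlock cabsM cabs_real ger0_norm ?expR_ge0 // cabsE /= cos2Dsin2 sqrtr1 mulr1.
Qed.

Lemma cexp_neq0 (z : R[i]) : cexp z != 0.
Proof.
apply/eqP => h; have := cabs_cexp z; rewrite h cabs0 => /esym/eqP.
by rewrite expR_eq0.
Qed.

Lemma cexpN (z : R[i]) : cexp (- z) = (cexp z)^-1.
Proof.
by apply: (mulfI (cexp_neq0 z)); rewrite -cexpD subrr cexp0 mulfV ?cexp_neq0.
Qed.

Lemma cexp_conj (z : R[i]) : conjc (cexp z) = cexp (conjc z).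
Proof.
case: z => a b; rewrite !cexp.unlock /= cosN sinN.
by apply/eqP; rewrite eq_complex /=; apply/andP; split; apply/eqP; ring.
Qed.

Lemma eeE (w : R[i]) : ee w = cexp (((2 * pi)%:C * 'i) * w).
Proof.
rewrite ee.unlock cexp.unlock /expi; case: w => a b /=.
by congr ((expR _)%:C * (cos _ +i* sin _)); ring.
Qed.

Lemma eeD (z w : R[i]) : ee (z + w) = ee z * ee w.
Proof. by rewrite !eeE mulrDr cexpD. Qed.

Lemma ee0 : ee (0 : R[i]) = 1. Proof. by rewrite eeE mulr0 cexp0. Qed.

Lemma cabs_ee (w : R[i]) : cabs (ee w) = expR (- (2 * pi * complex.Im w)).
Proof. by rewrite eeE cabs_cexp; case: w => a b /=; congr expR; ring. Qed.

Lemma cabs_ee_real (x : R) : cabs (ee x%:C) = 1.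
Proof. by rewrite cabs_ee /= mulr0 oppr0 expR0. Qed.

Lemma cabs_ee_realN (x : R) : cabs (ee (- x%:C)) = 1.
Proof. by rewrite cabs_ee /= !oppr0 mulr0 oppr0 expR0. Qed.

Lemma ee_neq0 (w : R[i]) : ee w != 0. Proof. by rewrite eeE cexp_neq0. Qed.

Lemma eeN (z : R[i]) : ee (- z) = (ee z)^-1. Proof. by rewrite !eeE mulrN cexpN. Qed.

Lemma ee1 : ee (1 : R[i]) = 1.
Proof. by rewrite ee.unlock /expi /= !mulr0 mulr1 oppr0 expR0 mulr_natl cos2pi sin2pi mul1r. Qed.

Lemma ee_nat n : ee (n%:R : R[i]) = 1.
Proof. by elim: n => [|n IH]; rewrite ?ee0 // -natr1 eeD IH ee1 mul1r. Qed.

Lemma ee_int (n : int) : ee (n%:~R : R[i]) = 1.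
Proof.
by case: n => n; rewrite ?NegzE ?rmorphN /= ?eeN -?pmulrn ee_nat ?invr1.
Qed.

Lemma ee_addint (z : R[i]) (n : int) : ee (z + n%:~R) = ee z.
Proof. by rewrite eeD ee_int mulr1. Qed.

Lemma eeM_natl n (w : R[i]) : ee (n%:R * w) = ee w ^+ n.
Proof.
by elim: n => [|n IH]; rewrite ?mul0r ?ee0 ?expr0 // exprS -IH -eeD -natr1 mulrDl mul1r addrC.
Qed.

Lemma ee_conj (w : R[i]) : conjc (ee w) = ee (- conjc w).
Proof. by rewrite !eeE cexp_conj; case: w => a b /=; congr cexp; apply/eqP; rewrite eq_complex /=; apply/andP; split; apply/eqP; ring. Qed.

Lemma expR_sub1_bound (x : R) : `|expR x - 1| <= `|x| * expR `|x|.
Proof.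
have h1 := expR_ge1Dx x; have h2 : expR x - 1 <= x * expR x.
  have := expR_ge1Dx (- x); rewrite -(ler_pM2r (expR_gt0 x)) expRN mulVf ?gt_eqF ?expR_gt0 //.
  by lra.
have e1 : 1 <= expR `|x| by rewrite -expR0 ler_expR.
have [x0|x0] := leP 0 x.
  rewrite ger0_norm; last by rewrite subr_ge0 -expR0 ler_expR.
  by rewrite !ger0_norm.
have : expR x <= 1 by rewrite -expR0 ler_expR ltW.
rewrite -subr_le0 => /ler0_norm ->; rewrite (ltr0_norm x0) in e1 *.
by nra.
Qed.

Lemma expR_sub2_bound (x : R) : `|expR x - 1 - x| <= x ^+ 2 * expR `|x|.
Proof.
have h1 := expR_ge1Dx x; rewrite ger0_norm; last by rewrite -addrA -opprD subr_ge0.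
have h2 : expR x - 1 <= x * expR x.
  have := expR_ge1Dx (- x); rewrite -(ler_pM2r (expR_gt0 x)) expRN mulVf ?gt_eqF ?expR_gt0 //.
  by lra.
have -> : x ^+ 2 * expR `|x| = `|x| * (`|x| * expR `|x|).
  by rewrite mulrA -expr2 real_normK ?num_real.
apply: (@le_trans _ _ (`|x| * `|expR x - 1|)); last first.
  by rewrite ler_wpM2l // expR_sub1_bound.
by rewrite -normrM (le_trans _ (ler_norm _)) //; lra.
Qed.

Lemma mvt_bound (f f' : R -> R) (K x : R) : (forall z : R, is_derive z 1 f (f' z)) ->
  (forall z : R, `|z| <= `|x| -> `|f' z| <= K) -> `|f x - f 0| <= K * `|x|.
Proof.
move=> df bf.
have cf (a b : R) : {within `[a, b], continuous f}.
  apply: derivable_within_continuous => z _; exact: ex_derive.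
have [x0|x0|->] := ltgtP x 0.
- have [c cx E] := MVT x0 (fun z _ => df z) (cf x 0).
  rewrite distrC E sub0r normrM normrN ler_wpM2r // bf //.
  by move: cx; rewrite in_itv /= => /andP[? ?]; rewrite !ler0_norm ?lerN2 //; lra.
- have [c cx E] := MVT x0 (fun z _ => df z) (cf 0 x).
  rewrite E subr0 normrM ler_wpM2r // bf //.
  by move: cx; rewrite in_itv /= => /andP[? ?]; rewrite !ger0_norm //; lra.
- by rewrite subrr normr0 mulr0.
Qed.

Lemma sin_bound (x : R) : `|sin x| <= `|x|.
Proof.
have := @mvt_bound sin cos 1 x (fun z => is_derive_sin z) (fun z _ => cos_max z).
by rewrite sin0 subr0 mul1r.
Qed.

Lemma cos_bound (x : R) : `|cos x - 1| <= x ^+ 2.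
Proof.
have D (z : R) : is_derive z 1 (cos : R -> R) (- sin z) by exact: is_derive_cos.
have := @mvt_bound cos _ `|x| x D; rewrite cos0 -expr2 real_normK ?num_real //.
by apply=> z zx; rewrite normrN (le_trans (sin_bound _)).
Qed.

Lemma cos_bound1 (x : R) : `|cos x - 1| <= `|x|.
Proof.
have D (z : R) : is_derive z 1 (cos : R -> R) (- sin z) by exact: is_derive_cos.
have := @mvt_bound cos _ 1 x D; rewrite cos0 mul1r.
by apply=> z zx; rewrite normrN sin_max.
Qed.

Lemma sin_bound2 (x : R) : `|sin x - x| <= x ^+ 2.
Proof.
have D (z : R) : is_derive z 1 (fun y : R => sin y - y) (cos z - 1).
  by apply: is_deriveB.
have := @mvt_bound _ _ `|x| x D; rewrite sin0 !subr0 -expr2 real_normK ?num_real //.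
by apply=> z zx; rewrite (le_trans (cos_bound1 _)).
Qed.

Lemma cexp_bound1 (z : R[i]) : complex.Re z <= 0 -> cabs (cexp z - 1) <= 3 * cabs z.
Proof.
case: z => a b; rewrite [complex.Re _]/= => a0.
have ha := expR_sub1_bound a; have hb := cos_bound1 b; have hs := sin_bound b.
have ea : expR a <= 1 by rewrite -expR0 ler_expR.
have Ra : `|a| <= cabs (a +i* b) := cabs_Re (a +i* b).
have Ib : `|b| <= cabs (a +i* b) := cabs_Im (a +i* b).
rewrite cexp.unlock; have -> : (expR a)%:C * (cos b +i* sin b) - 1 = ((expR a - 1) * cos b + (cos b - 1))%:C + 'i * (expR a * sin b)%:C.
  by apply/eqP; rewrite eq_complex /=; apply/andP; split; apply/eqP; ring.
have h1 : `|expR a - 1| <= `|a|.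
  have : expR a - 1 <= 0 by rewrite subr_le0.
  move/ler0_norm => ->; rewrite ler0_norm //.
  have := expR_ge1Dx a; lra.
rewrite (le_trans (cabsD _ _)) // cabsM cabs_i mul1r !cabs_real.
have hc := cos_max b.
have h2 : `|(expR a - 1) * cos b + (cos b - 1)| <= `|a| + `|b|.
  rewrite (le_trans (ler_normD _ _)) // lerD // normrM.
  by rewrite -[leRHS]mulr1 ler_pM.
have h3 : `|expR a * sin b| <= `|b|.
  by rewrite normrM ger0_norm ?expR_ge0 // -[leRHS]mul1r ler_pM ?expR_ge0.
lra.
Qed.

Lemma cexp_bound2 (z : R[i]) : cabs (cexp z - 1 - z) <= 4 * cabs z ^+ 2 * expR (cabs z).
Proof.
case: z => a b.
have Ra : `|a| <= cabs (a +i* b) := cabs_Re (a +i* b).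
have Ib : `|b| <= cabs (a +i* b) := cabs_Im (a +i* b).
set c := cabs (a +i* b) in Ra Ib *.
rewrite cexp.unlock; have -> : (expR a)%:C * (cos b +i* sin b) - 1 - (a +i* b) =
  ((expR a - 1 - a) + expR a * (cos b - 1))%:C
   + 'i * ((expR a - 1) * sin b + (sin b - b))%:C.
  by apply/eqP; rewrite eq_complex /=; apply/andP; split; apply/eqP; ring.
rewrite (le_trans (cabsD _ _)) // cabsM cabs_i mul1r !cabs_real.
have e1 : expR `|a| <= expR c by rewrite ler_expR.
have e2 : expR a <= expR c by rewrite ler_expR (le_trans (ler_norm _)).
have e3 : 1 <= expR c by rewrite -expR0 ler_expR cabs_ge0.
have c0 : 0 <= c by exact: cabs_ge0.
have c2 : 0 <= c ^+ 2 by exact: sqr_ge0.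
have a2 : a ^+ 2 <= c ^+ 2 by rewrite -(@real_normK _ a) ?num_real // lerXn2r ?nnegrE.
have b2 : b ^+ 2 <= c ^+ 2 by rewrite -(@real_normK _ b) ?num_real // lerXn2r ?nnegrE.
have k1 : `|expR a - 1 - a| <= c ^+ 2 * expR c.
  by rewrite (le_trans (expR_sub2_bound _)) // ler_pM ?sqr_ge0 ?expR_ge0.
have k2 : `|expR a * (cos b - 1)| <= c ^+ 2 * expR c.
  rewrite normrM (ger0_norm (expR_ge0 a)) mulrC ler_pM ?expR_ge0 //.
  by rewrite (le_trans (cos_bound _)).
have k3 : `|(expR a - 1) * sin b| <= c ^+ 2 * expR c.
  have -> : c ^+ 2 * expR c = (c * expR c) * c by ring.
  rewrite normrM ler_pM // ?(le_trans (sin_bound _)) //.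
  by rewrite (le_trans (expR_sub1_bound _)) // ler_pM ?expR_ge0.
have k4 : `|sin b - b| <= c ^+ 2 * expR c.
  by rewrite (le_trans (sin_bound2 _)) // (le_trans b2) // ler_peMr.
have := ler_normD (expR a - 1 - a) (expR a * (cos b - 1)).
have := ler_normD ((expR a - 1) * sin b) (sin b - b).
lra.
Qed.

(** If $\cos x \ge 1/2$, the mean value theorem applies with slope at least 1/2; otherwise $\sin x
    \ge 1/2$, while $x \le 2$. *)
Lemma sin_lower (x : R) : 0 <= x <= pi / 2 -> x / 4 <= sin x.
Proof.
move=> /andP[x0 xp].
have pi4 : pi / 2 <= 2 :> R by have /andP[_ /ltW] := @pihalf_02 R.
have s0 : 0 <= sin x by rewrite sin_ge0_pi // x0 /=; lra.
have [xe|xp0] := eqVneq x 0; first by rewrite xe mul0r sin0.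
have xg : 0 < x by rewrite lt_neqAle eq_sym xp0.
have [c|c] := leP (1 / 2) (cos x).
  have cf : {within `[0, x], continuous (sin : R -> R)}.
    by apply: derivable_within_continuous => z _; exact: ex_derive.
  have [y yx E] := MVT xg (fun z _ => is_derive_sin z) cf.
  move: yx; rewrite in_itv /= => /andP[y0 yx].
  have : cos x <= cos y.
    by rewrite le_eqVlt ltr_cos ?yx ?orbT // in_itv /=; apply/andP; split; lra.
  move: E; rewrite sin0 !subr0 => ->; nra.
have c0 : 0 <= cos x by apply: cos_ge0_pihalf; apply/andP; split; lra.
have := sin2cos2 x => h.
have : (1 / 2) ^+ 2 <= sin x ^+ 2 by rewrite h; nra.
rewrite ler_pXn2r ?nnegrE //; lra.
Qed.

End Cexp.

(** * Convergent sums over the integers *)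

Section IntSum.
Variable R : realType.
Local Open Scope complex_scope.
Local Open Scope fset_scope.
Local Open Scope ring_scope.

Lemma asum_int (u : int -> R) M M' :
  asum (fun n : nat => u n) M -> asum (fun n : nat => u (Negz n)) M' -> asum u (M + M').
Proof.
move=> [u0 hM] [v0 hM']; split=> [[n|n]|A //]; first exact: u0; first exact: v0.
have su : forall i, 0 <= u i by move=> [n|n]; [exact: u0|exact: v0].
pose A1 := [fset absz x | x in A]; pose A2 := [fset absz (x + 1) | x in A].
have S : A `<=` [fset Posz n | n in A1] `|` [fset Negz n | n in A2].
  apply/fsubsetP => x xA; rewrite in_fsetU; case: x xA => n nA; apply/orP; [left|right].
    by apply/imfsetP; exists n => //=; apply/imfsetP; exists (Posz n).
  apply/imfsetP; exists n => //=; apply/imfsetP; exists (Negz n) => //=.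
  by rewrite NegzE; lia.
rewrite (le_trans (ler_fset_sum S su)) //.
have D : [disjoint [fset Posz n | n in A1] & [fset Negz n | n in A2]]%fset.
  by apply/fdisjointP => _ /imfsetP[n _ ->]; apply/imfsetP => -[].
rewrite (fset_sumU _ (fsubsetUl _ _)) lerD //.
  by rewrite big_imfset /= ?hM // => x y _ _ [].
rewrite (_ : _ `\` _ = [fset Negz n | n in A2]).
  by rewrite big_imfset /= ?hM' // => x y _ _ [].
by rewrite fsetDUl fsetDv fset0U; apply/fsetDidPl; rewrite fdisjoint_sym.
Qed.

Lemma asum_nat_mono (u : nat -> R) M : (forall n, 0 <= u n) ->
  (forall n, \sum_(0 <= i < n) u i <= M) -> asum u M.
Proof.
move=> u0 h; split=> // A; pose n := (\max_(i <- A) i.+1)%N.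
rewrite (le_trans _ (h n)) // [leRHS]uniq_fset_sum ?iota_uniq //.
apply: ler_fset_sum => //; apply/fsubsetP => i iA; rewrite in_fset_/= mem_index_iota /=.
exact: (leq_bigmax_seq (F := succn)).
Qed.

Lemma asum_expR_nat (b : R) : 0 < b -> asum (fun n : nat => expR (- (b * n%:R))) (1 + b^-1).
Proof.
move=> b0; apply: asum_nat_mono => [n|n]; first exact: expR_ge0.
have e1 : expR (- b) < 1 by rewrite expR_lt1 oppr_lt0.
have -> : \sum_(0 <= i < n) expR (- (b * i%:R)) = \sum_(i < n) expR (- b) ^+ i.
  by rewrite big_mkord; apply: eq_bigr => i _; rewrite -expRM_natr mulNr.
have := subrXX_comm n (commr1 (expR (- b))).
have := @subrX1 R (expR (- b)) n => E.
have g0 : 0 <= expR (- b) ^+ n by rewrite exprn_ge0 ?expR_ge0.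
set S := \sum_(i < n) _ in E * => _.
have h : (1 - expR (- b)) * S <= 1 by rewrite -opprB mulNr -E; lra.
have p : 0 < 1 - expR (- b) by rewrite subr_gt0.
rewrite -(ler_pM2l p) (le_trans h) //.
have := expR_ge1Dx b; rewrite expRN => h1.
have hb : 0 < expR b by exact: expR_gt0.
have : (expR b)^-1 <= (1 + b)^-1 by rewrite lef_pV2 ?posrE ?ltr_pwDl // ltW.
move=> h2; apply: (@le_trans _ _ ((1 - (1 + b)^-1) * (1 + b^-1))).
  by rewrite le_eqVlt; apply/orP; left; apply/eqP; field; apply/andP; split; lra.
by rewrite ler_pM2r ?lerB // addr_gt0 ?invr_gt0.
Qed.

Lemma tsum_int_shift (u : int -> R[i]) (k : int) : summ u ->
  tsum u = tsum (fun n => u (n + k)).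
Proof.
move=> h; apply: (tsum_bij (h := fun n : int => n + k) (g := fun n => n - k)) => //.
  exact: addrK.
exact: subrK.
Qed.

Lemma asum_int_shift (u : int -> R) (k : int) M : asum u M -> asum (fun n => u (n + k)) M.
Proof. by move=> h; apply: (asum_inj (h := fun n : int => n + k) _ h); exact: addIr. Qed.

(** Translation by the floor of [a] leaves a shift in $[0,1)$, so the bound does not depend on [a].
    This uniformity later allows several variables to be summed one at a time. *)
Lemma asum_expR_int (b a : R) : 0 < b ->
  asum (fun n : int => expR (- (b * `|n%:~R + a|))) (2 * (1 + b^-1)).
Proof.
move=> b0; pose k := Num.floor a; pose r := a - k%:~R.
have kr : 0 <= r < 1.
  have /andP[h1 h2] := floor_itv a; rewrite /r /k; move: h2; rewrite intrD /= => h2.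
  by apply/andP; split; lra.
have -> : (fun n : int => expR (- (b * `|n%:~R + a|))) =
   (fun n : int => (fun n : int => expR (- (b * `|n%:~R + r|))) (n + k)).
  apply/funext => n; congr (expR (- (b * `|_|))); rewrite /r intrD; ring.
apply: (asum_int_shift (u := fun n : int => expR (- (b * `|n%:~R + r|)))).
case/andP: kr => r0 r1.
rewrite mulr_natl mulr2n; apply: asum_int.
  apply: asum_le (asum_expR_nat b0) => n; rewrite expR_ge0 ler_expR lerN2 ler_pM2l //=.
  by rewrite -pmulrn ger0_norm ?lerDl // addr_ge0.
apply: asum_le (asum_expR_nat b0) => n; rewrite expR_ge0 ler_expR lerN2 ler_pM2l //=.
rewrite NegzE mulrNz -pmulrn -natr1; have n0 := ler0n R n.
by rewrite ler0_norm; lra.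
Qed.

Lemma gauss_le_exp (y : R) : expR (- y ^+ 2) <= expR 1 * expR (- `|y|).
Proof.
rewrite -expRD ler_expR; have : `|y| ^+ 2 = y ^+ 2 by rewrite real_normK ?num_real.
by move: `|y| => z <-; nra.
Qed.

Lemma asum_gauss_int (b a : R) : 0 < b ->
  asum (fun n : int => expR (- (b * (n%:~R + a) ^+ 2)))
    (2 * expR 1 * (1 + (Num.sqrt b)^-1)).
Proof.
move=> b0; have s0 : 0 < Num.sqrt b by rewrite sqrtr_gt0.
have -> : 2 * expR 1 * (1 + (Num.sqrt b)^-1) = expR 1 * (2 * (1 + (Num.sqrt b)^-1)) by ring.
apply: asum_le (asumZ (expR_ge0 1) (asum_expR_int a s0)) => n.
rewrite expR_ge0 /=.
have := gauss_le_exp (Num.sqrt b * (n%:~R + a)).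
by rewrite exprMn (sqr_sqrtr (ltW b0)) normrM (gtr0_norm s0).
Qed.

Lemma asum_inv_sq : asum (fun k : int => (1 + k%:~R ^+ 2)^-1 : R) 8.
Proof.
have H : asum (fun k : nat => (1 + k%:R ^+ 2)^-1 : R) 4.
  apply: asum_nat_mono => n; first by rewrite invr_ge0 addr_ge0 ?sqr_ge0.
  (* Telescoping: $1/(1+i^2) \le 4/(i+1) - 4/(i+2)$. *)
  suff : \sum_(0 <= i < n) (1 + i%:R ^+ 2)^-1 <= 4 - 4 / (n%:R + 1) :> R.
    move/le_trans; apply; have : 0 <= 4 / (n%:R + 1) :> R by rewrite divr_ge0 ?addr_ge0.
    lra.
  elim: n => [|n IH]; first by rewrite big_geq // add0r; lra.
  rewrite big_nat_recr //=; apply: le_trans (lerD IH (lexx _)) _.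
  rewrite -[n.+1%:R]natr1; have n0 : 0 <= n%:R :> R by [].
  move: (n%:R : R) n0 => x x0; rewrite -subr_ge0.
  have p1 : 0 < (x + 1) * (x + 1 + 1) * (1 + x ^+ 2).
    by rewrite !mulr_gt0 //; [lra|lra|nra].
  have -> : 4 - 4 / (x + 1 + 1) - (4 - 4 / (x + 1) + (1 + x ^+ 2)^-1) =
    (4 * (1 + x ^+ 2) - (x + 1) * (x + 1 + 1)) / ((x + 1) * (x + 1 + 1) * (1 + x ^+ 2)).
    field; apply/and3P; split; apply/eqP; nra.
  by rewrite divr_ge0 ?ltW //; nra.
rewrite (_ : 8 = 4 + 4); last by lra.
apply: asum_int; first by [].
have := asum_inj (h := succn) succn_inj H; apply: asum_le => n /=.
by rewrite NegzE mulrNz sqrrN -pmulrn lexx andbT invr_ge0 addr_ge0 ?sqr_ge0.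
Qed.

End IntSum.

Lemma le_sqr (R : realType) (x y : R) : 0 <= x -> x <= y -> x ^+ 2 <= y ^+ 2.
Proof. by move=> x0 xy; rewrite lerXn2r ?nnegrE // (le_trans x0). Qed.

HB.lock Definition gau (R : realType) (t z : complex R) : complex R :=
  cexp (- ((pi : R)%:C%C * t * z ^+ 2)).

(** * Poisson summation *)

Section Gauss.
Variable R : realType.
Local Open Scope complex_scope.
Local Open Scope ring_scope.

Lemma gauE (t z : R[i]) : gau t z = cexp (- (pi%:C * t * z ^+ 2)). Proof. by rewrite gau.unlock. Qed.

(** The Riemann sum of mesh [h] for the Fourier transform of $e^{-\pi t x^2}$ at the frequency
    [k]. *)
Definition ghat (t : R[i]) (h k : R) : R[i] :=
  tsum (fun n : int => h%:C * (gau t (n%:~R * h)%:C * ee (- (n%:~R * h * k)%:C))).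
(** The Riemann sum of the Gaussian with nodes displaced by a complex [s], a discrete substitute for
    the integral along a shifted line. *)
Definition gsum (t : R[i]) (h : R) (s : R[i]) : R[i] :=
  tsum (fun n : int => h%:C * gau t ((n%:~R * h)%:C + s)).

Lemma tsum_sum (J : choiceType) (I : Type) (r : seq I) (u : I -> J -> R[i]) :
  (forall i, summ (u i)) ->
  summ (fun j => \sum_(i <- r) u i j) /\
  tsum (fun j => \sum_(i <- r) u i j) = \sum_(i <- r) tsum (u i).
Proof.
move=> hu; elim: r => [|i r [IH1 IH2]].
  rewrite (_ : (fun j => _) = fun=> 0); last by apply/funext => j; rewrite big_nil.
  split; last first.
    rewrite big_nil; apply: hsum_tsum => e e0; exists fset0 => B _.
    by rewrite big1 // subrr cabs0 ltW.
  exists 0; split=> [j|A]; first exact: cabs_ge0.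
  by rewrite big1 // => j _; rewrite cabs0.
have -> : (fun j => \sum_(k <- i :: r) u k j) = (fun j => u i j + \sum_(k <- r) u k j).
  by apply/funext => j; rewrite big_cons.
by split; [exact: summD|rewrite big_cons tsumD // IH2].
Qed.

Lemma Re_inv_gt0 (t : R[i]) : 0 < complex.Re t -> 0 < complex.Re t^-1.
Proof.
case: t => a b /= a0; rewrite divr_gt0 // ltr_pwDl ?sqr_ge0 //.
by rewrite exprn_gt0.
Qed.

Lemma Re_gt0_neq0 (t : R[i]) : 0 < complex.Re t -> t != 0.
Proof. by move=> h; apply/eqP => E; move: h; rewrite E ltxx. Qed.

Variable t : R[i].
Hypothesis ht : 0 < complex.Re t.

Let t0 : t != 0. Proof. exact: Re_gt0_neq0. Qed.
Let pi0 : 0 < pi :> R. Proof. exact: pi_gt0. Qed.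

(** By completing the square, the quadratic decay absorbs any factor $e^{K|x|}$, and with it the
    polynomial factors met later. *)
Lemma gau_maj (L K : R) : 0 <= L -> 0 <= K -> exists2 C, 0 <= C &
  forall x s, cabs s <= L ->
    cabs (gau t (x%:C + s)) * expR (K * (1 + `|x|)) <= C * expR (- `|x|).
Proof.
move=> L0 K0; pose T := cabs t; pose b := 2 * pi * T * L + K + 1.
pose a := pi * complex.Re t.
have a0 : 0 < a by rewrite mulr_gt0.
exists (expR (b ^+ 2 / (4 * a) + pi * T * L ^+ 2 + K)); first exact: expR_ge0.
move=> x s sL; rewrite gauE cabs_cexp -!expRD ler_expR.
have E : complex.Re (- (pi%:C * t * (x%:C + s) ^+ 2)) =
  - (a * x ^+ 2 + 2 * pi * x * complex.Re (t * s) + pi * complex.Re (t * s ^+ 2)).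
  by rewrite /a; case: t s {sL} => [p q] [c d] /=; ring.
have h1 : `|complex.Re (t * s)| <= T * L.
  by rewrite (le_trans (cabs_Re _)) // cabsM ler_wpM2l ?cabs_ge0.
have h2 : `|complex.Re (t * s ^+ 2)| <= T * L ^+ 2.
  rewrite (le_trans (cabs_Re _)) // cabsM cabsX ler_wpM2l ?cabs_ge0 //.
  by rewrite lerXn2r ?nnegrE ?cabs_ge0.
rewrite E; set r1 := complex.Re (t * s) in h1 *; set r2 := complex.Re _ in h2 *.
have x2 : x ^+ 2 = `|x| ^+ 2 by rewrite real_normK ?num_real.
have k1 : - (2 * pi * x * r1) <= 2 * pi * T * L * `|x|.
  rewrite (le_trans (ler_norm _)) // normrN !normrM (gtr0_norm pi0) (@ger0_norm _ 2) //.
  have := ler_wpM2l (normr_ge0 x) h1.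
  have : 0 <= pi :> R by exact: ltW.
  nra.
have k2 : - (pi * r2) <= pi * T * L ^+ 2.
  by rewrite (le_trans (ler_norm _)) // normrN normrM (gtr0_norm pi0) -mulrA ler_pM2l.
have k3 : b * `|x| - a * `|x| ^+ 2 <= b ^+ 2 / (4 * a).
  rewrite -subr_ge0.
  have -> : b ^+ 2 / (4 * a) - (b * `|x| - a * `|x| ^+ 2) = (b - 2 * a * `|x|) ^+ 2 / (4 * a).
    by field; rewrite gt_eqF.
  by rewrite divr_ge0 ?sqr_ge0 // mulr_ge0 // ltW.
rewrite x2; move: k3; rewrite {1}/b; lra.
Qed.

(** Taylor remainder of second order with a summable majorant. The factor $e^{K(1+|x|)}$ available
    in [gau_maj] pays for the squares of [1 + |x|] and for the exponential in [cexp_bound2]. *)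
Lemma gau_rem (L : R) : 0 <= L -> exists2 C, 0 <= C &
  forall x s e, cabs s <= L -> cabs e <= 1 ->
    cabs (gau t (x%:C + s + e) - gau t (x%:C + s)
          + 2%:R * pi%:C * t * (x%:C + s) * e * gau t (x%:C + s))
      <= C * cabs e ^+ 2 * expR (- `|x|).
Proof.
move=> L0; pose T := cabs t; pose K1 := pi * T * (2 * L + 3).
have T0 : 0 <= T by exact: cabs_ge0.
have pp : 0 <= pi :> R by exact: ltW.
have pT : 0 <= pi * T by exact: mulr_ge0.
have K0 : 0 <= K1 by rewrite mulr_ge0 //; lra.
have kk : pi * T <= K1 by rewrite /K1; nra.
have K2 : 0 <= K1 + 2 by lra.
have [C C0 hC] := gau_maj L0 K2.
exists ((4 * K1 ^+ 2 + K1) * C); first by rewrite mulr_ge0 // addr_ge0 // mulr_ge0 ?sqr_ge0.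
move=> x s e sL e1; set z := x%:C + s.
pose u := - (pi%:C * t * (2%:R * z * e + e ^+ 2)).
have -> : gau t (z + e) = gau t z * cexp u.
  by rewrite !gauE -cexpD; congr cexp; rewrite /u; ring.
have -> : gau t z * cexp u - gau t z + 2%:R * pi%:C * t * z * e * gau t z =
   gau t z * ((cexp u - 1 - u) - pi%:C * t * e ^+ 2) by rewrite /u; ring.
rewrite cabsM.
have x0 := normr_ge0 x; have e0 := cabs_ge0 e.
have zx : cabs z <= `|x| + L.
  by rewrite (le_trans (cabsD _ _)) // cabs_real lerD.
have hu : cabs u <= K1 * cabs e * (1 + `|x|).
  rewrite /u cabsN !cabsM cabs_real (ger0_norm pp) -/T /K1 -!mulrA ler_pM2l //.
  apply: ler_wpM2l => //.
  rewrite (le_trans (cabsD _ _)) // cabsX 2!cabsM cabs_nat.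
  have := ler_wpM2r e0 zx => hz.
  have : cabs e ^+ 2 <= cabs e by rewrite expr2 ler_piMr.
  have := mulr_ge0 (mulr_ge0 L0 x0) e0; have := mulr_ge0 x0 e0; have := mulr_ge0 L0 e0.
  by move: (cabs e ^+ 2) hz => e2 hz; lra.
have hu1 : cabs u <= K1 * (1 + `|x|).
  by rewrite (le_trans hu) // -mulrA ler_wpM2l // ler_piMl // addr_ge0.
clearbody K1.
have x1 : (1 + `|x|) ^+ 2 <= expR (2 * (1 + `|x|)).
  rewrite expRM_natl lerXn2r ?nnegrE ?expR_ge0 ?addr_ge0 //.
  by rewrite (le_trans _ (expR_ge1Dx _)) // lerDr.
have E1 : 1 <= expR ((K1 + 2) * (1 + `|x|)).
  by rewrite -expR0 ler_expR mulr_ge0 // addr_ge0.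
have main : cabs (cexp u - 1 - u - pi%:C * t * e ^+ 2) <=
   (4 * K1 ^+ 2 + K1) * cabs e ^+ 2 * expR ((K1 + 2) * (1 + `|x|)).
  rewrite (le_trans (cabsB _ _)) // mulrDl mulrDl lerD //.
    rewrite (le_trans (cexp_bound2 _)) //.
    rewrite (_ : (K1 + 2) * (1 + `|x|) = 2 * (1 + `|x|) + K1 * (1 + `|x|)); last by ring.
    rewrite expRD.
    rewrite (_ : 4 * K1 ^+ 2 * cabs e ^+ 2 * (expR (2 * (1 + `|x|)) * expR (K1 * (1 + `|x|))) =
      (4 * (K1 ^+ 2 * cabs e ^+ 2 * expR (2 * (1 + `|x|)))) * expR (K1 * (1 + `|x|))); last by ring.
    apply: ler_pM; [by rewrite mulr_ge0 ?sqr_ge0|exact: expR_ge0| |by rewrite ler_expR].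
    rewrite ler_pM2l //.
    apply: (@le_trans _ _ ((K1 * cabs e * (1 + `|x|)) ^+ 2)).
      exact: le_sqr (cabs_ge0 _) hu.
    rewrite !exprMn; apply: ler_wpM2l; [by apply: mulr_ge0; exact: sqr_ge0|exact: x1].
  rewrite cabsM cabsX cabsM cabs_real (ger0_norm pp) -/T.
  apply: (@le_trans _ _ (K1 * cabs e ^+ 2)).
    by rewrite ler_wpM2r ?sqr_ge0.
  by rewrite ler_peMr // mulr_ge0 ?sqr_ge0.
apply: (le_trans (ler_wpM2l (cabs_ge0 _) main)).
have D0 : 0 <= (4 * K1 ^+ 2 + K1) * cabs e ^+ 2.
  by rewrite mulr_ge0 ?sqr_ge0 // addr_ge0 // mulr_ge0 ?sqr_ge0.
have := ler_wpM2l D0 (hC x s sL); rewrite -/z.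
by rewrite [leLHS]mulrCA => /le_trans; apply; rewrite le_eqVlt; apply/orP; left; apply/eqP; ring.
Qed.

Lemma gau_bound (L : R) : 0 <= L -> exists2 C, 0 <= C &
  forall x s, cabs s <= L -> cabs (gau t (x%:C + s)) <= C * expR (- `|x|).
Proof.
move=> L0; have [C C0 hC] := gau_maj L0 (lexx 0); exists C => // x s /(hC x).
by rewrite mul0r expR0 mulr1.
Qed.

Lemma asum_mesh (h : R) : 0 < h <= 1 -> asum (fun n : int => h * expR (- `|n%:~R * h|)) 4.
Proof.
case/andP=> h0 h1; apply: (@asum_leM _ _ _ (h * (2 * (1 + h^-1)))).
  by rewrite (_ : h * _ = 2 * h + 2); [lra|field; rewrite gt_eqF].
apply: asumZ; first exact: ltW.
have := asum_expR_int 0 h0; congr asum; apply/funext => n.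
by rewrite addr0 normrM (gtr0_norm h0) mulrC.
Qed.

Lemma asum_mesh_le (h K : R) (u : int -> R[i]) : 0 < h <= 1 -> 0 <= K ->
  (forall n, cabs (u n) <= K * expR (- `|n%:~R * h|)) ->
  asum (fun n => cabs (h%:C * u n)) (K * 4).
Proof.
move=> hh K0 hu; apply: asum_le (asumZ K0 (asum_mesh hh)) => n.
rewrite cabs_ge0 cabsM cabs_real ger0_norm; last by case/andP: hh => /ltW.
rewrite mulrCA ler_wpM2l //; by case/andP: hh => /ltW.
Qed.

(** A discrete contour shift. [gsum] has period [h] in [s], so $e/h$ times its increment over one
    period, which is 0, may be subtracted. This cancels the term linear in [e] and leaves two Taylor
    remainders, each $O(h|e|)$. *)
Lemma gsum_step (L : R) : 0 <= L -> exists2 C, 0 <= C &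
  forall h s e, 0 < h <= 1 -> cabs s <= L -> cabs e <= h ->
    cabs (gsum t h (s + e) - gsum t h s) <= C * h * cabs e.
Proof.
move=> L0; have [C C0 hC] := gau_rem L0.
have L1 : 0 <= L + 1 by lra.
have [B B0 hB] := gau_bound L1.
exists (C * 8) => [|h s e hh sL eh]; first by rewrite mulr_ge0.
have /andP[h0 h1] := hh.
have hsm s' : cabs s' <= L + 1 -> summ (fun n : int => h%:C * gau t ((n%:~R * h)%:C + s')).
  by move=> hs; exists (B * 4); apply: asum_mesh_le => // n; exact: hB.
have se : cabs (s + e) <= L + 1 by rewrite (le_trans (cabsD _ _)) // lerD // (le_trans eh).
have sh : cabs (s + h%:C) <= L + 1.
  by rewrite (le_trans (cabsD _ _)) // lerD // cabs_real gtr0_norm.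
have ss : cabs s <= L + 1 by rewrite (le_trans sL) // lerDl.
have Z : gsum t h (s + h%:C) = gsum t h s.
  rewrite /gsum [RHS](tsum_int_shift 1); last exact: hsm.
  apply: tsum_eq => n.
  by congr (_ * gau _ _); rewrite intrD mulrDl mul1r rmorphD /=; ring.
pose D (e' : R[i]) n := gau t ((n%:~R * h)%:C + s + e') - gau t ((n%:~R * h)%:C + s)
          + 2%:R * pi%:C * t * ((n%:~R * h)%:C + s) * e' * gau t ((n%:~R * h)%:C + s).
have h_neq0 : h%:C != 0 by rewrite fmorph_eq0 gt_eqF.
have -> : gsum t h (s + e) - gsum t h s =
   tsum (fun n : int => h%:C * (D e n - (e / h%:C) * D h%:C n)).
  transitivity ((gsum t h (s + e) - gsum t h s) -
     (e / h%:C) * (gsum t h (s + h%:C) - gsum t h s)).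
    by rewrite Z subrr mulr0 subr0.
  have Bd e' : cabs (s + e') <= L + 1 ->
    summ (fun n : int => h%:C * (gau t ((n%:~R * h)%:C + s + e') - gau t ((n%:~R * h)%:C + s)))
    /\ gsum t h (s + e') - gsum t h s =
    tsum (fun n : int => h%:C * (gau t ((n%:~R * h)%:C + s + e') - gau t ((n%:~R * h)%:C + s))).
    move=> he; have -> : (fun n : int => h%:C * (gau t ((n%:~R * h)%:C + s + e') - gau t ((n%:~R * h)%:C + s))) =
       (fun n : int => h%:C * gau t ((n%:~R * h)%:C + (s + e')) - h%:C * gau t ((n%:~R * h)%:C + s)).
      by apply/funext => n; rewrite mulrBr addrA.
    split; last by rewrite tsumB //; exact: hsm.
    have := summD (hsm _ he) (summZ (-1) (hsm _ ss)); congr summ.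
    by apply/funext => n; rewrite mulN1r.
  have [s1 ->] := Bd e se; have [s2 ->] := Bd h%:C sh.
  rewrite -tsumZ // -tsumB //; last exact: summZ.
  by apply: tsum_eq => n; rewrite /D; field.
apply: (@le_trans _ _ ((C * (2 * h * cabs e)) * 4)); last by rewrite le_eqVlt; apply/orP; left; apply/eqP; ring.
have e0 := cabs_ge0 e.
apply: tsum_le; apply: asum_mesh_le => //; first by rewrite !mulr_ge0 // ltW.
move=> n; rewrite (le_trans (cabsB _ _)) //.
have h3 := hC (n%:~R * h) s e sL (le_trans eh h1).
have h4 : cabs (D h%:C n) <= C * cabs h%:C ^+ 2 * expR (- `|n%:~R * h|).
  by apply: hC => //; rewrite cabs_real gtr0_norm.
rewrite cabs_real (gtr0_norm h0) in h4.
rewrite cabsM cabsM cabsV cabs_real (gtr0_norm h0).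
have h5 : cabs e / h * cabs (D h%:C n) <= C * h * cabs e * expR (- `|n%:~R * h|).
  rewrite (le_trans (ler_wpM2l _ h4)) ?divr_ge0 ?(ltW h0) // le_eqVlt; apply/orP; left.
  by apply/eqP; field; rewrite gt_eqF.
have h6 : cabs (D e n) <= C * h * cabs e * expR (- `|n%:~R * h|).
  rewrite (le_trans h3) // ler_wpM2r ?expR_ge0 // -mulrA ler_wpM2l //.
  by rewrite expr2 ler_wpM2r.
rewrite (_ : C * _ * _ = C * h * cabs e * expR (- `|n%:~R * h|) + C * h * cabs e * expR (- `|n%:~R * h|)); last by ring.
exact: lerD.
Qed.

(** The segment from 0 to [s] is walked in [K] steps of length at most [h]; each costs $O(h|e|)$,
    together $O(h|s|)$. *)
Lemma gsum_shift (s : R[i]) : exists2 C, 0 <= C &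
  forall h, 0 < h <= 1 -> cabs (gsum t h s - gsum t h 0) <= C * h.
Proof.
have [C C0 hC] := gsum_step (cabs_ge0 s).
exists (C * cabs s); first by rewrite mulr_ge0 ?cabs_ge0.
move=> h hh; have /andP[h0 h1] := hh.
pose K := (Num.truncn (cabs s / h)).+1.
have K0 : 0 < K%:R :> R by rewrite ltr0n.
have hK : cabs s / h <= K%:R by rewrite ltW // truncnS_gt // divr_ge0 ?cabs_ge0 // ltW.
pose e := s / K%:R.
have ce : cabs e = cabs s / K%:R by rewrite cabsM cabsV cabs_nat.
have eh : cabs e <= h by rewrite ce ler_pdivrMr // mulrC -ler_pdivrMr.
have H (j : nat) : (j <= K)%N -> cabs (gsum t h (j%:R * e) - gsum t h 0) <= C * h * (j%:R * cabs e).
  elim: j => [_|j IH jK]; first by rewrite !mul0r mulr0 subrr cabs0.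
  have jn : cabs (j%:R * e) <= cabs s.
    rewrite cabsM cabs_nat ce mulrCA ler_piMr ?cabs_ge0 // ler_pdivrMr // mul1r ler_nat.
    exact: ltnW.
  have := hC h (j%:R * e) e hh jn eh; have := IH (ltnW jK).
  rewrite -![j.+1%:R]natr1 !mulrDl !mul1r mulrDr => a1 a2.
  have -> : gsum t h (j%:R * e + e) - gsum t h 0 =
    (gsum t h (j%:R * e) - gsum t h 0) + (gsum t h (j%:R * e + e) - gsum t h (j%:R * e)) by ring.
  by rewrite (le_trans (cabsD _ _)) // lerD.
have Ke : K%:R * e = s.
  rewrite /e mulrC divfK // -(rmorph_nat (real_complex R)) fmorph_eq0.
  by rewrite gt_eqF.
have Kce : K%:R * cabs e = cabs s by rewrite ce mulrC divfK // gt_eqF.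
by have := H K (leqnn _); rewrite Ke Kce -mulrA [h * _]mulrC mulrA.
Qed.

Lemma summ_ghat h k : 0 < h <= 1 ->
  summ (fun n : int => h%:C * (gau t (n%:~R * h)%:C * ee (- (n%:~R * h * k)%:C))).
Proof.
move=> hh; have [B B0 hB] := gau_bound (lexx 0).
exists (B * 4); apply: asum_mesh_le => // n.
rewrite cabsM cabs_ee_realN mulr1.
by have := hB (n%:~R * h) 0; rewrite cabs0 addr0; apply.
Qed.

Lemma ghat_bound : exists2 C, 0 <= C & forall h k, 0 < h <= 1 -> cabs (ghat t h k) <= C.
Proof.
have [B B0 hB] := gau_bound (lexx 0); exists (B * 4); first by rewrite mulr_ge0.
move=> h k hh; apply: tsum_le; apply: asum_mesh_le => // n.
rewrite cabsM cabs_ee_realN mulr1.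
by have := hB (n%:~R * h) 0; rewrite cabs0 addr0; apply.
Qed.

(** Completing the square: a frequency [k] is the same as an imaginary displacement of the nodes, up
    to an explicit factor. *)
Lemma gsum_ghat h k : 0 < h <= 1 ->
  gsum t h ('i * k%:C / t) = cexp (pi%:C * k%:C ^+ 2 / t) * ghat t h k.
Proof.
move=> hh; rewrite /ghat -tsumZ; last exact: summ_ghat.
apply: tsum_eq => n.
rewrite mulrCA; congr (_ * _); rewrite !gauE eeE -!cexpD; congr cexp.
have i2 : 'i * 'i = -1 :> R[i] by rewrite -expr2 sqr_i.
set x := (n%:~R * h)%:C.
have -> : (n%:~R * h * k)%:C = x * k%:C by rewrite -rmorphM.
have -> : - (pi%:C * t * (x + 'i * k%:C / t) ^+ 2) =
  - (pi%:C * t * x ^+ 2) - 2%:R * pi%:C * 'i * x * k%:C - pi%:C * ('i * 'i) * k%:C ^+ 2 / t.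
  by field.
by rewrite i2 rmorphM /= rmorph_nat; field.
Qed.

Lemma ghat_shift k : exists2 C, 0 <= C & forall h, 0 < h <= 1 ->
  cabs (ghat t h k - ghat t h 0 * cexp (- (pi%:C * k%:C ^+ 2 / t))) <= C * h.
Proof.
have [C C0 hC] := gsum_shift ('i * k%:C / t).
exists (cabs (cexp (- (pi%:C * k%:C ^+ 2 / t))) * C); first by rewrite mulr_ge0 ?cabs_ge0.
move=> h hh; have := hC h hh; rewrite gsum_ghat //.
have -> : gsum t h 0 = ghat t h 0.
  by have := gsum_ghat 0 hh; rewrite rmorph0 mulr0 mul0r expr0n /= mulr0 mul0r cexp0 mul1r.
move=> H; rewrite -[cabs _ * C * h]mulrA.
have H2 := ler_wpM2l (cabs_ge0 (cexp (- (pi%:C * k%:C ^+ 2 / t)))) H.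
apply: le_trans H2; rewrite -cabsM mulrBr cexpN.
by rewrite mulKf ?cexp_neq0 // [ghat t h 0 * _]mulrC.
Qed.

(** Summation by parts. Moving the nodes by $\pm h$ multiplies the sum by $w^{\pm 1}$, so $w +
    w^{-1} - 2$ times it is a second difference, in which the linear Taylor terms cancel. That
    factor is $-4\sin^2(\pi hk)$, comparable with $(hk)^2$ as long as $h|k| \le 1/2$. *)
Lemma ghat_decay : exists2 C, 0 <= C & forall h k, 0 < h <= 1 -> h * `|k| <= 1 / 2 ->
  cabs (ghat t h k) <= C / (1 + k ^+ 2).
Proof.
have [C C0 hC] := gau_rem (lexx 0); have [B B0 hB] := ghat_bound.
pose D := 2 * B + 2 * (C * 8).
exists D; first by rewrite addr_ge0 ?mulr_ge0.
move=> h k hh hk; have /andP[h0 h1] := hh.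
have p1 : 0 < 1 + k ^+ 2 by rewrite ltr_pwDl ?sqr_ge0.
rewrite ler_pdivlMr //.
have [k1|k1] := leP (k ^+ 2) 1.
  apply: (@le_trans _ _ (B * 2)).
    by rewrite ler_pM ?cabs_ge0 ?hB //; lra.
  by rewrite /D; lra.
suff main : cabs (ghat t h k) * k ^+ 2 <= C * 8.
  apply: (@le_trans _ _ (2 * (cabs (ghat t h k) * k ^+ 2))); last by rewrite /D; lra.
  by rewrite mulrCA ler_wpM2l ?cabs_ge0 //; lra.
pose w : R[i] := ee (h * k)%:C.
have sm := summ_ghat k hh.
pose u (n : int) := gau t (n%:~R * h)%:C * ee (- (n%:~R * h * k)%:C).
have E1 : w * ghat t h k = tsum (fun n : int =>
     h%:C * (gau t ((n%:~R * h)%:C + h%:C) * ee (- (n%:~R * h * k)%:C))).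
  rewrite /ghat (tsum_int_shift 1) // -tsumZ; last first.
    by apply: (summ_inj (h := fun n : int => n + 1) _ sm); exact: addIr.
  apply: tsum_eq => n; rewrite mulrCA; congr (_ * _).
  rewrite mulrCA /w -eeD; congr (gau _ _ * ee _); rewrite intrD.
    by rewrite !rmorphM /= rmorphD /=; ring.
  by rewrite !rmorphM /= rmorphD /=; ring.
have E2 : w^-1 * ghat t h k = tsum (fun n : int =>
     h%:C * (gau t ((n%:~R * h)%:C - h%:C) * ee (- (n%:~R * h * k)%:C))).
  rewrite /ghat (tsum_int_shift (-1)) // -tsumZ; last first.
    by apply: (summ_inj (h := fun n : int => n - 1) _ sm); exact: addIr.
  apply: tsum_eq => n; rewrite mulrCA; congr (_ * _).
  rewrite mulrCA /w -eeN -eeD; congr (gau _ _ * ee _); rewrite intrD.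
    by rewrite !rmorphM /= rmorphD /=; ring.
  by rewrite !rmorphM /= rmorphD /=; ring.
have [B1 B10 hB1] := gau_bound ler01.
have smp (e : R[i]) : cabs e <= 1 -> summ (fun n : int =>
     h%:C * (gau t ((n%:~R * h)%:C + e) * ee (- (n%:~R * h * k)%:C))).
  move=> e1; exists (B1 * 4); apply: asum_mesh_le => // n.
  by rewrite cabsM cabs_ee_realN mulr1 hB1.
have ch : cabs h%:C <= 1 by rewrite cabs_real gtr0_norm.
have chN : cabs (- h%:C) <= 1 by rewrite cabsN.
have E : cabs ((w + w^-1 - 2%:R) * ghat t h k) <= C * (2 * h ^+ 2) * 4.
  have E3 : 2%:R * ghat t h k = _ := esym (tsumZ 2%:R sm).
  rewrite mulrBl mulrDl E1 E2 E3 -(tsumD (smp _ ch) (smp _ chN)) -tsumB; last 2 first.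
  - by apply: summD; exact: smp.
  - exact: summZ.
  apply: (@tsum_le _ _ (fun n : int => _)).
  rewrite (_ : (fun n : int => cabs _) = fun n : int => cabs (h%:C *
     ((gau t ((n%:~R * h)%:C + 0 + h%:C) - gau t ((n%:~R * h)%:C + 0) +
       2%:R * pi%:C * t * ((n%:~R * h)%:C + 0) * h%:C * gau t ((n%:~R * h)%:C + 0) +
      (gau t ((n%:~R * h)%:C + 0 + (- h%:C)) - gau t ((n%:~R * h)%:C + 0) +
       2%:R * pi%:C * t * ((n%:~R * h)%:C + 0) * (- h%:C) * gau t ((n%:~R * h)%:C + 0)))
       * ee (- (n%:~R * h * k)%:C)))); last first.
    by apply/funext => n; congr cabs; rewrite !addr0; ring.
  apply: (asum_mesh_le hh).
    by apply: mulr_ge0 => //; apply: mulr_ge0 => //; exact: sqr_ge0.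
  move=> n; rewrite cabsM cabs_ee_realN mulr1 (le_trans (cabsD _ _)) //.
  have c0 : cabs (0 : R[i]) <= 0 by rewrite cabs0.
  have a1 := hC (n%:~R * h) 0 h%:C c0 ch; have a2 := hC (n%:~R * h) 0 (- h%:C) c0 chN.
  rewrite cabsN in a2; rewrite cabs_real (gtr0_norm h0) in a1 a2.
  by rewrite (le_trans (lerD a1 a2)) // le_eqVlt; apply/orP; left; apply/eqP; ring.
have W : w + w^-1 - 2%:R = (- (4 * sin (pi * (h * k)) ^+ 2))%:C.
  rewrite /w -eeN ee.unlock /expi /= !mulr0 !oppr0 expR0 !mul1r mulrN cosN sinN.
  have -> : 2 * pi * (h * k) = (pi * (h * k)) *+ 2 :> R by ring.
  rewrite cos_mulr2n sin_mulr2n.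
  rewrite -(rmorph_nat (real_complex R) 2).
  have := cos2Dsin2 (pi * (h * k)); move: (cos _) (sin _) => c s cs.
  apply/eqP; rewrite eq_complex /= ?mulr0 ?oppr0 ?expR0; apply/andP; split; apply/eqP; last by ring.
  by have -> : s ^+ 2 = 1 - c ^+ 2; [rewrite -cs; ring|ring].
rewrite cabsM W cabs_real normrN normrM normrX (@ger0_norm _ 4) // in E.
have S : pi * (h * `|k|) / 4 <= `|sin (pi * (h * k))|.
  have hk0 : 0 <= pi * (h * `|k|) <= pi / 2.
    rewrite !mulr_ge0 ?(ltW pi0) ?(ltW h0) //=; rewrite ler_pM2l //; lra.
  have := sin_lower hk0 => /le_trans; apply.
  have [k0|k0] := leP 0 k; first by rewrite (ger0_norm k0) ler_norm.
  by rewrite (ltr0_norm k0) !mulrN sinN -normrN ler_norm.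
have S2 : h * `|k| / 2 <= `|sin (pi * (h * k))|.
  apply: le_trans S; have := @pi_ge2 R => p2.
  have : 0 <= h * `|k| by rewrite mulr_ge0 // ltW.
  nra.
have S3 : h ^+ 2 * k ^+ 2 / 4 <= `|sin (pi * (h * k))| ^+ 2.
  have -> : h ^+ 2 * k ^+ 2 / 4 = (h * `|k| / 2) ^+ 2.
    by rewrite !exprMn real_normK ?num_real //; field.
  by rewrite lerXn2r ?nnegrE // divr_ge0 // mulr_ge0 // ltW.
have h2 : 0 < h ^+ 2 by rewrite exprn_gt0.
rewrite -(ler_pM2l h2).
have g0 := cabs_ge0 (ghat t h k).
have := ler_wpM2r g0 S3; lra.
Qed.

End Gauss.

Section Pois.
Variable R : realType.
Local Open Scope complex_scope.
Local Open Scope ring_scope.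
Implicit Types (t : R[i]) (a b : R).

(** The space side of the Poisson formula in one variable with twist [b]; [gper] is the frequency
    side without its constant. *)
Definition hper t b a : R[i] :=
  tsum (fun l : int => gau t (l%:~R + a)%:C * ee (- (b * (l%:~R + a))%:C)).
Definition gper t b a : R[i] :=
  tsum (fun k : int => ee (k%:~R * a)%:C * cexp (- (pi%:C * (k%:~R + b)%:C ^+ 2 / t))).

Lemma geom_root (M : nat) (d k0 : int) : (0 < M)%N ->
  \sum_(i < M) ee ((k0 + i%:Z)%:~R * (d%:~R / M%:R) : R)%:C =
  if (M%:Z %| d)%Z then M%:R else 0.
Proof.
move=> M0; have M0' : M%:R != 0 :> R by rewrite pnatr_eq0 -lt0n.
pose w : R[i] := ee (d%:~R / M%:R : R)%:C.
have E i : ee ((k0 + i%:Z)%:~R * (d%:~R / M%:R) : R)%:C = ee (k0%:~R * (d%:~R / M%:R) : R)%:C * w ^+ i.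
  rewrite /w -eeM_natl -eeD; congr ee.
  by rewrite -(rmorph_nat (real_complex R)) -rmorphM -rmorphD /=; congr (_%:C); rewrite intrD -pmulrn; ring.
under eq_bigr do rewrite E.
rewrite -mulr_sumr.
have wM : w ^+ M = 1.
  rewrite /w -eeM_natl -(rmorph_nat (real_complex R)) -rmorphM /= mulrC divfK //.
  by rewrite (rmorph_int (real_complex R)) ee_int.
have [/dvdzP[q Eq]|nd] := ifPn.
  have w1 : w = 1.
    rewrite /w Eq intrM -pmulrn mulfK //.
    by rewrite (rmorph_int (real_complex R)) ee_int.
  rewrite (eq_bigr (fun=> 1)) => [|i _]; last by rewrite w1 expr1n.
  rewrite sumr_const card_ord Eq intrM -pmulrn mulfK //.
  by rewrite -intrM (rmorph_int (real_complex R)) ee_int mul1r.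
have w1 : w != 1.
  apply: contra nd => /eqP; rewrite /w ee.unlock /expi /= mulr0 oppr0 expR0 => /eqP.
  rewrite eq_complex /= => /andP[/eqP h1 _]; move: h1; rewrite mul1r mul0r subr0 => h1.
  pose x := pi * (d%:~R / M%:R) : R.
  have s0 : sin x = 0.
    have : cos (x *+ 2) = 1 by rewrite -h1 /x; congr cos; ring.
    rewrite cos_mulr2n => h2; have := sin2cos2 x => h3.
    by apply/eqP; rewrite -sqrf_eq0 h3; apply/eqP; lra.
  have pi0 : 0 < pi :> R by exact: pi_gt0.
  pose q := Num.floor (d%:~R / M%:R : R); pose y := d%:~R / M%:R - q%:~R : R.
  have /andP[f1 f2] := floor_itv (d%:~R / M%:R : R).
  rewrite intrD in f2.
  have y0 : 0 <= y < 1 by rewrite /y /q; apply/andP; split; lra.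
  have sy : sin (pi * y) = 0.
    have -> : pi * y = x + (- q%:~R) * pi by rewrite /x /y; ring.
    rewrite sinD s0 mul0r add0r; suff -> : sin (- q%:~R * pi : R) = 0 by rewrite mulr0.
    have sn (n : nat) : sin (n%:R * pi : R) = 0.
      elim: n => [|n IH]; first by rewrite mul0r sin0.
      by rewrite -natr1 mulrDl mul1r sinD IH sinpi mul0r mulr0 addr0.
    rewrite mulNr sinN; case: (q) => n; first by rewrite -pmulrn sn oppr0.
    by rewrite NegzE mulrNz mulNr sinN -pmulrn sn !oppr0.
  have [yz|yn] := eqVneq y 0; last first.
    have : 0 < sin (pi * y).
      case/andP: y0 => y0 y1; apply: sin_gt0_pi; apply/andP; split.
        by rewrite mulr_gt0 // lt_neqAle eq_sym yn.
      by rewrite gtr_pMr.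
    by rewrite sy ltxx.
  apply/dvdzP; exists q; apply/eqP; rewrite -(eqr_int R) intrM -pmulrn.
  by move/eqP: yz; rewrite /y subr_eq0 => /eqP <-; rewrite divfK.
have := subrX1 w M; rewrite wM subrr => /esym/eqP.
by rewrite mulf_eq0 subr_eq0 (negbTE w1) /= => /eqP ->; rewrite mulr0.
Qed.

Lemma summ_hper t b a : 0 < complex.Re t ->
  summ (fun l : int => gau t (l%:~R + a)%:C * ee (- (b * (l%:~R + a))%:C)).
Proof.
move=> ht; have [B B0 hB] := gau_bound ht (lexx 0).
have H := asumZ B0 (asum_expR_int a (ltr01 : 0 < 1 :> R)).
apply: (summ_le _ H) => l; rewrite cabsM cabs_ee_realN mulr1 mul1r.
by have := hB (l%:~R + a) 0; rewrite cabs0 addr0; apply.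
Qed.

Lemma cabs_cexpinv t (k : R) : cabs (cexp (- (pi%:C * k%:C ^+ 2 / t))) =
  expR (- (pi * complex.Re t^-1 * k ^+ 2)).
Proof.
rewrite cabs_cexp; congr expR; case: t => c d.
by rewrite /= ; ring.
Qed.

Lemma summ_gper t b a : 0 < complex.Re t ->
  summ (fun k : int => ee (k%:~R * a)%:C * cexp (- (pi%:C * (k%:~R + b)%:C ^+ 2 / t))).
Proof.
move=> ht; have r0 : 0 < pi * complex.Re t^-1 by rewrite mulr_gt0 ?pi_gt0 ?Re_inv_gt0.
by apply: (summ_le _ (asum_gauss_int b r0)) => k; rewrite cabsM cabs_ee_real mul1r cabs_cexpinv.
Qed.

(** An identity without error term: the frequencies run over one full period modulo [M], so
    [geom_root] keeps exactly the nodes congruent to [j]. The window of frequencies may start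
    anywhere. *)
Lemma dft t b (M : nat) (j k0 : int) : 0 < complex.Re t -> (0 < M)%N ->
  \sum_(i < M) ee ((k0 + i%:Z)%:~R * (j%:~R / M%:R) : R)%:C * ghat t (M%:R^-1) ((k0 + i%:Z)%:~R + b)
  = hper t b (j%:~R / M%:R).
Proof.
move=> ht M0; have Mp : 0 < M%:R :> R by rewrite ltr0n.
have M0' : M%:R != 0 :> R by rewrite gt_eqF.
have hh : 0 < (M%:R^-1 : R) <= 1 by rewrite invr_gt0 Mp invf_le1 // ler1n.
pose u (n : int) := gau t (n%:~R / M%:R)%:C * ee (- (b * (n%:~R / M%:R))%:C).
have E i : ee ((k0 + i%:Z)%:~R * (j%:~R / M%:R) : R)%:C * ghat t (M%:R^-1) ((k0 + i%:Z)%:~R + b)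
   = tsum (fun n => (M%:R^-1 : R)%:C * u n * ee ((k0 + i%:Z)%:~R * ((j - n)%:~R / M%:R) : R)%:C).
  rewrite /ghat -tsumZ; last exact: summ_ghat.
  apply: tsum_eq => n; rewrite /u mulrCA -!mulrA; congr (_ * _).
  rewrite mulrCA; congr (_ * _); rewrite -!eeD; congr ee.
  rewrite -!rmorphN -!rmorphD /=; congr (_%:C); rewrite intrB; ring.
under eq_bigr do rewrite E.
have su i : summ (fun n => (M%:R^-1 : R)%:C * u n * ee ((k0 + i%:Z)%:~R * ((j - n)%:~R / M%:R) : R)%:C).
  have [B] := summ_ghat ht b hh; case=> B0 hB; exists B.
  apply: asum_le (conj B0 hB) => n; rewrite cabs_ge0 cabsM cabs_ee_real mulr1 !cabsM.
  by rewrite !cabs_ee_realN !mulr1 lexx.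
rewrite -(tsum_sum _ (fun i : 'I_M => su i)).2.
have -> : (fun n => \sum_(i < M) (M%:R^-1 : R)%:C * u n * ee ((k0 + i%:Z)%:~R * ((j - n)%:~R / M%:R) : R)%:C)
  = fun n => if (M%:Z %| j - n)%Z then u n else 0.
  apply/funext => n; rewrite -mulr_sumr geom_root //; case: ifP => _; last by rewrite mulr0.
  rewrite mulrAC -(rmorph_nat (real_complex R)) -rmorphM mulVf //= mul1r //.
rewrite /hper (tsum_inj (h := fun l : int => j + l * M%:Z)).
- apply: tsum_eq => l /=; have -> : j - (j + l * M%:Z) = (- l) * M%:Z by ring.
  rewrite dvdz_mull //.
  rewrite /u; have -> : (j + l * M%:Z)%:~R / M%:R = l%:~R + j%:~R / M%:R :> R.
    by rewrite intrD intrM -pmulrn mulrDl mulfK // addrC.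
  by [].
- by move=> x y /addrI /(mulIf (_ : M%:Z != 0)); apply; rewrite -lt0n.
- move=> n hn; case: ifP => // /dvdzP[q Eq]; case: (hn (- q)).
  by rewrite mulNr -Eq opprB addrC subrK.
- have [B hB] := summ_ghat ht b hh; exists (M%:R * B).
  apply: asum_le (asumZ (ltW Mp) hB) => n; rewrite cabs_ge0 /=; case: ifP => _.
    rewrite !cabsM !cabs_ee_realN !mulr1 cabs_real ger0_norm ?invr_ge0 ?(ltW Mp) //.
    by rewrite mulrA mulfV // mul1r.
  by rewrite cabs0 mulr_ge0 ?cabs_ge0 // ltW.
Qed.

Lemma inv_sq_shift (b k : R) : (1 + (k + b) ^+ 2)^-1 <= (2 + 2 * b ^+ 2) * (1 + k ^+ 2)^-1.
Proof.
have p1 : 0 < 1 + (k + b) ^+ 2 by rewrite ltr_pwDl ?sqr_ge0.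
have p2 : 0 < 1 + k ^+ 2 by rewrite ltr_pwDl ?sqr_ge0.
rewrite -div1r ler_pdivrMr // mulrAC ler_pdivlMr // mul1r.
have := sqr_ge0 (k + 2 * b); have := mulr_ge0 (sqr_ge0 b) (sqr_ge0 (k + b)); nra.
Qed.

Lemma pois_conv t (p : int) (q : nat) b (e : R) : 0 < complex.Re t -> (0 < q)%N -> 0 < e ->
  exists n0, forall n, (n0 <= n)%N ->
    cabs (hper t b (p%:~R / q%:R) -
      ghat t ((q * n.+1)%:R^-1) 0 * gper t b (p%:~R / q%:R)) <= e.
Proof.
move=> ht q0 e0.
have [C1 C10 hC1] := ghat_decay ht; have [C2 C20 hC2] := ghat_bound ht.
pose r := pi * complex.Re t^-1.
have r0 : 0 < r by rewrite mulr_gt0 ?pi_gt0 ?Re_inv_gt0.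
have qR : 0 < q%:R :> R by rewrite ltr0n.
pose M n := (q * n.+1)%N.
have M0 n : (0 < M n)%N by rewrite muln_gt0 q0.
have MR n : 0 < (M n)%:R :> R by rewrite ltr0n.
have hh n : 0 < ((M n)%:R^-1 : R) <= 1 by rewrite invr_gt0 MR (invf_le1 (MR n)) ler1n M0.
(* The window of [M n] frequencies is centred so that $|k + b|$ is at most half its length, which is
   the range of [ghat_decay]. *)
pose k0 n : int := - Num.floor ((M n)%:R / 2 + b).
pose a : R := p%:~R / q%:R.
have aM n : a = (p * n.+1%:Z)%:~R / (M n)%:R.
  rewrite /a /M natrM intrM -pmulrn -mulf_div divff ?mulr1 //.
pose inb n (k : int) := (k0 n <= k < k0 n + (M n)%:Z).
pose A n := ghat t ((M n)%:R^-1) 0.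
pose g (k : int) := ee (k%:~R * a)%:C * cexp (- (pi%:C * (k%:~R + b)%:C ^+ 2 / t)).
pose f n (k : int) := if inb n k then ee (k%:~R * a)%:C * ghat t ((M n)%:R^-1) (k%:~R + b) else 0.
have rng n k : inb n k -> (M n)%:R^-1 * `|k%:~R + b| <= 1 / 2.
  move=> /andP[h1 h2]; rewrite mulrC ler_pdivrMr // ler_norml.
  have /andP[f1 f2] := floor_itv ((M n)%:R / 2 + b).
  have h1' : - (Num.floor ((M n)%:R / 2 + b))%:~R <= k%:~R :> R by rewrite -mulrNz ler_int.
  have h2' : k%:~R + 1 <= - (Num.floor ((M n)%:R / 2 + b))%:~R + (M n)%:R :> R.
    by have := h2; rewrite /k0 -lezD1 -(ler_int R) !intrD mulrNz -pmulrn.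
  rewrite intrD in f2; apply/andP; split; lra.
pose W (k : int) := (C1 + C2 * (1 + r^-1)) * ((2 + 2 * b ^+ 2) * (1 + k%:~R ^+ 2)^-1).
have Wsum : asum W ((C1 + C2 * (1 + r^-1)) * ((2 + 2 * b ^+ 2) * 8)).
  have ri : 0 <= r^-1 by rewrite invr_ge0 ltW.
  apply: asumZ; first by rewrite addr_ge0 // mulr_ge0 // addr_ge0.
  by apply: asumZ (asum_inv_sq R); rewrite addr_ge0 // mulr_ge0 ?sqr_ge0.
have gW k : cabs (g k) <= (1 + r^-1) / (1 + (k%:~R + b) ^+ 2).
  rewrite /g cabsM cabs_ee_real mul1r cabs_cexpinv -/r.
  have p1 : 0 < 1 + (k%:~R + b) ^+ 2 :> R by rewrite ltr_pwDl ?sqr_ge0.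
  rewrite expRN ler_pdivlMr // mulrC ler_pdivrMr ?expR_gt0 //.
  have x0 : 0 <= (k%:~R + b) ^+ 2 :> R by exact: sqr_ge0.
  have := expR_ge1Dx (r * (k%:~R + b) ^+ 2).
  have ri : 0 < r^-1 by rewrite invr_gt0.
  rewrite -(ler_pM2l (_ : 0 < 1 + r^-1)); last by rewrite addr_gt0.
  apply: le_trans; have := mulr_ge0 (ltW r0) x0; move: ((k%:~R + b) ^+ 2) => x rx.
  have -> : (1 + r^-1) * (1 + r * x) = 1 + r * x + r^-1 + x by field; rewrite gt_eqF.
  lra.
have fW n k : cabs (f n k) <= C1 / (1 + (k%:~R + b) ^+ 2).
  rewrite /f; case: ifP => [h|_]; first by rewrite cabsM cabs_ee_real mul1r hC1 // rng.
  by rewrite cabs0 divr_ge0 // addr_ge0 // sqr_ge0.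
have AW n : cabs (A n) <= C2 by exact: hC2.
have dom n k : cabs (f n k - A n * g k) <= W k.
  rewrite (le_trans (cabsB _ _)) // cabsM.
  apply: (@le_trans _ _ ((C1 + C2 * (1 + r^-1)) * (1 + (k%:~R + b) ^+ 2)^-1)).
    by rewrite [leRHS]mulrDl lerD // -mulrA ler_pM ?cabs_ge0.
  apply: ler_wpM2l; last exact: inv_sq_shift.
  by rewrite addr_ge0 // mulr_ge0 // addr_ge0 // invr_ge0 ltW.
have pw k d : 0 < d -> exists n0, forall n, (n0 <= n)%N -> cabs (f n k - A n * g k - 0) <= d.
  move=> d0.
have [C3 C30 hC3] := ghat_shift ht (k%:~R + b).
pose X : R := C3 / d + 2 * (`|k%:~R + b| + 2).
exists (Num.truncn X).+1 => n hn; rewrite subr0.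
have X0 : 0 <= X by rewrite addr_ge0 ?divr_ge0 ?mulr_ge0 ?addr_ge0 // ltW.
have Xn : X <= (M n)%:R.
  rewrite (le_trans (ltW (truncnS_gt _))) // ler_nat (leq_trans hn) //.
  by rewrite (leq_trans (leqnSn n)) // leq_pmull.
have P1 : 0 <= C3 / d by rewrite divr_ge0 // ltW.
have kb := ler_norm (k%:~R + b); have kbN := ler_norm (- (k%:~R + b)); rewrite normrN in kbN.
have n0 := normr_ge0 (k%:~R + b).
have Xe : X = C3 / d + 2 * (`|k%:~R + b| + 2) by [].
have I : inb n k.
  have /andP[f1 f2] := floor_itv ((M n)%:R / 2 + b); rewrite intrD in f2.
  rewrite /inb /k0; apply/andP; split.
    rewrite -(ler_int R) mulrNz; lra.
  rewrite -(ltr_int R) intrD mulrNz -pmulrn; lra.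
rewrite /f I /A /g [ghat _ _ 0 * (_ * _)]mulrCA -mulrBr cabsM cabs_ee_real mul1r.
apply: le_trans (hC3 _ (hh n)) _.
rewrite ler_pdivrMr // -ler_pdivrMl // mulrC; lra.
have [n0 hn0] := @tannery R int (fun n k => f n k - A n * g k) (fun=> 0) W _ Wsum dom pw e e0.
exists n0 => n /hn0; rewrite (_ : tsum (fun=> 0) = 0); last first.
    by apply: hsum_tsum => d d0; exists fset0 => B _; rewrite big1 // subrr cabs0 ltW.
  have sf : summ (f n).
    apply: (summ_le (fW n)).
    have b2 : 0 <= 2 + 2 * b ^+ 2 by rewrite addr_ge0 // mulr_ge0 ?sqr_ge0.
    apply: asum_le (asumZ C10 (asumZ b2 (asum_inv_sq R))) => k.
    rewrite divr_ge0 ?addr_ge0 ?sqr_ge0 //=; apply: ler_wpM2l => //; exact: inv_sq_shift.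
  rewrite subr0 tsumB //; last by apply: summZ; exact: summ_gper.
  rewrite tsumZ; last exact: summ_gper.
  suff -> : tsum (f n) = hper t b a by [].
  rewrite [in RHS](aM n) -(dft b (p * n.+1%:Z) (k0 n) ht (M0 n)).
  rewrite (tsum_inj (h := fun i : 'I_(M n) => k0 n + (i : nat)%:Z)) //.
  - rewrite tsum_fin; apply: eq_bigr => i _ /=; rewrite /f /inb lerDl ltrD2l ltz_nat ltn_ord /= -aM //.
  - by move=> i i' /addrI [] /val_inj.
  - move=> k hk; rewrite /f; case: ifP => // /andP[h1 h2].
    have hk' : (`|k - k0 n| < M n)%N by lia.
    by case: (hk (Ordinal hk')); rewrite /= ; lia.
Qed.

(** If the series vanished at all $j/L$, averaging over [j] would keep only the terms with $L \mid
    k$; as [L] grows their sum tends to the term at 0, which is 1. *)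
Lemma gper_nz t : 0 < complex.Re t -> exists L j : nat, (0 < L)%N /\ gper t 0 (j%:R / L%:R) != 0.
Proof.
move=> ht; apply: contrapT => hz.
have hz' (L : nat) (j : nat) : (0 < L)%N -> gper t 0 (j%:R / L%:R) = 0.
  move=> L0; apply/eqP; apply: contrapT => /negP h; apply: hz; by exists L, j.
pose r := pi * complex.Re t^-1.
have r0 : 0 < r by rewrite mulr_gt0 ?pi_gt0 ?Re_inv_gt0.
pose c (k : R) := cexp (- (pi%:C * k%:C ^+ 2 / t)).
have cc k : cabs (c k) = expR (- (r * k ^+ 2)) by rewrite cabs_cexpinv.
have S0 (L : nat) : (0 < L)%N -> tsum (fun l : int => c (l%:~R * L%:R)) = 0.
  move=> L0; have LR : L%:R != 0 :> R[i] by rewrite -(rmorph_nat (real_complex R)) fmorph_eq0 pnatr_eq0 -lt0n.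
  have := tsum_sum (index_enum 'I_L) (fun j : 'I_L => summ_gper 0 ((j : nat)%:R / L%:R) ht).
  case=> sm; rewrite [RHS]big1; last by move=> j _; exact: hz'.
  have E : (fun k : int => \sum_(i < L) ee (k%:~R * ((i : nat)%:R / L%:R))%:C * cexp (- (pi%:C * (k%:~R + 0)%:C ^+ 2 / t)))
    = fun k : int => L%:R * (if (L%:Z %| k)%Z then c k%:~R else 0).
    apply/funext => k; rewrite -mulr_suml addr0.
    rewrite (eq_bigr (fun i : 'I_L => ee ((0 + (i : nat)%:Z)%:~R * (k%:~R / L%:R) : R)%:C)); last first.
      by move=> i _; congr (ee _%:C); rewrite add0r -pmulrn mulrCA.
    rewrite geom_root //; case: ifP => _ //; by rewrite mulr0 mul0r.
  rewrite E in sm *; rewrite (tsum_inj (h := fun l : int => l * L%:Z)) //.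
  - move=> H.
    have sm' := summ_inj (h := fun l : int => l * L%:Z) _ sm.
    have ij : injective (fun l : int => l * L%:Z).
      by move=> x y /(mulIf (_ : L%:Z != 0)); apply; rewrite -lt0n.
    have E2 : (fun k : int => L%:R * (if (L%:Z %| k)%Z then c k%:~R else 0)) \o (fun l : int => l * L%:Z) =
      fun l : int => L%:R * c (l%:~R * L%:R).
      by apply/funext => l /=; rewrite dvdz_mull // intrM -pmulrn.
    rewrite E2 in H.
    have s2 : summ (fun l : int => c (l%:~R * L%:R)).
      have := summZ L%:R^-1 (sm' ij); rewrite E2; congr summ; apply/funext => l.
      by rewrite mulKf.
    by move: H; rewrite tsumZ // => /eqP; rewrite mulf_eq0 (negbTE LR) /= => /eqP.
  - by move=> x y /(mulIf (_ : L%:Z != 0)); apply; rewrite -lt0n.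
  - move=> k hk; case: ifP => [/dvdzP[q Eq]|_]; last by rewrite mulr0.
    by case: (hk q).
pose v (l : int) : R[i] := if l == 0 then 1 else 0.
have dom (n : nat) (l : int) : cabs (c (l%:~R * n.+1%:R)) <= expR (- (r * (l%:~R + 0) ^+ 2)).
  rewrite cc ler_expR lerN2 addr0 ler_pM2l // exprMn ler_peMr ?sqr_ge0 //.
  by rewrite -natrX ler1n expn_gt0.
have vE : tsum v = 1.
  rewrite (tsum_inj (h := fun _ : 'I_1 => 0 : int)).
  - by rewrite tsum_fin big_ord1.
  - by move=> x y _; rewrite !ord1.
  - by move=> i hi; rewrite /v; case: eqP => // i0; case: (hi ord0).
  - exists 1; split=> [i|B]; first exact: cabs_ge0.
    apply: (@le_trans _ _ (\sum_(i <- fsetU B [fset (0 : int)]%fset) cabs (v i))).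
      by apply: ler_fset_sum; [exact: fsubsetUl|move=> i; exact: cabs_ge0].
    rewrite (big_fsetD1 0) ?inE ?eqxx ?orbT //= big1_fset ?addr0 => [|i].
      by rewrite /v eqxx cabs1.
    by rewrite !inE => /andP[/negbTE i0 _] _; rewrite /v i0 cabs0.
have h2 : 0 < 1 / 2 :> R by lra.
have [] := @tannery R int (fun n l => c (l%:~R * n.+1%:R)) v _ _ (asum_gauss_int 0 r0) dom _ _ h2; last first.
  by move=> n0 /(_ n0 (leqnn _)); rewrite S0 // vE sub0r cabsN cabs1; lra.
move=> l d d0; rewrite /v; case: eqP => [->|/eqP l0].
  by exists 0%N => n _; rewrite mul0r /c expr0n /= mulr0 mul0r oppr0 cexp0 subrr cabs0 ltW.
exists (Num.truncn (r^-1 / d)).+1 => n hn; rewrite subr0 cc expRN -[d]invrK.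
have x0 : 0 <= r^-1 / d by rewrite divr_ge0 ?invr_ge0 // ltW.
rewrite lef_pV2 ?posrE ?expR_gt0 ?invr_gt0 //.
apply: le_trans (expR_ge1Dx _); apply: (@le_trans _ _ (r * (r^-1 / d))).
  by rewrite mulrA mulfV ?mul1r // gt_eqF.
rewrite -[leLHS]add0r lerD // ler_pM2l //.
apply: (le_trans (ltW (truncnS_gt _))).
apply: (@le_trans _ _ n.+1%:R); first by rewrite ler_nat ltnW.
rewrite exprMn -[leLHS]mul1r ler_pM //.
  have h1 : 1 <= `|l%:~R| :> R by rewrite -intr_norm ler1z -gtz0_ge1 normr_gt0.
  by rewrite -[(l%:~R : R) ^+ 2]real_normK ?num_real //; nra.
by rewrite -natrX ler_nat expnS expn1 leq_pmull.
Qed.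

Definition lim_along (L : nat) t (A : R[i]) := forall e, 0 < e -> exists n0, forall n, (n0 <= n)%N ->
  cabs (ghat t ((L * n.+1)%:R^-1) 0 - A) <= e.

Lemma lim_alongM (L K : nat) t A : (0 < K)%N -> lim_along L t A -> lim_along (L * K) t A.
Proof.
move=> K0 h e /h[n0 hn]; exists n0 => n nn.
have -> : (L * K * n.+1 = L * (K * n.+1).-1.+1)%N by rewrite prednK ?muln_gt0 ?K0 // mulnA.
apply: hn; rewrite -ltnS prednK ?muln_gt0 ?K0 //.
by rewrite (leq_ltn_trans nn) // leq_pmull.
Qed.

Lemma lim_along_uniq L t A A' : lim_along L t A -> lim_along L t A' -> A = A'.
Proof.
move=> h h'; apply/eqP; rewrite -subr_eq0; apply/eqP/cabs_eq0/eqP.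
rewrite eq_le cabs_ge0 andbT; apply/ler_addgt0Pl => e e0; rewrite addr0.
have e2 : 0 < e / 2 by rewrite divr_gt0.
have [n1 h1] := h _ e2; have [n2 h2] := h' _ e2.
have {}h1 := h1 (maxn n1 n2) (leq_maxl _ _); have {}h2 := h2 (maxn n1 n2) (leq_maxr _ _).
set g := ghat _ _ _ in h1 h2.
have -> : A - A' = (g - A') - (g - A) by ring.
by rewrite (le_trans (cabsB _ _)) // (splitr e) lerD.
Qed.

Lemma le_eps0 (x : R) (K : R) : 0 <= x -> (forall e, 0 < e -> x <= K * e) -> x = 0.
Proof.
move=> x0 h; apply/eqP; rewrite eq_le x0 andbT; apply/ler_addgt0Pl => e e0; rewrite addr0.
have K0 : 0 <= K by rewrite -[K]mulr1 (le_trans x0) ?h.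
apply: (le_trans (h (e / (1 + K)) _)); first by rewrite divr_gt0 // ltr_pwDl.
by rewrite mulrA ler_pdivrMr ?ltr_pwDl // mulrC ler_pM2l // lerDr.
Qed.

(** The limit of Riemann sums identifies [A] and gives access to scaling and conjugation; the second
    part is Poisson summation, at rational shifts since the meshes are reciprocals of integers. *)
Definition is_pois t A := (exists2 L, (0 < L)%N & lim_along L t A) /\
  forall (p : int) (q : nat) b, (0 < q)%N -> hper t b (p%:~R / q%:R) = A * gper t b (p%:~R / q%:R).

(** [A] is read off at one fraction where the dual series is nonzero; meshes with common denominator
    [L * q] carry it to every other fraction. *)
Lemma pois_exists t : 0 < complex.Re t -> exists A, is_pois t A.
Proof.
move=> ht; have [L [j [L0 gnz]]] := gper_nz ht.
pose a : R := j%:R / L%:R; pose A := hper t 0 a / gper t 0 a.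
have hA : lim_along L t A.
  move=> e e0; have c0 := cabs_gt0 gnz.
  have [n0 hn] := pois_conv j 0 ht L0 (mulr_gt0 e0 c0).
  exists n0 => n /hn; rewrite -pmulrn -/a.
  have -> : hper t 0 a - ghat t ((L * n.+1)%:R^-1) 0 * gper t 0 a =
    - ((ghat t ((L * n.+1)%:R^-1) 0 - A) * gper t 0 a) by rewrite /A mulrBl divfK // opprB.
  by rewrite cabsN cabsM ler_pM2r.
exists A; split; first by exists L.
move=> p q b q0; apply/eqP; rewrite -subr_eq0; apply/eqP/cabs_eq0.
apply: (@le_eps0 _ (1 + cabs (gper t b (p%:~R / q%:R)))) => [|e e0]; first exact: cabs_ge0.
have qL : (0 < L * q)%N by rewrite muln_gt0 L0.
have [n1 h1] := pois_conv (p * L%:Z) b ht qL e0.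
have [n2 h2] := lim_alongM q0 hA e0.
have {}h1 := h1 (maxn n1 n2) (leq_maxl _ _); have {}h2 := h2 (maxn n1 n2) (leq_maxr _ _).
have E : (p * L%:Z)%:~R / (L * q)%:R = p%:~R / q%:R :> R.
  by rewrite intrM -pmulrn natrM; field; rewrite !pnatr_eq0 -!lt0n q0 L0.
rewrite E in h1; set g := ghat _ _ _ in h1 h2; set G := gper _ _ _ in h1 *.
have -> : hper t b (p%:~R / q%:R) - A * G = (hper t b (p%:~R / q%:R) - g * G) + (g - A) * G by ring.
by rewrite (le_trans (cabsD _ _)) // [leRHS]mulrDl mul1r lerD // cabsM mulrC ler_wpM2l ?cabs_ge0.
Qed.

(** Rescaling multiplies the mesh by a factor that may be irrational, so meshes that are merely
    close to each other have to be compared. *)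
Lemma ghat_mesh t : 0 < complex.Re t -> exists2 C, 0 <= C & forall h r, 0 < h <= 1 -> 1 <= r <= 2 ->
  h * r <= 1 -> cabs (ghat t (h * r) 0 - ghat t h 0) <= C * (r - 1).
Proof.
move=> ht; have [C C0 hC] := gau_maj ht (lexx 0) (ler0n R 2).
pose T := pi * cabs t; have T0 : 0 <= T by rewrite mulr_ge0 ?cabs_ge0 ?pi_ge0.
have TC := mulr_ge0 T0 C0; have KK : 0 <= C + 9 * T * C by lra.
exists ((C + 9 * T * C) * 4); first by lra.
move=> h r hh /andP[r1 r2] hr1; have /andP[h0 h1] := hh.
have hhr : 0 < h * r <= 1 by rewrite hr1 andbT mulr_gt0 //; lra.
have gm x : cabs (gau t x%:C) * expR (2 * (1 + `|x|)) <= C * expR (- `|x|).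
  by have := hC x 0; rewrite cabs0 addr0; apply.
rewrite -tsumB; [|exact: summ_ghat|exact: summ_ghat].
have -> : (fun n : int => (h * r)%:C * (gau t (n%:~R * (h * r))%:C * ee (- (n%:~R * (h * r) * 0)%:C)) -
   h%:C * (gau t (n%:~R * h)%:C * ee (- (n%:~R * h * 0)%:C))) =
   fun n : int => h%:C * ((r - 1)%:C * gau t (n%:~R * h * r)%:C +
      (gau t (n%:~R * h * r)%:C - gau t (n%:~R * h)%:C)).
  apply/funext => n; rewrite !mulr0 oppr0 ee0 !mulr1 rmorphM rmorphB rmorph1 /= !mulrA; ring.
apply: tsum_le; rewrite [X in asum _ X](_ : _ = ((C + 9 * T * C) * (r - 1)) * 4); last by ring.
apply: (asum_mesh_le hh); first by apply: mulr_ge0 => //; rewrite subr_ge0.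
move=> n; move: (n%:~R * h) => x.
have x2 : (1 + `|x|) ^+ 2 <= expR (2 * (1 + `|x|)).
  rewrite expRM_natl; apply: le_sqr; first by rewrite addr_ge0.
  by rewrite (le_trans _ (expR_ge1Dx _)) // lerDr.
have e1 : 1 <= expR (2 * (1 + `|x|)) by rewrite -expR0 ler_expR mulr_ge0 // addr_ge0.
have b1 : cabs (gau t (x * r)%:C) <= C * expR (- `|x|).
  apply: (@le_trans _ _ (C * expR (- `|x * r|))).
    apply: le_trans (gm (x * r)); rewrite ler_peMr ?cabs_ge0 //.
    by rewrite -expR0 ler_expR mulr_ge0 // addr_ge0.
  rewrite ler_wpM2l // ler_expR lerN2 normrM ler_peMr //.
  by rewrite (le_trans r1) // ler_norm.
have b2 : x ^+ 2 * cabs (gau t x%:C) <= C * expR (- `|x|).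
  apply: le_trans (gm x); rewrite mulrC ler_wpM2l ?cabs_ge0 //.
  apply: le_trans x2; rewrite -[x ^+ 2]real_normK ?num_real //.
  by apply: le_sqr => //; rewrite lerDr.
pose u := - (pi%:C * t * (r ^+ 2 - 1)%:C * x%:C ^+ 2).
have Eu : gau t (x * r)%:C - gau t x%:C = gau t x%:C * (cexp u - 1).
  rewrite mulrBr mulr1; congr (_ - _); rewrite !gauE -cexpD; congr cexp.
  by rewrite /u rmorphM rmorphB rmorphXn rmorph1 /=; ring.
have r3 : 0 <= r ^+ 2 - 1 <= 3 * (r - 1) by apply/andP; split; nra.
have Ru : complex.Re u <= 0.
  have -> : complex.Re u = - (pi * (r ^+ 2 - 1) * x ^+ 2 * complex.Re t).
    by rewrite /u; case: (t) => c d /=; ring.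
  have [r30 _] := andP r3.
  by rewrite oppr_le0; apply: mulr_ge0 (ltW ht); apply: mulr_ge0 (sqr_ge0 _); apply: mulr_ge0 r30; exact: pi_ge0.
have cu : cabs u = T * (r ^+ 2 - 1) * x ^+ 2.
  have [r30 _] := andP r3.
  rewrite /u cabsN 3!cabsM cabsX 3!cabs_real (ger0_norm (pi_ge0 R)) (ger0_norm r30).
  by rewrite real_normK ?num_real.
rewrite (le_trans (cabsD _ _)) // mulrDl mulrDl lerD //.
  rewrite cabsM cabs_real ger0_norm ?subr_ge0 // [leRHS]mulrAC mulrC.
  by rewrite ler_wpM2r ?subr_ge0.
rewrite Eu cabsM.
have g0 := cabs_ge0 (gau t x%:C).
apply: (le_trans (ler_wpM2l g0 (cexp_bound1 Ru))); rewrite cu.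
case/andP: r3 => r30 r31.
have k1 : T * (r ^+ 2 - 1) * (x ^+ 2 * cabs (gau t x%:C)) <= T * (3 * (r - 1)) * (C * expR (- `|x|)).
  apply: ler_pM => //; [by rewrite mulr_ge0|by rewrite mulr_ge0 ?sqr_ge0|by rewrite ler_wpM2l].
lra.
Qed.

Lemma ghat_scale t (d h : R) : 0 < complex.Re t -> 0 < d -> 0 < h -> h <= 1 -> Num.sqrt d * h <= 1 ->
  ghat (t * d%:C) h 0 = (Num.sqrt d)^-1%:C * ghat t (Num.sqrt d * h) 0.
Proof.
move=> ht d0 h0 h1 hd; have s0 : 0 < Num.sqrt d by rewrite sqrtr_gt0.
rewrite /ghat -tsumZ; last by apply: summ_ghat => //; rewrite hd mulr_gt0.
have E : (Num.sqrt d)^-1%:C * (Num.sqrt d * h)%:C = h%:C.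
  by rewrite -(rmorphM (real_complex R)) mulrA mulVf ?gt_eqF // mul1r.
apply: tsum_eq => n; rewrite [RHS]mulrA E.
rewrite !mulr0; congr (_ * (_ * _)); rewrite !gauE; congr cexp.
have dE : d%:C = (Num.sqrt d)%:C ^+ 2 by rewrite -rmorphXn /= sqr_sqrtr // ltW.
by rewrite dE !rmorphM /=; ring.
Qed.

(** Substitution turns the mesh [h] into [eps = sqrt d * h], which need not be the reciprocal of an
    integer. It is compared through [ghat_mesh] with the nearby mesh [eps'] of the form
    [1 / (L1 * n'.+1)]; the ratio is within [eps * L1] of 1. *)
Lemma pois_scale t (d : R) A A' : 0 < complex.Re t -> 0 < d -> is_pois t A -> is_pois (t * d%:C) A' ->
  A' = (Num.sqrt d)^-1%:C * A.
Proof.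
move=> ht d0 [[L1 L10 h1] _] [[L2 L20 h2] _].
have s0 : 0 < Num.sqrt d by rewrite sqrtr_gt0.
have [C C0 hC] := ghat_mesh ht.
apply/eqP; rewrite -subr_eq0; apply/eqP/cabs_eq0.
apply: (@le_eps0 _ (1 + (Num.sqrt d)^-1 * (1 + C))) => [|e e0]; first exact: cabs_ge0.
have [n1 hn1] := h1 _ e0; have [n2 hn2] := h2 _ e0.
pose s := Num.sqrt d; have sp : 0 < s by exact: s0.
(* Large enough for [K1] to [K4]: [eps] and [eps * L1] are at most 1, [eps * L1] is at most [e], and
   [n'] reaches [n1]. *)
pose X : R := s * (1 + L1%:R * (n1.+2)%:R) + s * L1%:R / e.
pose n := maxn n2 (Num.truncn X).+1.
have L1R : 1 <= L1%:R :> R by rewrite ler1n.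
have L1R0 : 0 < L1%:R :> R by rewrite ltr0n.
have X0 : 0 <= X by rewrite addr_ge0 ?divr_ge0 ?mulr_ge0 ?addr_ge0 // ltW.
pose h : R := (L2 * n.+1)%:R^-1.
have Xh : X <= h^-1.
  rewrite /h invrK (le_trans (ltW (truncnS_gt _))) // ler_nat.
  by rewrite (leq_trans (leq_maxr n2 _)) // (leq_trans (leqnSn _)) // leq_pmull.
have h0 : 0 < h by rewrite invr_gt0 ltr0n muln_gt0 L20.
have hle1 : h <= 1 by rewrite invf_le1 ?ltr0n ?muln_gt0 ?L20 // ler1n muln_gt0 L20.
have P1 : 0 <= s * L1%:R / e by rewrite !mulr_ge0 ?invr_ge0 // ltW.
pose eps := s * h.
have eps0 : 0 < eps by rewrite mulr_gt0.
have Xs : X * h <= 1 by rewrite -ler_pdivlMr // div1r.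
have K1 : eps * (1 + L1%:R * (n1.+2)%:R) <= 1.
  apply: le_trans Xs; rewrite /X mulrDl /eps.
  by rewrite mulrAC lerDl mulr_ge0 // ltW.
have K2 : eps * L1%:R <= e.
  rewrite -[leRHS]mul1r -ler_pdivrMr //; apply: le_trans Xs.
  have : s * (1 + L1%:R * (n1.+2)%:R) * h >= 0 by rewrite !mulr_ge0 ?addr_ge0 ?mulr_ge0 // ltW.
  rewrite /X mulrDl /eps => ?; rewrite [leLHS](_ : _ = s * L1%:R / e * h); [lra|ring].
have K3 : eps <= 1.
  apply: le_trans K1; rewrite ler_peMr ?(ltW eps0) // lerDl mulr_ge0 // ltW.
have K4 : eps * L1%:R <= 1.
  apply: le_trans K1; rewrite ler_pM2l // -[leLHS]add0r lerD // ler_peMr ?ltW // ltr1n //.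
pose y := (eps * L1%:R)^-1.
have y1 : 1 <= y by rewrite -[1]invr1 lef_pV2 ?posrE // mulr_gt0.
have y0 : 0 <= y by rewrite (le_trans _ y1).
pose n' := Num.truncn y.
have n'1 : n'%:R <= y by rewrite truncn_le.
have n'2 : y < n'.+1%:R by exact: truncnS_gt.
have yE : y * (eps * L1%:R) = 1 by rewrite mulVf // gt_eqF // mulr_gt0.
have nn1 : (n1 <= n')%N.
  rewrite -ltnS -(ltr_nat R); apply: le_lt_trans n'2.
  rewrite -(ler_pM2r (_ : 0 < eps * L1%:R)) ?mulr_gt0 // yE; apply: le_trans K1.
  have H (z k x : R) : 0 <= z -> 0 <= z * k -> x * (z * k) <= z * (1 + k * (x + 2)) by move=> z0 zk; lra.
  by rewrite -[n1.+2]addn2 natrD; apply: H; rewrite ?mulr_ge0 // ltW.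
pose eps' : R := (L1 * n'.+1)%:R^-1.
have e'p : 0 < eps' by rewrite invr_gt0 ltr0n muln_gt0 L10.
have e'1 : eps' <= 1 by rewrite invf_le1 ?ltr0n ?muln_gt0 ?L10 // ler1n muln_gt0 L10.
pose r := eps / eps'.
have rE : r = eps * L1%:R * n'.+1%:R by rewrite /r /eps' invrK natrM mulrA.
have eL0 : 0 < eps * L1%:R by rewrite mulr_gt0.
have r1 : 1 <= r by rewrite rE mulrC -[leLHS]yE ler_pM2r // ltW.
have r2 : r - 1 <= eps * L1%:R.
  rewrite rE -natr1 mulrDr mulr1; have := ler_wpM2l (ltW eL0) n'1; rewrite [_ * y]mulrC yE; lra.
have epsE : eps = eps' * r by rewrite /r mulrC divfK // gt_eqF.
have m1 : cabs (ghat t eps 0 - ghat t eps' 0) <= C * (r - 1).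
  rewrite epsE; apply: hC; rewrite ?e'p ?e'1 //; last by rewrite -epsE.
  by rewrite r1 /=; lra.
have m2 := hn1 n' nn1; have m3 := hn2 n (leq_maxl _ _).
rewrite -/h (ghat_scale ht d0 h0 hle1 K3) -/eps in m3; rewrite -/eps' in m2.
set g := ghat t eps 0 in m1 m3; set g' := ghat t eps' 0 in m1 m2.
have -> : A' - s^-1%:C * A = s^-1%:C * ((g - g') + (g' - A)) - (s^-1%:C * g - A') by ring.
rewrite (le_trans (cabsB _ _)) // mulrDl mul1r addrC lerD // cabsM cabs_real.
have si : 0 < s^-1 by rewrite invr_gt0.
rewrite (gtr0_norm si) -mulrA ler_pM2l // (le_trans (cabsD _ _)) //.
have := ler_wpM2l C0 (le_trans r2 K2); lra.
Qed.

Lemma tsum_conj (I : choiceType) (u : I -> R[i]) : summ u ->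
  tsum (fun i => conjc (u i)) = conjc (tsum u).
Proof.
move=> hs; apply: hsum_tsum => e /(summ_hsum hs)[A hA]; exists A => B /hA.
by rewrite -cabs_conj rmorphB rmorph_sum.
Qed.

Lemma conjcM (z w : R[i]) : conjc (z * w) = conjc z * conjc w. Proof. exact: rmorphM. Qed.
Lemma conjcN (z : R[i]) : conjc (- z) = - conjc z. Proof. exact: rmorphN. Qed.
Lemma conjcX (z : R[i]) n : conjc (z ^+ n) = conjc z ^+ n. Proof. exact: rmorphXn. Qed.

Lemma pois_conj t A A' : 0 < complex.Re t -> is_pois t A -> is_pois (conjc t) A' -> A' = conjc A.
Proof.
move=> ht [[L L0 h] _] [[K K0 h'] _].
apply: (@lim_along_uniq (K * L) (conjc t)); first exact: lim_alongM.
rewrite mulnC; apply: lim_alongM => // e /h[n0 hn]; exists n0 => n /hn.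
rewrite -cabs_conj rmorphB; congr (cabs (_ - _) <= _).
transitivity (conjc (ghat t ((L * n.+1)%:R^-1) 0)); first by [].
rewrite /ghat -tsum_conj; last first.
  apply: summ_ghat => //; rewrite invr_gt0 ltr0n muln_gt0 L0 /= invf_le1 ?ltr0n ?muln_gt0 ?L0 //.
  by rewrite ler1n muln_gt0 L0.
apply: tsum_eq => m; rewrite !mulr0 oppr0 ee0 !mulr1 conjcM conjc_real; congr (_ * _).
by rewrite !gauE cexp_conj conjcN 2!conjcM conjcX 2!conjc_real.
Qed.

(** The formulas at [t] and at [t^-1] exchange the two sides; their constants are compared at a
    point where the dual series is nonzero. *)
Lemma pois_inv t A A' : 0 < complex.Re t -> is_pois t A -> is_pois t^-1 A' -> A' * A = 1.
Proof.
move=> ht [_ h] [_ h']; have [L [j [L0 gnz]]] := gper_nz ht.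
pose b : R := j%:R / L%:R.
have E1 : hper t^-1 b (0%:~R / 1%:R) = gper t 0 b.
  rewrite /hper mul0r (tsum_bij (h := fun k : int => - k) (g := fun k : int => - k) (@opprK _) (@opprK _)); last first.
    exact: summ_hper (Re_inv_gt0 ht).
  apply: tsum_eq => k /=; rewrite !addr0 mulrC; congr (ee _ * _).
    by rewrite -rmorphN /=; congr (_%:C); rewrite mulrNz; ring.
  rewrite gauE; congr cexp; rewrite mulrNz rmorphN sqrrN; ring.
have E2 : gper t^-1 b (0%:~R / 1%:R) = hper t 0 b.
  apply: tsum_eq => k; rewrite mul0r mulr0 ee0 mul1r mul0r oppr0 ee0 mulr1 gauE invrK.
  by congr cexp; ring.
have := h' 0 1%N b isT; rewrite E1 E2.
have := h j L 0 L0; rewrite -pmulrn -/b => ->; rewrite mulrA => H.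
by apply: (mulIf gnz); rewrite -H mul1r.
Qed.

(** As $1/t = \bar t\,|t|^{-2}$, scaling and conjugation give $A(1/t) = |t|\,\overline{A(t)}$, and
    [pois_inv] gives $A(1/t)A(t) = 1$. No Gaussian integral is evaluated. *)
Lemma pois_abs t A : 0 < complex.Re t -> is_pois t A -> cabs A ^+ 2 * cabs t = 1.
Proof.
move=> ht hA; have t0 := Re_gt0_neq0 ht; have ct := cabs_gt0 t0.
have ht' : 0 < complex.Re (conjc t) by case: (t) ht.
have [A1 hA1] := pois_exists ht'; have [A2 hA2] := pois_exists (Re_inv_gt0 ht).
have e1 := pois_conj ht hA hA1.
pose d := cabs t ^- 2; have d0 : 0 < d by rewrite invr_gt0 exprn_gt0.
have tE : t^-1 = conjc t * d%:C.
  apply: (mulfI t0); rewrite mulfV // /d cabs_sqr; case: (t) t0 => a b /=.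
  rewrite eq_complex /= negb_and => ab.
  have n0 : a ^+ 2 + b ^+ 2 != 0.
    rewrite paddr_eq0 ?sqr_ge0 // !sqrf_eq0 negb_and; exact: ab.
  by apply/eqP; rewrite eq_complex /=; apply/andP; split; apply/eqP; field.
rewrite tE in hA2; have e2 := pois_scale ht' d0 hA1 hA2.
rewrite -tE in hA2; have e3 := pois_inv ht hA hA2.
have sd : (Num.sqrt d)^-1 = cabs t.
  by rewrite /d sqrtrV ?sqr_ge0 // sqrtr_sqr (gtr0_norm ct) invrK.
move/(congr1 (@cabs R)): e3; rewrite cabs1 cabsM e2 e1 sd cabsM cabs_conj cabs_real (gtr0_norm ct).
by move=> <-; ring.
Qed.

(** Classically $t^{-1/2}$; only its modulus and its scaling rule are used. *)
Definition Apo t : R[i] := xget 0 [set A | is_pois t A].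

Lemma ApoP t : 0 < complex.Re t -> is_pois t (Apo t).
Proof. by move=> /pois_exists[A hA]; apply: (@xgetPex _ 0 [set A | is_pois t A]); exists A. Qed.

End Pois.

Section Cv.
Variable A : comPzRingType.

Definition cv m (a : A) (x : 'cV[A]_m) : 'cV[A]_(1 + m) := col_mx a%:M x.
Definition hd m (x : 'cV[A]_(1 + m)) : A := usubmx x 0 0.
Definition tl m (x : 'cV[A]_(1 + m)) : 'cV[A]_m := dsubmx x.
Definition dotp m (x y : 'cV[A]_m) : A := (x^T *m y) 0 0.
Definition qf m (G : 'M[A]_m) (x : 'cV[A]_m) : A := (x^T *m G *m x) 0 0.

Lemma hd_cv m a (x : 'cV[A]_m) : hd (cv a x) = a.
Proof. by rewrite /hd /cv col_mxKu mxE eqxx mulr1n. Qed.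
Lemma tl_cv m a (x : 'cV[A]_m) : tl (cv a x) = x.
Proof. by rewrite /tl /cv col_mxKd. Qed.
Lemma cv_eta m (x : 'cV[A]_(1 + m)) : cv (hd x) (tl x) = x.
Proof. by rewrite /cv /hd /tl -mx11_scalar vsubmxK. Qed.
Lemma cvD m a b (x y : 'cV[A]_m) : cv a x + cv b y = cv (a + b) (x + y).
Proof. by rewrite /cv add_col_mx raddfD. Qed.
Lemma cvN m a (x : 'cV[A]_m) : - cv a x = cv (- a) (- x).
Proof. by rewrite /cv opp_col_mx raddfN. Qed.
Lemma dot_cv m a b (x y : 'cV[A]_m) : dotp (cv a x) (cv b y) = a * b + dotp x y.
Proof. by rewrite /dotp /cv tr_col_mx mul_row_col mxE tr_scalar_mx -scalar_mxM mxE eqxx mulr1n. Qed.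
Lemma dotpDl m (x y z : 'cV[A]_m) : dotp (x + y) z = dotp x z + dotp y z.
Proof. by rewrite /dotp linearD mulmxDl mxE. Qed.
Lemma dotpDr m (x y z : 'cV[A]_m) : dotp z (x + y) = dotp z x + dotp z y.
Proof. by rewrite /dotp mulmxDr mxE. Qed.
Lemma dotpZl m a (x y : 'cV[A]_m) : dotp (a *: x) y = a * dotp x y.
Proof. by rewrite /dotp linearZ -scalemxAl mxE. Qed.
Lemma dotpZr m a (x y : 'cV[A]_m) : dotp x (a *: y) = a * dotp x y.
Proof. by rewrite /dotp -scalemxAr mxE. Qed.
Lemma dotpE m (x y : 'cV[A]_m) : dotp x y = \sum_i x i 0 * y i 0.
Proof. by rewrite /dotp mxE; apply: eq_bigr => i _; rewrite mxE. Qed.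
Lemma dotpC m (x y : 'cV[A]_m) : dotp x y = dotp y x.
Proof. by rewrite !dotpE; apply: eq_bigr => i _; rewrite mulrC. Qed.
Lemma qfE m (G : 'M[A]_m) x : qf G x = dotp x (G *m x).
Proof. by rewrite /qf /dotp mulmxA. Qed.
Lemma dotp_mul m (G : 'M[A]_m) x y : dotp x (G *m y) = dotp (G^T *m x) y.
Proof. by rewrite /dotp trmx_mul trmxK mulmxA. Qed.
End Cv.

Lemma map_cv (m : nat) (R : realType) a (x : 'cV[int]_m) :
  map_mx (intr : int -> R) (cv a x) = cv a%:~R (map_mx intr x).
Proof. by rewrite /cv map_col_mx map_scalar_mx. Qed.

(** * Pivots, Schur complements and Poisson summation in several variables *)

Section Ldl.
Variable R : realType.

Definition pdef m (G : 'M[R]_m) := G^T = G /\ forall x : 'cV[R]_m, x != 0 -> 0 < qf G x.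

(** The one-variable Poisson formula holds at rational shifts, so rationality has to be carried
    through the elimination. *)
Definition ratl (x : R) := exists r : rat, x = ratr r.
Definition ratm m n (M : 'M[R]_(m, n)) := forall i j, ratl (M i j).

Lemma ratlD x y : ratl x -> ratl y -> ratl (x + y).
Proof. by move=> [a ->] [b ->]; exists (a + b); rewrite rmorphD. Qed.
Lemma ratlM x y : ratl x -> ratl y -> ratl (x * y).
Proof. by move=> [a ->] [b ->]; exists (a * b); rewrite rmorphM. Qed.
Lemma ratlN x : ratl x -> ratl (- x).
Proof. by move=> [a ->]; exists (- a); rewrite rmorphN. Qed.
Lemma ratlV x : ratl x -> ratl x^-1.
Proof. by move=> [a ->]; exists (a^-1); rewrite fmorphV. Qed.
Lemma ratl_int (n : int) : ratl n%:~R. Proof. by exists n%:~R; rewrite ratr_int. Qed.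
Lemma ratl_sum (I : finType) (F : I -> R) : (forall i, ratl (F i)) -> ratl (\sum_i F i).
Proof.
by move=> h; elim/big_rec: _ => [|i x _ hx]; [exists 0; rewrite rmorph0|exact: ratlD].
Qed.
Lemma ratl_frac x : ratl x -> exists (p : int) (q : nat), (0 < q)%N /\ x = p%:~R / q%:R.
Proof.
move=> [r ->]; exists (numq r), `|denq r|%N; split; first by rewrite absz_gt0 denq_neq0.
by rewrite -{1}(divq_num_den r) fmorph_div !rmorph_int pmulrn gez0_abs // ltW ?denq_gt0.
Qed.

Definition schur m (G : 'M[R]_(1 + m)) : 'M[R]_m :=
  drsubmx G - (G 0 0)^-1 *: (dlsubmx G *m ursubmx G).

(** The pivots of Gaussian elimination, that is, the squared lengths of the Gram-Schmidt vectors of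
    a basis with Gram matrix [G]. *)
Fixpoint ldl (m : nat) : 'M[R]_m -> seq R :=
  match m with
  | 0 => fun _ => [::]
  | m'.+1 => fun G : 'M[R]_(1 + m') => G 0 0 :: ldl (schur G)
  end.

Lemma size_ldl m (G : 'M[R]_m) : size (ldl G) = m.
Proof. by elim: m G => [|m IH] G //=; rewrite IH. Qed.

Definition brow m (G : 'M[R]_(1 + m)) : 'cV[R]_m := (G 0 0)^-1 *: (ursubmx G)^T.

Lemma blockE m (G : 'M[R]_(1 + m)) : G^T = G ->
  G = block_mx (G 0 0)%:M (ursubmx G) (ursubmx G)^T (drsubmx G).
Proof.
move=> sG; have -> : (ursubmx G)^T = dlsubmx G by rewrite -{1}sG trmx_ursub trmxK.
rewrite -[LHS]submxK; congr block_mx; rewrite [LHS]mx11_scalar; congr (_%:M).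
by rewrite mxE mxE; congr (G _ _); apply: val_inj.
Qed.

Lemma qf_split m (G : 'M[R]_(1 + m)) a x : G^T = G -> G 0 0 != 0 ->
  qf G (cv a x) = G 0 0 * (a + dotp (brow G) x) ^+ 2 + qf (schur G) x.
Proof.
move=> sG d0.
set d := G 0 0 in d0 *; set b := ursubmx G.
have bt : dlsubmx G = b^T by rewrite /b trmx_ursub sG.
have bx : (b *m x) = (dotp b^T x)%:M by rewrite [LHS]mx11_scalar /dotp trmxK.
have xb : (x^T *m b^T) = (dotp b^T x)%:M by rewrite -trmx_mul bx tr_scalar_mx.
have sE : qf (schur G) x = (x^T *m drsubmx G *m x) 0 0 - d^-1 * (dotp b^T x) ^+ 2.
  rewrite /qf /schur bt -/d -/b mulmxBr mulmxBl mxE mxE; congr (_ + _).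
  rewrite mxE; congr (- _).
  by rewrite -scalemxAr -scalemxAl mxE !mulmxA -[x^T *m b^T *m b *m x]mulmxA xb bx -scalar_mxM mxE eqxx mulr1n.
rewrite sE /brow dotpZl -/d -/b {1}/qf {1}(blockE sG) -/d -/b /cv tr_col_mx mul_row_block mul_row_col.
rewrite tr_scalar_mx !mulmxDl -!mulmxA bx [x^T *m (b^T *m _)]mulmxA xb mulmxA -!scalar_mxM !mxE !eqxx !mulr1n.
by field.
Qed.

Lemma pdef_d m (G : 'M[R]_(1 + m)) : pdef G -> 0 < G 0 0.
Proof.
move=> [sG pG]; have := pG (cv 1 0).
have -> : qf G (cv 1 0) = G 0 0.
  rewrite /qf {1}(blockE sG) /cv tr_col_mx mul_row_block mul_row_col !trmx0 !mul0mx !mulmx0 !addr0.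
  by rewrite tr_scalar_mx mul1mx mulmx1 mxE eqxx mulr1n.
apply; apply/eqP => /(congr1 (@hd _ _)); rewrite hd_cv /hd linear0 mxE => /eqP.
by rewrite oner_eq0.
Qed.

Lemma schur_pdef m (G : 'M[R]_(1 + m)) : pdef G -> pdef (schur G).
Proof.
move=> pG; have d0 := pdef_d pG; case: pG => sG pG; split.
  rewrite /schur linearB linearZ /= trmx_mul trmx_drsub sG; congr (_ - _ *: _).
  by rewrite trmx_ursub trmx_dlsub sG.
move=> x x0; have := pG (cv (- dotp (brow G) x) x).
rewrite qf_split ?gt_eqF // addNr expr0n mulr0 add0r; apply.
by apply: contra x0 => /eqP /(congr1 (@tl _ _)); rewrite tl_cv /tl linear0 => ->.
Qed.

Lemma schur_ratm m (G : 'M[R]_(1 + m)) : ratm G -> ratm (schur G).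
Proof.
move=> rG i j; rewrite /schur !mxE; apply: ratlD; first exact: rG.
apply: ratlN; apply: ratlM; first exact/ratlV/rG.
by apply: ratl_sum => k; rewrite !mxE; apply: ratlM; exact: rG.
Qed.

Lemma det_schur m (G : 'M[R]_(1 + m)) : G^T = G -> G 0 0 != 0 ->
  \det G = G 0 0 * \det (schur G).
Proof.
move=> sG d0; set d := G 0 0 in d0 *.
have bt : dlsubmx G = (ursubmx G)^T by rewrite trmx_ursub sG.
have E : G = block_mx 1%:M 0 (d^-1 *: (ursubmx G)^T) 1%:M *m block_mx d%:M (ursubmx G) 0 (schur G).
  rewrite mulmx_block !mul1mx !mul0mx ?mulmx0 !addr0 {1}(blockE sG) -/d; congr block_mx.
    by rewrite mul_mx_scalar scalerA mulfV // scale1r.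
  by rewrite /schur bt -/d -scalemxAl addrCA subrr addr0.
by rewrite {1}E det_mulmx det_lblock det_ublock !det1 !mul1r det_scalar1.
Qed.

Lemma ldl_gt0 m (G : 'M[R]_m) : pdef G -> forall d, d \in ldl G -> 0 < d.
Proof.
elim: m G => [|m IH] G pG d //=; rewrite inE => /orP[/eqP ->|]; first exact: (@pdef_d m).
by apply: IH; exact: (@schur_pdef m).
Qed.

Lemma det_ldl m (G : 'M[R]_m) : pdef G -> \det G = \prod_(d <- ldl G) d.
Proof.
elim: m G => [|m IH] G pG; first by rewrite det_mx00 big_nil.
rewrite /= big_cons -IH; last exact: (@schur_pdef m).
by apply: (@det_schur m); [case: pG|rewrite gt_eqF // (@pdef_d m)].
Qed.

Lemma det_gt0 m (G : 'M[R]_m) : pdef G -> 0 < \det G.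
Proof.
move=> pG; rewrite det_ldl // big_seq; apply: prodr_gt0 => d; exact: ldl_gt0.
Qed.

(** Dual to [qf_split]: for the inverse matrix the displacement [k *: brow G] falls on the remaining
    coordinates. This identifies the iterated one-variable formula with the Gaussian of [Gi]. *)
Lemma qf_inv m (G Gi : 'M[R]_(1 + m)) (Si : 'M[R]_m) k y : pdef G -> G *m Gi = 1%:M ->
   schur G *m Si = 1%:M ->
  qf Gi (cv k y) = k ^+ 2 / G 0 0 + qf Si (y - k *: brow G).
Proof.
move=> pG GGi SSi; have d0 := pdef_d pG; have [sG _] := pG; have [sS _] := schur_pdef pG.
pose x := Gi *m cv k y; set d := G 0 0 in d0 *; set b := ursubmx G.
have Gx : G *m x = cv k y by rewrite /x mulmxA GGi mul1mx.
have GiG : Gi *m G = 1%:M by exact: mulmx1C.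
have qx : qf Gi (cv k y) = qf G x.
  by rewrite !qfE Gx -/x dotpC.
have xE : x = cv (hd x) (tl x) by rewrite cv_eta.
have e1 : k = d * hd x + dotp b^T (tl x).
  move: Gx; rewrite {1}xE {1}(blockE sG) -/d -/b /cv mul_block_col => /eq_col_mx[+ _].
  rewrite -scalar_mxM => /matrixP /(_ 0 0); rewrite !mxE !eqxx !mulr1n => <-.
  by rewrite /dotp trmxK mxE.
have e2 : y = hd x *: b^T + drsubmx G *m tl x.
  move: Gx; rewrite {1}xE {1}(blockE sG) -/d -/b /cv mul_block_col => /eq_col_mx[_ <-].
  by rewrite mul_mx_scalar.
have e3 : y - k *: brow G = schur G *m tl x.
  rewrite /brow -/d -/b /schur -/d.
  have -> : dlsubmx G = b^T by rewrite /b trmx_ursub sG.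
  rewrite mulmxBl -scalemxAl -mulmxA -/b.
  have -> : b *m tl x = (dotp b^T (tl x))%:M by rewrite [LHS]mx11_scalar /dotp trmxK.
  have kd : k * d^-1 = hd x + dotp b^T (tl x) / d by rewrite {1}e1; field; rewrite gt_eqF.
  rewrite mul_mx_scalar scalerA kd scalerDl {1}e2 opprD addrA [hd x *: _ + _]addrC addrK scalerA.
  by rewrite [d^-1 * _]mulrC.
rewrite qx {1}xE qf_split ?gt_eqF //; congr (_ + _).
  rewrite -/d /brow -/d -/b dotpZl e1; field; by rewrite gt_eqF.
have SiS : Si *m schur G = 1%:M by exact: mulmx1C.
rewrite e3 [RHS]qfE mulmxA SiS mul1mx qfE dotpC //.
Qed.

Lemma pdef_inv m (G Gi : 'M[R]_m) : pdef G -> G *m Gi = 1%:M -> pdef Gi.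
Proof.
move=> [sG pG] GGi; have GiG := mulmx1C GGi; split.
  by rewrite -[LHS]mul1mx -GiG -mulmxA -{1}sG -trmx_mul GiG trmx1 mulmx1.
move=> x x0; have -> : qf Gi x = qf G (Gi *m x).
  by rewrite !qfE mulmxA GGi mul1mx dotpC.
apply: pG; apply: contra x0 => /eqP h.
by rewrite -[x]mul1mx -GGi -mulmxA h mulmx0.
Qed.

End Ldl.

Section PoisM.
Variable R : realType.
Local Open Scope complex_scope.
Local Notation cR := (map_mx (intr : int -> R)).

Definition cvp m (p : 'cV[int]_m * int) : 'cV[int]_m.+1 := cv p.2 p.1.
Definition cvi m (x : 'cV[int]_m.+1) : 'cV[int]_m * int := (@tl _ m x, @hd _ m x).
Lemma cvpK m : cancel (@cvp m) (@cvi m).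
Proof. by case=> x a; rewrite /cvp /cvi /= hd_cv tl_cv. Qed.
Lemma cviK m : cancel (@cvi m) (@cvp m).
Proof. by move=> x; rewrite /cvp /cvi /= cv_eta. Qed.

Definition gbound (kap d : R) := 2 * expR 1 * (1 + (Num.sqrt (kap * d))^-1).

Lemma gbound_ge0 kap d : 0 <= gbound kap d.
Proof. by rewrite mulr_ge0 ?mulr_ge0 ?expR_ge0 // addr_ge0 // invr_ge0 sqrtr_ge0. Qed.

Lemma asum_cv m (u : 'cV[int]_m.+1 -> R) M : asum (u \o @cvp m) M -> asum u M.
Proof.
move=> h; have := asum_inj (can_inj (@cviK m)) h.
by congr asum; apply/funext => x /=; rewrite cviK.
Qed.

Lemma asum_unit (I : choiceType) (u : I -> R) i0 : (forall i, i = i0) -> 0 <= u i0 -> asum u (u i0).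
Proof.
move=> hi u0; split=> [i|A]; first by rewrite (hi i).
have [h|h] := boolP (i0 \in A).
  rewrite (big_fsetD1 i0) //= big1_fset ?addr0 // => i; rewrite !inE => /andP[/eqP]; by case.
rewrite big1_fset // => i iA _; by move: h; rewrite -(hi i) iA.
Qed.

(** After completing the square in the first coordinate its sum is bounded uniformly in the others,
    so every pivot contributes an independent factor. *)
Lemma asum_gauss m (G : 'M[R]_m) kap r : pdef G -> 0 < kap ->
  asum (fun x : 'cV[int]_m => expR (- (kap * qf G (cR x + r)))) (\prod_(d <- ldl G) gbound kap d).
Proof.
move=> + k0; elim: m G r => [|m IH] G r pG.
  have := @asum_unit 'cV[int]_0 (fun x => expR (- (kap * qf G (cR x + r)))) 0.
  rewrite big_nil /qf mxE big_ord0 mulr0 oppr0 expR0; apply => //.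
  by move=> x; apply/matrixP => -[].
rewrite /= big_cons mulrC; apply: asum_cv.
have d0 := @pdef_d R m G pG; have pS := @schur_pdef R m G pG; have [sG _] := pG.
pose r' := @tl _ m r.
have E (x : 'cV[int]_m) a : qf G (cR (cvp (x, a)) + r) =
   G 0 0 * (a%:~R + (hd r + dotp (@brow R m G) (cR x + r'))) ^+ 2 + qf (schur G) (cR x + r').
  rewrite /cvp /= map_cv -{1}(cv_eta r) cvD -/r' (@qf_split R m) ?gt_eqF //.
  by rewrite addrA.
pose v x := expR (- (kap * qf (schur G) (cR x + r'))) * gbound kap (G 0 0).
have A1 x : asum (fun a => expR (- (kap * qf G (cR (cvp (x, a)) + r)))) (v x).
  have kd : 0 < kap * G 0 0 by rewrite mulr_gt0.
  have := asumZ (expR_ge0 (- (kap * qf (schur G) (cR x + r')))) (asum_gauss_int (hd r + dotp (@brow R m G) (cR x + r')) kd).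
  congr asum; apply/funext => a; rewrite -expRD E; congr expR; ring.
apply: (asum_prod A1).
have := asumZ (gbound_ge0 kap (G 0 0)) (IH (schur G) r' pS).
by rewrite mulrC; congr asum; apply/funext => x; rewrite mulrC.
Qed.

Lemma tsum_unit (I : choiceType) (u : I -> R[i]) i0 : (forall i, i = i0) -> tsum u = u i0.
Proof.
move=> hi; apply: hsum_tsum => e e0; exists [fset i0]%fset => B hB.
have -> : B = [fset i0]%fset.
  by apply/fsetP => i; rewrite (hi i) inE eqxx; apply: (fsubsetP hB); rewrite inE.
by rewrite big_seq_fset1 subrr cabs0 ltW.
Qed.

Definition gterm (t : R[i]) m (G : 'M[R]_m) (X s : 'cV[R]_m) : R[i] :=
  cexp (- (pi%:C * t * (qf G X)%:C)) * ee (dotp s X)%:C.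

Lemma cabs_gterm t m (G : 'M[R]_m) X s :
  cabs (gterm t G X s) = expR (- (pi * complex.Re t * qf G X)).
Proof.
rewrite /gterm cabsM cabs_ee_real mulr1 cabs_cexp; congr expR.
by case: t => a b /=; ring.
Qed.

Lemma summ_gterm t m (G : 'M[R]_m) r s : pdef G -> 0 < complex.Re t ->
  summ (fun x : 'cV[int]_m => gterm t G (cR x + r) s).
Proof.
move=> pG ht; have k0 : 0 < pi * complex.Re t by rewrite mulr_gt0 ?pi_gt0.
exists (\prod_(d <- ldl G) gbound (pi * complex.Re t) d).
by have := asum_gauss r pG k0; congr asum; apply/funext => x; rewrite cabs_gterm.
Qed.

Lemma Apo_scale (t : R[i]) (d : R) : 0 < complex.Re t -> 0 < d -> Apo (t * d%:C) = (Num.sqrt d)^-1%:C * Apo t.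
Proof.
move=> ht d0; apply: (pois_scale ht d0 (ApoP ht)); apply: ApoP.
by case: t ht => a b /= a0; rewrite mulr0 subr0 mulr_gt0.
Qed.

Definition dterm (t : R[i]) m (Gi : 'M[R]_m) (Y r s : 'cV[R]_m) : R[i] :=
  cexp (- (pi%:C * (qf Gi (Y - s))%:C / t)) * ee (dotp Y r)%:C.

Lemma summ_dterm t m (Gi : 'M[R]_m) r s : pdef Gi -> 0 < complex.Re t ->
  summ (fun y : 'cV[int]_m => dterm t Gi (cR y) r s).
Proof.
move=> pG ht; have k0 : 0 < pi * complex.Re t^-1 by rewrite mulr_gt0 ?pi_gt0 ?Re_inv_gt0.
exists (\prod_(d <- ldl Gi) gbound (pi * complex.Re t^-1) d).
have := asum_gauss (- s) pG k0; congr asum; apply/funext => x.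
rewrite /dterm cabsM cabs_ee_real mulr1 cabs_cexp; congr expR.
by case: (t) => a b /=; ring.
Qed.

(* Poisson summation in one variable at a time, through the Schur complement. *)
Lemma poissonM m (G Gi : 'M[R]_m) t r s : pdef G -> ratm G -> G *m Gi = 1%:M ->
  0 < complex.Re t -> ratm r ->
  tsum (fun x : 'cV[int]_m => gterm t G (cR x + r) s) =
  Apo t ^+ m * (Num.sqrt (\det G))^-1%:C *
  tsum (fun y : 'cV[int]_m => dterm t Gi (cR y) r s).
Proof.
move=> + + + ht; elim: m G Gi r s => [|m IH] G Gi r s pG rG GGi rr.
  have h0 (i : 'cV[int]_0) : i = 0 by apply/matrixP => -[].
  rewrite !(tsum_unit _ h0) /gterm /dterm /qf /dotp !mxE !big_ord0 det_mx00 sqrtr1 invr1 expr0 !mulr0 mul0r oppr0.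
  by rewrite cexp0 ee0 !mulr1.
have d0 := @pdef_d R m G pG; have pS := @schur_pdef R m G pG; have [sG _] := pG.
pose S : 'M[R]_m := @schur R m G; pose b := @brow R m G; pose d := G 0 0.
pose r1 := @hd _ m r; pose r' := @tl _ m r; pose s1 := @hd _ m s; pose s' := @tl _ m s.
have rS : ratm S by exact: (@schur_ratm R m).
have dS := det_gt0 pS.
pose Si := invmx S.
have SSi : S *m Si = 1%:M by rewrite mulmxV // unitmxE unitfE gt_eqF.
have htd : 0 < complex.Re (t * d%:C) by move: ht; rewrite /d; case: (t) => p q /= p0; rewrite mulr0 subr0 mulr_gt0.
have t0 : t != 0 by exact: Re_gt0_neq0.
have dC0 : d%:C != 0 :> R[i] by rewrite fmorph_eq0 gt_eqF.
have rr' : ratm r' by move=> i j; rewrite /r' /tl mxE.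
have rr1 : ratl r1 by rewrite /r1 /hd mxE; exact: rr.
have rb i : ratl (b i 0) by rewrite /b /brow !mxE; apply: ratlM; [exact/ratlV/rG|exact: rG].
(* The shift of the first coordinate after completing the square; [ral] makes it rational, as the
   one-variable formula requires. *)
pose al (x : 'cV[int]_m) : R := r1 + dotp b (cR x + r').
have ral x : ratl (al x).
  apply: ratlD => //; rewrite dotpE; apply: ratl_sum => i; apply: ratlM => //.
  by rewrite mxE mxE; apply: ratlD; [exact: ratl_int|exact: rr'].
pose F (p : 'cV[int]_m * int) := gterm t G (cR (cvp p) + r) s.
have FE x a : F (x, a) = gterm t S (cR x + r') (s' - s1 *: b) *
    (gau (t * d%:C) (a%:~R + al x)%:C * ee (- (- s1 * (a%:~R + al x))%:C)).
  rewrite /F /gterm /cvp /= map_cv -{1 2}(cv_eta r) -{1}(cv_eta s) cvD -/r1 -/r' -/s1 -/s'.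
  rewrite (@qf_split R m) ?gt_eqF // dot_cv -/d -/S -/b gauE mulrACA -cexpD -eeD.
  congr (cexp _ * ee _).
    rewrite /al addrA; ring.
  rewrite -rmorphN -rmorphD /=; congr (_%:C); rewrite /al dotpDl -[- (s1 *: b)]scaleNr dotpZl; ring.
have SF : summ F.
  exact: (summ_inj (can_inj (@cvpK m)) (summ_gterm r s pG ht)).
rewrite (tsum_bij (@cvpK m) (@cviK m)) ?summ_gterm //.
rewrite -[LHS]/(tsum F) tsum_prod //.
pose K (k : int) := cexp (- (pi%:C * (k%:~R - s1)%:C ^+ 2 / (t * d%:C))).
(* The summand after Poisson in the first coordinate only: [p.1] is still a lattice vector, [p.2]
   already a frequency. *)
pose H (p : 'cV[int]_m * int) := gterm t S (cR p.1 + r') (s' + (p.2%:~R - s1) *: b) * (K p.2 * ee (p.2%:~R * r1)%:C).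
have inner x : tsum (fun a => F (x, a)) = Apo (t * d%:C) * tsum (fun k => H (x, k)).
  have [p [q [q0 Eq]]] := ratl_frac (ral x).
  have := (ApoP htd).2 p q (- s1) q0; rewrite -Eq => HH.
  under tsum_eq do rewrite FE.
  rewrite tsumZ; last exact: summ_hper.
  rewrite -[tsum (fun l : int => gau _ _ * _)]/(hper (t * d%:C) (- s1) (al x)) HH mulrCA; congr (_ * _).
  rewrite /gper -tsumZ; last exact: summ_gper.
  apply: tsum_eq => k; rewrite /H /= /K [_ * cexp (- (_ * _ / _))]mulrC mulrCA [RHS]mulrCA; congr (_ * _).
  rewrite /gterm -!mulrA; congr (_ * _); rewrite -!eeD; congr ee; rewrite -!rmorphD /=; congr (_%:C).
  rewrite /al !dotpDl -[- (s1 *: b)]scaleNr !dotpZl; ring.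
have SH : summ H.
  have k0 : 0 < pi * complex.Re t by rewrite mulr_gt0 ?pi_gt0.
  have k1 : 0 < pi * complex.Re (t * d%:C)^-1 by rewrite mulr_gt0 ?pi_gt0 ?Re_inv_gt0.
  pose B := 2 * expR 1 * (1 + (Num.sqrt (pi * complex.Re (t * d%:C)^-1))^-1).
  have B0 : 0 <= B by rewrite mulr_ge0 ?mulr_ge0 ?expR_ge0 // addr_ge0 // invr_ge0 sqrtr_ge0.
  exists (B * \prod_(d <- ldl S) gbound (pi * complex.Re t) d).
  apply: (@asum_prod _ _ _ _ (fun x => B * expR (- (pi * complex.Re t * qf S (cR x + r'))))) => [x|].
    rewrite mulrC; have := asumZ (expR_ge0 (- (pi * complex.Re t * qf S (cR x + r')))) (asum_gauss_int (- s1) k1).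
    rewrite -/B; have -> : (fun k => expR (- (pi * complex.Re t * qf S (cR x + r'))) *
       expR (- (pi * complex.Re (t * d%:C)^-1 * (k%:~R + - s1) ^+ 2))) = (fun k => cabs (H (x, k))) => //.
    apply/funext => k; rewrite /H /= cabsM cabs_gterm cabsM cabs_ee_real mulr1 /K.
    by rewrite cabs_cexpinv.
  exact: (asumZ B0 (asum_gauss r' pS k0)).
under tsum_eq do rewrite inner.
rewrite tsumZ; last exact: summ_row.
rewrite tsum_exchange //.
have inner2 k : tsum (fun x => H (x, k)) = (Apo t ^+ m * (Num.sqrt (\det S))^-1%:C) *
   tsum (fun y : 'cV[int]_m => dterm t Gi (cR (cvp (y, k))) r s).
  have sm : summ (fun x : 'cV[int]_m => gterm t S (cR x + r') (s' + (k%:~R - s1) *: b)) by exact: summ_gterm.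
  rewrite /H /=; under tsum_eq do rewrite mulrC.
  rewrite tsumZ // (IH _ Si) // mulrCA; congr (_ * _).
  have pSi := pdef_inv pS SSi.
  rewrite -tsumZ; last exact: summ_dterm.
  apply: tsum_eq => y.
  rewrite /K /dterm mulrACA -cexpD -eeD /cvp /= map_cv -{1}(cv_eta r) -{1}(cv_eta s) cvN cvD dot_cv -/r1 -/r' -/s1 -/s'.
  rewrite (@qf_inv R m G Gi Si) // -/d -/b.
  congr (cexp _ * ee _).
    have Ek (u v : R) : (u / G 0 0 + v)%:C = u%:C / (G 0 0)%:C + v%:C :> R[i].
      by rewrite rmorphD /= rmorphM /= fmorphV.
    rewrite opprD addrA Ek rmorphXn /=; field; by rewrite t0 dC0.
  by rewrite -rmorphD.
under tsum_eq do rewrite inner2.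
have pGi := pdef_inv pG GGi.
have sD : summ (fun p : 'cV[int]_m * int => dterm t Gi (cR (cvp p)) r s).
  exact: (summ_inj (can_inj (@cvpK m)) (summ_dterm r s pGi ht)).
rewrite tsumZ; last exact: (summ_row (summ_prod_swap sD)).
rewrite [in RHS](tsum_bij (@cvpK m) (@cviK m)) ?summ_dterm //.
pose D (p : 'cV[int]_m * int) := dterm t Gi (cR (cvp p)) r s.
have DE : tsum D = tsum (fun k => tsum (fun y => D (y, k))) by rewrite (tsum_prod sD) (tsum_exchange sD).
rewrite -[in RHS]/(tsum D) DE !mulrA; congr (_ * _).
- rewrite (Apo_scale ht d0) (@det_schur R m G sG) ?gt_eqF // sqrtrM ?(ltW d0) // invfM rmorphM /= exprS.
  by rewrite -/d -/S; ring.
- exact: summ_dterm.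
- exact: summ_gterm.
Qed.

End PoisM.

Section Tf2.
(** Cancelling 2 recovers [qform] from its double, which the Gram matrix determines; this is
    possible over the integers, the reals and all p-adic integers, [p = 2] included. *)
Definition tf2 (A : comPzRingType) := forall a : A, a *+ 2 = 0 -> a = 0.

Lemma tf2_int : tf2 int. Proof. by move=> a /eqP; rewrite mulrn_eq0 => /eqP. Qed.
Lemma tf2_real (R : realType) : tf2 R. Proof. by move=> a /eqP; rewrite mulrn_eq0 => /eqP. Qed.

Lemma tf2_padic p : prime p -> tf2 (padic_int p).
Proof.
move=> pp a a0; apply: padic_int_eq => k.
have pk j : (0 : int) < (p ^ j)%:Z by rewrite ltz_nat expn_gt0 prime_gt0.
have h j : ((p ^ j)%:Z %| a j * 2)%Z.
  apply/dvdz_mod0P; have := congr1 (fun b : padic_int p => b j) a0; rewrite mulr2n /= => h2.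
  by rewrite mulr_natr mulr2n h2 mod0z.
rewrite -[LHS]residueS /= mod0z; apply/dvdz_mod0P.
(* For [p = 2] the factor 2 costs one digit, whence the passage to the residue at [k.+1]. *)
have [p2|p2] := eqVneq p 2%N.
  have p2' : (p ^ k.+1)%:Z = (p ^ k)%:Z * 2 by rewrite expnS {1}p2 mulnC PoszM.
  by have := h k.+1; rewrite p2' dvdz_mul2r.
have := h k.+1; rewrite mulrC Gauss_dvdzr; last first.
  by rewrite coprimezE !absz_nat coprimeXl // prime_coprime // dvdn_prime2.
by apply: dvdz_trans; rewrite dvdzE !absz_nat dvdn_exp2l.
Qed.
End Tf2.

(** * Quadratic forms and genera *)

Section Form.
Variable m : nat.
Implicit Types Q S : 'M[int]_m.

Definition evsym Q := Q^T = Q /\ forall i, (2 %| Q i i)%Z.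

Section Gen.
Variable A : comPzRingType.
Hypothesis tA : tf2 A.
Notation cA := (map_mx (intr : int -> A)).

Lemma qform2 Q (x : 'cV[A]_m) : evsym Q -> qform Q x *+ 2 = qf (cA Q) x.
Proof. by case=> s e; rewrite qform_double. Qed.

Lemma tf2I (a b : A) : a *+ 2 = b *+ 2 -> a = b.
Proof. by move=> h; apply/eqP; rewrite -subr_eq0; apply/eqP/tA; rewrite mulrnBl h subrr. Qed.

Lemma qfD (G : 'M[A]_m) x y : G^T = G -> qf G (x + y) = qf G x + qf G y + dotp x (G *m y) *+ 2.
Proof.
move=> sG; rewrite !qfE mulmxDr !dotpDl !dotpDr [dotp y (G *m x)]dotp_mul sG [dotp (G *m y) x]dotpC.
by ring.
Qed.

Lemma qformD Q (x y : 'cV[A]_m) : evsym Q ->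
  qform Q (x + y) = qform Q x + qform Q y + dotp x (cA Q *m y).
Proof.
move=> eQ; apply: tf2I; rewrite [LHS]qform2 // qfD; last by rewrite map_trmx; case: eQ => ->.
by rewrite [RHS]mulrnDl [X in _ = X + _]mulrnDl !qform2.
Qed.

Lemma qformZ Q a (x : 'cV[A]_m) : qform Q (a *: x) = a ^+ 2 * qform Q x.
Proof.
rewrite /qform mulrDr !big_distrr /=; congr (_ + _).
  by apply: eq_bigr => i _; rewrite mxE; ring.
apply: eq_bigr => i _; rewrite big_distrr /=; apply: eq_bigr => j _; rewrite !mxE; ring.
Qed.
End Gen.

Lemma map_intr_id n p (M : 'M[int]_(n, p)) : map_mx (intr : int -> int) M = M.
Proof. by apply/matrixP => i j; rewrite mxE intz. Qed.

Lemma qform_cast (A : comPzRingType) Q (x : 'cV[int]_m) : qform Q (map_mx intr x) = (qform Q x)%:~R :> A.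
Proof.
rewrite /qform rmorphD !rmorph_sum /=; congr (_ + _).
  by apply: eq_bigr => i _; rewrite rmorphM rmorphXn /= intz mxE.
apply: eq_bigr => i _; rewrite rmorph_sum; apply: eq_bigr => j _.
by rewrite !rmorphM /= !intz !mxE.
Qed.

Lemma qform2i Q (x : 'cV[int]_m) : evsym Q -> qform Q x *+ 2 = qf Q x.
Proof. by move=> eQ; rewrite qform2 // map_intr_id. Qed.

Lemma qformDi Q (x y : 'cV[int]_m) : evsym Q ->
  qform Q (x + y) = qform Q x + qform Q y + dotp x (Q *m y).
Proof. by move=> eQ; rewrite (qformD tf2_int) // map_intr_id. Qed.

Lemma qf_cast (A : comPzRingType) Q (x : 'cV[int]_m) :
  qf (map_mx intr Q) (map_mx intr x) = (qf Q x)%:~R :> A.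
Proof. by rewrite /qf map_trmx -!map_mxM mxE. Qed.

Lemma dotp_cast (A : comPzRingType) (x y : 'cV[int]_m) :
  dotp (map_mx intr x) (map_mx intr y) = (dotp x y)%:~R :> A.
Proof. by rewrite /dotp map_trmx -map_mxM mxE. Qed.

Lemma evpd_evsym (R : realType) Q : even_posdef R Q -> evsym Q.
Proof. by case. Qed.

Lemma evpd_pdef (R : realType) Q : even_posdef R Q -> pdef (map_mx (intr : int -> R) Q).
Proof. by case=> s _ p; split=> //; rewrite map_trmx s. Qed.

Lemma evpd_det (R : realType) Q : even_posdef R Q -> 0 < \det Q.
Proof. by move=> /evpd_pdef/det_gt0; rewrite det_map_mx ltr0z. Qed.

Lemma qf_mulmx (A : comPzRingType) p (G : 'M[A]_m) (X : 'M[A]_(m, p)) (x : 'cV[A]_p) :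
  qf G (X *m x) = qf (X^T *m G *m X) x.
Proof. by rewrite /qf trmx_mul !mulmxA. Qed.

(** Each vector of value at most [T] contributes at least $e^{-T}$ to a convergent Gaussian sum. *)
Lemma qf_finite (R : realType) (G : 'M[R]_m) T : pdef G ->
  exists s : seq 'cV[int]_m, forall x, qf G (map_mx intr x) <= T -> x \in s.
Proof.
move=> pG; pose u (x : 'cV[int]_m) : R := expR (- (1 * qf G (map_mx intr x + 0))).
have hu := asum_gauss 0 pG (ltr01 : 0 < 1 :> R); rewrite -/u in hu.
set M := \prod_(d <- _) _ in hu.
have [f|f] := pselect (finite_set [set x : 'cV[int]_m | qf G (map_mx intr x) <= T]).
  exists (enum_fset (fset_set [set x : 'cV[int]_m | qf G (map_mx intr x) <= T])) => x hx.
  by rewrite in_fset_set // inE.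
exfalso; have M0 := asum_ge0 hu.
have [B hB cB] := infinite_set_fset (Num.truncn (M * expR T)).+1 f.
have := hu.2 B; apply/negP; rewrite -ltNge.
apply: (@lt_le_trans _ _ (\sum_(i <- B) expR (- T))); last first.
  rewrite big_seq [leRHS]big_seq; apply: ler_sum => i iB; rewrite /u ler_expR addr0 mul1r lerN2.
  exact: (hB i iB).
rewrite big_const_seq count_predT iter_addr_0 -[X in _ < X]mulr_natr expRN -ltr_pdivrMl ?invr_gt0 ?expR_gt0 // invrK mulrC.
apply: lt_le_trans (truncnS_gt _) _; by rewrite ler_nat.
Qed.

End Form.

Section CongMx.
Variables (p q : nat).
Definition mcong (M : int) (X Y : 'M[int]_(p, q)) := forall i j, (M %| X i j - Y i j)%Z.
Lemma mcong_refl M X : mcong M X X. Proof. by move=> i j; rewrite subrr dvdz0. Qed.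
Lemma mcong_sym M X Y : mcong M X Y -> mcong M Y X.
Proof. by move=> h i j; rewrite -opprB rpredN h. Qed.
Lemma mcong_trans M X Y Z : mcong M X Y -> mcong M Y Z -> mcong M X Z.
Proof. by move=> h k i j; rewrite -(subrKA (Y i j)) rpredD. Qed.
Lemma mcong_dvd M M' X Y : (M' %| M)%Z -> mcong M X Y -> mcong M' X Y.
Proof. by move=> d h i j; exact: dvdz_trans d (h i j). Qed.
Lemma mcongP M X Y : mcong M X Y -> exists K, X = Y + M *: K.
Proof.
move=> h; exists (\matrix_(i, j) ((X i j - Y i j) %/ M)%Z); apply/matrixP => i j.
by rewrite !mxE mulrC divzK // addrC subrK.
Qed.
End CongMx.

Lemma dvdz_mulB (M a b a' b' : int) : (M %| a - b)%Z -> (M %| a' - b')%Z -> (M %| a * a' - b * b')%Z.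
Proof.
move=> h h'; rewrite (_ : _ - _ = (a - b) * a' + b * (a' - b')); last by ring.
by apply: rpredD; [exact: dvdz_mulr|exact: dvdz_mull].
Qed.

Lemma mcongM p q r M (X X' : 'M[int]_(p, q)) (Y Y' : 'M[int]_(q, r)) :
  mcong M X X' -> mcong M Y Y' -> mcong M (X *m Y) (X' *m Y').
Proof.
move=> h h' i j; rewrite !mxE -sumrB; apply: rpred_sum => k _; exact: dvdz_mulB.
Qed.

Lemma mcongZ p q M (a : int) (X X' : 'M[int]_(p, q)) : mcong M X X' -> mcong M (a *: X) (a *: X').
Proof. by move=> h i j; rewrite !mxE -mulrBr dvdz_mull. Qed.

Lemma mcongT p q M (X X' : 'M[int]_(p, q)) : mcong M X X' -> mcong M X^T X'^T.
Proof. by move=> h i j; rewrite !mxE. Qed.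

Lemma cong_det n M (X Y : 'M[int]_n) : mcong M X Y -> (M %| \det X - \det Y)%Z.
Proof.
move=> h; rewrite /determinant -sumrB; apply: rpred_sum => s _; rewrite -mulrBr dvdz_mull //.
elim/big_rec2: _ => [|i y1 y2 _ hy]; first by rewrite subrr dvdz0.
exact: dvdz_mulB (h _ _) hy.
Qed.

Lemma int_mx_scaleI p q (d : int) (X Y : 'M[int]_(p, q)) : d != 0 -> d *: X = d *: Y -> X = Y.
Proof.
move=> d0 /matrixP h; apply/matrixP => i j; have := h i j; rewrite !mxE; exact: mulfI.
Qed.

Section Padic.
Variable p : nat.
Lemma padic0 k : (0 : padic_int p) k = 0. Proof. by rewrite /= mod0z. Qed.
Lemma padicM (a b : padic_int p) k : ((p ^ k)%:Z %| (a * b)%R k - a k * b k)%Z.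
Proof. by rewrite -eqz_mod_dvd /= modz_mod. Qed.
Lemma padicD (a b : padic_int p) k : ((p ^ k)%:Z %| (a + b)%R k - (a k + b k))%Z.
Proof. by rewrite -eqz_mod_dvd /= modz_mod. Qed.
Lemma padic_sum (I : finType) (F : I -> padic_int p) k :
  ((p ^ k)%:Z %| (\sum_i F i)%R k - \sum_i F i k)%Z.
Proof.
elim/big_rec2: _ => [|i y1 y2 _ h]; first by rewrite padic0 subrr dvdz0.
rewrite (_ : _ - _ = ((F i + y2)%R k - (F i k + y2 k)) + (y2 k - y1)); last by ring.
by rewrite rpredD ?padicD.
Qed.
Lemma padic_int_cast (n : int) k : ((p ^ k)%:Z %| (n%:~R : padic_int p) k - n)%Z.
Proof.
have o1 : ((p ^ k)%:Z %| (1 : padic_int p)%R k - 1)%Z by rewrite -eqz_mod_dvd /= modz_mod.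
have nat_ (a : nat) : ((p ^ k)%:Z %| (a%:R : padic_int p) k - a%:Z)%Z.
  elim: a => [|a IH]; first by rewrite padic0 subrr dvdz0.
  rewrite -[a.+1%:R]natr1 -addn1 PoszD.
  rewrite (_ : _ - _ = ((a%:R + 1 : padic_int p)%R k - ((a%:R : padic_int p) k + (1 : padic_int p)%R k)) +
     ((a%:R : padic_int p) k - a%:Z) + ((1 : padic_int p)%R k - 1)); last by ring.
  by apply: rpredD => //; apply: rpredD => //; exact: padicD.
case: n => a; first exact: nat_.
rewrite NegzE rmorphN /= -pmulrn.
rewrite (_ : _ - _ = ((- (a.+1%:R : padic_int p))%R k + (a.+1%:R : padic_int p) k) - ((a.+1%:R : padic_int p) k - a.+1%:Z)); last by ring.
rewrite rpredB ?nat_ //; rewrite -[X in (_ + X)%R]opprK -eqz_mod_dvd /= modz_mod //.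
Qed.

Definition resm n r k (X : 'M[padic_int p]_(n, r)) : 'M[int]_(n, r) := map_mx (fun a : padic_int p => a k) X.

Lemma resmM n r t k (X : 'M[padic_int p]_(n, r)) (Y : 'M[padic_int p]_(r, t)) :
  mcong (p ^ k)%:Z (resm k (X *m Y)) (resm k X *m resm k Y).
Proof.
move=> i j; rewrite !mxE.
rewrite (_ : _ - _ = ((\sum_j0 X i j0 * Y j0 j)%R k - \sum_j0 (X i j0 * Y j0 j)%R k) +
   (\sum_j0 (X i j0 * Y j0 j)%R k - \sum_j0 resm k X i j0 * resm k Y j0 j)); last by ring.
rewrite rpredD ?padic_sum // -sumrB; apply: rpred_sum => l _; rewrite !mxE; exact: padicM.
Qed.
Lemma resm_int n r k (X : 'M[int]_(n, r)) :
  mcong (p ^ k)%:Z (resm k (map_mx intr X)) X.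
Proof. by move=> i j; rewrite !mxE; exact: padic_int_cast. Qed.
End Padic.

Section Genus.
Variables (m : nat) (R : realType).
Implicit Types Q S : 'M[int]_m.

(** What survives of local equivalence modulo a single integer, with [V] an inverse of [U] modulo
    it; the Gauss sums, the level and the determinant need no more. *)
Definition congr_equiv (M : nat) Q S := exists U V : 'M[int]_m,
  [/\ mcong M%:Z (U *m V) 1%:M, mcong M%:Z (V *m U) 1%:M & mcong M%:Z (U^T *m Q *m U) S].

Lemma congr_equiv_prime p k Q S : equiv_over (padic_int p) Q S -> congr_equiv (p ^ k) Q S.
Proof.
move=> [U [[V [UV VU]] E]]; exists (resm k U), (resm k V).
have one : mcong (p ^ k)%:Z (resm k (1%:M : 'M[padic_int p]_m)) 1%:M.
  move=> i j; rewrite !mxE; case: eqP => _; rewrite ?mulr1n ?mulr0n ?padic0 ?subrr ?dvdz0 //.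
  by have := @padic_int_cast p 1 k.
split.
- by rewrite -UV in one; exact: mcong_trans (mcong_sym (resmM k U V)) one.
- by rewrite -VU in one; exact: mcong_trans (mcong_sym (resmM k V U)) one.
have e1 := resmM k (U^T *m map_mx intr Q) U; rewrite E in e1.
have e2 := resmM k U^T (map_mx intr Q).
apply: mcong_trans (@resm_int p _ _ k S); apply: mcong_trans (mcong_sym e1).
apply: mcongM; last exact: mcong_refl.
apply: mcong_trans (mcong_sym e2); rewrite /resm map_trmx.
apply: mcongM; first exact: mcong_refl.
exact/mcong_sym/resm_int.
Qed.

Definition crtm (a b : nat) n r (X Y : 'M[int]_(n, r)) := \matrix_(i, j) zchinese a b (X i j) (Y i j).

Lemma crtml (a b : nat) n r (X Y : 'M[int]_(n, r)) : coprime a b -> mcong a (crtm a b X Y) X.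
Proof. by move=> c i j; rewrite mxE -eqz_mod_dvd; apply/eqP; apply: zchinese_modl. Qed.
Lemma crtmr (a b : nat) n r (X Y : 'M[int]_(n, r)) : coprime a b -> mcong b (crtm a b X Y) Y.
Proof. by move=> c i j; rewrite mxE -eqz_mod_dvd; apply/eqP; apply: zchinese_modr. Qed.

Lemma mcong_mul (a b : nat) n r (X Y : 'M[int]_(n, r)) : coprime a b -> mcong a X Y -> mcong b X Y ->
  mcong (a * b)%N X Y.
Proof. by move=> c h k i j; rewrite PoszM Gauss_dvdz // ?h ?k. Qed.

Lemma congr_equivM a b Q S : coprime a b -> congr_equiv a Q S -> congr_equiv b Q S ->
  congr_equiv (a * b) Q S.
Proof.
move=> c [U [V [h1 h2 h3]]] [U' [V' [k1 k2 k3]]].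
have [ul ur] := (@crtml a b _ _ U U' c, @crtmr a b _ _ U U' c).
have [vl vr] := (@crtml a b _ _ V V' c, @crtmr a b _ _ V V' c).
exists (crtm a b U U'), (crtm a b V V'); split; apply: mcong_mul => //.
- exact: mcong_trans (mcongM ul vl) h1.
- exact: mcong_trans (mcongM ur vr) k1.
- exact: mcong_trans (mcongM vl ul) h2.
- exact: mcong_trans (mcongM vr ur) k2.
- exact: mcong_trans (mcongM (mcongM (mcongT ul) (mcong_refl _ _)) ul) h3.
- exact: mcong_trans (mcongM (mcongM (mcongT ur) (mcong_refl _ _)) ur) k3.
Qed.

(** One prime power is split off at a time, and solutions for coprime moduli are glued entrywise by
    the Chinese remainder theorem. *)
Lemma genus_congr Q S M : genus R Q S -> (0 < M)%N -> congr_equiv M Q S.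
Proof.
move=> [_ hp _]; elim/ltn_ind: M => M IH M0.
have [->|M1] := eqVneq M 1%N.
  by exists 1%:M, 1%:M; split=> i j; rewrite dvd1z.
have M2 : (1 < M)%N by case: M M0 M1 {IH} => [|[|]].
pose p := pdiv M; have pp : prime p by exact: pdiv_prime.
have E : (p ^ logn p M * M`_p^')%N = M by rewrite -p_part partnC.
rewrite -E; apply: congr_equivM; first by rewrite -p_part coprime_partC.
  exact/congr_equiv_prime/hp.
apply: IH; last exact: part_gt0.
rewrite -{2}E ltn_Pmull ?part_gt0 // -{1}(expn0 p) ltn_exp2l ?prime_gt1 // logn_gt0.
by rewrite mem_primes pp M0 pdiv_dvd.
Qed.

(** Modulo a common multiple of the two determinants, each divides the other; both are positive. *)
Lemma genus_det Q S : even_posdef R Q -> genus R Q S -> \det S = \det Q.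
Proof.
move=> eQ gS; have [eS _ _] := gS.
have dQ := evpd_det eQ; have dS := evpd_det eS.
pose M := (`|\det Q| * `|\det S|)%N.
have M0 : (0 < M)%N by rewrite muln_gt0 !absz_gt0 !gt_eqF.
have [U [V [UV VU E]]] := genus_congr gS M0.
have dQM : (\det Q %| M%:Z)%Z by rewrite /M PoszM dvdz_mulr // /dvdz /=.
have dSM : (\det S %| M%:Z)%Z by rewrite /M PoszM dvdz_mull // /dvdz /=.
have h1 : (\det Q %| \det S)%Z.
  have := cong_det E; rewrite !det_mulmx det_tr => /(dvdz_trans dQM).
  by rewrite -rpredN opprB => h; rewrite -(subrK (\det U * \det Q * \det U) (\det S)) rpredD // dvdz_mulr // dvdz_mull.
have E2 : mcong M%:Z (V^T *m S *m V) Q.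
  apply: mcong_trans (mcongM (mcongM (mcong_refl _ _) (mcong_sym E)) (mcong_refl _ _)) _.
  rewrite !mulmxA -trmx_mul -!mulmxA.
  apply: mcong_trans (mcongM (mcongT UV) (mcongM (mcong_refl _ Q) UV)) _.
  by rewrite trmx1 mul1mx mulmx1; exact: mcong_refl.
have h2 : (\det S %| \det Q)%Z.
  have := cong_det E2; rewrite !det_mulmx det_tr => /(dvdz_trans dSM).
  by rewrite -rpredN opprB => h; rewrite -(subrK (\det V * \det S * \det V) (\det Q)) rpredD // dvdz_mulr // dvdz_mull.
rewrite !dvdzE in h1 h2; rewrite -[LHS]gtz0_abs // -[RHS]gtz0_abs //.
by congr Posz; apply/eqP; rewrite eqn_dvd h1 h2.
Qed.

Lemma level_multipleP Q N : \det Q != 0 -> level_multiple Q N <->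
  exists B : 'M[int]_m, N%:Z *: \adj Q = \det Q *: B /\ forall i, (2 %| B i i)%Z.
Proof.
move=> d0; have dr : (\det Q)%:~R != 0 :> rat by rewrite intr_eq0.
have ud : (map_mx intr Q : 'M[rat]_m) \in unitmx by rewrite unitmxE det_map_mx unitfE.
have E : invmx (map_mx intr Q : 'M[rat]_m) = (\det Q)%:~R^-1 *: map_mx intr (\adj Q).
  by rewrite /invmx ud det_map_mx map_mx_adj.
move: (\adj Q) E => AQ E.
split=> -[B [h e]]; exists B; split=> //.
  apply/matrixP => i j; have := congr1 (fun X : 'M[rat]_m => (\det Q)%:~R * X i j) h.
  rewrite E !mxE mulrCA mulVKf // => h2; apply: (@intr_inj rat).
  rewrite !intrM -h2; congr (_ * _).
apply/matrixP => i j; have := congr1 (fun X : 'M[int]_m => (X i j)%:~R : rat) h.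
rewrite /= E !mxE !intrM => h2; apply: (mulfI dr).
by rewrite -h2 mulrCA mulVKf.
Qed.

Lemma genus_level Q S N : even_posdef R Q -> genus R Q S -> level_multiple Q N -> level_multiple S N.
Proof.
move=> eQ gS; have dd := genus_det eQ gS; have dQ := evpd_det eQ.
have d0 : \det Q != 0 by rewrite gt_eqF.
move=> /(level_multipleP _ d0)[B [hB eB]]; apply/level_multipleP; first by rewrite dd.
(* The factor $\det Q$ allows the error to be divided out, and the factor 2 keeps the corrected
   diagonal even. *)
pose M := (2 * `|\det Q|)%N.
have ME : M%:Z = \det Q * 2 by rewrite /M PoszM gez0_abs ?ltW // mulrC.
have M0 : (0 < M)%N by rewrite muln_gt0 absz_gt0.
have [U [V [UV VU E]]] := genus_congr gS M0.
have QB : Q *m B = N%:Z%:M.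
  apply: (int_mx_scaleI d0); rewrite scalemxAr -hB -scalemxAr mul_mx_adj.
  by rewrite !scale_scalar_mx mulrC.
have symB : B^T = B.
  apply: (int_mx_scaleI d0); rewrite -hB -linearZ /= -hB linearZ /= trmx_adj; case: eQ => -> _ _.
  by [].
pose W := V *m B *m V^T.
have evW i : (2 %| W i i)%Z.
  have -> : W i i = qf B (row i V)^T.
    rewrite /qf trmxK -!row_mul /W !mxE; apply: eq_bigr => k _; rewrite !mxE.
    by [].
  have /qform2i <- : evsym B by split.
  by rewrite -[X in (_ %| X)%Z]mulr_natr dvdz_mull.
have SW : mcong M%:Z (S *m W) N%:Z%:M.
  apply: mcong_trans (mcongM (mcong_sym E) (mcong_refl _ _)) _.
  rewrite /W -!mulmxA (mulmxA U) (mulmxA Q).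
  apply: (@mcong_trans _ _ _ _ (U^T *m (Q *m 1%:M *m (B *m V^T)))).
    by apply: mcongM (mcong_refl _ _) _; rewrite -!mulmxA; apply: mcongM (mcong_refl _ _) _;
       rewrite !mulmxA; do 2! apply: mcongM _ (mcong_refl _ _).
  rewrite mulmx1 (mulmxA Q) QB mul_scalar_mx -scalemxAr -trmx_mul.
  rewrite -[X in mcong _ _ X]scalemx1; apply: mcongZ.
  by have := mcongT VU; rewrite trmx1.
have [K HK] := mcongP SW.
(* [S *m W] is the scalar [N] only modulo [M]; the multiple of [\adj S *m K] removes the error
   exactly. *)
exists (W - 2 *: (\adj S *m K)); split; last first.
  move=> i; move: (\adj S *m K) => L.
  have -> : (W - 2 *: L) i i = W i i - 2 * L i i by rewrite mxE [in X in _ + X]mxE [X in _ - X]mxE.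
  by rewrite rpredB // dvdz_mulr.
have := congr1 (mulmx (\adj S)) HK; rewrite mulmxA mul_adj_mx mul_scalar_mx mulmxDr mul_mx_scalar -scalemxAr dd ME => e.
by rewrite scalerBr e scalerA addrK.
Qed.

Lemma genus_equiv_form (A : comPzRingType) Q S (U : 'M[A]_m) : tf2 A -> evsym Q -> evsym S ->
  U^T *m map_mx intr Q *m U = map_mx intr S -> forall x, qform S x = qform Q (U *m x).
Proof. by move=> tA eQ eS E x; apply: (tf2I tA); rewrite !qform2 // qf_mulmx E. Qed.

Lemma invertible_mul (A : comPzRingType) (U V : 'M[A]_m) : invertible_mx U -> invertible_mx V -> invertible_mx (U *m V).
Proof.
move=> [U' [h h']] [V' [k k']]; exists (V' *m U'); split.
  by rewrite mulmxA -(mulmxA U) k mulmx1 h.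
by rewrite mulmxA -(mulmxA V') h' mulmx1 k'.
Qed.

Lemma genus_local Q S nu r2 : even_posdef R Q -> genus R Q S -> local_exponents Q nu r2 -> local_exponents S nu r2.
Proof.
move=> eQ [eS hp _] [h1 h2].
have tr p : prime p -> exists2 V : 'M[padic_int p]_m, invertible_mx V & forall x, qform S (V *m x) = qform Q x.
  move=> pp; have [U [[V [UV VU]] E]] := hp p pp; exists V; first by exists U.
  move=> x; rewrite (genus_equiv_form (tf2_padic pp) (evpd_evsym eQ) (evpd_evsym eS) E).
  by rewrite mulmxA UV mul1mx.
split.
  move=> p pp op; have [U [u [iU hu hx]]] := h1 p pp op; have [V iV hV] := tr p pp.
  exists (V *m U), u; split=> //; first exact: invertible_mul.
  by move=> x; rewrite -mulmxA hV hx.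
have [r1 [nut [U [u [a b iU hu hx]]]]] := h2; have [V iV hV] := tr 2%N isT.
exists r1, nut, (V *m U), u; split=> //; first exact: invertible_mul.
by move=> x; rewrite -mulmxA hV hx.
Qed.

(** [fset_set] returns the empty set on infinite sets, so finiteness is what must be shown: the
    columns of an automorph have bounded form value. The positivity of the total weight of the genus
    rests on this. *)
Lemma automorphs_gt0 S : even_posdef R S -> (0 < #|` automorphs S|)%N.
Proof.
move=> eS; have pS := evpd_pdef eS.
set X := [set U : 'M[int]_m | invertible_mx U /\ U^T *m S *m U = S].
have fX : finite_set X.
  pose T : R := \sum_(i < m) (S i i)%:~R.
  have [s hs] := qf_finite T pS.
  have Sge i : 0 <= (S i i)%:~R :> R.
    have -> : (S i i)%:~R = qf (map_mx intr S) (delta_mx i 0) :> R.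
      by rewrite /qf trmx_delta -rowE -colE !mxE.
    case: (pS) => _ p; apply/ltW/p; apply/eqP => /matrixP /(_ i 0) /eqP.
    by rewrite !mxE !eqxx oner_eq0.
  have colU (U : 'M[int]_m) i : X U -> col i U \in s.
    move=> [_ E]; apply: hs; rewrite qf_cast.
    have -> : qf S (col i U) = S i i.
      rewrite colE qf_mulmx E /qf trmx_delta -rowE -colE !mxE //.
    by rewrite /T (bigD1 i) //= lerDl sumr_ge0.
  have f2 : finite_set [set f : {ffun 'I_m -> seq_sub s} | True] by exact: finite_finset.
  apply: (@sub_finite_set _ _ ((fun f : {ffun 'I_m -> seq_sub s} => \matrix_(i, j) (val (f j) i 0)) @` [set f | True])).
    move=> U XU /=; exists [ffun j => SeqSub (colU U j XU)] => //.
    by apply/matrixP => i j; rewrite mxE ffunE /= mxE.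
  exact: finite_image.
rewrite /automorphs -/X cardfs_gt0; apply/fset0Pn; exists 1%:M; rewrite in_fset_set // inE /X /=.
by split; [exists 1%:M; rewrite mulmx1|rewrite trmx1 mul1mx mulmx1].
Qed.

End Genus.

(** * Gauss sums and the Smith form *)

Section Residues.
Variables (n m : nat).
Let c : int := n.+1%:Z.
Notation ZV := 'cV[int]_m.
Notation CV := 'cV['I_n.+1]_m.

Definition lft (r : CV) : ZV := map_mx (fun i : 'I_n.+1 => (i : nat)%:Z) r.
Definition red (x : ZV) : CV := map_mx (fun a : int => inord `|(a %% c)%Z|) x.

Lemma c_gt0 : (0 : int) < c. Proof. by []. Qed.

Lemma inord_mod (a : int) : ((inord `|(a %% c)%Z| : 'I_n.+1) : nat)%:Z = (a %% c)%Z.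
Proof.
have h0 : 0 <= (a %% c)%Z by exact: modz_ge0.
rewrite inordK ?gez0_abs //.
by have := ltz_pmod a c_gt0; rewrite -{1}(gez0_abs h0).
Qed.

Lemma lft_red x : exists k : ZV, lft (red x) = x + c *: k.
Proof.
exists (\matrix_(i, j) - (x i j %/ c)%Z); apply/matrixP => i j.
rewrite !mxE inord_mod mulrN mulrC; apply/eqP; rewrite -subr_eq opprK; apply/eqP.
by rewrite {3}(divz_eq (x i j) c) addrC.
Qed.

Lemma red_lft r : red (lft r) = r.
Proof.
apply/matrixP => i j; rewrite !mxE; apply: val_inj => /=.
rewrite modz_small ?inordK //=; case: (r i j) => a ha //=.
Qed.

Lemma redD x k : red (x + c *: k) = red x.
Proof. by apply/matrixP => i j; rewrite !mxE mulrC addrC modzMDl. Qed.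

Definition cper (T : Type) (F : ZV -> T) := forall x k, F (x + c *: k) = F x.

Lemma cper_red (T : Type) (F : ZV -> T) x : cper F -> F (lft (red x)) = F x.
Proof. by move=> h; have [k ->] := lft_red x. Qed.

Lemma sum_bij (V : nmodType) (F : ZV -> V) (h g : ZV -> ZV) : cper F ->
  (forall x k, exists l, h (x + c *: k) = h x + c *: l) ->
  (forall x k, exists l, g (x + c *: k) = g x + c *: l) ->
  (forall x, exists l, g (h x) = x + c *: l) -> (forall x, exists l, h (g x) = x + c *: l) ->
  \sum_(r : CV) F (h (lft r)) = \sum_(r : CV) F (lft r).
Proof.
move=> pF ph pg gh hg.
have redp f : (forall x k, exists l, f (x + c *: k) = f x + c *: l) -> forall x, red (f (lft (red x))) = red (f x).
  by move=> pf x; have [k ->] := lft_red x; have [l ->] := pf x k; rewrite redD.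
rewrite [RHS](reindex (fun r => red (h (lft r)))) /=.
  by apply: eq_bigr => r _; rewrite cper_red.
exists (fun r => red (g (lft r))) => r _.
  by rewrite redp //; have [l ->] := gh (lft r); rewrite redD red_lft.
by rewrite redp //; have [l ->] := hg (lft r); rewrite redD red_lft.
Qed.

Lemma sum_shift (V : nmodType) (F : ZV -> V) t : cper F ->
  \sum_(r : CV) F (lft r + t) = \sum_(r : CV) F (lft r).
Proof.
move=> pF; apply: (@sum_bij _ F (fun x => x + t) (fun x => x - t)) => // x.
- by move=> k; exists k; rewrite addrAC.
- by move=> k; exists k; rewrite addrAC.
- by exists 0; rewrite scaler0 addr0 addrK.
- by exists 0; rewrite scaler0 addr0 subrK.
Qed.

Lemma sum_mulmx (V : nmodType) (F : ZV -> V) (U W : 'M[int]_m) : cper F ->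
  mcong c (U *m W) 1%:M -> mcong c (W *m U) 1%:M ->
  \sum_(r : CV) F (U *m lft r) = \sum_(r : CV) F (lft r).
Proof.
move=> pF /mcongP[K hK] /mcongP[L hL]; apply: (@sum_bij _ F (mulmx U) (mulmx W)) => // x.
- by move=> k; exists (U *m k); rewrite mulmxDr scalemxAr.
- by move=> k; exists (W *m k); rewrite mulmxDr scalemxAr.
- by exists (L *m x); rewrite mulmxA hL mulmxDl mul1mx scalemxAl.
- by exists (K *m x); rewrite mulmxA hK mulmxDl mul1mx scalemxAl.
Qed.

Lemma card_CV : #|{: CV}| = (n.+1 ^ m)%N.
Proof. by rewrite card_mx card_ord muln1. Qed.
End Residues.

Section GaussSum.
Variables (R : realType) (n m : nat).
Let c : int := n.+1%:Z.
Local Open Scope complex_scope.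
Notation ZV := 'cV[int]_m.
Notation CV := 'cV['I_n.+1]_m.
Implicit Types (Q S : 'M[int]_m) (x y t : ZV).

Definition ec (k : int) : R[i] := ee (k%:~R / n.+1%:R : R)%:C.

Lemma n1C : n.+1%:R != 0 :> R. Proof. by rewrite pnatr_eq0. Qed.
Lemma ecD a b : ec (a + b) = ec a * ec b.
Proof. by rewrite /ec -eeD -rmorphD /= intrD mulrDl. Qed.
Lemma ec_c a b : ec (a + c * b) = ec a.
Proof.
rewrite /ec intrD mulrDl intrM (_ : c%:~R = n.+1%:R) // mulrAC mulfV ?n1C // mul1r rmorphD /=.
by rewrite (_ : (b%:~R)%:C = b%:~R) ?ee_addint // rmorph_int.
Qed.
Lemma ec_dvd a b : (c %| a - b)%Z -> ec a = ec b.
Proof. by move=> /dvdzP[k h]; rewrite -(subrK b a) h addrC mulrC ec_c. Qed.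
Lemma cabs_ec a : cabs (ec a) = 1. Proof. by rewrite /ec cabs_ee_real. Qed.
Lemma ec0 : ec 0 = 1. Proof. by rewrite /ec mul0r ee0. Qed.
Lemma ecN a : ec (- a) = (ec a)^-1. Proof. by rewrite /ec intrN mulNr rmorphN /= eeN. Qed.
Lemma ec_neq0 a : ec a != 0. Proof. exact: ee_neq0. Qed.
Lemma ec_conj a : conjc (ec a) = ec (- a).
Proof. by rewrite /ec ee_conj conjc_real intrN mulNr rmorphN. Qed.

Lemma ec_eq1 a : ec a = 1 -> (c %| a)%Z.
Proof.
pose r := (a %% c)%Z; have r0 : 0 <= r by exact: modz_ge0.
have rc : r < c by exact: ltz_pmod.
have -> : ec a = ec r by apply: ec_dvd; rewrite /r {1}(divz_eq a c) addrK dvdz_mull.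
have [rE _|rn] := eqVneq r 0; first by apply/dvdz_mod0P.
pose x : R := r%:~R / n.+1%:R.
have x01 : 0 < x < 1.
  apply/andP; split; first by apply: divr_gt0; rewrite ?ltr0z ?ltr0n // lt_neqAle eq_sym rn.
  by rewrite /x ltr_pdivrMr ?ltr0n // mul1r -[n.+1%:R]/(n.+1%:Z%:~R) ltr_int.
rewrite /ec -/x; have -> : ee x%:C = (cos (2 * pi * x)) +i* (sin (2 * pi * x)).
  by rewrite ee.unlock /expi /= mulr0 oppr0 expR0 mul1r.
move=> [h _]; exfalso; move: x01 => /andP[x0 x1].
have s0 : 0 < sin (pi * x) by apply: sin_gt0_pi; rewrite mulr_gt0 ?pi_gt0 //= gtr_pMr ?pi_gt0.
have : cos (2 * pi * x) = 1 - 2 * sin (pi * x) ^+ 2.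
  have -> : 2 * pi * x = pi * x + pi * x by ring.
  by have := cos2Dsin2 (pi * x); rewrite cosD; nra.
by rewrite h => e; have := exprn_gt0 2 s0; lra.
Qed.

Lemma orth (v : ZV) : \sum_(r : CV) ec (dotp (lft r) v) =
  (if [forall i, (c %| v i 0%R)%Z] then (n.+1 ^ m)%:R else 0).
Proof.
have per : @cper n m _ (fun x => ec (dotp x v)).
  by move=> x k; rewrite dotpDl dotpZl ec_c.
case: ifPn => [/forallP h|].
  rewrite (eq_bigr (fun=> 1)); last first.
    move=> r _; rewrite -ec0; apply: ec_dvd; rewrite subr0 dotpE.
    by apply: rpred_sum => i _; rewrite dvdz_mull.
  by rewrite sumr_const card_CV.
move=> /forallPn[i hi]; set s := \sum_r _.
have : s = ec (v i 0) * s.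
  rewrite -[LHS](sum_shift (delta_mx i 0) per) /s mulr_sumr; apply: eq_bigr => r _.
  rewrite -ecD dotpDl addrC; congr (ec (_ + _)).
  by rewrite /dotp trmx_delta -rowE mxE.
move=> /eqP; rewrite -subr_eq0 -{1}(mul1r s) -mulrBl mulf_eq0 => /orP[|/eqP //].
by rewrite subr_eq0 => /eqP /esym /ec_eq1 h; rewrite h in hi.
Qed.

(** The radical of the bilinear form of [Q] modulo [c]; the modulus is kept as [n.+1] so that it is
    positive by construction. *)
Definition Rad Q : {set CV} := [set t : CV | [forall i, (c %| (Q *m lft t) i 0%R)%Z]].
Definition Gs Q a y : R[i] := \sum_(r : CV) ec (a * qform Q (lft r) + dotp (lft r) y).

Lemma qform_c Q x k : evsym Q -> exists l, qform Q (x + c *: k) = qform Q x + c * l.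
Proof.
move=> eQ; exists (c * qform Q k + dotp x (Q *m k)).
by rewrite qformDi // qformZ -scalemxAr dotpZr; ring.
Qed.

Lemma Gs_per Q a y : evsym Q -> @cper n m _ (fun x => ec (a * qform Q x + dotp x y)).
Proof.
move=> eQ x k; have [l ->] := qform_c x k eQ; rewrite dotpDl dotpZl.
by rewrite (_ : _ + _ = a * qform Q x + dotp x y + c * (a * l + dotp k y)) ?ec_c //; ring.
Qed.

Lemma coprime_dvd a (v : int) : coprimez a c -> (c %| a * v)%Z = (c %| v)%Z.
Proof. by move=> h; rewrite Gauss_dvdzr // coprimez_sym. Qed.

(** In the double sum one index is written as [t + r']; the sum over [r'] is then a full character
    sum, zero unless [t] is in the radical. *)
Lemma Gs_sqr Q a y : evsym Q -> coprimez a c ->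
  (cabs (Gs Q a y) ^+ 2)%:C = (n.+1 ^ m)%:R * \sum_(t in Rad Q) ec (a * qform Q (lft t) + dotp (lft t) y).
Proof.
move=> eQ ca; pose f x := a * qform Q x + dotp x y.
have -> : (cabs (Gs Q a y) ^+ 2)%:C = Gs Q a y * conjc (Gs Q a y).
  by rewrite cabs_sqr; case: (Gs Q a y) => u v /=; apply/eqP; rewrite eq_complex /=; apply/andP; split; apply/eqP; ring.
have -> : Gs Q a y * conjc (Gs Q a y) = \sum_(r' : CV) \sum_(t : CV) ec (f (lft t)) * ec (dotp (lft r') (a *: (Q *m lft t))).
  rewrite {2}/Gs rmorph_sum mulr_sumr /=; apply: eq_bigr => r' _.
  rewrite ec_conj (_ : Gs Q a y = \sum_(t : CV) ec (a * qform Q (lft t + lft r') + dotp (lft t + lft r') y)); last by rewrite (sum_shift (lft r') (Gs_per a y eQ)).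
  rewrite mulr_suml; apply: eq_bigr => t _.
  rewrite -!ecD; congr ec; rewrite /f qformDi // dotpZr dotpDl.
  have -> : dotp (lft t) (Q *m lft r') = dotp (lft r') (Q *m lft t).
    by rewrite dotp_mul; case: eQ => -> _; rewrite dotpC.
  ring.
rewrite exchange_big /= (bigID (fun t : CV => t \in Rad Q)) /= [X in _ + X]big1 ?addr0; last first.
  move=> t; rewrite inE => ht; rewrite -mulr_sumr orth ifN ?mulr0 //.
  by apply: contra ht => /forallP h; apply/forallP => i; have := h i; rewrite mxE coprime_dvd.
rewrite mulr_sumr; apply: eq_bigr => t; rewrite inE => /forallP ht.
rewrite -mulr_sumr orth ifT 1?mulrC //.
by apply/forallP => i; rewrite mxE dvdz_mull.
Qed.

Lemma Gs_bound Q a y : evsym Q -> coprimez a c ->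
  cabs (Gs Q a y) ^+ 2 <= (n.+1 ^ m)%:R * #|Rad Q|%:R.
Proof.
move=> eQ ca; have -> : cabs (Gs Q a y) ^+ 2 = cabs ((cabs (Gs Q a y) ^+ 2)%:C : R[i]).
  by rewrite cabs_real ger0_norm // sqr_ge0.
rewrite Gs_sqr // cabsM cabs_nat ler_wpM2l //.
apply: le_trans (cabs_sum _ _ _) _; rewrite (eq_bigr (fun=> 1)) ?sumr_const //.
by move=> t _; rewrite cabs_ec.
Qed.

(** Translating the summation variable by a radical vector [t] multiplies the sum by a root of
    unity, which must be 1 if the sum is nonzero. *)
Lemma Gs_supp Q a y (t : ZV) : evsym Q -> (forall i, (c %| (Q *m t) i 0%R)%Z) -> Gs Q a y != 0 ->
  (c %| a * qform Q t + dotp t y)%Z.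
Proof.
move=> eQ ht g0; apply: ec_eq1.
have : Gs Q a y = ec (a * qform Q t + dotp t y) * Gs Q a y.
  rewrite {1}/Gs -(sum_shift t (Gs_per a y eQ)) mulr_sumr; apply: eq_bigr => r _.
  rewrite -ecD; apply: ec_dvd; rewrite qformDi // dotpDl.
  rewrite (_ : _ - _ = a * dotp (lft r) (Q *m t)); last by ring.
  by rewrite dvdz_mull // dotpE; apply: rpred_sum => i _; rewrite dvdz_mull.
by move=> /eqP; rewrite -subr_eq0 -{1}(mul1r (Gs _ _ _)) -mulrBl mulf_eq0 (negbTE g0) orbF subr_eq0 => /eqP.
Qed.

(** Completing the square with [d], the inverse of [a] modulo [c], removes the linear term. *)
Lemma Gs_Q Q a d x : evsym Q -> (c %| a * d - 1)%Z ->
  Gs Q a (Q *m x) = ec (- (d * qform Q x)) * Gs Q a 0.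
Proof.
move=> eQ had; rewrite {1}/Gs -(sum_shift (- d *: x) (Gs_per a (Q *m x) eQ)) /Gs mulr_sumr.
apply: eq_bigr => r _; rewrite -ecD; apply: ec_dvd.
rewrite qformDi // dotpDl qformZ -!scalemxAr dotpZr dotpZl.
have -> : dotp x (Q *m x) = 2 * qform Q x by rewrite -qfE -qform2i // mulr_natl.
have -> : dotp (lft r) (0 : ZV) = 0 by rewrite /dotp mulmx0 mxE.
set u := dotp (lft r) _; set q := qform Q x; set q' := qform Q _.
rewrite (_ : _ - _ = (a * d - 1) * (d * q - u)); last by ring.
by rewrite dvdz_mulr.
Qed.

(** The congruence is taken modulo [2 * c] because [qform], half of the even form, must agree modulo
    [c]. *)
Lemma Gs_genus Q S a : even_posdef R Q -> genus R Q S -> Gs Q a 0 = Gs S a 0.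
Proof.
move=> eQ gS; have eS := evpd_evsym (let: And3 h _ _ := gS in h); have eQ' := evpd_evsym eQ.
have M0 : (0 < 2 * n.+1)%N by [].
have [U [V [UV VU E]]] := genus_congr gS M0.
have cd : (c %| (2 * n.+1)%N%:Z)%Z by rewrite PoszM dvdz_mull.
rewrite /Gs -(sum_mulmx (Gs_per a 0 eQ') (mcong_dvd cd UV) (mcong_dvd cd VU)).
apply: eq_bigr => r _; apply: ec_dvd; rewrite /dotp !mulmx0 !mxE !addr0 -mulrBr dvdz_mull //.
have : ((2 * n.+1)%N%:Z %| qf (U^T *m Q *m U) (lft r) - qf S (lft r))%Z.
  exact: (mcongM (mcongM (mcong_refl _ _) E) (mcong_refl _ _)) 0 0.
rewrite -qf_mulmx -!qform2i // -mulrnBl -[_ *+ 2]mulr_natl PoszM dvdz_mul2l //.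
Qed.

End GaussSum.

Lemma level_inverse (m : nat) (Q : 'M[int]_m) N : \det Q != 0 -> Q^T = Q -> level_multiple Q N ->
  exists B : 'M[int]_m, [/\ evsym B, Q *m B = N%:Z%:M & B *m Q = N%:Z%:M].
Proof.
move=> d0 sQ /(level_multipleP _ d0)[B [hB eB]]; exists B.
have symB : B^T = B by apply: (int_mx_scaleI d0); rewrite -hB -linearZ /= -hB linearZ /= trmx_adj sQ.
split; first by split.
  by apply: (int_mx_scaleI d0); rewrite scalemxAr -hB -scalemxAr mul_mx_adj !scale_scalar_mx mulrC.
by apply: (int_mx_scaleI d0); rewrite scalemxAl -hB -scalemxAl mul_adj_mx !scale_scalar_mx mulrC.
Qed.

Lemma count_dvd_mul (n e : nat) : (0 < e)%N ->
  #|[set k : 'I_n.+1 | (n.+1 %| e * k)%N]%SET| = gcdn e n.+1.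
Proof.
move=> e0; set g := gcdn e n.+1; have g0 : (0 < g)%N by rewrite gcdn_gt0 orbT.
have [ge gn] : (g %| e)%N /\ (g %| n.+1)%N by rewrite dvdn_gcdl dvdn_gcdr.
pose h := (n.+1 %/ g)%N; have hg : (h * g = n.+1)%N by rewrite divnK.
have h0 : (0 < h)%N by rewrite divn_gt0 // dvdn_leq.
have lt (j : 'I_g) : (h * j < n.+1)%N by rewrite -hg ltn_pmul2l.
have <- : #|[set Ordinal (lt j) | j : 'I_g]%SET| = g.
  rewrite card_imset ?card_ord // => i j /(congr1 val) /= /eqP; rewrite eqn_pmul2l // => /eqP.
  exact: val_inj.
apply: eq_card => k; rewrite inE; apply/idP/imsetP => [|[j _ ->] /=]; last first.
  by rewrite mulnA -{1}hg dvdn_mulr // mulnC dvdn_pmul2r.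
have cop : coprime h (e %/ g) by rewrite coprime_sym /coprime /h -(eqn_pmul2r g0) mul1n muln_gcdl !divnK // eqxx.
rewrite -{1}hg -(divnK ge) mulnAC dvdn_pmul2r // Gauss_dvdr // => /dvdnP[j kj].
have jg : (j < g)%N by rewrite -(ltn_pmul2l h0) hg mulnC -kj.
by exists (Ordinal jg) => //; apply: val_inj; rewrite /= kj mulnC.
Qed.

Lemma unit_absz m (A : 'M[int]_m) : A \in unitmx -> `|\det A|%N = 1%N.
Proof.
move=> uA; have := congr1 (fun X : 'M[int]_m => `|\det X|%N) (mulmxV uA).
by rewrite det_mulmx det1 abszM => /eqP; rewrite muln_eq1 => /andP[/eqP].
Qed.

Section SmithData.
Variables (m : nat) (Q : 'M[int]_m) (A B : 'M[int]_m) (e : 'I_m -> nat).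
Definition diagZ (e : 'I_m -> nat) : 'M[int]_m := diag_mx (\row_i (e i)%:Z).
Hypothesis uA : A \in unitmx.
Hypothesis uB : B \in unitmx.
Hypothesis eQ : evsym Q.
Hypothesis QE : Q = A *m diagZ e *m B.
Hypothesis e0 : forall i, (0 < e i)%N.

Lemma diagZ_mul p (f : 'I_m -> nat) (X : 'M[int]_(m, p)) i j : (diagZ f *m X) i j = (f i)%:Z * X i j.
Proof. by rewrite /diagZ mul_diag_mx !mxE. Qed.

Lemma smith_det : 0 < \det Q -> \det Q = \prod_i (e i)%:Z.
Proof.
move=> dQ; rewrite -[LHS]gtz0_abs // {1}QE !det_mulmx !abszM (unit_absz uA) (unit_absz uB) mul1n muln1 det_diag.
rewrite (eq_bigr (fun i => (e i)%:Z)) => [|i _]; last by rewrite mxE.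
by rewrite gez0_abs // prodr_ge0.
Qed.

Lemma smith_level N (Bl : 'M[int]_m) : Q *m Bl = N%:Z%:M -> forall i, (e i %| N)%N.
Proof.
rewrite QE -!mulmxA => h i.
have : diagZ e *m (B *m Bl *m A) = N%:Z%:M.
  have h2 : diagZ e *m (B *m Bl) = N%:Z *: invmx A by rewrite -[LHS](mulKmx uA) h mul_mx_scalar.
  by rewrite mulmxA h2 -scalemxAl mulVmx // scalemx1.
move=> /matrixP /(_ i i); rewrite diagZ_mul [X in _ = X -> _]mxE eqxx mulr1n => E.
by have : ((e i)%:Z %| N%:Z)%Z by rewrite -E dvdz_mulr.
Qed.

Section Mod.
Variables (n : nat).
Let c : int := n.+1%:Z.
Definition gg i := gcdn (e i) n.+1.
Definition ff i := (e i %/ gg i)%N.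

Lemma gg_gt0 i : (0 < gg i)%N. Proof. by rewrite gcdn_gt0 orbT. Qed.
Lemma gg_dvdc i : (gg i %| n.+1)%N. Proof. exact: dvdn_gcdr. Qed.
Lemma ff_gg i : (ff i * gg i)%N = e i. Proof. by rewrite divnK // dvdn_gcdl. Qed.
Lemma ff_gt0 i : (0 < ff i)%N. Proof. by rewrite divn_gt0 ?gg_gt0 // dvdn_leq // dvdn_gcdl. Qed.

(** Its columns span the lattice of vectors that pair to 0 modulo [c] with the whole radical. *)
Definition Lam : 'M[int]_m := B^T *m diagZ gg.

Lemma unit_dvd (U : 'M[int]_m) (x : 'cV[int]_m) : U \in unitmx ->
  (forall i, (c %| (U *m x) i 0%R)%Z) <-> (forall i, (c %| x i 0%R)%Z).
Proof.
have dv (W : 'M[int]_m) (y : 'cV[int]_m) : (forall i, (c %| y i 0%R)%Z) -> forall i, (c %| (W *m y) i 0%R)%Z.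
  by move=> h i; rewrite mxE; apply: rpred_sum => j _; rewrite dvdz_mull.
by move=> uU; split=> [h|]; [rewrite -[x](mulKmx uU)|]; exact: dv.
Qed.

(** After unimodular changes on both sides the condition is $c \mid e_i x_i$ in each coordinate,
    with $\gcd(e_i, c)$ solutions. *)
Lemma Rad_card : #|Rad n Q| = (\prod_i gg i)%N.
Proof.
pose F (x : 'cV[int]_m) : nat := [forall i, (c %| (e i)%:Z * x i 0%R)%Z].
have pF : @cper n m _ F.
  move=> x k; congr (nat_of_bool _); apply: eq_forallb => i; rewrite !mxE mulrDr.
  by rewrite rpredDr // mulrCA dvdz_mulr.
have -> : #|Rad n Q| = (\sum_(t : 'cV['I_n.+1]_m) F (B *m lft t))%N.
  rewrite -sum1_card big_mkcond /=; apply: eq_bigr => t _; rewrite inE /F.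
  congr (nat_of_bool _); have -> : Q *m lft t = A *m (diagZ e *m (B *m lft t)) by rewrite QE !mulmxA.
  apply/forallP/forallP => h.
    by move=> i; have := (unit_dvd (diagZ e *m (B *m lft t)) uA).1 h i; rewrite diagZ_mul.
  by apply/(unit_dvd _ uA) => i; rewrite diagZ_mul; exact: h.
have uw : B *m invmx B = 1%:M by rewrite mulmxV.
have wu : invmx B *m B = 1%:M by rewrite mulVmx.
rewrite (sum_mulmx (W := invmx B) pF); last 2 first.
- by rewrite uw; exact: mcong_refl.
- by rewrite wu; exact: mcong_refl.
have -> : (\sum_(r : 'cV['I_n.+1]_m) F (lft r) = \sum_(f : {ffun 'I_m -> 'I_n.+1}) \prod_i (n.+1 %| e i * f i)%N)%N.
  rewrite (reindex (fun f : {ffun 'I_m -> 'I_n.+1} => \col_i f i)) /=; last first.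
    exists (fun r : 'cV_m => [ffun i => r i 0%R]) => r _; first by apply/ffunP => i; rewrite ffunE mxE.
    by apply/matrixP => i j; rewrite mxE ffunE ord1.
  apply: eq_bigr => f _; rewrite /F.
  have E i : (c %| (e i)%:Z * lft (\col_i0 f i0) i 0%R)%Z = (n.+1 %| e i * f i)%N.
    by rewrite !mxE -PoszM.
  case: forallP => h.
    by rewrite big1 // => i _; rewrite -E h.
  case: (pickP (fun i => ~~ (n.+1 %| e i * f i)%N)) => [i /negbTE hi|ha].
    by rewrite (bigD1 i) //= hi.
  by case: h => i; rewrite E; have := ha i => /negbFE.
rewrite -(bigA_distr_bigA (fun i (k : 'I_n.+1) => nat_of_bool (n.+1 %| e i * k)%N)) /=; apply: eq_bigr => i _.
rewrite /gg -(count_dvd_mul n (e0 i)) -sum1_card [RHS]big_mkcond /=; apply: eq_bigr => k _.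
by rewrite inE; case: (_ %| _)%N.
Qed.

(* [t = (c / g_i) B^-1 e_i] lies in the radical; pairing with it detects divisibility by [g_i] *)
Lemma Lam_of_dual (z : 'cV[int]_m) :
  (forall t : 'cV[int]_m, (forall i, (c %| (Q *m t) i 0%R)%Z) -> (c %| dotp t z)%Z) ->
  exists k, z = Lam *m k.
Proof.
move=> h; pose w := (invmx B)^T *m z.
have hw i : ((gg i)%:Z %| w i 0%R)%Z.
  pose t : 'cV[int]_m := (n.+1 %/ gg i)%N%:Z *: (invmx B *m delta_mx i 0).
  have ht : forall j, (c %| (Q *m t) j 0%R)%Z.
    move=> j; rewrite /t -scalemxAr QE -!mulmxA (mulmxA B) mulmxV // mul1mx.
    have -> : diagZ e *m delta_mx i 0 = (e i)%:Z *: (delta_mx i 0 : 'cV[int]_m).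
      by apply/matrixP => a b; rewrite diagZ_mul !mxE; case: eqP => [->|]; rewrite ?mulr0.
    rewrite -scalemxAr mxE [X in (_ %| _ * X)%Z]mxE mulrA dvdz_mulr // -PoszM -(ff_gg i) mulnCA.
    by rewrite divnK ?gg_dvdc // PoszM dvdz_mull.
  have := h t ht; rewrite /t dotpZl.
  have -> : dotp (invmx B *m delta_mx i 0) z = w i 0.
    rewrite /w /dotp trmx_mul trmx_delta -mulmxA -rowE mxE //.
  have -> : c = (n.+1 %/ gg i)%N%:Z * (gg i)%:Z by rewrite -PoszM divnK ?gg_dvdc.
  rewrite dvdz_mul2l //.
  by rewrite -lt0n divn_gt0 ?gg_gt0 // dvdn_leq ?gg_dvdc.
exists (\col_i (w i 0%R %/ (gg i)%:Z)%Z).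
have -> : Lam *m (\col_i (w i 0%R %/ (gg i)%:Z)%Z) = B^T *m w.
  rewrite /Lam -mulmxA; congr (_ *m _); apply/matrixP => i j.
  by rewrite diagZ_mul mxE ord1 mulrC divzK.
by rewrite /w mulmxA -trmx_mul mulVmx // trmx1 mul1mx.
Qed.

Lemma supp_coset (R : realType) a y y0 : Gs R n Q a y != 0 -> Gs R n Q a y0 != 0 ->
  exists k, y - y0 = Lam *m k.
Proof.
move=> h h0; apply: Lam_of_dual => t ht.
have := Gs_supp eQ ht h; have := Gs_supp eQ ht h0 => d0 d.
rewrite dotpDr -[- y0]scaleN1r dotpZr mulN1r.
by rewrite (_ : _ - _ = (a * qform Q t + dotp t y) - (a * qform Q t + dotp t y0)) ?rpredB //; ring.
Qed.

(** What keeps [y] out of the lattice is the term $a\,q(t)$; doubling replaces it by $a\,t^TQt$,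
    which [c] divides on the radical. This bounds [qs] from below on the support. *)
Lemma supp_double (R : realType) a y : Gs R n Q a y != 0 -> exists k, y *+ 2 = Lam *m k.
Proof.
move=> h; apply: Lam_of_dual => t ht.
have d := Gs_supp eQ ht h.
rewrite mulr2n dotpDr (_ : _ + _ = 2 * (a * qform Q t + dotp t y) - a * (qform Q t *+ 2)); last by ring.
apply: rpredB; first exact: dvdz_mull.
rewrite dvdz_mull // qform2i // qfE dotpE.
by apply: rpred_sum => i _; rewrite dvdz_mull.
Qed.

(** $\Lambda^T = \operatorname{diag}(g)B = \operatorname{diag}(1/f)A^{-1}Q$, so $Q^{-1}$ cancels and
    only the denominators $f_i$ remain. *)
Lemma gram_Lam (R : realType) : 0 < \det Q -> exists M : 'M[int]_m,
  map_mx (intr : int -> R) Lam^T *m invmx (map_mx intr Q) *m map_mx intr Lam =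
  diag_mx (\row_i (ff i)%:R^-1) *m map_mx intr M.
Proof.
move=> dQ; have uQ : map_mx (intr : int -> R) Q \in unitmx.
  by rewrite unitmxE det_map_mx unitfE intr_eq0 gt_eqF.
exists (invmx A *m Lam).
have E : diag_mx (\row_i (ff i)%:R^-1) *m map_mx intr (invmx A) *m map_mx intr Q = map_mx (intr : int -> R) Lam^T.
  have LT : Lam^T = diagZ gg *m B by rewrite /Lam trmx_mul trmxK /diagZ tr_diag_mx.
  rewrite -mulmxA -map_mxM QE -mulmxA mulKmx // LT.
  have ent (f : 'I_m -> nat) i j : map_mx (intr : int -> R) (diagZ f *m B) i j = (f i)%:R * (B i j)%:~R.
    by rewrite mxE diagZ_mul intrM.
  apply/matrixP => i j; rewrite mul_diag_mx mxE !ent mxE mulrA; congr (_ * _).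
  by rewrite -(ff_gg i) natrM mulrA mulVf ?mul1r // pnatr_eq0 -lt0n ff_gt0.
have E2 : map_mx (intr : int -> R) Lam^T *m invmx (map_mx intr Q) =
    diag_mx (\row_i (ff i)%:R^-1) *m map_mx intr (invmx A) by rewrite -E mulmxK.
by rewrite E2 -mulmxA -map_mxM.
Qed.

Lemma det_Lam : \det Lam != 0.
Proof.
rewrite /Lam det_mulmx det_tr mulf_neq0 //.
  by move: uB; rewrite unitmxE; apply: contraTneq => ->; rewrite unitr0.
rewrite /diagZ det_diag prodf_seq_neq0; apply/allP => i _; rewrite mxE /=.
by rewrite -lt0n gg_gt0.
Qed.
End Mod.
End SmithData.

Lemma smith_exists (m : nat) (Q : 'M[int]_m) : \det Q != 0 -> exists A B (e : 'I_m -> nat),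
  [/\ A \in unitmx, B \in unitmx, Q = A *m diagZ e *m B,
      (forall i, 0 < e i)%N & (forall i j : 'I_m, (i <= j)%N -> (e i %| e j)%N)].
Proof.
move=> d0; have [A uA [B uB [d sd E]]] := int_Smith_normal_form Q.
(* The signs of the invariant factors are moved into the left unimodular factor. *)
pose sg : 'rV[int]_m := \row_i (if 0 <= d`_i then 1 else -1).
have sgu : diag_mx sg \in unitmx.
  rewrite unitmxE det_diag; apply: rpred_prod => i _; rewrite mxE; case: ifP => _; [exact: unitr1|exact: unitrN1].
exists (A *m diag_mx sg), B, (fun i : 'I_m => absz (d`_i)).
have DE : \matrix_(i < m, j < m) (d`_i *+ (i == j :> nat)) = diag_mx sg *m diagZ (fun i : 'I_m => absz (d`_i)).
  apply/matrixP => i j; rewrite mul_diag_mx !mxE; rewrite -val_eqE /=; case: eqP => // _; rewrite ?mulr0 // !mulr1n.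
  case: ifP => h; first by rewrite mul1r gez0_abs.
  by rewrite mulN1r ltz0_abs ?opprK // ltNge h.
have QE : Q = A *m diag_mx sg *m diagZ (fun i : 'I_m => absz (d`_i)) *m B by rewrite E DE !mulmxA.
split=> //; first by rewrite unitmx_mul uA.
- move=> i; rewrite lt0n; apply: contra d0 => /eqP h.
  rewrite QE !det_mulmx /diagZ [in X in _ * X * _]det_diag (bigD1 i) //= mxE h mul0r mulr0 mul0r //.
move=> i j ij; have hs : (j < size d)%N.
  rewrite ltnNge; apply: contra d0 => h.
  by rewrite QE !det_mulmx /diagZ [in X in _ * X * _]det_diag (bigD1 j) //= mxE nth_default // mul0r mulr0 mul0r.
have : (d`_i %| d`_j)%Z.
  have tr : transitive dvdz by move=> a b c; exact: dvdz_trans.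
  apply: (sorted_leq_nth tr (fun x => dvdzz x) 0 sd) => //; rewrite inE //.
  exact: leq_ltn_trans ij hs.
by [].
Qed.

(** * Theta series at the cusps *)

Section ThetaTransform.
Variables (R : realType) (m : nat).
Local Open Scope complex_scope.
Local Notation cR := (map_mx (intr : int -> R)).
Implicit Types (Q S : 'M[int]_m).

Lemma theta_tsum Q (z : R[i]) : theta Q z = tsum (fun x : 'cV[int]_m => ee ((qform Q x)%:~R * z)).
Proof. by rewrite tsum.unlock ee.unlock. Qed.

Definition qs Q (y : 'cV[int]_m) : R := qf (invmx (cR Q)) (cR y) / 2.

(** The theta series of the dual form with Gauss sums as coefficients: the shape of [theta] at the
    cusp [a / n.+1], up to elementary factors. *)
Definition Th n Q a (w : R[i]) : R[i] :=
  tsum (fun y : 'cV[int]_m => Gs R n Q a y * ee ((qs Q y)%:C * w)).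

Definition Phi (F : R[i] -> R[i]) (z : R[i]) : R := cabs (F z) ^+ 2 * complex.Im z `^ (m%:R / 2).

Definition actf (a b c d : int) (w : R[i]) : R[i] := (a%:~R * w + b%:~R) / (c%:~R * w + d%:~R).

Lemma evpd_unit Q : even_posdef R Q -> cR Q \in unitmx.
Proof. by move=> /evpd_pdef/det_gt0 h; rewrite unitmxE unitfE gt_eqF. Qed.

Lemma evpd_inv Q : even_posdef R Q -> pdef (invmx (cR Q)).
Proof. by move=> eQ; apply: (pdef_inv (evpd_pdef eQ)); rewrite mulmxV // evpd_unit. Qed.

Lemma cabs_ee_qs Q y (w : R[i]) : cabs (ee ((qs Q y)%:C * w)) = expR (- (2 * pi * qs Q y * complex.Im w)).
Proof. by rewrite cabs_ee; congr expR; case: w => u v /=; ring. Qed.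

Lemma asum_qs Q k : even_posdef R Q -> 0 < k ->
  exists M, asum (fun y => expR (- (k * qs Q y))) M.
Proof.
move=> eQ k0; have k2 : 0 < k / 2 by rewrite divr_gt0.
exists (\prod_(d <- ldl (invmx (cR Q))) gbound (k / 2) d).
have := asum_gauss 0 (evpd_inv eQ) k2; have -> // : (fun x : 'cV[int]_m => expR (- (k / 2 * qf (invmx (cR Q)) (cR x + 0)))) =
  (fun y => expR (- (k * qs Q y))).
by apply/funext => y; rewrite addr0 /qs; congr expR; field.
Qed.

Lemma summ_Th n Q a (w : R[i]) : even_posdef R Q -> coprimez a n.+1%:Z -> 0 < complex.Im w ->
  summ (fun y : 'cV[int]_m => Gs R n Q a y * ee ((qs Q y)%:C * w)).
Proof.
move=> eQ ca w0; have k0 : 0 < 2 * pi * complex.Im w by rewrite !mulr_gt0 ?pi_gt0.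
have [M hM] := asum_qs eQ k0.
pose K := 1 + (n.+1 ^ m)%:R * #|Rad n Q|%:R : R.
have K0 : 0 <= K by rewrite addr_ge0 // mulr_ge0.
apply: (summ_le _ (asumZ K0 hM)) => y.
rewrite cabsM cabs_ee_qs; apply: ler_pM; rewrite ?cabs_ge0 ?expR_ge0 //; last first.
  by rewrite [X in expR (- X)](_ : _ = 2 * pi * complex.Im w * qs Q y) //; ring.
have := Gs_bound R y (evpd_evsym eQ) ca; rewrite -/K => h.
have : cabs (Gs R n Q a y) <= 1 + cabs (Gs R n Q a y) ^+ 2 by nra.
move=> /le_trans; apply; by rewrite lerD2l.
Qed.

Lemma summ_theta Q (z : R[i]) : even_posdef R Q -> 0 < complex.Im z ->
  summ (fun x : 'cV[int]_m => ee ((qform Q x)%:~R * z)).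
Proof.
move=> eQ z0; have k0 : 0 < pi * complex.Im z by rewrite mulr_gt0 ?pi_gt0.
exists (\prod_(d <- ldl (cR Q)) gbound (pi * complex.Im z) d).
have := asum_gauss 0 (evpd_pdef eQ) k0.
have -> // : (fun x : 'cV[int]_m => expR (- (pi * complex.Im z * qf (cR Q) (cR x + 0)))) =
  (fun x => cabs (ee ((qform Q x)%:~R * z))).
apply/funext => x; rewrite addr0 qf_cast -(qform2i _ (evpd_evsym eQ)) cabs_ee.
have -> : ((qform Q x)%:~R : R[i]) = ((qform Q x)%:~R : R)%:C by rewrite rmorph_int.
by congr expR; rewrite rmorphMn /= mulr2n; case: z {z0 k0} => u v /=; ring.
Qed.

Definition resp n (p : 'cV['I_n.+1]_m * 'cV[int]_m) : 'cV[int]_m := lft p.1 + n.+1%:Z *: p.2.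
Definition resi n (x : 'cV[int]_m) : 'cV['I_n.+1]_m * 'cV[int]_m :=
  (red n x, \col_i ((x - lft (red n x)) i 0%R %/ n.+1%:Z)%Z).

Lemma respK n : cancel (@resp n) (@resi n).
Proof.
case=> r x; rewrite /resi /resp /= redD red_lft; congr (_, _); apply/matrixP => i j.
by rewrite addrC addKr !mxE ord1 mulKz.
Qed.

Lemma resiK n : cancel (@resi n) (@resp n).
Proof.
move=> x; rewrite /resi /resp /=; have [k hk] := lft_red n x.
have E1 : x - lft (red n x) = n.+1%:Z *: - k by rewrite hk opprD addrA subrr add0r scalerN.
have -> : \col_i ((x - lft (red n x)) i 0%R %/ n.+1%:Z)%Z = - k.
  by apply/matrixP => i j; rewrite E1 mxE mxE mulKz // ord1.
by rewrite scalerN hk addrK.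
Qed.

Lemma Im_addint (w : R[i]) (x : R) : complex.Im (w + x%:C) = complex.Im w.
Proof. by case: w => u v /=; rewrite addr0. Qed.

Lemma Re_iinv (w : R[i]) : 0 < complex.Im w -> 0 < complex.Re ('i / w).
Proof.
move=> w0; have wn : w != 0 by apply/eqP => E; move: w0; rewrite E ltxx.
have c0 := cabs_gt0 wn.
have -> : 'i / w = ((cabs w ^+ 2)^-1)%:C * ('i * conjc w).
  rewrite cabs_sqr; move: w0; case: w wn {c0} => u v /= _ v0.
  have h : u ^+ 2 + v ^+ 2 != 0 by rewrite gt_eqF // ltr_wpDl ?sqr_ge0 // exprn_gt0.
  by apply/eqP; rewrite eq_complex /=; apply/andP; split; apply/eqP; field.
move: w0; case: w wn c0 => u v /= n' c0 v0; rewrite !(mul0r, mulr0, mul1r, mulr1, subr0, add0r, sub0r, opprK, addr0).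
by rewrite mulr_gt0 // invr_gt0 exprn_gt0.
Qed.

Section Act.
Variables (n : nat) (a b d : int) (w : R[i]).
Hypothesis det1 : a * d - b * n.+1%:Z = 1.
Hypothesis w0 : 0 < complex.Im w.
Let w' := w + (d%:~R / n.+1%:R)%:C.

Lemma Im_shift_gt0 : 0 < complex.Im w'. Proof. by rewrite /w' Im_addint. Qed.
Lemma shift_neq0 : w' != 0. Proof. by apply/eqP => E; move: Im_shift_gt0; rewrite E ltxx. Qed.

Lemma actfE : actf a b n.+1 d w = (a%:~R / n.+1%:R) - (n.+1%:R ^+ 2 * w')^-1.
Proof.
have w'n := shift_neq0.
have [C [C0 CE]] : exists C : R[i], C != 0 /\ n.+1%:R = C by exists n.+1%:R; rewrite pnatr_eq0.
have w'E : w' = w + d%:~R / C by rewrite /w' rmorphM /= fmorphV rmorph_nat rmorph_int CE.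
have h : a%:~R * d%:~R - b%:~R * C = 1 :> R[i].
  by rewrite -CE -[n.+1%:R]/((n.+1%:Z)%:~R) -!intrM -intrB det1.
rewrite /actf -[(Posz n.+1)%:~R]/(n.+1%:R) CE.
have cw : C * w + d%:~R = C * w' by rewrite w'E; field.
rewrite cw; have E : a%:~R * w + b%:~R = a%:~R * w' - C^-1 :> R[i].
  by apply: (mulfI C0); rewrite [RHS]mulrBr mulfV // -[X in _ = _ - X]h w'E; field.
by rewrite E; move: w'n; move: (w') => W Wn; field; rewrite C0 Wn.
Qed.

Lemma Im_actf : complex.Im (actf a b n.+1 d w) = complex.Im w / (n.+1%:R * cabs w') ^+ 2.
Proof.
rewrite -(Im_addint w (d%:~R / n.+1%:R)) -/w' actfE exprMn cabs_sqr.
have nR : n.+1%:R != 0 :> R by rewrite pnatr_eq0.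
have -> : a%:~R / n.+1%:R = (a%:~R / n.+1%:R : R)%:C :> R[i] by rewrite rmorphM /= fmorphV rmorph_nat rmorph_int.
have -> : n.+1%:R = (n.+1%:R : R)%:C :> R[i] by rewrite rmorph_nat.
have := Im_shift_gt0; have := shift_neq0; move: (w') => W; case: W => u v w'n v0'; have v0 : 0 < v := v0'.
have h : u ^+ 2 + v ^+ 2 != 0 by rewrite gt_eqF // ltr_wpDl ?sqr_ge0 // exprn_gt0.
move: nR; move: (n.+1%:R : R) => c nR.
have -> : (c%:C ^+ 2 * (u +i* v))^-1 = (u / (c ^+ 2 * (u ^+ 2 + v ^+ 2))) +i* (- v / (c ^+ 2 * (u ^+ 2 + v ^+ 2))).
  apply: (mulfI (x := c%:C ^+ 2 * (u +i* v))); first by rewrite mulf_neq0 // expf_neq0 // fmorph_eq0.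
  rewrite mulfV; last by rewrite mulf_neq0 // expf_neq0 // fmorph_eq0.
  by rewrite -rmorphXn /=; apply/eqP; rewrite eq_complex /=; apply/andP; split; apply/eqP; field; rewrite nR h.
by rewrite /=; field; rewrite nR h.
Qed.

Lemma Im_actf_gt0 : 0 < complex.Im (actf a b n.+1 d w).
Proof. by rewrite Im_actf divr_gt0 // exprn_gt0 // mulr_gt0 ?ltr0n // cabs_gt0 // shift_neq0. Qed.
End Act.

(** The vectors are sorted by their class [r] modulo [c]. On each class $a\,q(x)/c$ is constant
    modulo 1, which leaves a Gaussian with parameter [t = 'i / w'] and rational shift [r / c], ready
    for [poissonM]. Collecting the classes produces the Gauss sums. *)
Lemma theta_transform Q n (a b d : int) (w : R[i]) : even_posdef R Q -> a * d - b * n.+1%:Z = 1 -> 0 < complex.Im w ->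
  let w' := w + (d%:~R / n.+1%:R)%:C in
  theta Q (actf a b n.+1 d w) =
    Apo ('i / w') ^+ m * (Num.sqrt (\det (cR Q)))^-1%:C * Th n Q a w'.
Proof.
move=> eQ det1 w0 w'.
have w'0 := Im_shift_gt0 n d w0; have w'n := shift_neq0 n d w0; rewrite -/w' in w'0 w'n.
have t0 := Re_iinv w'0.
have gwE := actfE det1 w0; rewrite -/w' in gwE.
have Imgw := Im_actf_gt0 det1 w0.
have n0 : n.+1%:R != 0 :> R[i] by rewrite pnatr_eq0.
have [C [C0 CE]] : exists C : R[i], C != 0 /\ n.+1%:R = C by exists n.+1%:R; rewrite pnatr_eq0.
have [c [c0 ce]] : exists c : R, c != 0 /\ n.+1%:R = c by exists n.+1%:R; rewrite pnatr_eq0.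
have uQ := evpd_unit eQ.
have QQ : cR Q *m invmx (cR Q) = 1%:M by rewrite mulmxV.
pose t := 'i / w'.
pose A := Apo t ^+ m * (Num.sqrt (\det (cR Q)))^-1%:C.
pose rr (r : 'cV['I_n.+1]_m) : 'cV[R]_m := n.+1%:R^-1 *: cR (lft r).
have sT := summ_theta eQ Imgw.
rewrite theta_tsum (tsum_bij (@respK n) (@resiK n)) // -[LHS]/(tsum _).
rewrite tsum_finprod; last exact: (summ_inj (can_inj (@respK n)) sT).
have termE r x : ee ((qform Q (resp (r, x)))%:~R * actf a b n.+1 d w) =
   ec R n (a * qform Q (lft r)) * gterm t (cR Q) (cR x + rr r) 0.
  rewrite gwE mulrBr eeD; congr (_ * _).
    rewrite /ec -[LHS]/(ee _); have [l hl] := qform_c n (lft r) x (evpd_evsym eQ).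
    rewrite /resp /= hl.
    have -> : (qform Q (lft r) + n.+1%:Z * l)%:~R * (a%:~R / n.+1%:R) =
      ((a * qform Q (lft r))%:~R / n.+1%:R : R)%:C + (l * a)%:~R :> R[i].
      rewrite rmorphM /= fmorphV rmorph_nat rmorph_int intrD !intrM -[(n.+1%:Z)%:~R]/(n.+1%:R) CE; field; exact: C0.
    by rewrite ee_addint.
  rewrite /gterm [dotp _ _]dotpC /dotp mulmx0 mxE ee0 mulr1 eeE; congr cexp.
  have E : qf (cR Q) (cR x + rr r) = 2 * (qform Q (resp (r, x)))%:~R / n.+1%:R ^+ 2.
    have nR : n.+1%:R != 0 :> R by rewrite pnatr_eq0.
    have -> : cR x + rr r = n.+1%:R^-1 *: cR (resp (r, x)).
      have mz : cR (n.+1%:Z *: x) = n.+1%:R *: cR x by apply/matrixP => i j; rewrite !mxE intrM.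
      by rewrite /resp /= map_mxD mz scalerDr scalerA mulVf // scale1r addrC.
    by rewrite qfE -scalemxAr dotpZl dotpZr -qfE qf_cast -(qform2i _ (evpd_evsym eQ)) rmorphMn /= ce; field; exact: c0.
  rewrite E /t; set q := qform Q _.
  rewrite !(rmorphM, fmorphV, rmorphXn, rmorph_nat, rmorph_int) /= CE; move: w'n; move: (w') => W Wn; field; by rewrite C0 Wn.
transitivity (\sum_(r : 'cV['I_n.+1]_m) ec R n (a * qform Q (lft r)) *
   (A * tsum (fun y : 'cV[int]_m => dterm t (invmx (cR Q)) (cR y) (rr r) 0))).
  apply: eq_bigr => r _.
  have rq : ratm (cR Q) by move=> i j; rewrite mxE; exact: ratl_int.
  have rrr : ratm (rr r).
    by move=> i j; rewrite !mxE; apply: ratlM; [apply: ratlV; exact: (ratl_int R n.+1)|exact: ratl_int].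
  rewrite -(poissonM 0 (evpd_pdef eQ) rq QQ t0 rrr) -tsumZ; last exact: summ_gterm (evpd_pdef eQ) t0.
  by apply: tsum_eq => x; rewrite -termE.
have dtE r y : dterm t (invmx (cR Q)) (cR y) (rr r) 0 = ee ((qs Q y)%:C * w') * ec R n (dotp (lft r) y).
  rewrite /dterm subr0 [ee (_ * w')]eeE; congr (cexp _ * ee _).
    rewrite /qs /t !rmorphM /= fmorphV !rmorph_nat.
    have i2 : 'i * 'i = -1 :> R[i] by rewrite -expr2 sqr_i.
    have i0 : 'i != 0 :> R[i] by rewrite neq0Ci.
    have ii : 'i / w' != 0 by rewrite mulf_neq0 // invr_eq0.
    move: (qf _ _)%:C => q; move: w'n i0; move: (w') => W Wn i0.
    rewrite invf_div -[LHS]mulr1; have {1}-> : 1 = - ('i * 'i) :> R[i] by rewrite i2 opprK.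
    by field; rewrite i0.
  rewrite /ec -dotp_cast [dotp (cR (lft r)) _]dotpC /rr dotpZr mulrC //.
have eaq r : ec R n (a * qform Q (lft r)) * ec R n (dotp (lft r) 0) = ec R n (a * qform Q (lft r)).
  by rewrite /dotp mulmx0 mxE ec0 mulr1.
have sd r : summ (fun y : 'cV[int]_m => dterm t (invmx (cR Q)) (cR y) (rr r) 0).
  exact: summ_dterm (evpd_inv eQ) t0.
rewrite /Th /A -!/A.
transitivity (A * \sum_(r : 'cV['I_n.+1]_m) tsum (fun y : 'cV[int]_m => ec R n (a * qform Q (lft r)) * dterm t (invmx (cR Q)) (cR y) (rr r) 0)).
  by rewrite mulr_sumr; apply: eq_bigr => r _; rewrite tsumZ // mulrCA.
congr (_ * _); rewrite -(tsum_sum _ _).2; last by move=> r; apply: summZ.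
apply: tsum_eq => y; rewrite /Gs mulr_suml; apply: eq_bigr => r _.
by rewrite dtE ecD mulrA mulrAC.
Qed.

Lemma cabs_Apo (w : R[i]) : 0 < complex.Im w -> cabs (Apo ('i / w)) ^+ 2 = cabs w.
Proof.
move=> w0; have t0 := Re_iinv w0; have wn : w != 0 by apply/eqP => E; move: w0; rewrite E ltxx.
have c0 := cabs_gt0 wn.
have := pois_abs t0 (ApoP t0); rewrite cabsM cabs_i mul1r cabsV => h.
by apply: (mulIf (x := (cabs w)^-1)); rewrite ?invr_eq0 ?gt_eqF // h mulfV // gt_eqF.
Qed.

End ThetaTransform.

Lemma det2 (g : 'M[int]_2) : \det g = g 0 0 * g 1 1 - g 0 1 * g 1 0.
Proof.
rewrite (expand_det_row _ 0) big_ord_recl big_ord1 /cofactor !det_mx11 !mxE /= expr0 expr1 mul1r mulN1r mulrN.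
have -> : lift ord0 ord0 = 1 :> 'I_2 by apply: val_inj.
by have -> : lift 1 ord0 = 0 :> 'I_2 by apply: val_inj.
Qed.

Section Inv.
Variables (R : realType) (m : nat).
Local Open Scope complex_scope.
Local Notation cR := (map_mx (intr : int -> R)).
Implicit Types (Q S : 'M[int]_m).

Lemma powR_sqr_half (u : R) : 0 <= u -> (u ^+ 2) `^ (m%:R / 2) = u ^+ m.
Proof.
by move=> u0; rewrite -powR_mulrn // -powRrM -[RHS]powR_mulrn //; congr (_ `^ _); field.
Qed.

(** The factor $|w'|^m$ from the Poisson constant cancels the one in $\operatorname{Im}^{m/2}$, so
    no factor of automorphy is left. *)
Lemma Phi_transform Q S n (a b d : int) (w : R[i]) : even_posdef R Q -> even_posdef R S -> \det S = \det Q ->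
  a * d - b * n.+1%:Z = 1 -> 0 < complex.Im w ->
  let w' := w + (d%:~R / n.+1%:R)%:C in
  Phi m (fun z => theta Q z - theta S z) (actf a b n.+1 d w) =
  (\det Q)%:~R^-1 / n.+1%:R ^+ m * complex.Im w `^ (m%:R / 2) * cabs (Th n Q a w' - Th n S a w') ^+ 2.
Proof.
move=> eQ eS dd det1 w0 w'; have w'0 := Im_shift_gt0 n d w0; have w'n := shift_neq0 n d w0; rewrite -/w' in w'0 w'n.
rewrite /Phi (theta_transform eQ det1 w0) (theta_transform eS det1 w0) -/w' !det_map_mx dd -mulrBr /=.
rewrite (Im_actf det1 w0) -/w'; set T := _ - _.
have dQ : 0 < (\det Q)%:~R :> R by rewrite ltr0z (evpd_det eQ).
have cw := cabs_gt0 w'n.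
rewrite !cabsM cabsX cabs_real !exprMn -exprM mulnC exprM cabs_Apo // real_normK ?num_real // exprVn sqr_sqrtr ?(ltW dQ) //.
have nR : 0 < n.+1%:R :> R by rewrite ltr0n.
rewrite powRM ?(ltW w0) ?invr_ge0 ?exprn_ge0 ?mulr_ge0 ?(ltW nR) ?(ltW cw) //.
have -> : (n.+1%:R ^+ 2 * cabs w' ^+ 2)^-1 `^ (m%:R / 2) = (n.+1%:R ^+ m * cabs w' ^+ m)^-1.
  rewrite -exprMn -exprVn powR_sqr_half ?invr_ge0 ?mulr_ge0 ?(ltW nR) ?(ltW cw) //.
  by rewrite exprVn exprMn.
move: (n.+1%:R : R) nR => c c0.
have c1 : c ^+ m != 0 by rewrite expf_neq0 // gt_eqF.
have c2 : cabs w' ^+ m != 0 by rewrite expf_neq0 // gt_eqF.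
move: (c ^+ m) c1 (cabs w' ^+ m) c2 => x x0 y y0.
by field; rewrite x0 y0 gt_eqF.
Qed.

Lemma qs_Q Q x : even_posdef R Q -> qs R Q (Q *m x) = (qform Q x)%:~R.
Proof.
move=> eQ; have uQ := evpd_unit eQ; rewrite /qs qfE map_mxM mulmxA mulVmx // mul1mx dotpC -qfE qf_cast.
by rewrite -(qform2i _ (evpd_evsym eQ)) rmorphMn /=; field.
Qed.

(** When $N \mid c$, the vectors $(c/N)Bs$ lie in the radical and [qform] is 0 modulo [c] on them;
    [Gs_supp] then gives $N \mid s^TBy$ for every [s]. *)
Lemma level_support Q N B n a y : evsym Q -> evsym B -> Q *m B = N%:Z%:M -> B *m Q = N%:Z%:M -> (0 < N)%N ->
  (N %| n.+1)%N -> Gs R n Q a y != 0 -> exists x, y = Q *m x.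
Proof.
move=> eQ eB QB BQ N0 Nn g0.
have qt (s : 'cV[int]_m) : let t := (n.+1 %/ N)%N%:Z *: (B *m s) in
   (forall i, (n.+1%:Z %| (Q *m t) i 0%R)%Z) /\ (n.+1%:Z %| qform Q t)%Z.
  move=> t; have Qt : Q *m t = n.+1%:Z *: s.
    rewrite /t -scalemxAr mulmxA QB mul_scalar_mx scalerA -PoszM divnK //.
  split; first by move=> i; rewrite Qt mxE dvdz_mulr.
  have tf : qform Q t *+ 2 = ((n.+1 %/ N)%N%:Z * n.+1%:Z * qform B s) *+ 2.
    rewrite qform2i // qfE Qt dotpZr /t dotpZl -mulrnAr qform2i // qfE dotpC; ring.
  by rewrite (tf2I tf2_int tf) mulrAC dvdz_mull.
have dv (s : 'cV[int]_m) : (N%:Z %| dotp s (B *m y))%Z.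
  have [h1 h2] := qt s; have := Gs_supp eQ h1 g0; rewrite rpredDl ?dvdz_mull //.
  have nE : n.+1%:Z = (n.+1 %/ N)%N%:Z * N%:Z by rewrite -PoszM divnK.
  rewrite dotpZl [X in (X %| _)%Z]nE dvdz_mul2l; last by rewrite -lt0n divn_gt0 // dvdn_leq.
  by rewrite dotp_mul eB.1.
exists (\col_i ((B *m y) i 0%R %/ N%:Z)%Z); apply: (@int_mx_scaleI _ _ N%:Z); first by rewrite -lt0n.
have -> : N%:Z *: y = Q *m (B *m y) by rewrite mulmxA QB mul_scalar_mx.
rewrite scalemxAr; congr (_ *m _); move: (B *m y) dv => v dv; apply/matrixP => i j; rewrite !mxE !ord1.
have := dv (delta_mx i 0); rewrite /dotp trmx_delta -rowE mxE => h.
by rewrite mulrC divzK.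
Qed.

Lemma mulQ_inj Q : even_posdef R Q -> injective (fun x : 'cV[int]_m => Q *m x).
Proof.
move=> eQ x y h; have d0 : \det Q != 0 by rewrite gt_eqF // (evpd_det eQ).
apply: (int_mx_scaleI d0); have := congr1 (mulmx (\adj Q)) h.
by rewrite !mulmxA mul_adj_mx !mul_scalar_mx.
Qed.

Lemma Th_level Q N B n a d (w : R[i]) : even_posdef R Q -> evsym B -> Q *m B = N%:Z%:M -> B *m Q = N%:Z%:M -> (0 < N)%N ->
  (N %| n.+1)%N -> (n.+1%:Z %| a * d - 1)%Z -> 0 < complex.Im w ->
  Th n Q a (w + (d%:~R / n.+1%:R)%:C) = Gs R n Q a 0 * theta Q w.
Proof.
move=> eQ eB QB BQ N0 Nn ad w0; have eQ' := evpd_evsym eQ.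
have ca : coprimez a n.+1%:Z.
  apply/coprimezP; have /dvdzP[k hk] := ad; exists (d, - k) => /=.
  by rewrite mulNr -hk mulrC; ring.
have w'0 := Im_shift_gt0 n d w0.
rewrite /Th (tsum_inj (mulQ_inj eQ)); last exact: summ_Th.
  rewrite theta_tsum -tsumZ; last exact: summ_theta.
  apply: tsum_eq => x /=; rewrite (Gs_Q R x eQ' ad) qs_Q // [_%:C * (w + _)]mulrDr eeD rmorph_int.
  have -> : ee ((qform Q x)%:~R * (d%:~R / n.+1%:R)%:C) = ec R n (d * qform Q x).
    rewrite /ec; congr ee; rewrite !rmorphM /= !rmorph_int; ring.
  rewrite ecN; set E := ec R n _; have E0 : E != 0 by exact: ec_neq0.
  by rewrite mulrACA [X in _ * X]mulrC mulrA -[RHS]mul1r -(mulVf E0); ring.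
move=> y hy; have [->|g0] := eqVneq (Gs R n Q a y) 0; first by rewrite mul0r.
by have [x hx] := level_support eQ' eB QB BQ N0 Nn g0; case: (hy x); rewrite hx.
Qed.

(** Here [qform] is 0 modulo [c] on the whole radical, so every term of [Gs_sqr] is 1, and the
    radical has $\prod e_i = \det Q$ elements since each $e_i$ divides [c]. *)
Lemma Gs0_level Q N B n a : even_posdef R Q -> evsym B -> Q *m B = N%:Z%:M -> B *m Q = N%:Z%:M -> (0 < N)%N ->
  (N %| n.+1)%N -> coprimez a n.+1%:Z ->
  cabs (Gs R n Q a 0) ^+ 2 = n.+1%:R ^+ m * (\det Q)%:~R.
Proof.
move=> eQ eB QB BQ N0 Nn ca; have eQ' := evpd_evsym eQ; have dQ := evpd_det eQ.
have := Gs_sqr R 0 eQ' ca; rewrite (eq_bigr (fun=> 1)); last first.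
  move=> t; rewrite inE => /forallP ht; rewrite -(ec0 R n); apply: ec_dvd; rewrite subr0 rpredD //; last first.
    by rewrite /dotp mulmx0 mxE dvdz0.
  rewrite dvdz_mull //.
  have [s hs] : exists s, Q *m lft t = n.+1%:Z *: s.
    exists (\col_i ((Q *m lft t) i 0%R %/ n.+1%:Z)%Z); apply/matrixP => i j.
    by rewrite [RHS]mxE [X in _ = _ * X]mxE mulrC divzK ?ord1.
  have tE : N%:Z *: lft t = n.+1%:Z *: (B *m s) by rewrite -mul_scalar_mx -BQ -mulmxA hs scalemxAr.
  have tE2 : lft t = (n.+1 %/ N)%N%:Z *: (B *m s).
    apply: (@int_mx_scaleI _ _ N%:Z); first by rewrite -lt0n.
    by rewrite tE scalerA -PoszM mulnC divnK.
  have tf : qform Q (lft t) *+ 2 = ((n.+1 %/ N)%N%:Z * n.+1%:Z * qform B s) *+ 2.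
    rewrite qform2i // qfE hs dotpZr tE2 dotpZl -mulrnAr qform2i // qfE dotpC; ring.
  by rewrite (tf2I tf2_int tf) mulrAC dvdz_mull.
rewrite sumr_const => h.
have d0 : \det Q != 0 by rewrite gt_eqF.
have [A [Bm [e [uA uB QE e0 ch]]]] := smith_exists d0.
have Rc : #|Rad n Q|%:R = (\det Q)%:~R :> R.
  rewrite (Rad_card uA uB QE e0) (smith_det uA uB QE dQ) natr_prod rmorph_prod /=; apply: eq_bigr => i _.
  rewrite /gg; have /gcdn_idPl -> // : (e i %| n.+1)%N.
  exact: dvdn_trans (smith_level uA QE QB i) Nn.
apply: (@complexI R); rewrite h -Rc natrX.
by rewrite rmorphM /= rmorphXn /= !rmorph_nat.
Qed.

Lemma theta_addint Q (w : R[i]) (b : int) : theta Q (w + b%:~R) = theta Q w.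
Proof.
rewrite !theta_tsum; apply: tsum_eq => x; rewrite mulrDr -intrM ee_addint //.
Qed.

Lemma Im_int (w : R[i]) (b : int) : complex.Im (w + b%:~R) = complex.Im w.
Proof. by rewrite -(rmorph_int (@real_complex R)) Im_addint. Qed.

Lemma moebius_actf (g : 'M[int]_2) (z : R[i]) : moebius g z = actf (g 0 0) (g 0 1) (g 1 0) (g 1 1) z.
Proof. by []. Qed.

Lemma actfN (a b c d : int) (z : R[i]) : actf (- a) (- b) (- c) (- d) z = actf a b c d z.
Proof.
rewrite /actf; have E (x y : int) : (- x)%:~R * z + (- y)%:~R = - (x%:~R * z + y%:~R) :> R[i].
  by rewrite !intrN; ring.
by rewrite !E invrN mulrNN.
Qed.

Section Pair.
Variables (Q S : 'M[int]_m) (N : nat).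
Hypothesis eQ : even_posdef R Q.
Hypothesis gS : genus R Q S.
Hypothesis lQ : level_multiple Q N.
Hypothesis N0 : (0 < N)%N.
Let F := fun z : R[i] => theta Q z - theta S z.

(** The dual series collapses to $G(0)\theta$, with the same $G(0)$ for both forms; $|G(0)|^2 =
    c^m\det Q$ cancels the prefactor of [Phi_transform], so the character never appears. *)
Lemma Phi_inv_pos n (a b d : int) (w : R[i]) : (N %| n.+1)%N -> a * d - b * n.+1%:Z = 1 -> 0 < complex.Im w ->
  Phi m F (actf a b n.+1 d w) = Phi m F w.
Proof.
move=> Nn det1 w0; have eS : even_posdef R S by case: gS.
have dd := genus_det eQ gS; have lS := genus_level eQ gS lQ.
have dQ := evpd_det eQ; have dS := evpd_det eS.
have dQ0 : \det Q != 0 by rewrite gt_eqF. have dS0 : \det S != 0 by rewrite gt_eqF.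
have [B [eB QB BQ]] := level_inverse dQ0 (evpd_evsym eQ).1 lQ.
have [B' [eB' SB BS]] := level_inverse dS0 (evpd_evsym eS).1 lS.
have ad : (n.+1%:Z %| a * d - 1)%Z by rewrite -det1 (_ : _ - _ = b * n.+1%:Z) ?dvdz_mull //; ring.
have ca : coprimez a n.+1%:Z.
  by apply/coprimezP; exists (d, - b) => /=; rewrite mulNr mulrC.
rewrite (Phi_transform eQ eS dd det1 w0) (Th_level eQ eB QB BQ N0 Nn ad w0) (Th_level eS eB' SB BS N0 Nn ad w0).
rewrite -(Gs_genus n a eQ gS) -mulrBr cabsM exprMn (Gs0_level eQ eB QB BQ N0 Nn ca) /Phi -/(F w).
have c1 : n.+1%:R ^+ m != 0 :> R by rewrite expf_neq0 // pnatr_eq0.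
move: (n.+1%:R ^+ m : R) c1 => x x0.
have d0 : (\det Q)%:~R != 0 :> R by rewrite intr_eq0.
by field; rewrite x0 d0.
Qed.

Lemma Phi_inv (g : 'M[int]_2) (z : R[i]) : Gamma0 N g -> 0 < complex.Im z ->
  Phi m F (moebius g z) = Phi m F z.
Proof.
move=> [dg Ng] z0; rewrite moebius_actf.
have det1 : g 0 0 * g 1 1 - g 0 1 * g 1 0 = 1 by rewrite -dg det2.
move: Ng det1; move: (g 0 0) (g 0 1) (g 1 0) (g 1 1) => a b c d.
case: c => [[|n]|n] Nc det1.
- have ad : a * d = 1 by rewrite -det1 mulr0 subr0.
  have Hs (u v : int) : Phi m F (z + u%:~R) = Phi m F z by rewrite /Phi /F !theta_addint Im_int.
  have : (a == 1) && (d == 1) || (a == -1) && (d == -1).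
    have : (`|a| * `|d| == 1)%N by rewrite -abszM ad.
    rewrite muln_eq1 => /andP[/eqP ha /eqP hd]; move: ad ha hd.
    by case: a {Nc det1} => [[|[|a]]|[|a]] //; case: d => [[|[|d]]|[|d]].
  case/orP => /andP[/eqP -> /eqP ->].
    by rewrite /actf mul0r add0r invr1 mulr1 mul1r Hs.
  rewrite /actf mul0r add0r !intrN !mulN1r (_ : (- z + b%:~R) / - 1 = z + (- b)%:~R); first by rewrite Hs.
  by rewrite invrN invr1 mulrN mulr1 opprD opprK intrN.
- by apply: Phi_inv_pos.
rewrite -actfN NegzE opprK; apply: Phi_inv_pos => //.
by rewrite mulrNN mulNr -mulrN -NegzE.
Qed.
End Pair.
End Inv.

(** * Divisors and binary quadratic forms *)

Section Divisors.
Local Open Scope nat_scope.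

Definition ndiv (n : nat) := size (divisors n).

Lemma ndivM m n : 0 < m -> 0 < n -> coprime m n -> ndiv (m * n) <= ndiv m * ndiv n.
Proof.
move=> m0 n0 cmn.
pose s := [seq x * y | x <- divisors m, y <- divisors n].
have : {subset divisors (m * n) <= s}.
  move=> d; rewrite -dvdn_divisors ?muln_gt0 ?m0 // => dmn.
  apply/allpairsP; exists (gcdn d m, gcdn d n); split=> /=.
  - by rewrite -dvdn_divisors // dvdn_gcdr.
  - by rewrite -dvdn_divisors // dvdn_gcdr.
  - have c : coprime (gcdn d m) (gcdn d n).
      by apply: (coprime_dvdl (dvdn_gcdr _ _)); apply: (coprime_dvdr (dvdn_gcdr _ _)).
    apply/eqP; rewrite eqn_dvd Gauss_dvd // !dvdn_gcdl !andbT muln_gcdl dvdn_gcd dvdn_mulr //=.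
    by rewrite muln_gcdr dvdn_gcd dvdn_mull //= dmn.
move=> sub; have := uniq_leq_size (divisors_uniq _) sub.
by rewrite size_allpairs.
Qed.

Lemma ndiv_pexp p e : prime p -> ndiv (p ^ e) <= e.+1.
Proof.
move=> pp; pose s := [seq p ^ i | i <- iota 0 e.+1].
have : {subset divisors (p ^ e) <= s}.
  move=> d; rewrite -dvdn_divisors ?expn_gt0 ?prime_gt0 // => /(dvdn_pfactor _ _ pp)[k ke ->].
  by apply/mapP; exists k => //; rewrite mem_iota.
move=> sub; have := uniq_leq_size (divisors_uniq _) sub.
by rewrite size_map size_iota.
Qed.

End Divisors.

Section DivisorBound.
Variable R : realType.
Local Open Scope ring_scope.

(** Prime powers of primes above $2^{1/\varepsilon}$ obey the bound with constant 1; each of the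
    finitely many smaller primes costs at most a factor [K]. *)
Lemma ndiv_bound (eps : R) : 0 < eps -> exists2 C : R, 0 < C &
  forall n : nat, (0 < n)%N -> (ndiv n)%:R <= C * n%:R `^ eps.
Proof.
move=> e0.
(* beyond P, p^eps >= 2 so that e+1 <= p^(e eps) *)
pose P := (Num.truncn (2 `^ eps^-1 : R)).+1.
pose K : R := 1 + eps^-1 / ln 2.
have l2 : 0 < ln 2 :> R by rewrite ln_gt0 // ltr1n.
have K1 : 1 <= K by rewrite lerDl divr_ge0 ?invr_ge0 ?ltW.
have K0 : 0 <= K by rewrite (le_trans _ K1).
have small p e : prime p -> e.+1%:R <= K * (p ^ e)%:R `^ eps.
  move=> pp; have p2 : (2 : R) <= p%:R by rewrite ler_nat prime_gt1.
  have p0 : 0 < p%:R :> R by rewrite ltr0n prime_gt0.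
  have pe : (p ^ e)%:R `^ eps = expR (e%:R * eps * ln p%:R).
    by rewrite natrX -powR_mulrn ?ltW // -powRrM /powR gt_eqF.
  have lp : ln 2 <= ln p%:R :> R by rewrite ler_ln ?posrE.
  rewrite pe; apply: (@le_trans _ _ (K * (1 + e%:R * eps * ln 2))); last first.
    rewrite ler_wpM2l // (le_trans (expR_ge1Dx _)) // ler_expR ler_wpM2l //.
    by rewrite mulr_ge0 // ltW.
  have x0 : 0 <= e%:R * eps * ln 2 :> R by rewrite !mulr_ge0 // ltW.
  have : eps^-1 / ln 2 * (e%:R * eps * ln 2) = e%:R by field; rewrite !gt_eqF.
  have i0 : 0 <= eps^-1 / ln 2 by rewrite divr_ge0 ?invr_ge0 ?ltW.
  by rewrite -natr1 /K; nra.
have large p e : prime p -> (P <= p)%N -> e.+1%:R <= (p ^ e)%:R `^ eps.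
  move=> pp Pp; have p0 : 0 < p%:R :> R by rewrite ltr0n prime_gt0.
  have : 2 <= p%:R `^ eps :> R.
    have h : (2 `^ eps^-1 : R) <= p%:R.
      by rewrite (le_trans (ltW (truncnS_gt _))) // ler_nat.
    have := @ge0_ler_powR R eps (ltW e0) (2 `^ eps^-1) p%:R; rewrite !nnegrE powR_ge0 ltW // => /(_ isT isT h).
    by rewrite -powRrM mulVf ?gt_eqF // powRr1.
  move=> h2; rewrite natrX -(powR_mulrn _ (ltW p0)) -powRrM mulrC powRrM powR_mulrn ?powR_ge0 //.
  apply: (@le_trans _ _ (2 ^+ e)); last by rewrite lerXn2r ?nnegrE ?powR_ge0.
  by rewrite -natrX ler_nat ltn_expl.
exists (K ^+ P); first by rewrite exprn_gt0 // (lt_le_trans _ K1).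
(* induct on a bound B for the primes of n *)
have H (B n : nat) : (0 < n)%N -> (forall p, prime p -> (p %| n)%N -> (p < B)%N) ->
    (ndiv n)%:R <= K ^+ (minn B P) * n%:R `^ eps.
  elim: B n => [|B IH] n n0 hB.
    have n1 : n = 1%N.
      by case: n n0 hB => [|[|n]] // _ /(_ (pdiv n.+2)); rewrite pdiv_prime // pdiv_dvd => /(_ isT isT).
    by rewrite n1 min0n expr0 mul1r powR1 /ndiv.
  have [Bp|Bp] := boolP (prime B); last first.
    apply: le_trans (IH n n0 _) _.
      move=> p pp pn; have := hB p pp pn; rewrite ltnS leq_eqVlt => /orP[/eqP E|//].
      by rewrite -E pp in Bp.
    rewrite ler_wpM2r ?powR_ge0 // ler_weXn2l //; lia.
  pose a := (n`_B)%N; pose b := (n`_(B^'))%N.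
  have ab : n = (a * b)%N by rewrite partnC.
  have a0 : (0 < a)%N := part_gt0 _ _. have b0 : (0 < b)%N := part_gt0 _ _.
  have cab : coprime a b by exact: coprime_partC.
  have aE : a = (B ^ logn B n)%N by rewrite /a p_part.
  have hb : (ndiv b)%:R <= K ^+ (minn B P) * b%:R `^ eps.
    apply: IH => // p pp pb; have := hB p pp (dvdn_trans pb (dvdn_part _ _)).
    rewrite ltnS leq_eqVlt => /orP[/eqP E|//].
    have := part_pnat (negn B) n => /pnatP => /(_ b0 p pp pb).
    by rewrite E !inE eqxx.
  have ha : (ndiv a)%:R <= (if (B < P)%N then K else 1) * a%:R `^ eps.
    rewrite aE; apply: (@le_trans _ _ (logn B n).+1%:R); first by rewrite ler_nat ndiv_pexp.
    by case: ltnP => BP; [exact: small|rewrite mul1r large].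
  rewrite {1}ab; apply: (@le_trans _ _ ((ndiv a)%:R * (ndiv b)%:R)).
    by rewrite -natrM ler_nat ndivM.
  apply: (le_trans (ler_pM _ _ ha hb)) => //.
  rewrite [in leRHS]ab natrM powRM // mulrACA ler_wpM2r ?mulr_ge0 ?powR_ge0 //.
  case: ltnP => BP.
    by rewrite -exprS; rewrite ler_weXn2l //; lia.
  by rewrite mul1r ler_weXn2l //; lia.
move=> n n0; apply: le_trans (H n.+1 n n0 _) _.
  by move=> p pp pn; rewrite ltnS dvdn_leq.
by rewrite ler_wpM2r ?powR_ge0 // ler_weXn2l // geq_minr.
Qed.

End DivisorBound.

Section RootCount.
Local Open Scope nat_scope.

Definition sqfree (D : nat) := forall e, (e ^ 2 %| D) -> e = 1.

Definition sqroots (D n : nat) : seq nat := [seq t <- iota 0 n | n %| t ^ 2 + D].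

Lemma dvdn_div_gcd a b n : 0 < n -> n %| a * b -> n %/ gcdn a n %| b.
Proof.
move=> n0 nab; have g0 : 0 < gcdn a n by rewrite gcdn_gt0 n0 orbT.
have c : coprime (n %/ gcdn a n) (a %/ gcdn a n).
  rewrite /coprime -(eqn_pmul2r g0) muln_gcdl mul1n !divnK ?dvdn_gcdl ?dvdn_gcdr //.
  by rewrite gcdnC.
rewrite -(Gauss_dvdr _ c) -(dvdn_pmul2r g0) divnK ?dvdn_gcdr //.
by rewrite mulnAC divnK ?dvdn_gcdl.
Qed.

(** Two residues with $n \mid 2(t_1 - t_2)$ coincide or differ by $n/2$; the parity of $\lfloor 2t/n
    \rfloor$ tells these cases apart. *)
Lemma double_cancel (n t1 t2 k q1 r1 q2 r2 : nat) : t1 < n -> t2 < n ->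
  2 * `|t1%:Z - t2%:Z|%N = k * n -> t1 * 2 = q1 * n + r1 -> r1 < n ->
  t2 * 2 = q2 * n + r2 -> r2 < n -> odd q1 = odd q2 -> t1 = t2.
Proof.
move=> l1 l2; case: k => [|[|k]]; rewrite ?mulSn ?mul0n; [lia| |lia].
case: q1 => [|[|q1]]; rewrite ?mulSn ?mul0n; [|move=> ? ? ?|lia];
  case: q2 => [|[|q2]]; rewrite ?mulSn ?mul0n //=; lia.
Qed.

Lemma sqfree_dvd D e : sqfree D -> e ^ 2 %| 4 * D -> e %| 2.
Proof.
move=> sD h; have [od|ev] := boolP (odd e).
  have c : coprime (e ^ 2) 4 by rewrite coprimeXl // -[4]/(2 ^ 2) coprimeXr // coprimen2.
  by rewrite (sD e) // -(Gauss_dvdr _ c).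
have -> : e = e./2 * 2 by rewrite muln2 -{1}(odd_double_half e) (negbTE ev).
rewrite (sD e./2) //; move: h; rewrite -{1}(odd_double_half e) (negbTE ev) add0n -muln2 expnMn mulnC.
by rewrite dvdn_pmul2l.
Qed.

Lemma sqroots_bound (D n : nat) : sqfree D -> 0 < n -> size (sqroots D n) <= 2 * ndiv n.
Proof.
move=> sD n0.
case E : (sqroots D n) => [//|t0 s0]; rewrite -E.
have t0r : t0 \in sqroots D n by rewrite E mem_head.
have {}t0r : n %| t0 ^ 2 + D by move: t0r; rewrite mem_filter => /andP[].
(* t is determined modulo n/e by d = gcd(t - t0, n), where e = gcd(d, n/d) divides 2 *)
pose key (t : nat) : nat * bool := (gcdn `|t%:Z - t0%:Z|%N n, odd (t * 2 %/ n)).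
pose tgt := [seq (d, b) | d <- divisors n, b <- [:: true; false]].
have u : uniq (sqroots D n) by rewrite filter_uniq ?iota_uniq.
have root t : n %| t ^ 2 + D -> n %/ gcdn `|t%:Z - t0%:Z|%N n %| `|(t%:Z + t0%:Z)%R|%N.
  move=> r; apply: dvdn_div_gcd => //; rewrite -abszM.
  have -> : ((t%:Z - t0%:Z) * (t%:Z + t0%:Z) = (t ^ 2 + D)%N%:Z - (t0 ^ 2 + D)%N%:Z)%R.
    by rewrite !PoszD -!mulnn !PoszM; ring.
  rewrite -[n]/(`|n%:Z|%N) -dvdzE; apply: rpredB; rewrite dvdzE //.
have inj : {in sqroots D n &, injective key}.
  move=> t1 t2; rewrite !mem_filter !mem_iota /= !add0n => /andP[r1 l1] /andP[r2 l2] [E1 E2].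
  set d := gcdn `|t1%:Z - t0%:Z|%N n in E1.
  have dn : d %| n by exact: dvdn_gcdr.
  have f1 : d %| `|t1%:Z - t0%:Z|%N by exact: dvdn_gcdl.
  have f2 : d %| `|t2%:Z - t0%:Z|%N by rewrite E1 dvdn_gcdl.
  have g1 : n %/ d %| `|(t1%:Z + t0%:Z)%R|%N by exact: root.
  have g2 : n %/ d %| `|(t2%:Z + t0%:Z)%R|%N by rewrite E1; exact: root.
  have d0 : 0 < d by rewrite gcdn_gt0 n0 orbT.
  set e := gcdn d (n %/ d).
  have e0 : 0 < e by rewrite gcdn_gt0 d0.
  have a1 : d %| `|t1%:Z - t2%:Z|%N.
    have -> : (t1%:Z - t2%:Z = (t1%:Z - t0%:Z) - (t2%:Z - t0%:Z))%R by ring.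
    by move: f1 f2; rewrite -[d]/(`|d%:Z|%N) -!dvdzE => ? ?; apply: rpredB.
  have a2 : n %/ d %| `|t1%:Z - t2%:Z|%N.
    have -> : (t1%:Z - t2%:Z = (t1%:Z + t0%:Z) - (t2%:Z + t0%:Z))%R by ring.
    by move: g1 g2; rewrite -[n %/ d]/(`|(n %/ d)%:Z|%N) -!dvdzE => ? ?; apply: rpredB.
  (* [e] divides $t_1 - t_0$ and $t_1 + t_0$, hence $2t_0$, and $e^2 \mid n$; so $e^2 \mid 4D$, and
     squarefreeness applies. *)
  have e2 : e %| 2.
    apply: (sqfree_dvd sD).
    have h1 : (e%:Z %| (2 * t0%:Z)%R)%Z.
      have -> : (2 * t0%:Z = (t1%:Z + t0%:Z) - (t1%:Z - t0%:Z))%R by ring.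
      apply: rpredB; rewrite dvdzE /=.
        exact: dvdn_trans (dvdn_gcdr _ _) g1.
      exact: dvdn_trans (dvdn_gcdl _ _) f1.
    have h2 : e ^ 2 %| n.
      rewrite -(divnK dn) -mulnn; apply: dvdn_mul; [exact: dvdn_gcdr|exact: dvdn_gcdl].
    have h3 : e ^ 2 %| (2 * t0) ^ 2.
      by rewrite dvdn_exp2r // -[e]/(`|e%:Z|%N) -[2 * t0]/(`|(2 * t0)%N%:Z|%N) -dvdzE PoszM.
    have h4 : e ^ 2 %| 4 * (t0 ^ 2 + D) by rewrite dvdn_mull // (dvdn_trans h2).
    by move: h4; rewrite mulnDr dvdn_addr // (_ : 4 = 2 ^ 2) // -expnMn.
  have L : n %| 2 * `|t1%:Z - t2%:Z|%N.
    have : lcmn d (n %/ d) %| `|t1%:Z - t2%:Z|%N by rewrite dvdn_lcm a1 a2.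
    move=> /(dvdn_mul e2); rewrite mulnC muln_lcm_gcd mulnC divnK //.
  case/dvdnP: L => k Ek.
  exact: (double_cancel l1 l2 Ek (divn_eq (t1 * 2) n) (ltn_pmod (t1 * 2) n0)
     (divn_eq (t2 * 2) n) (ltn_pmod (t2 * 2) n0) E2).
have sub : {subset map key (sqroots D n) <= tgt}.
  move=> _ /mapP[t _ ->]; apply/allpairsP; exists (key t); split=> //=.
    by rewrite -dvdn_divisors // dvdn_gcdr.
  by case: odd; rewrite !inE.
have := uniq_leq_size _ sub; rewrite map_inj_in_uniq // size_map size_allpairs /= mulnC.
by apply.
Qed.

Lemma sqfree_decomp (n : nat) : 0 < n -> exists D g, [/\ sqfree D, 0 < D, 0 < g & n = D * g ^ 2].
Proof.
move=> n0; pose P g := g ^ 2 %| n.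
have ex : exists g, P g by exists 1; rewrite /P exp1n dvd1n.
have bd g : P g -> g <= n.
  by move=> /dvdn_leq -/(_ n0); apply: leq_trans; rewrite -mulnn; case: g => // g; rewrite leq_pmulr.
case: (ex_maxnP ex bd) => g /dvdnP[D E] gm.
have D0 : 0 < D by move: n0; rewrite E muln_gt0 => /andP[].
have g0 : 0 < g by move: n0; rewrite E muln_gt0 => /andP[_]; rewrite expn_gt0 orbF.
exists D, g; split=> // e /dvdnP[D' ED].
have : P (e * g) by rewrite /P E ED expnMn -mulnA dvdn_mull.
move=> /gm; rewrite -[leqRHS]mul1n leq_pmul2r // => e1.
by case: e e1 ED => [|[|]] //; rewrite exp0n // muln0 => _ D00; rewrite D00 in D0.
Qed.

End RootCount.

Section Reps.
Local Open Scope ring_scope.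

(** A common root gives $n \mid ZW' - Z'W$, while $(ZZ'+DWW')^2 + D(ZW'-Z'W)^2 = n^2$. Either this
    determinant vanishes, or $D = 1$ and $ZZ' + WW' = 0$, which equal signs exclude. *)
Lemma rep_prim_inj (D n : nat) (Z W Z' W' : int) (t : nat) : (0 < D)%N -> (0 < n)%N ->
  Z ^+ 2 + D%:Z * W ^+ 2 = n%:Z -> Z' ^+ 2 + D%:Z * W' ^+ 2 = n%:Z ->
  coprimez Z W -> coprimez Z' W' ->
  (n%:Z %| Z - t%:Z * W)%Z -> (n%:Z %| Z' - t%:Z * W')%Z ->
  Num.sg Z = Num.sg Z' -> Num.sg W = Num.sg W' -> Z = Z' /\ W = W'.
Proof.
move=> D0 n0 E E' c c' d d' sZ sW.
have nk : (n%:Z %| Z * W' - Z' * W)%Z.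
  have -> : Z * W' - Z' * W = (Z - t%:Z * W) * W' - (Z' - t%:Z * W') * W by ring.
  by apply: rpredB; apply: dvdz_mulr.
have [k Ek] := dvdzP nk.
have id : (Z * Z' + D%:Z * W * W') ^+ 2 + D%:Z * (Z * W' - Z' * W) ^+ 2 = n%:Z ^+ 2.
  have -> : n%:Z ^+ 2 = (Z ^+ 2 + D%:Z * W ^+ 2) * (Z' ^+ 2 + D%:Z * W' ^+ 2) by rewrite E E' expr2.
  by ring.
have nz : n%:Z != 0 by rewrite -lt0n.
have n0Z : 0 < n%:Z by [].
have D1 : 1 <= D%:Z by [].
have [k0|kn] := eqVneq k 0.
  have pr : Z * W' = Z' * W by apply/eqP; rewrite -subr_eq0 Ek k0 mul0r.
  have a1 : (Z %| Z')%Z by rewrite -(Gauss_dvdzl _ c) -pr dvdz_mulr.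
  have a2 : (Z' %| Z)%Z by rewrite -(Gauss_dvdzl _ c') pr dvdz_mulr.
  have aZ : `|Z| = `|Z'|.
    by apply/eqP; rewrite -!abszE eqz_nat eqn_dvd; move: a1 a2; rewrite !dvdzE => -> ->.
  have eZ : Z = Z' by rewrite [LHS]numEsg [RHS]numEsg aZ sZ.
  split=> //; have : D%:Z * W ^+ 2 = D%:Z * W' ^+ 2.
    by apply: (addrI (Z ^+ 2)); rewrite E {1}eZ E'.
  move=> /(mulfI (_ : D%:Z != 0)) => /(_ _)/eqP; rewrite -lt0n => /(_ D0).
  rewrite eqf_sqr => /orP[/eqP //|/eqP WN].
  move: sW; rewrite WN sgrN => /eqP; rewrite eq_sym -addr_eq0 -mulr2n mulrn_eq0 /= sgr_eq0 => /eqP ->.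
  by rewrite oppr0.
have k2 : 1 <= k ^+ 2 by rewrite -gtz0_ge1 exprn_even_gt0.
have S0 := sqr_ge0 (Z * Z' + D%:Z * W * W').
have kk : D%:Z * k ^+ 2 * n%:Z ^+ 2 <= n%:Z ^+ 2.
  have E3 : D%:Z * k ^+ 2 * n%:Z ^+ 2 = D%:Z * (Z * W' - Z' * W) ^+ 2 by rewrite Ek; ring.
  by rewrite E3 -[leRHS]id lerDr.
have n2 : 0 < n%:Z ^+ 2 by rewrite exprn_gt0.
have kk' : D%:Z * k ^+ 2 <= 1 by move: kk; rewrite ger_pMl.
have Dk1 : D%:Z <= D%:Z * k ^+ 2 by rewrite ler_peMr.
have Dk2 : k ^+ 2 <= D%:Z * k ^+ 2 by rewrite ler_peMl // (le_trans _ k2).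
have k21 : k ^+ 2 = 1 by apply/eqP; rewrite eq_le k2 andbT (le_trans Dk2 kk').
have De : D%:Z = 1 by apply/eqP; rewrite eq_le D1 andbT (le_trans Dk1 kk').
have z0 : Z * Z' + W * W' = 0.
  by apply/eqP; rewrite -sqrf_eq0; move: id; rewrite Ek exprMn k21 De !mul1r -[RHS]add0r => /addIr ->.
exfalso; rewrite De !mul1r in E E'.
have hz : 0 <= Z * Z' by rewrite -sgr_ge0 sgrM sZ -expr2 sqr_ge0.
have hw : 0 <= W * W' by rewrite -sgr_ge0 sgrM sW -expr2 sqr_ge0.
move/eqP: z0; rewrite paddr_eq0 // => /andP[/eqP e1 /eqP e2].
have sZ0 : Z = 0.
  have : Num.sg Z * Num.sg Z' = 0 by rewrite -sgrM e1 sgr0.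
  by rewrite -sZ => /eqP; rewrite mulf_eq0 orbb sgr_eq0 => /eqP.
have sW0 : W = 0.
  have : Num.sg W * Num.sg W' = 0 by rewrite -sgrM e2 sgr0.
  by rewrite -sW => /eqP; rewrite mulf_eq0 orbb sgr_eq0 => /eqP.
by move: E; rewrite sZ0 sW0 => E; move: n0Z; rewrite -E.
Qed.

(** The root is $Z/W$ modulo [n]; [W] is invertible because the representation is primitive. *)
Lemma rep_root (D n : nat) (Z W : int) : (0 < n)%N -> Z ^+ 2 + D%:Z * W ^+ 2 = n%:Z ->
  coprimez Z W -> exists2 t, t \in sqroots D n & (n%:Z %| Z - t%:Z * W)%Z.
Proof.
move=> n0 E c.
have cW : coprimez n%:Z W.
  rewrite coprimez_sym -E; have -> : Z ^+ 2 + D%:Z * W ^+ 2 = (D%:Z * W) * W + Z ^+ 2 by ring.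
  by rewrite /coprimez gcdzMDl -/(coprimez W (Z ^+ 2)) coprimezXr // coprimez_sym.
have [[a b] /= ab] := coprimezP _ _ cW.
pose t := absz (Z * b %% n%:Z)%Z.
have tE : t%:Z = (Z * b %% n%:Z)%Z by rewrite abszE ger0_norm // modz_ge0 // -lt0n.
have nt : (n%:Z %| Z - t%:Z * W)%Z.
  have := divz_eq (Z * b) n%:Z; rewrite -tE => h.
  have -> : Z - t%:Z * W = (Z * a + (Z * b %/ n%:Z)%Z * W) * n%:Z.
    have t' : t%:Z = Z * b - (Z * b %/ n%:Z)%Z * n%:Z by rewrite {1}h; ring.
    have -> : Z - t%:Z * W = Z * (a * n%:Z + b * W) - (Z * b - (Z * b %/ n%:Z)%Z * n%:Z) * W.
      by rewrite ab mulr1 -t'.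
    by ring.
  exact: dvdz_mull.
exists t => //; rewrite mem_filter mem_iota /= add0n; apply/andP; split; last first.
  by rewrite -ltz_nat tE ltz_pmod.
rewrite -[n]/(`|n%:Z|%N) -[X in (_ %| X)%N]/(`|(t ^ 2 + D)%N%:Z|%N) -dvdzE.
have cW2 : coprimez n%:Z (W ^+ 2) by rewrite coprimezXr.
rewrite -(Gauss_dvdzl _ cW2) PoszD -mulnn PoszM.
have -> : (t%:Z * t%:Z + D%:Z) * W ^+ 2 = n%:Z - (Z - t%:Z * W) * (Z + t%:Z * W).
  by rewrite -E; ring.
by apply: rpredB => //; apply: dvdz_mulr.
Qed.

(** In the constant, 9 counts pairs of signs and 2 comes from [sqroots_bound]; one divisor factor
    counts contents, the other roots. *)
Lemma rep_count (D n : nat) (s : seq (int * int)) : sqfree D -> (0 < D)%N -> (0 < n)%N -> uniq s ->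
  (forall x, x \in s -> x.1 ^+ 2 + D%:Z * x.2 ^+ 2 = n%:Z) ->
  (size s <= 18 * ndiv n ^ 2)%N.
Proof.
move=> sD D0 n0 us hs.
have n0Z : 0 < n%:Z by [].
(* a representation is determined by its content g, a root modulo n/g^2 and two signs *)
pose rel (x : int * int) (k : (nat * nat) * (int * int)) :=
  [/\ k.1.1 \in divisors n, k.1.2 \in sqroots D (n %/ k.1.1 ^ 2), k.2 = (Num.sg x.1, Num.sg x.2) &
   exists Z W, [/\ x = (k.1.1%:Z * Z, k.1.1%:Z * W), (k.1.1 ^ 2 %| n)%N, coprimez Z W,
     Z ^+ 2 + D%:Z * W ^+ 2 = (n %/ k.1.1 ^ 2)%N%:Z &
     ((n %/ k.1.1 ^ 2)%N%:Z %| Z - k.1.2%:Z * W)%Z]].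
have ex x : exists k, x \in s -> rel x k.
  have [xs|] := boolP (x \in s); last by exists ((0%N, 0%N), (0, 0)).
  have E := hs x xs; case: x E {xs} => X Y /= E.
  pose g := gcdn `|X|%N `|Y|%N.
  have g0 : (0 < g)%N.
    rewrite gcdn_gt0 !absz_gt0; apply/orP; have [X0|] := eqVneq X 0; last by left.
    by right; apply/eqP => Y0; move: n0Z; rewrite -E X0 Y0 expr0n /= mulr0.
  have gz : g%:Z != 0 by rewrite -lt0n.
  have gX : (g%:Z %| X)%Z by rewrite dvdzE dvdn_gcdl.
  have gY : (g%:Z %| Y)%Z by rewrite dvdzE dvdn_gcdr.
  have [Z EZ] := dvdzP gX; have [W EW] := dvdzP gY.
  have En : n%:Z = (Z ^+ 2 + D%:Z * W ^+ 2) * (g ^ 2)%N%:Z.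
    by rewrite -E EZ EW -mulnn PoszM; ring.
  have gn : (g ^ 2 %| n)%N.
    by rewrite -[(g ^ 2)%N]/(`|(g ^ 2)%N%:Z|%N) -[n]/(`|n%:Z|%N) -dvdzE En dvdz_mull.
  have g20 : (0 < g ^ 2)%N by rewrite expn_gt0 g0.
  have E2 : Z ^+ 2 + D%:Z * W ^+ 2 = (n %/ g ^ 2)%N%:Z.
    apply: (mulIf (_ : (g ^ 2)%N%:Z != 0)); first by rewrite -lt0n.
    by rewrite -En -PoszM divnK.
  have c : coprimez Z W.
    have : gcdn `|X|%N `|Y|%N = g by [].
    rewrite EZ EW !abszM -muln_gcdl /= => /eqP; by rewrite -[X in _ == X]mul1n eqn_pmul2r.
  have m0 : (0 < n %/ g ^ 2)%N by rewrite divn_gt0 // dvdn_leq.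
  have [t tin tt] := rep_root m0 E2 c.
  exists ((g, t), (Num.sg X, Num.sg Y)) => _; split=> //=.
    rewrite -dvdn_divisors // (dvdn_trans _ gn) // dvdn_exp //.
  by exists Z, W; split=> //; rewrite [X]EZ [Y]EW ![_ * g%:Z]mulrC.
have /choice[key hk] := ex.
pose sg3 : seq int := [:: -1; 0; 1].
pose divs := [seq g <- divisors n | (g ^ 2 %| n)%N].
pose tgt := [seq (gt, b) | gt <- [seq (g, t) | g <- divs, t <- sqroots D (n %/ g ^ 2)],
                           b <- [seq (a, b) | a <- sg3, b <- sg3]].
have sgin (X : int) : Num.sg X \in sg3 by case: sgrP => _; rewrite !inE.
have sub : {subset map key s <= tgt}.
  move=> _ /mapP[x xs ->]; have [h1 h2 h3 [Z [W [_ h4 _ _ _]]]] := hk x xs.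
  apply/allpairsP; exists (key x); split=> //=; last by case: (key x) => ? [].
    apply/allpairsPdep; exists (key x).1.1, (key x).1.2; split=> //; last by case: (key x) => -[].
    by rewrite mem_filter h4.
  by rewrite h3; case: (sgrP x.1) => _; case: (sgrP x.2) => _; rewrite !inE.
have inj : {in s &, injective key}.
  move=> x y xs ys Exy.
  have [_ _ h3 [Z [W [ex1 gn c E t1]]]] := hk x xs.
  have [_ _ h3' [Z' [W' [ey1 _ c' E' t1']]]] := hk y ys.
  rewrite -Exy in h3' ey1 E' t1'.
  set g := (key x).1.1 in ex1 ey1 gn E E' t1 t1'.
  have g0 : (0 < g)%N.
    by case: (posnP g) => // g00; move: gn; rewrite g00 exp0n // dvd0n => /eqP n00; move: n0; rewrite n00.
  have m0 : (0 < n %/ g ^ 2)%N by rewrite divn_gt0 ?expn_gt0 ?g0 // dvdn_leq.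
  have [s1 s2] : Num.sg x.1 = Num.sg y.1 /\ Num.sg x.2 = Num.sg y.2 by move: h3 h3' => -> [].
  rewrite ex1 ey1 /= !sgrM in s1 s2.
  have sg0 : Num.sg g%:Z != 0 by rewrite sgr_eq0 -lt0n.
  have [eZ eW] := rep_prim_inj D0 m0 E E' c c' t1 t1' (mulfI sg0 s1) (mulfI sg0 s2).
  by rewrite ex1 ey1 eZ eW.
have := uniq_leq_size _ sub; rewrite map_inj_in_uniq // size_map => /(_ us) /leq_trans; apply.
rewrite size_allpairs size_allpairs /= mulnC (_ : (18 * ndiv n ^ 2 = 9 * (ndiv n * (2 * ndiv n)))%N); last by lia.
rewrite leq_mul2l /= size_allpairs_dep sumnE big_map.
apply: (@leq_trans (\sum_(g <- divs) 2 * ndiv n)%N); last first.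
  by rewrite big_const_seq count_predT iter_addn_0 mulnC leq_mul2r size_filter count_size orbT.
rewrite big_seq [leqRHS]big_seq; apply: leq_sum => g; rewrite mem_filter -dvdn_divisors // => /andP[g2 gn].
have g0 : (0 < g)%N by apply: dvdn_gt0 gn.
have m0 : (0 < n %/ g ^ 2)%N by rewrite divn_gt0 ?expn_gt0 ?g0 // dvdn_leq.
rewrite (leq_trans (sqroots_bound sD m0)) // leq_mul2l /=.
apply: uniq_leq_size; first exact: divisors_uniq.
by move=> d; rewrite -!dvdn_divisors // => /dvdn_trans; apply; exact: dvdn_div.
Qed.

End Reps.

Section Binary.
Variable R : realType.
Local Open Scope ring_scope.

(** Completing both squares turns the conic into $X^2 + DY^2 = n$, and the square part of [D] is
    moved into [Y]. The coefficients matter only through [H]; the 1 added to the constant covers $n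
    = 0$. *)
Lemma binary_count (eps : R) : 0 < eps -> exists2 C : R, 0 < C &
  forall (a b c d e f : int) (s : seq (int * int)), 0 < a -> 0 < 4 * a * c - b ^+ 2 -> uniq s ->
  (forall x, x \in s -> a * x.1 ^+ 2 + b * x.1 * x.2 + c * x.2 ^+ 2 + d * x.1 + e * x.2 + f = 0) ->
  forall H : R, 1 <= H ->
   ((2 * a * e - b * d) ^+ 2 + (4 * a * c - b ^+ 2) * (d ^+ 2 - 4 * a * f))%:~R <= H ->
  (size s)%:R <= C * H `^ eps.
Proof.
move=> e0; have e2 : 0 < eps / 2 by rewrite divr_gt0.
have [C C0 hC] := ndiv_bound e2.
exists (18 * C ^+ 2 + 1); first by rewrite addr_gt0 // mulr_gt0 // exprn_gt0.
move=> a b c d e f s a0 D0 us hs H H1; set D := 4 * a * c - b ^+ 2 in D0 *.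
set n := (X in X%:~R <= H) => nH.
have h1 : 1 <= H `^ eps by rewrite -(powRr0 H) ler_powR // ltW.
pose F (x : int * int) := (D * x.2 + (2 * a * e - b * d), 2 * a * x.1 + b * x.2 + d).
have FE x : x \in s -> (F x).1 ^+ 2 + D * (F x).2 ^+ 2 = n.
  move=> /hs h; have : 4 * a * D * (a * x.1 ^+ 2 + b * x.1 * x.2 + c * x.2 ^+ 2 + d * x.1 + e * x.2 + f) = 0.
    by rewrite h mulr0.
  by move=> h'; rewrite -[RHS]addr0 -h' /n /F /D /=; ring.
have a2 : 2 * a != 0 by rewrite mulf_neq0 // gt_eqF.
have Finj : injective F.
  move=> [x1 x2] [y1 y2] [/addIr /(mulfI (lt0r_neq0 D0)) -> /addIr /addIr /(mulfI a2) ->] //.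
have n_ge0 : s <> [::] -> 0 <= n.
  case: s us hs FE => // x s us hs FE _; rewrite -(FE x) ?mem_head //.
  by rewrite addr_ge0 ?sqr_ge0 // mulr_ge0 ?sqr_ge0 // ltW.
have [-> /=|/eqP s0] := eqVneq s [::].
  by rewrite mulr_ge0 ?powR_ge0 // addr_ge0 // mulr_ge0 // exprn_ge0 // ltW.
have n0 := n_ge0 s0.
have [n00|nn] := eqVneq n 0.
  have : (size s <= 1)%N.
    have hF x : x \in s -> F x = (0, 0).
      move=> xs; have := FE x xs; rewrite n00 => /eqP.
      have p1 := sqr_ge0 (F x).1; have p2 : 0 <= D * (F x).2 ^+ 2 by rewrite mulr_ge0 ?sqr_ge0 // ltW.
      rewrite (paddr_eq0 p1 p2) sqrf_eq0 => /andP[/eqP q1].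
      rewrite mulf_eq0 (gt_eqF D0) /= sqrf_eq0 => /eqP q2.
      exact: (congr2 pair q1 q2).
    case: s us hs FE hF {s0 n_ge0} => [|x [|y s]] // us _ _ hF.
    have : x = y by apply: Finj; rewrite !hF ?inE ?eqxx ?orbT.
    by move: us => /= /andP[]; rewrite inE => /norP[/eqP].
  move=> s1; apply: (@le_trans _ _ 1); first by rewrite lern1.
  by rewrite -[leLHS]mul1r ler_pM // lerDr mulr_ge0 // exprn_ge0 // ltW.
have npos : 0 < n by rewrite lt_neqAle eq_sym nn.
have [Dn DE] : exists Dn : nat, D = Dn%:Z by exists `|D|%N; rewrite gez0_abs // ltW.
have [nn' nE] : exists k : nat, n = k%:Z by exists `|n|%N; rewrite gez0_abs.
have Dn0 : (0 < Dn)%N by move: D0; rewrite DE.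
have k0 : (0 < nn')%N by move: npos; rewrite nE.
have [D1 [g [sD1 D10 g0 Dg]]] := sqfree_decomp Dn0.
pose G (x : int * int) := ((F x).1, g%:Z * (F x).2).
have gz : g%:Z != 0 by rewrite -lt0n.
have Ginj : injective G.
  move=> x y [h1' /(mulfI gz) h2']; apply: Finj; exact: (congr2 pair h1' h2').
have sz : (size (map G s) <= 18 * ndiv nn' ^ 2)%N.
  apply: (rep_count sD1 D10 k0); first by rewrite map_inj_uniq.
  move=> _ /mapP[x xs ->]; rewrite -nE -(FE x xs) /G /= DE Dg -mulnn !PoszM; ring.
rewrite size_map in sz; apply: (@le_trans _ _ (18 * ndiv nn' ^ 2)%:R); first by rewrite ler_nat.
rewrite natrM natrX; have := hC nn' k0; have d0 : 0 <= (ndiv nn')%:R :> R by [].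
set q := (ndiv nn')%:R in d0 * => hq.
have nR : nn'%:R <= H by move: nH; rewrite nE -pmulrn.
have n0R : 0 <= nn'%:R :> R by [].
have pw : (nn'%:R `^ (eps / 2)) ^+ 2 <= H `^ eps.
  rewrite -powR_mulrn ?powR_ge0 // -powRrM divfK //.
  by apply: ge0_ler_powR; rewrite ?nnegrE ?(ltW e0) // (le_trans _ H1).
have : q ^+ 2 <= C ^+ 2 * H `^ eps.
  apply: (@le_trans _ _ ((C * nn'%:R `^ (eps / 2)) ^+ 2)).
    by rewrite lerXn2r ?nnegrE // mulr_ge0 ?powR_ge0 // ltW.
  by rewrite exprMn ler_wpM2l // sqr_ge0.
have : 0 <= H `^ eps by exact: powR_ge0.
lra.
Qed.

End Binary.

Lemma round_half (R : realType) (b : R) : exists n : int, (n%:~R + b) ^+ 2 <= 1 / 4.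
Proof.
exists (Num.floor (1 / 2 - b)); have := real_floor_itv (num_real (1 / 2 - b)).
rewrite intrD => /andP[h1 h2]; nra.
Qed.

Lemma seq_argmin (R : realType) (T : eqType) (f : T -> R) (s : seq T) : s != [::] ->
  exists2 x, x \in s & forall y, y \in s -> f x <= f y.
Proof.
elim: s => [|a [|b s] IH] // _; first by exists a; rewrite ?inE // => y; rewrite inE => /eqP ->.
have [x xs hx] := IH isT; have [h|h] := leP (f a) (f x).
  exists a; rewrite ?inE ?eqxx // => y; rewrite inE => /orP[/eqP -> //|ys].
  exact: le_trans h (hx _ ys).
exists x; first by rewrite inE xs orbT.
by move=> y; rewrite inE => /orP[/eqP ->|ys]; [exact: ltW|exact: hx].
Qed.

(** * Reduced bases *)

Section Reduce.
Variable R : realType.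
Local Notation cR := (map_mx (intr : int -> R)).

Lemma qf_delta m (G : 'M[R]_m) i : qf G (delta_mx i 0) = G i i.
Proof. by rewrite /qf trmx_delta -rowE -colE !mxE. Qed.

Lemma cR_delta m (i : 'I_m) : cR (delta_mx i 0 : 'cV[int]_m) = delta_mx i 0.
Proof. by apply/matrixP => a b; rewrite !mxE; case: (_ && _). Qed.

Lemma cR_eq0 p q (x : 'M[int]_(p, q)) : (cR x == 0) = (x == 0).
Proof.
apply/eqP/eqP => [h|->]; last by rewrite map_mx0.
by apply/matrixP => i j; have /matrixP /(_ i j)/eqP := h; rewrite !mxE intr_eq0 => /eqP.
Qed.

Lemma pdef_cong p m (G : 'M[R]_m) (X : 'M[R]_(m, p)) : pdef G -> (forall x : 'cV[R]_p, X *m x = 0 -> x = 0) ->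
  pdef (X^T *m G *m X).
Proof.
move=> [s pG] hX; split; first by rewrite !trmx_mul trmxK s mulmxA.
move=> x x0; rewrite -qf_mulmx; apply: pG; apply: contra x0 => /eqP h; apply/eqP; exact: hX.
Qed.

Lemma pdef_unimod m (G : 'M[R]_m) (U V : 'M[int]_m) : pdef G -> V *m U = 1%:M ->
  pdef ((cR U)^T *m G *m cR U).
Proof.
move=> pG h; apply: pdef_cong => // x Ux.
by rewrite -[x]mul1mx -(map_mx1 (intr : {rmorphism int -> R})) -h map_mxM -mulmxA Ux mulmx0.
Qed.

Lemma min_vector m (G : 'M[R]_m.+1) : pdef G -> exists x : 'cV[int]_m.+1,
  x != 0 /\ forall y : 'cV[int]_m.+1, y != 0 -> qf G (cR x) <= qf G (cR y).
Proof.
move=> pG; pose x0 : 'cV[int]_m.+1 := delta_mx 0 0.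
have x00 : x0 != 0 by apply/eqP => /matrixP /(_ 0 0) /eqP; rewrite !mxE eqxx oner_eq0.
have [s hs] := qf_finite (qf G (cR x0)) pG.
pose s' := [seq x <- s | x != 0].
have x0s : x0 \in s' by rewrite mem_filter x00 hs.
have s'0 : s' != [::] by apply: contraTneq x0s => ->.
have [x xs hx] := seq_argmin (fun x => qf G (cR x)) s'0.
exists x; split; first by move: xs; rewrite mem_filter => /andP[].
move=> y y0; have [h|h] := leP (qf G (cR y)) (qf G (cR x0)); last exact: le_trans (hx _ x0s) (ltW h).
by apply: hx; rewrite mem_filter y0 hs.
Qed.

(** The Smith form of a minimal vector writes it as a multiple of the first column of a unimodular
    matrix, and that column is no longer than the vector. *)
Lemma min_column m (G : 'M[R]_m.+1) : pdef G -> exists U : 'M[int]_m.+1, U \in unitmx /\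
  forall y : 'cV[int]_m.+1, y != 0 -> qf G (cR (col 0 U)) <= qf G (cR y).
Proof.
move=> pG; have [x [x0 hx]] := min_vector pG.
have [L uL [W uW [d sd E]]] := int_Smith_normal_form x.
exists L; split=> // y y0; apply: le_trans (hx y y0).
set k : int := d`_0 * W 0 0.
have xE : x = k *: col 0 L.
  rewrite E -mulmxA; apply/matrixP => i j; rewrite !mxE (bigD1 0) //= big1 ?addr0; last first.
    move=> l l0; rewrite !mxE big1 ?mulr0 // => b _; rewrite !mxE ord1.
    by case: eqP => [/eqP|_]; rewrite ?mul0r // -val_eqE in l0 *; rewrite (negbTE l0).
  by rewrite !mxE big_ord1 !mxE eqxx mulr1n !ord1 /k; ring.
have k0 : k != 0 by apply: contra x0 => /eqP h; rewrite xE h scale0r.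
rewrite xE map_mxZ /=.
have -> : qf G (k%:~R *: cR (col 0 L)) = k%:~R ^+ 2 * qf G (cR (col 0 L)).
  by rewrite !qfE -scalemxAr dotpZl dotpZr mulrA expr2.
have q0 : 0 <= qf G (cR (col 0 L)).
  have [->|h] := eqVneq (cR (col 0 L)) 0; first by rewrite /qf mulmx0 mxE.
  by case: pG => _ h'; exact/ltW/h'.
rewrite ler_peMl // -rmorphXn /= -[1]/(1%:~R) ler_int -gtz0_ge1 lt_neqAle sqr_ge0 eq_sym expf_neq0 //.
Qed.

Lemma schurE m (G : 'M[R]_(1 + m)) i j : schur G i j =
  G (rshift 1 i) (rshift 1 j) - (G 0 0)^-1 * (G (rshift 1 i) 0 * G 0 (rshift 1 j)).
Proof.
have l0 : lshift m (0 : 'I_1) = 0 by apply: val_inj.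
by rewrite /schur !mxE big_ord1 !mxE l0.
Qed.

Lemma schur_block m (G : 'M[R]_(1 + m)) (U : 'M[R]_m) :
  let P : 'M[R]_(1 + m) := block_mx 1%:M 0 0 U in
  schur (P^T *m G *m P) = U^T *m schur G *m U /\ (P^T *m G *m P) 0 0 = G 0 0.
Proof.
set P := block_mx _ _ _ _ => /=.
have E : P^T *m G *m P = block_mx (ulsubmx G) (ursubmx G *m U) (U^T *m dlsubmx G) (U^T *m drsubmx G *m U).
  rewrite /P tr_block_mx -{1}[G]submxK !mulmx_block !trmx0 !trmx1 !mul0mx !mulmx0 !mul1mx !mulmx1 !addr0 !add0r.
  by [].
have E0 : (P^T *m G *m P) 0 0 = G 0 0.
  have l0 : (0 : 'I_(1 + m)) = lshift m (0 : 'I_1) by apply: val_inj.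
  by rewrite E [in LHS]l0 block_mxEul !mxE -l0.
split=> //; rewrite /schur E0 E block_mxKdr block_mxKdl block_mxKur.
by rewrite mulmxBr mulmxBl -scalemxAr -scalemxAl !mulmxA.
Qed.

Lemma ldl_head m (H : 'M[R]_m) (i : 'I_m) : val i = 0%N -> (ldl H)`_0 = H i i.
Proof. by case: m H i => [|m] H i h; [case: i h|rewrite /=; congr (H _ _); apply: val_inj]. Qed.

(** The consequence of Hermite-Korkine-Zolotarev reduction that is used: consecutive pivots fall by
    a factor of at most 3/4. *)
Definition hkz (d : seq R) := forall i, (i.+1 < size d)%N -> 3 / 4 * d`_i <= d`_i.+1.

(** A shortest vector comes first and the Schur complement is reduced recursively. Lifting the next
    vector with its first coordinate rounded to within 1/2 gives $d_0 \le d_0/4 + d_1$. *)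
Lemma hkz_exists m (G : 'M[R]_m) : pdef G -> exists U V : 'M[int]_m,
  [/\ U *m V = 1%:M, V *m U = 1%:M, hkz (ldl ((cR U)^T *m G *m cR U)) &
    forall x : 'cV[int]_m, x != 0 -> (ldl ((cR U)^T *m G *m cR U))`_0 <= qf G (cR x)].
Proof.
elim: m G => [|m IH] G pG.
  exists 1%:M, 1%:M; split; rewrite ?mulmx1 // => x.
  by case/eqP; apply/matrixP => -[].
have [L [uL hL]] := min_column pG.
have VL : invmx L *m L = 1%:M by rewrite mulVmx.
pose G1 : 'M[R]_(1 + m) := (cR L)^T *m G *m cR L.
have pG1 : pdef G1 by exact: pdef_unimod pG VL.
have d1 : G1 0 0 = qf G (cR (col 0 L)).
  by rewrite -qf_delta /G1 -qf_mulmx -cR_delta -map_mxM -colE.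
have min1 (x : 'cV[int]_m.+1) : x != 0 -> G1 0 0 <= qf G1 (cR x).
  move=> x0; rewrite /G1 d1 -qf_mulmx -map_mxM; apply: hL; apply: contra x0 => /eqP h.
  by rewrite -[x]mul1mx -VL -mulmxA h mulmx0.
have pS := schur_pdef pG1.
have [U2 [V2 [UV VU hz hm]]] := IH _ pS.
pose P : 'M[int]_(1 + m) := block_mx 1%:M 0 0 U2.
pose P' : 'M[int]_(1 + m) := block_mx 1%:M 0 0 V2.
have PP' : P *m P' = 1%:M.
  by rewrite /P /P' mulmx_block !mul1mx !mul0mx !mulmx0 !addr0 !add0r UV -scalar_mx_block.
have P'P : P' *m P = 1%:M by exact: mulmx1C.
have PR : cR P = block_mx 1%:M 0 0 (cR U2) by rewrite /P map_block_mx map_mx1 !map_mx0.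
have GE : (cR (L *m P))^T *m G *m cR (L *m P) = (cR P)^T *m G1 *m cR P.
  by rewrite map_mxM trmx_mul /G1 !mulmxA.
have [e1 e2] := schur_block G1 (cR U2); rewrite -PR in e1 e2.
have lE : ldl ((cR P)^T *m G1 *m cR P) = G1 0 0 :: ldl ((cR U2)^T *m schur G1 *m cR U2).
  by rewrite [LHS]/= e1 e2.
exists (L *m P), (P' *m invmx L); split.
- by rewrite mulmxA -(mulmxA L) PP' mulmx1 mulmxV.
- by rewrite mulmxA -(mulmxA P') VL mulmx1 P'P.
- rewrite GE lE => -[|i] /= hi; last exact: hz.
  move: hi; rewrite ltnS => m0.
  have m1 : (0 < m)%N by move: m0; rewrite size_ldl.
  pose i0 := Ordinal m1.
  have -> : (ldl ((cR U2)^T *m schur G1 *m cR U2))`_0 = qf (schur G1) (cR (col i0 U2)).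
    by rewrite (ldl_head _ (erefl : val i0 = 0%N)) -qf_delta -qf_mulmx -cR_delta -map_mxM -colE.
  have x0 : col i0 U2 != 0.
    apply/eqP => h; have := congr1 (fun X : 'M[int]_m => X i0 i0) VU.
    rewrite !mxE eqxx big1 => [/eqP|i _]; first by rewrite eq_sym oner_eq0.
    by have /matrixP /(_ i 0) := h; rewrite !mxE => ->; rewrite mulr0.
  have [n hn] := round_half (dotp (brow G1) (cR (col i0 U2))).
  have := min1 (cv n (col i0 U2)); rewrite map_cv qf_split; last 2 first.
  + by case: pG1.
  + by rewrite gt_eqF // pdef_d.
  have : cv n (col i0 U2) != 0.
    by apply: contra x0 => /eqP /(congr1 (@tl _ _)); rewrite tl_cv /tl linear0 => ->.
  move=> -> /(_ isT); have := pdef_d pG1; set D := G1 0 0; set q := qf _ _; set b := (_ + _) ^+ 2 in hn *.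
  nra.
- by rewrite GE lE /= d1.
Qed.

Lemma ldl_sub m a (h : (a <= m)%N) (G : 'M[R]_m) :
  ldl (mxsub (widen_ord h) (widen_ord h) G) = take a (ldl G).
Proof.
elim: m a h G => [|m IH] [|a] h G //=.
rewrite mxE; congr (G _ _ :: _); try exact: val_inj.
have h' : (a <= m)%N by [].
rewrite -(IH a h'); congr ldl; apply/matrixP => i j.
rewrite (schurE (mxsub (widen_ord h) (widen_ord h) G : 'M[R]_(1 + a)) i j) [RHS]mxE (schurE (G : 'M[R]_(1 + m))) !mxE.
have w0 : widen_ord h 0 = 0 :> 'I_m.+1 by apply: val_inj.
have wr (k : 'I_a) : widen_ord h (rshift 1 k) = rshift 1 (widen_ord h' k) by apply: val_inj.
by rewrite w0 !wr.
Qed.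

(** Cauchy-Binet before grouping: the sum runs over all maps, and those that are not injective give
    a determinant with equal rows. *)
Lemma det_mul_expand a m (X : 'M[R]_(a, m)) (P : 'M[R]_(m, a)) :
  \det (X *m P) = \sum_(phi : {ffun 'I_a -> 'I_m}) (\prod_j X j (phi j)) * \det (\matrix_(i, j) P (phi i) j).
Proof.
rewrite /determinant.
under eq_bigr => s _ do under eq_bigr => i _ do rewrite mxE.
under eq_bigr => s _ do rewrite bigA_distr_bigA mulr_sumr /=.
rewrite exchange_big /=; apply: eq_bigr => phi _; rewrite mulr_sumr; apply: eq_bigr => s _.
rewrite big_split /= mulrCA; congr (_ * (_ * _)).
by apply: eq_bigr => i _; rewrite mxE.
Qed.

Lemma det_integral a m (X P : 'M[int]_(m, a)) (f : 'I_m -> nat) (F : nat) : (forall i, 0 < f i)%N ->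
  (forall phi : 'I_a -> 'I_m, injective phi -> (\prod_j f (phi j) %| F)%N) ->
  exists k : int, F%:R * \det ((cR X)^T *m (diag_mx (\row_i (f i)%:R^-1) *m cR P)) = k%:~R.
Proof.
move=> f0 hF; rewrite mulmxA det_mul_expand mulr_sumr.
pose K (phi : {ffun 'I_a -> 'I_m}) : int :=
  (F %/ \prod_j f (phi j))%N%:Z * (\prod_j X (phi j) j) * \det (\matrix_(i, j) P (phi i) j).
exists (\sum_(phi : {ffun 'I_a -> 'I_m}) (if injectiveb phi then K phi else 0)); rewrite rmorph_sum /=; apply: eq_bigr => phi _.
case: injectiveP => [hi|/injectiveP]; last first.
  move=> /injectivePn[i [j ij e]]; rewrite (@determinant_alternate _ _ _ i j) ?mulr0 // => k.
  by rewrite !mxE e.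
have p0 : (0 < \prod_j f (phi j))%N by rewrite prodn_gt0.
have -> : \prod_j ((cR X)^T *m diag_mx (\row_i (f i)%:R^-1)) j (phi j) =
   (\prod_j X (phi j) j)%:~R / (\prod_j f (phi j))%:R :> R.
  rewrite rmorph_prod /= natr_prod -prodfV -big_split /=; apply: eq_bigr => j _.
  by rewrite mul_mx_diag !mxE.
have -> : \det (\matrix_(i, j) (cR P) (phi i) j) = (\det (\matrix_(i, j) P (phi i) j))%:~R :> R.
  by rewrite -det_map_mx; congr (\det _); apply/matrixP => i j; rewrite !mxE.
rewrite /K !intrM -{1}(divnK (hF phi hi)) natrM -[(_ %/ _)%N%:Z%:~R]/((F %/ \prod_j f (phi j))%N%:R).
by field; rewrite pnatr_eq0 -lt0n.
Qed.

(** The image indices outside the top [a] and the top indices outside the image are equally many;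
    every bijection between them raises the index, so divisibility holds factor by factor. *)
Lemma inj_prod_dvd a m (f : 'I_m -> nat) (phi : 'I_a -> 'I_m) : injective phi ->
  (forall i j : 'I_m, (i <= j)%N -> (f i %| f j)%N) ->
  (\prod_j f (phi j) %| \prod_(i < m | (m - a <= i)%N) f i)%N.
Proof.
move=> hi hf; pose A := [set phi j | j : 'I_a]%SET; pose T := [set i : 'I_m | (m - a <= i)%N]%SET.
have -> : (\prod_j f (phi j) = \prod_(i in A) f i)%N by rewrite big_imset //= => i j _ _; exact: hi.
have -> : (\prod_(i < m | (m - a <= i)%N) f i = \prod_(i in T) f i)%N by apply: eq_bigl => i; rewrite inE.
have am : (a <= m)%N by have := leq_card phi hi; rewrite !card_ord.
have cA : #|A| = a by rewrite card_imset // card_ord.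
have cT : #|T| = a.
  have := cardsC T; rewrite card_ord (_ : ~: T = [set i : 'I_m | (i < m - a)%N]%SET); last first.
    by apply/setP => i; rewrite !inE ltnNge.
  have -> : #|[set i : 'I_m | (i < m - a)%N]%SET| = (m - a)%N.
    have h : (m - a <= m)%N by exact: leq_subr.
    rewrite (_ : [set i : 'I_m | (i < m - a)%N]%SET = [set widen_ord h k | k : 'I_(m - a)]%SET).
      by rewrite card_imset ?card_ord // => i j /(congr1 val) /= e; exact: val_inj.
    apply/setP => i; rewrite inE; apply/idP/imsetP => [hi'|[k _ ->]] //=.
    by exists (Ordinal hi') => //; apply: val_inj.
  by lia.
rewrite (bigID (fun i => i \in T)) /= [X in (_ %| X)%N](bigID (fun i => i \in A)) /=.
rewrite (eq_bigl (fun i => (i \in T) && (i \in A))); last by move=> i; rewrite andbC.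
apply: dvdn_mul => //.
have e1 : (\prod_(i in A | i \notin T) f i = \prod_(i in A :\: T) f i)%N by apply: eq_bigl => i; rewrite !inE andbC.
have e2 : (\prod_(i in T | i \notin A) f i = \prod_(i in T :\: A) f i)%N by apply: eq_bigl => i; rewrite !inE andbC.
rewrite e1 e2.
have cc : #|A :\: T| = #|T :\: A|.
  by have := cardsID T A; have := cardsID A T; rewrite finset.setIC cA cT; lia.
rewrite [X in (X %| _)%N]big_enum_val [X in (_ %| X)%N]big_enum_val /=.
rewrite [X in (_ %| X)%N](reindex (cast_ord cc)) /=; last first.
  by exists (cast_ord (esym cc)) => i _; rewrite ?cast_ordK ?cast_ordKV.
elim/big_ind2: _ => // [x1 x2 y1 y2|i _]; first exact: dvdn_mul.
apply: hf; apply: ltnW; have := enum_valP i; have := enum_valP (cast_ord cc i).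
rewrite !inE => /andP[_ h1] /andP[h2 _]; apply: leq_trans h1; by rewrite ltnNge.
Qed.

(* a positive determinant with denominator dividing [F] is at least [1 / F] *)
Lemma ldl_lower m (G : 'M[R]_m) (M U V : 'M[int]_m) (f : 'I_m -> nat) a : pdef G ->
  G = diag_mx (\row_i (f i)%:R^-1) *m cR M -> V *m U = 1%:M ->
  (forall i, 0 < f i)%N -> (forall i j : 'I_m, (i <= j)%N -> (f i %| f j)%N) -> (a <= m)%N ->
  1 <= (\prod_(i < m | (m - a <= i)%N) f i)%N%:R * \prod_(d <- take a (ldl ((cR U)^T *m G *m cR U))) d.
Proof.
move=> pG GE VU f0 hf am; have pH := pdef_unimod pG VU.
set H := (cR U)^T *m G *m cR U in pH *.
pose W : 'M[int]_(m, a) := colsub (widen_ord am) U.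
have HE : mxsub (widen_ord am) (widen_ord am) H = (cR W)^T *m G *m cR W.
  apply/matrixP => i j; rewrite !mxE; apply: eq_bigr => k _; rewrite !mxE; congr (_ * _).
  by apply: eq_bigr => l _; rewrite !mxE.
have pW : pdef (mxsub (widen_ord am) (widen_ord am) H).
  rewrite HE; apply: pdef_cong => // x Wx.
  pose I : 'M[R]_(m, a) := colsub (widen_ord am) 1%:M.
  have WI : cR W = cR U *m I by rewrite /I mulmx_colsub mulmx1 /W map_mxsub.
  have Ix : I *m x = 0.
    move: Wx; rewrite WI -mulmxA => h.
    by rewrite -[_ *m x]mul1mx -(map_mx1 (intr : {rmorphism int -> R})) -VU map_mxM -mulmxA h mulmx0.
  apply/matrixP => i j; have /matrixP /(_ (widen_ord am i) j) := Ix.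
  rewrite !mxE (bigD1 i) //= big1 => [|k ki]; first by rewrite !mxE eqxx mul1r addr0.
  rewrite !mxE (_ : (widen_ord am i == widen_ord am k) = false) ?mul0r //.
  by apply/negbTE; apply: contra ki => /eqP/(congr1 val)/= e; apply/eqP/val_inj.
rewrite -ldl_sub -det_ldl // HE GE -!mulmxA -map_mxM.
have [k hk] := @det_integral a m W (M *m W) f (\prod_(i < m | (m - a <= i)%N) f i) f0 (fun phi hi => inj_prod_dvd hi hf).
rewrite hk -[1]/(1%:~R) ler_int -gtz0_ge1 -(ltr0z R) -hk mulr_gt0 //.
  by rewrite ltr0n prodn_gt0.
by move/det_gt0: pW; rewrite HE GE -!mulmxA -map_mxM.
Qed.

End Reduce.

(** * Local exponents *)

Section Jordan.
Variables (p m : nat) (Q : 'M[int]_m) (A B : 'M[int]_m) (e : 'I_m -> nat).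
Hypothesis pp : prime p.
Hypothesis eQ : evsym Q.
Hypothesis uA : A \in unitmx.
Hypothesis uB : B \in unitmx.
Hypothesis QE : Q = A *m diagZ e *m B.

(* columns of a p-adically unimodular matrix stay independent mod p, but lie in
   the span of the coordinates with [p^j | e_k] *)
Lemma indep_count (U : 'M[padic_int p]_m) (S : {set 'I_m}) j : invertible_mx U -> (0 < j)%N ->
  (forall i k, i \in S -> ((p ^ j)%:Z %| (Q *m resm j U) k i)%Z) ->
  (#|S| <= #|[set k : 'I_m | (p ^ j %| e k)%N]%SET|)%N.
Proof.
move=> [V [UV VU]] j0 hS.
pose f (x : int) : 'F_p := x%:~R.
have f0 (x : int) : (p%:Z %| x)%Z -> f x = 0.
  move=> /dvdzP[y ->]; rewrite /f intrM -[(p%:Z)%:~R]/(p%:R) -(Fp_nat_mod pp) modnn mulr0 //.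
pose W := map_mx f (B *m resm j U).
have pj : (p%:Z %| (p ^ j)%:Z)%Z by rewrite dvdzE /= dvdn_exp.
have uW : W \in unitmx.
  have VU1 : mcong p%:Z (resm j V *m resm j U) 1%:M.
    apply: (mcong_dvd pj); have one : mcong (p ^ j)%:Z (resm j (1%:M : 'M[padic_int p]_m)) 1%:M.
      move=> i k; rewrite !mxE; case: eqP => _; rewrite ?mulr1n ?mulr0n ?padic0 ?subrr ?dvdz0 //.
      by have := @padic_int_cast p 1 j.
    by rewrite -VU in one; exact: mcong_trans (mcong_sym (resmM j V U)) one.
  have fM n1 n2 n3 (X : 'M[int]_(n1, n2)) (Y : 'M[int]_(n2, n3)) : map_mx f (X *m Y) = map_mx f X *m map_mx f Y.
    exact: (map_mxM (intr : {rmorphism int -> 'F_p})).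
  have f1 : map_mx f (1%:M : 'M[int]_m) = 1%:M by exact: (map_mx1 (intr : {rmorphism int -> 'F_p})).
  have e1 : map_mx f (resm j V) *m map_mx f (resm j U) = 1%:M.
    rewrite -fM -f1; apply/matrixP => i k; rewrite ![map_mx _ _ _ _]mxE; apply/eqP; rewrite -subr_eq0 -rmorphB.
    by apply/eqP/f0; exact: VU1.
  have e2 : map_mx f (invmx B) *m map_mx f B = 1%:M by rewrite -fM mulVmx // f1.
  have : (map_mx f (resm j V) *m map_mx f (invmx B)) *m W = 1%:M.
    by rewrite /W fM mulmxA -(mulmxA (map_mx f (resm j V))) e2 mulmx1 e1.
  by move=> /mulmx1_unit[].
set T := [set k : 'I_m | (p ^ j %| e k)%N]%SET.
have W0 i k : i \in S -> k \notin T -> W k i = 0.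
  move=> iS; rewrite inE => kT; rewrite /W mxE; apply: f0.
  have h : ((p ^ j)%:Z %| (diagZ e *m (B *m resm j U)) k i)%Z.
    have E : diagZ e *m (B *m resm j U) = invmx A *m (Q *m resm j U).
      by rewrite QE -!mulmxA mulKmx.
    by rewrite E mxE; apply: rpred_sum => l _; rewrite dvdz_mull // hS.
  rewrite diagZ_mul in h; move: ((B *m resm j U) k i) h => x; rewrite !dvdzE abszM /= => h.
  apply/negPn/negP => npx.
  have : coprime (p ^ j) `|x| by rewrite coprimeXl // prime_coprime.
  by move=> c; move: h; rewrite Gauss_dvdl // (negbTE kT).
pose X : 'M['F_p]_(#|S|, m) := \matrix_(a, k) W k (enum_val a).
have rX : \rank X = #|S|.
  have -> : X = rowsub (@enum_val _ (mem S)) W^T by apply/matrixP => a k; rewrite !mxE.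
  have fr : row_free W^T by rewrite row_free_unit unitmx_tr.
  apply/eqP; rewrite -/(row_free _); apply/row_freeP.
  pose Y := invmx W^T; exists (Y *m (\matrix_(i, a) ((i == enum_val a)%:R) : 'M['F_p]_(m, #|S|))).
  apply/matrixP => a b; rewrite mulmxA.
  have -> : rowsub (@enum_val _ (mem S)) W^T *m Y = rowsub (@enum_val _ (mem S)) 1%:M.
    by rewrite -[in RHS](mulmxV (_ : W^T \in unitmx)) ?unitmx_tr // -mul_rowsub_mx.
  rewrite !mxE (bigD1 (enum_val a)) //= big1 ?addr0 => [|i ia].
    by rewrite !mxE eqxx mul1r (inj_eq enum_val_inj).
  by rewrite !mxE eq_sym (negbTE ia) mul0r.
(* By [W0] the entries outside [T] vanish, so [X] factors through [#|T|] coordinates and its full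
   row rank is at most [#|T|]. *)
pose Z : 'M['F_p]_(#|S|, #|T|) := \matrix_(a, b) W (enum_val b) (enum_val a).
have XZ : X = Z *m (\matrix_(b, k) ((enum_val b == k)%:R) : 'M['F_p]_(#|T|, m)).
  apply/matrixP => a k; rewrite [LHS]mxE [RHS]mxE.
  have [kT|kT] := boolP (k \in T).
    rewrite (bigD1 (enum_rank_in kT k)) //= big1 ?addr0 => [|b bk].
      by rewrite !mxE enum_rankK_in // eqxx mulr1.
    rewrite !mxE; case: eqP => [E|]; rewrite ?mulr0 //.
    by case/eqP: bk; apply: enum_val_inj; rewrite enum_rankK_in.
  rewrite big1 => [|b _]; first by rewrite W0 // enum_valP.
  rewrite !mxE; case: eqP => [E|]; rewrite ?mulr0 //.
  by move: kT; rewrite -E enum_valP.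
rewrite -[X in (X <= _)%N]rX XZ; apply: leq_trans (mulmx_max_rank _ _) _; exact: leqnn.
Qed.

(** The hypothesis says that the polar form against column [i] of [U] is divisible by $p^j$; testing
    it on [V *m delta_mx k 0], which [U] maps to the k-th unit vector, reads off the entries. *)
Lemma polar_col (U : 'M[padic_int p]_m) (i : 'I_m) (j : nat) :
  (forall x, exists c, qform Q (U *m (x + delta_mx i 0)) = qform Q (U *m x) + qform Q (U *m delta_mx i 0) + (p ^ j)%:R * c) ->
  invertible_mx U -> forall k, ((p ^ j)%:Z %| (Q *m resm j U) k i)%Z.
Proof.
move=> h [V [UV VU]] k.
have tA := tf2_padic pp.
have E x : exists c, dotp (U *m x) (map_mx intr Q *m (U *m delta_mx i 0)) = (p ^ j)%:R * c.
  have [c hc] := h x; exists c; move: hc; rewrite mulmxDr (qformD tA) //.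
  by move/addrI.
have [c] := E (V *m delta_mx k 0); rewrite mulmxA UV mul1mx /dotp trmx_delta -rowE mxE -colE.
have -> : map_mx intr Q *m col i U = col i (map_mx intr Q *m U) by rewrite !colE mulmxA.
rewrite mxE => E1.
have h1 : mcong (p ^ j)%:Z (resm j (map_mx intr Q *m U)) (Q *m resm j U).
  apply: mcong_trans (resmM j _ _) _; apply: mcongM; [exact: resm_int|exact: mcong_refl].
have := h1 k i; rewrite [X in (_ %| X - _)%Z]mxE E1.
rewrite -rpredN opprB => h2; rewrite -(subrK (((p ^ j)%:R * c : padic_int p) j) ((Q *m resm j U) k i)) rpredD //.
rewrite -(subrK ((((p ^ j)%:R : padic_int p) j) * c j) (((p ^ j)%:R * c : padic_int p) j)) rpredD ?padicM // dvdz_mulr //.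
have := @padic_int_cast p (p ^ j)%:Z j; rewrite -[((p ^ j)%:Z)%:~R]/((p ^ j)%:R).
by move=> h3; rewrite -(subrK (p ^ j)%:Z (((p ^ j)%:R : padic_int p) j)) rpredD.
Qed.
End Jordan.

Section JordanForms.
Variables (m : nat) (Q : 'M[int]_m).

Lemma coordnD (A : comPzRingType) (x y : 'cV[A]_m) k : coordn (x + y) k = coordn x k + coordn y k.
Proof. by rewrite /coordn; case: insub => [i|] /=; rewrite ?mxE ?addr0. Qed.

Lemma coordn_delta (A : comPzRingType) (i : 'I_m) k : coordn (delta_mx i 0 : 'cV[A]_m) k = (k == i :> nat)%:R.
Proof.
rewrite /coordn; case: insubP => [j _ <-|h] /=; first by rewrite mxE eqxx andbT -val_eqE.
by case: eqP => // E; move: h; rewrite E ltn_ord.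
Qed.

Lemma sum_multiple (A : comPzRingType) (P : A) (F : nat -> A) a b : (forall i, exists c, F i = P * c) ->
  exists c, \sum_(a <= i < b) F i = P * c.
Proof.
move=> h; elim/big_ind: _ => [|x y [c ->] [d ->]|i _]; last exact: h.
  by exists 0; rewrite mulr0.
by exists (c + d); rewrite mulrDr.
Qed.

Lemma odd_polar p (nu : nat -> nat) (U : 'M[padic_int p]_m) (u : nat -> padic_int p) (i : 'I_m) j : (j <= nu i)%N ->
  (forall x, qform Q (U *m x) = \sum_(0 <= k < m) (p ^ nu k)%:R * u k * coordn x k ^+ 2) ->
  forall x, exists c, qform Q (U *m (x + delta_mx i 0)) = qform Q (U *m x) + qform Q (U *m delta_mx i 0) + (p ^ j)%:R * c.
Proof.
move=> ji h x; rewrite !h -big_split /=.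
pose F (k : nat) : padic_int p := (p ^ nu k)%:R * u k * (coordn x k * (k == i :> nat)%:R) *+ 2.
have [k|c hc] := @sum_multiple _ ((p ^ j)%:R : padic_int p) F 0 m.
  rewrite /F; case: eqP => [->|_]; last by exists 0; rewrite !mulr0 mul0rn.
  exists ((p ^ (nu i - j))%:R * u i * coordn x i *+ 2).
  by rewrite mulr1 -[in LHS](subnKC ji) expnD natrM; ring.
exists c; rewrite -hc -big_split /=; apply: eq_bigr => k _.
by rewrite coordnD coordn_delta /F; case: (_ == _); ring.
Qed.

(** A binary block couples only the coordinates [2k] and [2k+1], which share the exponent [nut k]; a
    block with exponent below [j] therefore does not involve the coordinate [i]. *)
Lemma two_polar (nu : nat -> nat) r2 (r1 : nat) (nut : nat -> nat) (U : 'M[padic_int 2]_m) (u : nat -> padic_int 2) (i : 'I_m) j :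
  (r1 <= r2)%N -> (r2.*2 <= m)%N -> (forall j, (j < r2)%N -> nu j.*2 = nut j /\ nu j.*2.+1 = nut j) ->
  (forall x, let c := coordn x in
          qform Q (U *m x) =
            \sum_(0 <= i < r1)
               (2 ^ nut i)%:R *
               (c i.*2 ^+ 2 + c i.*2 * c i.*2.+1 + c i.*2.+1 ^+ 2) +
            \sum_(r1 <= i < r2) (2 ^ nut i)%:R * (c i.*2 * c i.*2.+1) +
            \sum_(r2.*2 <= i < m) (2 ^ nu i)%:R * u i * c i ^+ 2) ->
  (j <= nu i)%N ->
  forall x, exists c, qform Q (U *m (x + delta_mx i 0)) = qform Q (U *m x) + qform Q (U *m delta_mx i 0) + (2 ^ j)%:R * c.
Proof.
move=> r12 r2m hn h ji x.
pose d := coordn (delta_mx i 0 : 'cV[padic_int 2]_m).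
have dE k : d k = (k == i :> nat)%:R by exact: coordn_delta.
pose c := coordn x.
(* [F1], [F2] and [F3] are the cross terms of the three kinds of summands. *)
pose F1 k : padic_int 2 := (2 ^ nut k)%:R * (c k.*2 * d k.*2 *+ 2 + c k.*2 * d k.*2.+1 + d k.*2 * c k.*2.+1 + c k.*2.+1 * d k.*2.+1 *+ 2).
pose F2 k : padic_int 2 := (2 ^ nut k)%:R * (c k.*2 * d k.*2.+1 + d k.*2 * c k.*2.+1).
pose F3 k : padic_int 2 := (2 ^ nu k)%:R * u k * (c k * d k) *+ 2.
have pw n : (j <= n)%N -> (2 ^ n)%:R = (2 ^ j)%:R * (2 ^ (n - j))%:R :> padic_int 2.
  by move=> jn; rewrite -natrM -expnD subnKC.
have z k : (k < r2)%N -> (nut k < j)%N -> d k.*2 = 0 /\ d k.*2.+1 = 0.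
  move=> k2 kj; have [e1 e2] := hn k k2; rewrite !dE; split; case: eqP => // E; move: ji; rewrite -E ?e1 ?e2 leqNgt kj //.
have m12 (F : nat -> padic_int 2) (a b : nat) (G : nat -> padic_int 2) : (b <= r2)%N ->
   (forall k, F k = (2 ^ nut k)%:R * G k) -> (forall k, d k.*2 = 0 -> d k.*2.+1 = 0 -> G k = 0) ->
   exists c, \sum_(a <= k < b) F k = (2 ^ j)%:R * c.
  move=> br hF hG; rewrite big_nat_cond; elim/big_ind: _ => [|y y' [w ->] [w' ->]|k /andP[/andP[_ kb] _]].
  - by exists 0; rewrite mulr0.
  - by exists (w + w'); rewrite mulrDr.
  have [kj|kj] := ltnP (nut k) j.
    by have [z1 z2] := z k (leq_trans kb br) kj; exists 0; rewrite hF hG // !mulr0.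
  by exists ((2 ^ (nut k - j))%:R * G k); rewrite hF pw // mulrA.
have g1 k : d k.*2 = 0 -> d k.*2.+1 = 0 -> c k.*2 * d k.*2 *+ 2 + c k.*2 * d k.*2.+1 + d k.*2 * c k.*2.+1 + c k.*2.+1 * d k.*2.+1 *+ 2 = 0.
  by move=> -> ->; rewrite !mulr0 !mul0r !mul0rn !addr0.
have g2 k : d k.*2 = 0 -> d k.*2.+1 = 0 -> c k.*2 * d k.*2.+1 + d k.*2 * c k.*2.+1 = 0.
  by move=> -> ->; rewrite !mulr0 !mul0r !addr0.
have [c1 h1] := m12 F1 0%N r1 (fun k => c k.*2 * d k.*2 *+ 2 + c k.*2 * d k.*2.+1 + d k.*2 * c k.*2.+1 + c k.*2.+1 * d k.*2.+1 *+ 2) r12 (fun=> erefl) g1.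
have [c2 h2] := m12 F2 r1 r2 (fun k => c k.*2 * d k.*2.+1 + d k.*2 * c k.*2.+1) (leqnn _) (fun=> erefl) g2.
have [k|c3 h3] := @sum_multiple _ ((2 ^ j)%:R : padic_int 2) F3 r2.*2 m.
  rewrite /F3 dE; case: eqP => [->|_]; last by exists 0; rewrite !mulr0 mul0rn.
  by exists ((2 ^ (nu i - j))%:R * u i * c i *+ 2); rewrite mulr1 (pw (nu i)) //; ring.
exists (c1 + c2 + c3); rewrite !mulrDr -h1 -h2 -h3 !h /= -/c -/d.
have s1 : \sum_(0 <= k < r1) (2 ^ nut k)%:R * (coordn (x + delta_mx i 0) k.*2 ^+ 2 + coordn (x + delta_mx i 0) k.*2 * coordn (x + delta_mx i 0) k.*2.+1 + coordn (x + delta_mx i 0) k.*2.+1 ^+ 2) =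
   \sum_(0 <= k < r1) (2 ^ nut k)%:R * (c k.*2 ^+ 2 + c k.*2 * c k.*2.+1 + c k.*2.+1 ^+ 2) +
   \sum_(0 <= k < r1) (2 ^ nut k)%:R * (d k.*2 ^+ 2 + d k.*2 * d k.*2.+1 + d k.*2.+1 ^+ 2) + \sum_(0 <= k < r1) F1 k.
  by rewrite -!big_split /=; apply: eq_bigr => k _; rewrite !coordnD -/(c _) -/(c _) -/(d _) -/(d _) /F1; ring.
have s2 : \sum_(r1 <= k < r2) (2 ^ nut k)%:R * (coordn (x + delta_mx i 0) k.*2 * coordn (x + delta_mx i 0) k.*2.+1) =
   \sum_(r1 <= k < r2) (2 ^ nut k)%:R * (c k.*2 * c k.*2.+1) + \sum_(r1 <= k < r2) (2 ^ nut k)%:R * (d k.*2 * d k.*2.+1) + \sum_(r1 <= k < r2) F2 k.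
  by rewrite -!big_split /=; apply: eq_bigr => k _; rewrite !coordnD -/(c _) -/(c _) -/(d _) -/(d _) /F2; ring.
have s3 : \sum_(r2.*2 <= k < m) (2 ^ nu k)%:R * u k * coordn (x + delta_mx i 0) k ^+ 2 =
   \sum_(r2.*2 <= k < m) (2 ^ nu k)%:R * u k * c k ^+ 2 + \sum_(r2.*2 <= k < m) (2 ^ nu k)%:R * u k * d k ^+ 2 + \sum_(r2.*2 <= k < m) F3 k.
  by rewrite -!big_split /=; apply: eq_bigr => k _; rewrite coordnD -/(c _) -/(d _) /F3; ring.
rewrite s1 s2 s3; ring.
Qed.

(** One inequality suffices because [Ffactor] occurs in denominators only. *)
Lemma vcount_le nu r2 (A B : 'M[int]_m) (e : 'I_m -> nat) p j : evsym Q -> local_exponents Q nu r2 ->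
  A \in unitmx -> B \in unitmx -> Q = A *m diagZ e *m B -> prime p -> (0 < j)%N ->
  (vcount m nu p j <= #|[set k : 'I_m | (p ^ j %| e k)%N]%SET|)%N.
Proof.
move=> eQ [ho ht] uA uB QE pp j0; have [p2|po] := eqVneq p 2%N.
  subst p; have [r1 [nut [U [u [/andP[r12 r2m] hn iU _ hq]]]]] := ht.
  rewrite /vcount; apply: (indep_count pp uA uB QE iU j0) => i k; rewrite inE => ji.
  exact: (polar_col pp eQ (two_polar r12 r2m hn hq ji) iU).
have op : odd p by case: (even_prime pp) => // E; rewrite E in po.
have [U [u [iU _ hq]]] := ho p pp op.
rewrite /vcount; apply: (indep_count pp uA uB QE iU j0) => i k; rewrite inE => ji.
exact: (polar_col pp eQ (odd_polar ji hq) iU).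
Qed.
End JordanForms.

(** * Nonnegative sums over images and fibres *)

Section AsumMore.
Variable R : realType.

Lemma asum_seq (I : choiceType) (u : I -> R) M (s : seq I) : asum u M -> uniq s -> \sum_(i <- s) u i <= M.
Proof. by move=> [u0 h] us; rewrite (uniq_fset_sum _ us); exact: h. Qed.

Lemma asum_of_seq (I : choiceType) (u : I -> R) M : (forall i, 0 <= u i) ->
  (forall s : seq I, uniq s -> \sum_(i <- s) u i <= M) -> asum u M.
Proof. by move=> u0 h; split=> // A; apply: h; exact: fset_uniq. Qed.

Lemma asum_image (I J : choiceType) (h : J -> I) (u : I -> R) M : (forall i, 0 <= u i) ->
  (forall i, u i != 0 -> exists j, h j = i) -> asum (u \o h) M -> asum u M.
Proof.
move=> u0 hu hM; apply: asum_of_seq => // s us.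
pose g i := if pselect (exists j, h j = i) is left e then Some (projT1 (cid e)) else None.
have hg i j : g i = Some j -> h j = i.
  by rewrite /g; case: pselect => // e [<-]; case: cid.
have gn i : g i = None -> u i = 0.
  by rewrite /g; case: pselect => // e _; apply/eqP/negPn/negP => /hu.
have -> : \sum_(i <- s) u i = \sum_(j <- pmap g s) (u \o h) j.
  elim: s {us} => [|i s IH]; first by rewrite !big_nil.
  rewrite big_cons IH /=; case E: (g i) => [j|] /=; first by rewrite big_cons /= (hg _ _ E).
  by rewrite (gn _ E) add0r.
apply: asum_seq hM _.
elim: s us => //= i s IH /andP[si /IH us]; case E: (g i) => [j|] //=; rewrite us andbT.
apply/negP; rewrite mem_pmap => /mapP[i' si' /esym E'].
by move: si; rewrite -(hg _ _ E) (hg _ _ E') si'.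
Qed.

Lemma asum_fiber (I J : choiceType) (f : I -> J) (u : I -> R) (v : J -> R) M : (forall i, 0 <= u i) ->
  (forall j (s : seq I), uniq s -> (forall i, i \in s -> f i = j) -> \sum_(i <- s) u i <= v j) ->
  asum v M -> asum u M.
Proof.
move=> u0 hf hv; apply: asum_of_seq => // s us.
have -> : \sum_(i <- s) u i = \sum_(j <- undup (map f s)) \sum_(i <- s | f i == j) u i.
  rewrite (exchange_big_dep xpredT) //= big_seq [RHS]big_seq; apply: eq_bigr => i si.
  rewrite big_mkcond (bigD1_seq (f i)) ?undup_uniq ?mem_undup ?map_f //= eqxx big1 ?addr0 //.
  by move=> j /negbTE h; rewrite eq_sym h.
apply: le_trans (asum_seq hv (undup_uniq (map f s))); apply: ler_sum => j _.
rewrite -big_filter; apply: hf; first exact: filter_uniq.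
by move=> i; rewrite mem_filter => /andP[/eqP].
Qed.

Lemma asum_nat_lin (k : R) : 1 <= k -> asum (fun l : nat => l.+1%:R * expR (- (k * l%:R))) 16.
Proof.
move=> k1.
have e (l : nat) : l.+1%:R * expR (- (k * l%:R)) <= 2 * expR (- (1 / 2 * l%:R)).
  have l0 : 0 <= l%:R :> R by [].
  have h : 1 + 1 / 2 * l%:R <= expR (1 / 2 * l%:R) :> R by exact: expR_ge1Dx.
  have -> : expR (- (1 / 2 * l%:R)) = expR (1 / 2 * l%:R) * expR (- l%:R) :> R.
    by rewrite -expRD; congr expR; field.
  rewrite mulrA; apply: ler_pM; rewrite ?expR_ge0 //.
    by rewrite -natr1; move: h; set E := expR _; lra.
  by rewrite ler_expR lerN2 ler_peMl.
have h2 : 0 < 1 / 2 :> R by rewrite divr_gt0.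
have := asumZ (ler0n R 2) (asum_expR_nat h2) => H.
have H2 := asum_le (fun l => introT andP (conj (mulr_ge0 (ler0n R l.+1) (expR_ge0 (- (k * l%:R)))) (e l))) H.
apply: asum_leM H2; lra.
Qed.

End AsumMore.

(** * Counting lattice vectors *)

Section Slice.
Variables (R : realType) (m : nat).
Local Notation cR := (map_mx (intr : int -> R)).
Variables (Bi L : 'M[int]_m.+2) (N : nat) (y0 : 'cV[int]_m.+2).
Hypothesis eB : evsym Bi.
Hypothesis pB : pdef (cR Bi).
Hypothesis N0 : (0 < N)%N.
Hypothesis uL : cR L \in unitmx.
(** The Gram matrix of the dual form in the basis [L], as [Bi] will be $NQ^{-1}$. *)
Let G : 'M[R]_m.+2 := N%:R^-1 *: ((cR L)^T *m cR Bi *m cR L).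
Let qB (y : 'cV[int]_m.+2) : int := qform Bi y.
Let x0 := invmx (cR L) *m cR y0.
Let dd := ldl G.
Let NR : 0 < N%:R :> R. Proof. by rewrite ltr0n. Qed.
Let Nn : N%:R != 0 :> R. Proof. by rewrite gt_eqF. Qed.

Lemma slice_pdef : pdef G.
Proof.
have h : pdef ((cR L)^T *m cR Bi *m cR L).
  by apply: pdef_cong pB _ => x Lx; rewrite -[x](mulKmx uL) Lx mulmx0.
case: h => s p; split.
  by move: s; rewrite /G; move: (_ *m _) => M s; apply/matrixP => i j; rewrite !mxE -{1}s mxE.
move=> x x0'; have -> : qf G x = N%:R^-1 * qf ((cR L)^T *m cR Bi *m cR L) x.
  by rewrite !qfE /G -scalemxAl dotpZr.
by rewrite mulr_gt0 ?invr_gt0 // p.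
Qed.

Lemma slice_qf (X : 'cV[R]_m.+2) : qf (cR Bi) (cR y0 + cR L *m X) = N%:R * qf G (X + x0).
Proof.
have -> : cR y0 + cR L *m X = cR L *m (X + x0) by rewrite mulmxDr /x0 mulKVmx // addrC.
by rewrite qf_mulmx [in RHS]qfE /G -scalemxAl dotpZr -qfE mulrA mulfV // mul1r.
Qed.

Lemma slice_q k : (qB (y0 + L *m k))%:~R / N%:R = qf G (cR k + x0) / 2 :> R.
Proof.
have := slice_qf (cR k); rewrite -map_mxM -map_mxD qf_cast -(qform2i _ eB) rmorphMn /= -/(qB _) => h.
by apply: (mulfI Nn); rewrite mulrCA mulfV // mulr1 mulrA -h mulr2n; field.
Qed.

Lemma slice_total kap : 0 < kap ->
  asum (fun k => expR (- (kap * ((qB (y0 + L *m k))%:~R / N%:R)))) (\prod_(d <- dd) gbound (kap / 2) d).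
Proof.
move=> k0; have k2 : 0 < kap / 2 by rewrite divr_gt0.
have := asum_gauss x0 slice_pdef k2; have -> // : (fun x => expR (- (kap / 2 * qf G (cR x + x0)))) =
  (fun k => expR (- (kap * ((qB (y0 + L *m k))%:~R / N%:R)))).
by apply/funext => k; rewrite slice_q; congr expR; field.
Qed.

Let G1 : 'M[R]_m.+1 := @schur R m.+1 G.
Let G2 : 'M[R]_m := @schur R m G1.
Let d1 : R := dd`_0.
Let d2 : R := dd`_1.
Let tail := behead (behead dd).
Let pG := slice_pdef.
Let pG1 : pdef G1 := @schur_pdef R m.+1 G pG.
Let pG2 : pdef G2 := @schur_pdef R m G1 pG1.
Let d10 : 0 < d1. Proof. exact: (@pdef_d R m.+1 G pG). Qed.
Let d20 : 0 < d2. Proof. exact: (@pdef_d R m G1 pG1). Qed.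

Lemma slice_split (a b : R) (x : 'cV[R]_m) : exists be ga, qf G (cv a (cv b x : 'cV[R]_(1 + m)) : 'cV[R]_(1 + m.+1)) =
   d1 * (a + be) ^+ 2 + d2 * (b + ga) ^+ 2 + qf G2 x.
Proof.
exists (dotp (@brow R m.+1 G) (cv b x)), (dotp (@brow R m G1) x).
rewrite (@qf_split R m.+1 G a (cv b x) pG.1); last by rewrite gt_eqF // (@pdef_d R m.+1 G pG).
rewrite (@qf_split R m G1 b x pG1.1); last by rewrite gt_eqF // (@pdef_d R m G1 pG1).
by rewrite addrA.
Qed.

Let v1 : 'cV[int]_m.+2 := L *m (cv 1 0 : 'cV[int]_(1 + m.+1)).
Let v2 : 'cV[int]_m.+2 := L *m (cv 0 (cv 1 0 : 'cV[int]_(1 + m)) : 'cV[int]_(1 + m.+1)).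
Let zz (x : 'cV[int]_m) : 'cV[int]_m.+2 := y0 + L *m (cv 0 (cv 0 x : 'cV[int]_(1 + m)) : 'cV[int]_(1 + m.+1)).

Lemma cvZ (A : comPzRingType) p (k a : A) (x : 'cV[A]_p) : k *: cv a x = cv (k * a) (k *: x).
Proof. by rewrite /cv scale_col_mx scale_scalar_mx. Qed.

Lemma slice_y (a b : int) (x : 'cV[int]_m) :
  y0 + L *m (cv a (cv b x : 'cV[int]_(1 + m)) : 'cV[int]_(1 + m.+1)) = zz x + a *: v1 + b *: v2.
Proof.
rewrite /zz /v1 /v2 !scalemxAr -!addrA -!mulmxDr; congr (_ + _ *m _).
by rewrite !cvZ !cvD !scaler0 !mulr0 !mulr1 !addr0 !add0r !cvD !addr0 !add0r.
Qed.

(** For a fixed tail [x] the form is a quadratic polynomial in the first two coordinates; its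
    leading part [pa], [pb], [pc] does not depend on [x]. *)
Let pa := qB v1.
Let pb := dotp v1 (Bi *m v2).
Let pc := qB v2.
Let pd x := dotp v1 (Bi *m zz x).
Let pe x := dotp v2 (Bi *m zz x).
Let pq x := qB (zz x).

Lemma slice_poly (A : comPzRingType) (tA : tf2 A) x (s t : A) :
  qform Bi (map_mx intr (zz x) + s *: map_mx intr v1 + t *: map_mx intr v2) =
  pa%:~R * s ^+ 2 + pb%:~R * s * t + pc%:~R * t ^+ 2 + (pd x)%:~R * s + (pe x)%:~R * t + (pq x)%:~R.
Proof.
rewrite (qformD tA) // (qformD tA) // !qformZ !qform_cast -/pa -/pc -/(pq x).
rewrite -!scalemxAr -!map_mxM !dotpDl !dotpZl !dotpZr !dotp_cast.
have -> : dotp (zz x) (Bi *m v1) = pd x by rewrite dotp_mul eB.1 dotpC.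
have -> : dotp (zz x) (Bi *m v2) = pe x by rewrite dotp_mul eB.1 dotpC.
by rewrite -/pb; ring.
Qed.

Lemma slice_poly_int x (a b : int) : qB (y0 + L *m (cv a (cv b x : 'cV[int]_(1 + m)) : 'cV[int]_(1 + m.+1))) =
  pa * a ^+ 2 + pb * a * b + pc * b ^+ 2 + pd x * a + pe x * b + pq x.
Proof. by rewrite slice_y /qB; have := slice_poly tf2_int x a b; rewrite !map_intr_id !intz. Qed.

(** The leading part is compared with its completed square at the points (1,0), (0,1) and (1,1); the
    tail is set to 0. *)
Lemma slice_disc : pa%:~R = N%:R * d1 / 2 :> R /\ (4 * pa * pc - pb ^+ 2)%:~R = N%:R ^+ 2 * (d1 * d2) :> R.
Proof.
have qE (s t : R) : pa%:~R * s ^+ 2 + pb%:~R * s * t + pc%:~R * t ^+ 2 =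
   N%:R / 2 * (d1 * (s + dotp (@brow R m.+1 G) (cv t 0)) ^+ 2 + d2 * t ^+ 2) :> R.
  have -> : pa%:~R * s ^+ 2 + pb%:~R * s * t + pc%:~R * t ^+ 2 = qform Bi (s *: cR v1 + t *: cR v2) :> R.
    rewrite (qformD (@tf2_real R)) // !qformZ !qform_cast -!scalemxAr -!map_mxM dotpZl dotpZr dotp_cast -/pa -/pb -/pc; ring.
  have -> : s *: cR v1 + t *: cR v2 = cR L *m (cv s (cv t 0 : 'cV[R]_(1 + m)) : 'cV[R]_(1 + m.+1)).
    rewrite /v1 /v2 !map_mxM !scalemxAr -mulmxDr; congr (_ *m _).
    rewrite !map_cv !map_mx0 ?mulr1z ?mulr0z !cvZ ?scaler0 ?mulr0 ?mulr1.
    by rewrite cvD ?addr0 ?add0r.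
  apply: (tf2I (@tf2_real R)); rewrite qform2 // qf_mulmx.
  have -> : (cR L)^T *m cR Bi *m cR L = N%:R *: G by rewrite /G scalerA mulfV ?scale1r.
  rewrite qfE -scalemxAl dotpZr -qfE.
  rewrite (@qf_split R m.+1 G s (cv t 0) pG.1); last by rewrite gt_eqF // (@pdef_d R m.+1 G pG).
  rewrite (@qf_split R m G1 t 0 pG1.1); last by rewrite gt_eqF // (@pdef_d R m G1 pG1).
  have -> : dotp (@brow R m G1) (0 : 'cV[R]_m) = 0 by rewrite /dotp mulmx0 mxE.
  have -> : qf (@schur R m G1) (0 : 'cV[R]_m) = 0 by rewrite /qf mulmx0 mxE.
  by rewrite !addr0 mulr2n -[G 0 0]/d1 -[G1 0 0]/d2; field.
have bt t : dotp (@brow R m.+1 G) (cv t (0 : 'cV[R]_m)) = t * dotp (@brow R m.+1 G) (cv 1 (0 : 'cV[R]_m)).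
  by rewrite -dotpZr cvZ mulr1 scaler0.
move: (dotp _ (cv 1 _)) bt => be bt.
have e1 := qE 1 0; have e2 := qE 0 1; have e3 := qE 1 1.
rewrite (bt 0) in e1; rewrite (bt 1) in e2 e3.
have ea : pa%:~R = N%:R * d1 / 2 :> R by lra.
have ec : pc%:~R = N%:R / 2 * (d1 * be ^+ 2 + d2) :> R by lra.
have eb : pb%:~R = N%:R * d1 * be :> R by lra.
split=> //; rewrite rmorphB rmorphXn !rmorphM /= ea ec eb.
by rewrite -[(4 : int)%:~R]/(4 : R); field.
Qed.

(** [(s, t)] is the critical point of the polynomial; the identity expresses the value there through
    the height occurring in [binary_count]. *)
Lemma quad_min_identity (a b c d e q nn : R) : a != 0 -> 4 * a * c - b ^+ 2 != 0 ->
  let t := - (2 * a * e - b * d) / (4 * a * c - b ^+ 2) in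
  let s := - (b * t + d) / (2 * a) in
  4 * a * (4 * a * c - b ^+ 2) * nn - ((2 * a * e - b * d) ^+ 2 + (4 * a * c - b ^+ 2) * (d ^+ 2 - 4 * a * (q - nn))) =
  (4 * a * (4 * a * c - b ^+ 2)) * (a * s ^+ 2 + b * s * t + c * t ^+ 2 + d * s + e * t + q).
Proof. by move=> an Dn t s; rewrite /s /t; field; rewrite an Dn. Qed.

(** The form is nonnegative at the real critical point, so the height is bounded in terms of the
    value [n] alone, uniformly in the tail [x]. *)
Lemma slice_height x (n : int) : 0 < pa -> 0 < 4 * pa * pc - pb ^+ 2 ->
  ((2 * pa * pe x - pb * pd x) ^+ 2 + (4 * pa * pc - pb ^+ 2) * (pd x ^+ 2 - 4 * pa * (pq x - n)))%:~R <=
  4 * (N%:R * d1 / 2) * (N%:R ^+ 2 * (d1 * d2)) * n%:~R :> R.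
Proof.
move=> pa0 D0; have [ea eD] := slice_disc; rewrite -ea -eD.
have paR : 0 < pa%:~R :> R by rewrite ltr0z.
have DR : 0 < (4 * pa * pc - pb ^+ 2)%:~R :> R by rewrite ltr0z.
have h0 (s t : R) : 0 <= pa%:~R * s ^+ 2 + pb%:~R * s * t + pc%:~R * t ^+ 2 + (pd x)%:~R * s + (pe x)%:~R * t + (pq x)%:~R.
  rewrite -(slice_poly (@tf2_real R)); move: (_ + _ + _) => X.
  have : 0 <= qform Bi X *+ 2 :> R.
    rewrite qform2 //; have [->|X0] := eqVneq X 0; first by rewrite /qf mulmx0 mxE.
    by case: pB => _ h; exact/ltW/h.
  by rewrite pmulrn_lge0.
have Dn : (4 * pa * pc - pb ^+ 2)%:~R = 4 * pa%:~R * pc%:~R - pb%:~R ^+ 2 :> R.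
  by rewrite rmorphB rmorphXn !rmorphM.
have Hn : ((2 * pa * pe x - pb * pd x) ^+ 2 + (4 * pa * pc - pb ^+ 2) * (pd x ^+ 2 - 4 * pa * (pq x - n)))%:~R =
  (2 * pa%:~R * (pe x)%:~R - pb%:~R * (pd x)%:~R) ^+ 2 + (4 * pa%:~R * pc%:~R - pb%:~R ^+ 2) * ((pd x)%:~R ^+ 2 - 4 * pa%:~R * ((pq x)%:~R - n%:~R)) :> R.
  by rewrite -Dn !(rmorphB, rmorphD, rmorphM, rmorphXn) /=.
rewrite Hn; rewrite Dn in DR *; rewrite -subr_ge0 quad_min_identity ?gt_eqF //.
by apply: mulr_ge0; [rewrite !mulr_ge0 // ltW|exact: h0].
Qed.

Definition slice_map (p : 'cV[int]_m * (int * int)) : 'cV[int]_m.+2 :=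
  (cv p.2.1 (cv p.2.2 p.1 : 'cV[int]_(1 + m)) : 'cV[int]_(1 + m.+1)).

(** For each tail the admissible values are $r + lN$ with $l \ge 0$, each taken
    $O((H(l+1))^\varepsilon)$ times. Half of the exponent [kap] pays for the sum over [l]; the other
    half, since the value dominates half of [qf G2], becomes [kap / 4] on the tail. *)
Lemma slice_residue eps (C H kap : R) (r : int) : 0 < eps <= 1 -> 0 < C ->
  (forall (a b c d e f : int) (s : seq (int * int)), 0 < a -> 0 < 4 * a * c - b ^+ 2 -> uniq s ->
     (forall x, x \in s -> a * x.1 ^+ 2 + b * x.1 * x.2 + c * x.2 ^+ 2 + d * x.1 + e * x.2 + f = 0) ->
     forall H, 1 <= H -> ((2 * a * e - b * d) ^+ 2 + (4 * a * c - b ^+ 2) * (d ^+ 2 - 4 * a * f))%:~R <= H ->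
     (size s)%:R <= C * H `^ eps) ->
  0 <= r < N%:Z -> 2 <= kap -> 1 <= H -> 2 * N%:R ^+ 4 * d1 ^+ 2 * d2 <= H ->
  asum (fun k => if ((qB (y0 + L *m k) - r) %% N%:Z)%Z == 0 then expR (- (kap * ((qB (y0 + L *m k))%:~R / N%:R))) else 0)
    (16 * C * H `^ eps * \prod_(d <- tail) gbound (kap / 4) d).
Proof.
move=> /andP[e0 e1] C0 hC /andP[r0 rN] k2 H1 HH.
have [ea eD] := slice_disc.
have pa0 : 0 < pa by rewrite -(ltr0z R) ea divr_gt0 // mulr_gt0.
have D0 : 0 < 4 * pa * pc - pb ^+ 2 by rewrite -(ltr0z R) eD mulr_gt0 ?exprn_gt0 // mulr_gt0.
apply: (@asum_image R _ _ slice_map) => [k|k _|].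
- by case: ifP => _ //; exact: expR_ge0.
- exists (@tl _ m (@tl _ m.+1 k), (@hd _ m.+1 k, @hd _ m (@tl _ m.+1 k))).
  by rewrite /slice_map /= !cv_eta.
have k4 : 0 < kap / 4 by lra.
pose x2 := @tl _ m (@tl _ m.+1 x0).
pose v (x : 'cV[int]_m) := 16 * C * H `^ eps * expR (- (kap / 4 * qf G2 (cR x + x2))).
have W0 : 0 <= 16 * C * H `^ eps by rewrite !mulr_ge0 ?powR_ge0 // ltW.
apply: (@asum_prod _ _ _ _ v); last exact: (asumZ W0 (asum_gauss x2 pG2 k4)).
move=> x.
pose q (p : int * int) := qB (y0 + L *m slice_map (x, p)).
have qge p : qf G2 (cR x + x2) / 2 <= (q p)%:~R / N%:R :> R.
  rewrite slice_q /slice_map /= map_cv map_cv -(@cv_eta _ m.+1 x0) -(@cv_eta _ m (@tl _ m.+1 x0)) !cvD.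
  have [be [ga ->]] := slice_split (p.1%:~R + hd x0) (p.2%:~R + hd (tl x0)) (cR x + x2).
  rewrite ler_pM2r ?invr_gt0 // lerDr addr_ge0 // mulr_ge0 ?sqr_ge0 // ltW //.
have q0 p : 0 <= q p.
  have N1 : 0 < N%:R^-1 :> R by rewrite invr_gt0.
  rewrite -(ler0z R) -(pmulr_lge0 _ N1); apply: le_trans (qge p).
  rewrite divr_ge0 //; have [->|X0] := eqVneq (cR x + x2) 0; first by rewrite /qf mulmx0 mxE.
  by case: pG2 => _ h; exact/ltW/h.
pose w (p : int * int) : R := if ((q p - r) %% N%:Z)%Z == 0 then expR (- (kap / 2 * ((q p)%:~R / N%:R))) else 0.
have w0 p : 0 <= w p by rewrite /w; case: ifP => _ //; exact: expR_ge0.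
suff hw : asum w (16 * C * H `^ eps).
  have -> : v x = expR (- (kap / 4 * qf G2 (cR x + x2))) * (16 * C * H `^ eps) by rewrite /v mulrC.
  apply: asum_le (asumZ (expR_ge0 _) hw) => p /=; rewrite -/(q p) /w; case: ifP => _; rewrite ?mulr0 ?lexx // expR_ge0 /= -expRD ler_expR.
  have := qge p; set A := _ / N%:R; set E := qf _ _ => h; nra.
apply: (@asum_fiber R _ nat (fun p => `|((q p - r) %/ N%:Z)%Z|%N) w (fun l => C * H `^ eps * (l.+1%:R * expR (- (kap / 2 * l%:R))))) => //; last first.
  have CH0 : 0 <= C * H `^ eps by rewrite mulr_ge0 ?powR_ge0 // ltW.
  have k1 : 1 <= kap / 2 by lra.
  by rewrite (_ : 16 * C * H `^ eps = C * H `^ eps * 16); [exact: (asumZ CH0 (asum_nat_lin k1))|ring].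
move=> l s us hs.
rewrite (bigID (fun p => ((q p - r) %% N%:Z)%Z == 0)) /= [X in _ + X]big1 ?addr0; last first.
  by move=> p /negbTE hp; rewrite /w hp.
rewrite -big_filter; pose s' := [seq p <- s | ((q p - r) %% N%:Z)%Z == 0]; rewrite -/s'.
have NZ : 0 < N%:Z by [].
have qe p : p \in s' -> q p = r + l%:Z * N%:Z.
  rewrite mem_filter => /andP[/eqP h0 ps].
  have E := divz_eq (q p - r) N%:Z; rewrite h0 addr0 in E.
  have dge : 0 <= ((q p - r) %/ N%:Z)%Z.
    rewrite leNgt; apply/negP; rewrite -lezD1 => lt0.
    have := ler_wpM2r (ltW NZ) lt0; rewrite mulrDl mul0r mul1r -E.
    apply/negP; rewrite -ltNge (_ : q p - r + N%:Z = q p + (N%:Z - r)); last by ring.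
    by rewrite ltr_wpDl // subr_gt0.
  by rewrite -(hs p ps) gez0_abs // -E addrC subrK.
apply: (@le_trans _ _ ((size s')%:R * expR (- (kap / 2 * l%:R)))).
  apply: (@le_trans _ _ (\sum_(p <- s') expR (- (kap / 2 * l%:R)))); last first.
    by rewrite big_const_seq count_predT iter_addr_0 mulr_natl.
  rewrite big_seq [leRHS]big_seq; apply: ler_sum => p ps; rewrite /w; case: ifP => _; last exact: expR_ge0.
  rewrite ler_expR lerN2 (qe p ps) ler_wpM2l //; first lra.
  by rewrite ler_pdivlMr // rmorphD rmorphM /= lerDr ler0z.
rewrite mulrA ler_wpM2r ?expR_ge0 //.
have HL : 1 <= H * l.+1%:R by apply: (le_trans H1); rewrite ler_peMr ?ler1n // (le_trans ler01 H1).
have := @hC pa pb pc (pd x) (pe x) (pq x - (r + l%:Z * N%:Z)) s' pa0 D0 (filter_uniq _ us).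
have -> : C * H `^ eps * l.+1%:R = C * (H `^ eps * l.+1%:R) by rewrite mulrA.
move=> hh; apply: le_trans (hh _ _ HL _) _.
- move=> p ps; have := qe p ps; rewrite /q /slice_map /= slice_poly_int => e; rewrite addrA e; ring.
- apply: le_trans (slice_height x (r + l%:Z * N%:Z) pa0 D0) _.
  have nb : (r + l%:Z * N%:Z)%:~R <= N%:R * l.+1%:R :> R.
    rewrite rmorphD rmorphM /= -natr1 mulrDr mulr1 addrC [N%:R * _]mulrC lerD2l.
    by rewrite -[N%:R]/(N%:Z%:~R) ler_int ltW.
  have P0 : 0 <= 4 * (N%:R * d1 / 2) * (N%:R ^+ 2 * (d1 * d2)) :> R.
    by rewrite -ea -eD !mulr_ge0 // ?ler0z ltW.
  apply: le_trans (ler_wpM2l P0 nb) _.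
  rewrite [leLHS](_ : _ = 2 * N%:R ^+ 4 * d1 ^+ 2 * d2 * l.+1%:R); last by move: (l.+1%:R) (N%:R) => X1 X2; field.
  by rewrite ler_wpM2r.
rewrite ler_wpM2l ?(ltW C0) // powRM ?(le_trans ler01 H1) // ler_wpM2l ?powR_ge0 //.
by rewrite -[leRHS]powRr1 // ler_powR // ler1n.
Qed.

End Slice.

(** * Weights and the size of F(Q, s) *)

Section Clip.
Variable R : realType.

Definition clip (x : R) : R := Num.min 1 (Num.max 0 x).

Lemma clip_ge0 x : 0 <= clip x.
Proof. by rewrite /clip le_min ler01 le_max lexx. Qed.
Lemma clip_le1 x : clip x <= 1.
Proof. by rewrite /clip ge_min lexx. Qed.

Lemma clip_step (s : R) n : Num.min n%:R s + clip (s - n%:R) = Num.min n.+1%:R s.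
Proof.
rewrite /clip -natr1; move: (n%:R) => u.
by case: (leP u s) => h1; case: (leP 0 (s - u)) => h2; case: (leP 1 _) => h3; case: (leP (u + 1) s) => h4; lra.
Qed.

Lemma clip_sum (s : R) n : 0 <= s -> \sum_(0 <= i < n) clip (s - i%:R) = Num.min n%:R s.
Proof.
move=> s0; elim: n => [|n IH]; first by rewrite big_geq // min_l.
by rewrite big_nat_recr //= IH clip_step.
Qed.

Lemma clip_down (P : pred nat) (s : R) n : (forall i j, (i <= j)%N -> P j -> P i) -> 0 <= s ->
  \sum_(0 <= i < n | P i) clip (s - i%:R) = Num.min (\sum_(0 <= i < n | P i) 1)%N%:R s.
Proof.
move=> hP s0; elim: n => [|n IH]; first by rewrite !big_geq // min_l.
have [pn|pn] := boolP (P n); last first.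
  by rewrite !(big_mkcond P) !big_nat_recr //= (negbTE pn) addr0 addn0 -!(big_mkcond P).
have E (V : nmodType) (F : nat -> V) : \sum_(0 <= i < n.+1 | P i) F i = \sum_(0 <= i < n.+1) F i.
  by rewrite big_mkcond big_nat [RHS]big_nat; apply: eq_bigr => i /andP[_ h]; rewrite (hP i n).
have -> : (\sum_(0 <= i < n.+1 | P i) 1)%N = n.+1.
  rewrite big_mkcond big_nat (eq_bigr (fun=> 1%N)) => [|i /andP[_ h]]; last by rewrite (hP i n).
  by rewrite -big_nat sum_nat_const_nat subn0 muln1.
by rewrite E clip_sum.
Qed.

Lemma prod_powR (I : Type) (r : seq I) (P : pred I) (a : R) (w : I -> R) : 0 < a ->
  \prod_(i <- r | P i) a `^ w i = a `^ (\sum_(i <- r | P i) w i).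
Proof.
move=> a0; rewrite (big_morph (fun x => a `^ x) (id1 := 1) (op1 := *%R)) //; last exact: powRr0.
by move=> x y; rewrite powRD //; apply/implyP => _; rewrite gt_eqF.
Qed.
End Clip.

Section FBound.
Variables (R : realType) (m N : nat) (e : 'I_m -> nat).
Hypothesis N0 : (0 < N)%N.
Hypothesis e0 : forall i, (0 < e i)%N.
Hypothesis eN : forall i, (e i %| N)%N.
Hypothesis ch : forall i j : 'I_m, (i <= j)%N -> (e i %| e j)%N.

(** Counted from the last index, where the [e k] are largest. *)
Definition wgt (s : R) (k : 'I_m) : R := clip (s - (rev_ord k)%:R).

Lemma wgt_sum s : 0 <= s -> \sum_k wgt s k <= s.
Proof.
move=> s0; rewrite (reindex_inj rev_ord_inj) /=.
have -> : \sum_(j < m) wgt s (rev_ord j) = \sum_(0 <= i < m) clip (s - i%:R).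
  by rewrite big_mkord; apply: eq_bigr => i _; rewrite /wgt rev_ordK.
by rewrite clip_sum // ge_min lexx orbT.
Qed.

(** By the divisibility chain the indices with $p^j \mid e_k$ form a final segment, on which the
    clipped weights telescope. *)
Lemma wgt_top s p j : 0 <= s ->
  Num.min #|[set k : 'I_m | (p ^ j %| e k)%N]%SET|%:R s = \sum_(k | (p ^ j %| e k)%N) wgt s k.
Proof.
move=> s0; pose P i := oapp (fun k : 'I_m => (p ^ j %| e (rev_ord k))%N) false (insub i).
have PE (k : 'I_m) : P k = (p ^ j %| e (rev_ord k))%N by rewrite /P valK.
have hP i i' : (i <= i')%N -> P i' -> P i.
  rewrite /P => ii; case: insubP => //= k' _ k'i; rewrite -k'i in ii => h.
  have im : (i < m)%N by apply: leq_ltn_trans ii (ltn_ord k').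
  rewrite insubT /=; apply: dvdn_trans h (ch _); rewrite /=; lia.
rewrite -sum1_card; under eq_bigl do rewrite inE.
rewrite (reindex_inj rev_ord_inj) /= [RHS](reindex_inj rev_ord_inj) /=.
have -> : \sum_(k < m | (p ^ j %| e (rev_ord k))%N) wgt s (rev_ord k) = \sum_(0 <= i < m | P i) clip (s - i%:R).
  by rewrite big_mkord; apply: eq_big => [k|k _]; rewrite ?PE // /wgt rev_ordK.
rewrite clip_down //; congr (Num.min _%:R s); rewrite big_mkord.
by apply: eq_bigl => k; rewrite PE.
Qed.

Lemma logn_count p n : prime p -> (0 < n)%N -> (n %| N)%N -> \sum_(1 <= j < (logn p N).+1) (p ^ j %| n)%N%:R = (logn p n)%:R :> R.
Proof.
move=> pp n0 nN; have ll : (logn p n <= logn p N)%N by exact: dvdn_leq_log.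
rewrite (@big_cat_nat _ _ _ (logn p n).+1) //= [X in _ + X]big_nat [X in _ + X]big1 => [|j /andP[h _]]; last first.
  by rewrite pfactor_dvdn // leqNgt h.
rewrite addr0 big_nat (eq_bigr (fun=> 1)) => [|j /andP[_ h]]; last by rewrite pfactor_dvdn // -ltnS h.
by rewrite -big_nat sumr_const_nat subSS subn0.
Qed.

Lemma prod_primes_logn n : (0 < n)%N -> (n %| N)%N -> (\prod_(p <- primes N) p ^ logn p n)%N = n.
Proof.
move=> n0 nN; have h : (\pi(N)).-nat n.
  by rewrite /pnat n0; apply/allP => p; rewrite mem_primes => /and3P[pp _ pn]; rewrite inE /= mem_primes pp N0 (dvdn_trans pn).
have h2 : (n <= N)%N by exact: dvdn_leq.
transitivity (n`_(\pi(N)))%N; last exact: part_pnat_id.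
rewrite (widen_partn _ h2) -[RHS]big_filter.
apply: perm_big; apply: uniq_perm; rewrite ?primes_uniq ?filter_uniq ?iota_uniq // => p.
rewrite mem_filter mem_index_iota /= inE /=; case: (boolP (p \in primes N)) => //= h'.
by move: h'; rewrite mem_primes => /and3P[_ _ pN]; rewrite ltnS dvdn_leq.
Qed.

(** Exchanging the sums over [j] and [k] bounds $\mu_p(s)$ by $\sum_k w_k
    \operatorname{ord}_p(e_k)$; the power $2^m$ absorbs the separate factor at 2. *)
Lemma Ffactor_le (nu : nat -> nat -> nat) r2 s : 0 <= s ->
  (forall p j, prime p -> (0 < j)%N -> (vcount m nu p j <= #|[set k : 'I_m | (p ^ j %| e k)%N]%SET|)%N) ->
  0 < @Ffactor m R nu r2 N s <= 2 ^+ m * \prod_k (e k)%:R `^ wgt s k.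
Proof.
move=> s0 hv; have pr p : p \in primes N -> prime p by rewrite mem_primes => /and3P[].
have p0 p : p \in primes N -> 0 < p%:R :> R by move/pr/prime_gt0; rewrite ltr0n.
apply/andP; split.
  rewrite /Ffactor mulr_gt0 ?powR_gt0 //; rewrite big_seq; apply: prodr_gt0 => p /p0 pp; exact: powR_gt0.
rewrite /Ffactor; apply: ler_pM; rewrite ?powR_ge0 //.
- by apply: prodr_ge0 => p _; exact: powR_ge0.
- rewrite -powR_mulrn // ler_powR // ?ler1n // ge_min ler_nat; apply/orP; left; lia.
have E k : (e k)%:R `^ wgt s k = \prod_(p <- primes N) p%:R `^ ((logn p (e k))%:R * wgt s k) :> R.
  rewrite -{1}(prod_primes_logn (e0 k) (eN k)).
  elim: (primes N) => [|p r IH]; first by rewrite !big_nil powR1.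
  rewrite !big_cons natrM powRM // IH natrX -powR_mulrn // -powRrM //.
rewrite (eq_bigr _ (fun k _ => E k)) exchange_big /= big_seq [leRHS]big_seq; apply: ler_prod => p pP.
rewrite powR_ge0 /= prod_powR ?p0 // ler_powR // ?ler1n ?prime_gt0 ?pr //.
rewrite /mu; apply: (@le_trans _ _ (\sum_(1 <= j < (logn p N).+1) \sum_k (p ^ j %| e k)%N%:R * wgt s k)).
  rewrite big_nat [leRHS]big_nat; apply: ler_sum => j /andP[j0 _].
  have -> : \sum_k (p ^ j %| e k)%N%:R * wgt s k = \sum_(k | (p ^ j %| e k)%N) wgt s k.
    by rewrite [RHS]big_mkcond; apply: eq_bigr => k _; case: ifP; rewrite ?mul1r ?mul0r.
  rewrite -wgt_top // le_min !ge_min lexx orbT andbT; apply/orP; left.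
  by rewrite ler_nat hv ?pr.
rewrite exchange_big /=; apply: ler_sum => k _; rewrite -mulr_suml logn_count ?pr //.
Qed.
End FBound.

Section Arith.
Variable R : realType.

(** Applied with $x_i = f_i$, $g_i = \gcd(e_i, c)$ and $X = N/c$. The exponent of $x_i$ is $w_i - 1
    + t_i$; raising it to [sg i] and then $x_i$ to [X] costs $X^{h-1}$, which the leading [X]
    completes. *)
Lemma weight_ineq (I : finType) (x g w sg t : I -> R) (X c h : R) : 1 <= X -> 1 <= c ->
  (forall i, 1 <= x i <= X) -> (forall i, 1 <= g i <= c) -> (forall i, 0 <= w i) ->
  (forall i, 0 <= sg i) -> (forall i, w i - 1 + t i <= sg i) ->
  \sum_i sg i <= h - 1 -> \sum_i w i <= h ->
  X * \prod_i (x i)^-1 * \prod_i (x i) `^ t i * \prod_i (x i * g i) `^ w i <= (X * c) `^ h.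
Proof.
move=> X1 c1 hx hg w0 s0 ws hs hw.
have X0 : 0 < X by lra. have c0 : 0 < c by lra.
rewrite -!mulrA -!big_split /=.
apply: (@le_trans _ _ (X * \prod_i (X `^ sg i * c `^ w i))).
  rewrite ler_pM2l //; apply: ler_prod => i _.
  have [/andP[x1 xX] /andP[g1 gc]] := (hx i, hg i).
  have x0 : 0 < x i by lra. have g0 : 0 < g i by lra.
  rewrite !mulr_ge0 ?powR_ge0 ?invr_ge0 ?(ltW x0) //=.
  rewrite powRM ?(ltW x0) ?(ltW g0) // !mulrA -powR_inv1 ?(ltW x0) //.
  have xn b : b ==> (x i != 0) by rewrite gt_eqF // implybT.
  rewrite -!powRD //; apply: ler_pM; rewrite ?powR_ge0 //; last by rewrite ge0_ler_powR ?nnegrE ?(ltW g0) ?(ltW c0).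
  apply: (@le_trans _ _ (x i `^ sg i)); first by rewrite ler_powR //; have := ws i; lra.
  by rewrite ge0_ler_powR ?nnegrE ?(ltW x0) ?(ltW X0).
rewrite big_split /= !prod_powR // powRM ?(ltW X0) ?(ltW c0) // mulrA -{1}(powRr1 (ltW X0)) -powRD; last by apply/implyP => _; rewrite gt_eqF.
by apply: ler_pM; rewrite ?powR_ge0 // ler_powR //; lra.
Qed.
End Arith.

(** * Combining the pivot factors *)

Section Comb.
Variable R : realType.

Lemma powR_le_exp (k b : R) : 0 <= k -> 0 < b -> exists2 C : R, 0 < C & forall u, 0 < u -> u `^ k <= C * expR (b * u).
Proof.
move=> k0 b0; pose n := (Num.bound k).+1.
have kn : k <= n%:R by rewrite ltW // (lt_le_trans (archi_boundP k0)) // ler_nat.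
have n0 : 0 < n%:R :> R by rewrite ltr0n.
have C0 : 0 < (n%:R / b) ^+ n :> R by rewrite exprn_gt0 // divr_gt0.
exists (1 + (n%:R / b) ^+ n) => [|u u0]; first by rewrite addr_gt0.
have e1 : 1 <= expR (b * u) by rewrite -expR0 ler_expR mulr_ge0 // ltW.
have e2 : 1 `^ k = 1 :> R by rewrite powR1.
have [u1|u1] := leP u 1.
  apply: (@le_trans _ _ 1); first by rewrite -[leRHS]e2 ge0_ler_powR ?nnegrE ?(ltW u0).
  by rewrite mulrDl mul1r (le_trans e1) // lerDl mulr_ge0 ?expR_ge0 // ltW.
apply: (@le_trans _ _ (u ^+ n)); first by rewrite -powR_mulrn ?(ltW u0) // ler_powR // ltW.
rewrite mulrDl mul1r (@le_trans _ _ ((n%:R / b) ^+ n * expR (b * u))) // ?lerDr ?expR_ge0 //.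
have -> : expR (b * u) = expR (b * u / n%:R) ^+ n by rewrite -expRM_natl; congr expR; field; rewrite gt_eqF.
have nb : 0 <= n%:R / b by rewrite divr_ge0 // ltW.
rewrite -exprMn; apply: lerXn2r; rewrite ?nnegrE ?(ltW u0) // ?mulr_ge0 ?expR_ge0 ?invr_ge0 ?(ltW b0) //.
have h : b * u / n%:R <= expR (b * u / n%:R) by apply: le_trans (expR_ge1Dx _); rewrite lerDr.
have e3 : n%:R / b * (b * u / n%:R) = u by move: (n%:R) n0 => x x0; field; rewrite !gt_eqF.
by have := ler_wpM2l nb h; rewrite e3.
Qed.

(** For $a \ge M/2$ this is $(a-1)/a$, the mean of the weights 1/2, 1/2, 1, ..., 1. For smaller [a]
    it is raised until $a\kappa = M/2 - 1$, so that in all cases at most the first power of [Y] is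
    left over. *)
Definition kappa (M a : nat) : R := (Num.max a%:R (M%:R / 2) - 1) / a%:R.

Lemma prefix_nonneg (l : nat -> R) M : (forall i, (i.+1 < M)%N -> l i.+1 <= l i) ->
  exists a, [/\ (a <= M)%N, forall i, (i < a)%N -> 0 <= l i & forall i, (a <= i < M)%N -> l i < 0].
Proof.
elim: M => [|M IH] hl; first by exists 0%N; split=> // i; rewrite andbF.
have [i iM|a [aM h1 h2]] := IH; first by apply: hl; rewrite ltnW.
have [aM'|Ma] := ltnP a M.
  exists a; split=> // [|i /andP[ai]]; first exact: ltnW.
  rewrite ltnS leq_eqVlt => /orP[/eqP->|iM]; last by rewrite h2 // ai.
  case: M {IH aM} hl h2 aM' {i ai} => // M hl h2 aM'.
  by apply: le_lt_trans (hl M _) (h2 M _); rewrite // ltnSn andbT -ltnS.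
have {aM Ma} E : a = M by apply/eqP; rewrite eqn_leq aM Ma.
have [l0|l0] := leP 0 (l M).
  exists M.+1; split=> // [i|i]; last by move=> /andP[g1 g2]; rewrite ltnNge g1 in g2.
  by rewrite ltnS leq_eqVlt => /orP[/eqP->//|iM]; apply: h1; rewrite E.
exists M; split=> // [i|i /andP[Mi]]; first by rewrite -E; exact: h1.
by rewrite ltnS => iM; have -> : i = M by apply/eqP; rewrite eqn_leq iM Mi.
Qed.

(* The exponents are 1/2, 1/2, 1, 1, ...: the two largest terms get less than
   their share, so the weighted sum is at most the average weight times the sum. *)
Lemma log_weights (l : nat -> R) M : (3 <= M)%N -> (forall i, (i.+1 < M)%N -> l i.+1 <= l i) ->
  let L i := Num.max 0 (l i) in
  exists a, [/\ (0 < a <= M)%N & 1 / 2 * \sum_(0 <= i < M) L i + 1 / 2 * \sum_(2 <= i < M) L i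
      + (if l 0%N < 0 then (M%:R / 2 - 1) * l 0%N else 0) <= kappa M a * \sum_(0 <= i < a) l i].
Proof.
move=> M3 hl L; have [a [aM h1 h2]] := prefix_nonneg hl.
have L1 i : (i < a)%N -> L i = l i by move=> ia; rewrite /L max_r // h1.
have L2 i : (a <= i < M)%N -> L i = 0 by move=> ia; rewrite /L max_l // ltW // h2.
have MR : 3 <= M%:R :> R by rewrite ler_nat.
have Ls k : (k <= a)%N -> \sum_(k <= i < M) L i = \sum_(k <= i < a) l i.
  move=> ka; rewrite (big_cat_nat ka aM) /= [X in _ + X]big_nat [X in _ + X]big1 ?addr0 //.
  by rewrite big_nat [RHS]big_nat; apply: eq_bigr => i /andP[_ /L1].
have [a0|a0] := posnP a.
  (* All [l i] are negative, so the sums of the [L i] vanish and the last summand on the left equals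
     the right-hand side, as $\kappa = M/2 - 1$ for $a = 1$. *)
  exists 1%N; split; first by rewrite /= (leq_trans _ M3).
  have Lz k : \sum_(k <= i < M) L i = 0.
    by rewrite big_nat big1 // => i /andP[_ iM]; rewrite L2 // a0.
  rewrite !Lz big_nat1 h2 ?a0 ?(leq_trans _ M3) // /kappa divr1 max_r; last lra.
  by rewrite mulr0 !add0r.
exists a; split; first by rewrite a0.
rewrite ltNge (h1 0%N a0) /= addr0 Ls //.
have S0 : 0 <= \sum_(0 <= i < a) l i by rewrite big_nat; apply: sumr_ge0 => i /andP[_ /h1].
have [a1|a1] := leqP a 1.
  have x0 := h1 0%N a0; have E : a = 1%N by lia.
  have -> : \sum_(2 <= i < M) L i = 0 by rewrite big_nat big1 // => i /andP[i2 iM]; rewrite L2 // E iM (ltnW i2).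
  rewrite E big_nat1 /kappa divr1 max_r; last lra.
  move: x0; set x := l 0%N => x0; nra.
rewrite Ls //.
have E2 : \sum_(0 <= i < a) l i = l 0%N + l 1%N + \sum_(2 <= i < a) l i.
  by rewrite big_ltn // big_ltn // addrA.
have tail : \sum_(2 <= i < a) l i <= (a%:R - 2) * l 1%N.
  have hm i : (1 <= i < a)%N -> l i <= l 1%N.
    elim: i => // i IH /andP[_ ia]; case: i IH ia => // i IH ia.
    by apply: le_trans (hl _ _) (IH _); [exact: leq_trans ia aM|exact: ltnW].
  apply: (@le_trans _ _ (\sum_(2 <= i < a) l 1%N)).
    rewrite big_nat [leRHS]big_nat; apply: ler_sum => i /andP[i2 ia]; apply: hm; by rewrite ia (ltnW i2).
  by rewrite sumr_const_nat -[_ *+ (a - 2)]mulr_natl natrB.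
have l10 : l 1%N <= l 0%N by apply: hl; exact: leq_trans a1 aM.
have aR : 2 <= a%:R :> R by rewrite ler_nat.
have k1 : 1 - a%:R^-1 <= kappa M a.
  rewrite /kappa mulrBl mul1r lerB // ler_pdivlMr ?mul1r ?le_max ?lexx //; lra.
apply: le_trans (ler_wpM2r S0 k1).
rewrite E2; move: (\sum_(2 <= i < a) l i) tail => T tail.
have a0' : 0 < a%:R :> R by lra.
rewrite -(ler_pM2l a0') [leRHS]mulrA mulrBr mulr1 mulfV ?gt_eqF //.
move: (a%:R) (l 0%N) (l 1%N) aR tail l10 => A x y aR tail l10.
clear -aR tail l10; nra.
Qed.

Lemma sqrt_expR (x : R) : 0 < x -> (Num.sqrt x)^-1 = expR (- (1 / 2) * ln x).
Proof.
move=> x0; rewrite mulNr expRN; congr (_^-1).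
rewrite -[x in LHS](lnK x0) -[expR (ln x)](_ : expR (1 / 2 * ln x) ^+ 2 = _); first by rewrite sqrtr_sqr ger0_norm ?expR_ge0.
by rewrite expr2 -expRD; congr expR; field.
Qed.

(** Everything becomes an exponential of the logarithms [l i]. The factor $e^{-Y/N}$ is traded for
    $(N/Y)^\eta$, and $e^{-Yd_0/8}$ for $(Yd_0)^{1-M/2}$ when $Yd_0 > 1$. *)
Lemma combine M (eta : R) : (3 <= M)%N -> 0 < eta -> exists2 C : R, 0 < C &
  forall (d : nat -> R) (Y N : R), (forall i, 0 < d i) -> (forall i, (i.+1 < M)%N -> 3 / 4 * d i <= d i.+1) ->
  1 / 2 <= Y -> 0 < N -> exists a, [/\ (0 < a <= M)%N &
   Y `^ (M%:R / 2) * expR (- (Y * d 0%N / 8)) * expR (- (Y / N)) *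
     (\prod_(0 <= i < M) (1 + (Num.sqrt (Y * d i))^-1) * \prod_(2 <= i < M) (1 + (Num.sqrt (Y * d i))^-1)) <=
   C * N `^ eta * Y `^ (1 - eta) * ((\prod_(0 <= i < a) d i)^-1) `^ kappa M a].
Proof.
move=> M3 e0; have MR : 3 <= M%:R :> R by rewrite ler_nat.
have [C1 C10 hC1] := powR_le_exp (ltW e0) ltr01.
have k0 : 0 <= M%:R / 2 - 1 :> R by lra.
have b8 : 0 < 8^-1 :> R by rewrite invr_gt0.
have [C2 C20 hC2] := powR_le_exp k0 b8.
pose q : R := ln (4 / 3).
have q0 : 0 <= q by rewrite ln_ge0 //; lra.
pose c1 : R := M%:R / 2 * q.
have c10 : 0 <= c1 by rewrite mulr_ge0 //; lra.
have E0 : 0 < 2 * expR c1 by rewrite mulr_gt0 ?expR_gt0.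
pose C := C1 * (1 + C2) * (2 * expR c1) ^+ (M + M) * 2 `^ M%:R.
exists C => [|d Y N d0 hd Y2 N0].
  by rewrite /C !mulr_gt0 ?powR_gt0 ?exprn_gt0 //; lra.
have Y0 : 0 < Y by lra.
have Yd i : 0 < Y * d i by rewrite mulr_gt0.
(* The correction with $q = \ln(4/3)$ makes the sequence decreasing although pivots may drop by 3/4;
   [P1] absorbs it into [c1]. *)
pose l i := - ln (Y * d i) - i%:R * q.
have hl i : (i.+1 < M)%N -> l i.+1 <= l i.
  move=> iM; rewrite /l -natr1 mulrDl mul1r.
  suff : ln (Y * d i) <= ln (Y * d i.+1) + q by lra.
  rewrite -lnM ?posrE ?Yd ?divr_gt0 // ler_ln ?posrE ?Yd ?mulr_gt0 ?divr_gt0 //.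
  have := hd i iM; have := d0 i; have := d0 i.+1; move: (d i) (d i.+1) => u v v0 u0; nra.
have [a [aM hw]] := log_weights M3 hl; exists a; split=> //.
pose L i := Num.max 0 (l i); rewrite -/L in hw.
have P1 i : (i < M)%N -> 0 <= 1 + (Num.sqrt (Y * d i))^-1 <= 2 * expR c1 * expR (1 / 2 * L i).
  move=> iM; rewrite addr_ge0 ?invr_ge0 ?sqrtr_ge0 //= sqrt_expR //.
  have lL : l i <= L i by rewrite /L le_max lexx orbT.
  have L0 : 0 <= L i by rewrite /L le_max lexx.
  have h1 : 1 <= expR c1 * expR (1 / 2 * L i) by rewrite -expRD -[X in X <= _]expR0 ler_expR addr_ge0 // mulr_ge0 // divr_ge0.
  have h2 : expR (- (1 / 2) * ln (Y * d i)) <= expR c1 * expR (1 / 2 * L i).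
    rewrite -expRD ler_expR; have -> : ln (Y * d i) = - l i - i%:R * q by rewrite /l; ring.
    have : i%:R * q <= M%:R * q by rewrite ler_wpM2r // ler_nat ltnW.
    rewrite /c1; lra.
  by rewrite -mulrA; lra.
have PP k : (k <= M)%N -> \prod_(k <= i < M) (1 + (Num.sqrt (Y * d i))^-1) <= (2 * expR c1) ^+ M * expR (1 / 2 * \sum_(k <= i < M) L i).
  move=> kM; apply: (@le_trans _ _ (\prod_(k <= i < M) (2 * expR c1 * expR (1 / 2 * L i)))).
    by rewrite big_nat [leRHS]big_nat; apply: ler_prod => i /andP[_ /P1].
  rewrite big_split /= prodr_const_nat mulr_sumr expR_sum; apply: ler_wpM2r; first by apply: prodr_ge0 => i _; exact: expR_ge0.
  apply: ler_weXn2l; last exact: leq_subr.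
  have : 1 <= expR c1 by rewrite -expR0 ler_expR.
  lra.
have pE (u x : R) : 0 < u -> u `^ x = expR (x * ln u) by move=> u0; rewrite /powR gt_eqF.
pose W : R := if l 0%N < 0 then (M%:R / 2 - 1) * l 0%N else 0; rewrite -/W in hw.
have A1 : expR (- (Y / N)) <= C1 * expR (eta * ln N - eta * ln Y).
  have := hC1 (Y / N) (divr_gt0 Y0 N0); rewrite mul1r pE ?divr_gt0 // ln_div ?posrE // => h.
  rewrite expRN -(ler_pM2r (expR_gt0 (eta * (ln Y - ln N)))) -mulrA -expRD.
  rewrite (_ : _ - _ + _ = 0) ?expR0 ?mulr1; last by ring.
  by rewrite mulrC ler_pdivrMr ?expR_gt0.
have A2 : expR (- (Y * d 0%N / 8)) <= (1 + C2) * expR W.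
  rewrite /W; case: ifP => [l0|_]; last first.
    have : expR (- (Y * d 0%N / 8)) <= 1 by rewrite -expR0 ler_expR oppr_le0 divr_ge0 // ltW.
    rewrite expR0; lra.
  have := hC2 (Y * d 0%N) (Yd 0%N); rewrite pE ?Yd // => h.
  have -> : l 0%N = - ln (Y * d 0%N) by rewrite /l mul0r subr0.
  rewrite mulrN !expRN ler_pdivlMr ?expR_gt0 // mulrC ler_pdivrMr ?expR_gt0 //.
  have : 0 < expR (Y * d 0%N / 8) by exact: expR_gt0.
  by rewrite [Y * _ / _]mulrC; lra.
have P0 : 0 < \prod_(0 <= i < a) d i by apply: prodr_gt0.
have lP : \sum_(0 <= i < a) l i <= - a%:R * ln Y - ln (\prod_(0 <= i < a) d i).
  elim: (a) => [|b IH]; first by rewrite !big_geq // ln1 subr0 oppr0 mul0r.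
  have Pb : 0 < \prod_(0 <= i < b) d i by apply: prodr_gt0.
  rewrite !big_nat_recr //= lnM ?posrE // /l lnM ?posrE // -natr1.
  have : 0 <= b%:R * q by rewrite mulr_ge0.
  move: IH; move: (\sum_(_ <= _ < _) _) (ln _) => s t; lra.
have a0 : 0 < a%:R :> R by rewrite ltr0n; case/andP: aM.
have kE : kappa M a * a%:R = Num.max a%:R (M%:R / 2) - 1 by rewrite /kappa divfK // gt_eqF.
have mx1 : M%:R / 2 <= Num.max a%:R (M%:R / 2) :> R by rewrite le_max lexx orbT.
have mx2 : Num.max a%:R (M%:R / 2) <= M%:R :> R.
  by rewrite ge_max ler_nat; case/andP: aM => _ ->; lra.
have kap0 : 0 <= kappa M a by rewrite -(pmulr_lge0 _ a0) kE; lra.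
have A4 : M%:R / 2 * ln Y + W + (1 / 2 * \sum_(0 <= i < M) L i + 1 / 2 * \sum_(2 <= i < M) L i) + (eta * ln N - eta * ln Y) <=
    M%:R * ln 2 + eta * ln N + (1 - eta) * ln Y + kappa M a * ln (\prod_(0 <= i < a) d i)^-1.
  have hY : 0 <= ln Y + ln 2 by rewrite -lnM ?posrE // ln_ge0 //; lra.
  have h2 : 0 <= ln 2 :> R by rewrite ln_ge0 // ler1n.
  have h3 : kappa M a * \sum_(0 <= i < a) l i <= - (Num.max a%:R (M%:R / 2) - 1) * ln Y - kappa M a * ln (\prod_(0 <= i < a) d i).
    by apply: le_trans (ler_wpM2l kap0 lP) _; rewrite -kE le_eqVlt; apply/orP; left; apply/eqP; ring.
  rewrite lnV ?posrE // [kappa M a * - _]mulrN.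
  have q1 : 0 <= (Num.max a%:R (M%:R / 2) - M%:R / 2) * (ln Y + ln 2) by rewrite mulr_ge0 //; lra.
  have q2 : 0 <= (M%:R - (Num.max a%:R (M%:R / 2) - M%:R / 2)) * ln 2 :> R by rewrite mulr_ge0 //; lra.
  lra.
have e12 : expR (- (Y * d 0%N / 8)) * expR (- (Y / N)) <= (1 + C2) * expR W * (C1 * expR (eta * ln N - eta * ln Y)).
  by rewrite ler_pM ?expR_ge0.
have e34 : \prod_(0 <= i < M) (1 + (Num.sqrt (Y * d i))^-1) * \prod_(2 <= i < M) (1 + (Num.sqrt (Y * d i))^-1) <=
   (2 * expR c1) ^+ M * expR (1 / 2 * \sum_(0 <= i < M) L i) * ((2 * expR c1) ^+ M * expR (1 / 2 * \sum_(2 <= i < M) L i)).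
  apply: ler_pM; rewrite ?PP ?(ltnW M3) //; apply: prodr_ge0 => i _; rewrite addr_ge0 ?invr_ge0 ?sqrtr_ge0 //.
rewrite -[_ * _ * expR (- (Y / N))]mulrA -[_ * _ * (\prod_(_ <= _ < _) _ * _)]mulrA.
apply: le_trans (ler_wpM2l (powR_ge0 _ _) (ler_pM _ _ e12 e34)) _.
- by rewrite mulr_ge0 ?expR_ge0.
- by rewrite mulr_ge0 //; apply: prodr_ge0 => i _; rewrite addr_ge0 ?invr_ge0 ?sqrtr_ge0.
rewrite /C exprD !pE ?invr_gt0 //.
have E5 (x1 x2 x3 x4 x5 B D1 D2 : R) : expR x1 * (D2 * expR x2 * (D1 * expR x3) * (B * expR x4 * (B * expR x5))) =
   D1 * D2 * (B * B) * expR (x1 + x2 + (x4 + x5) + x3) by rewrite !expRD; ring.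
have E6 (x1 x2 x3 x4 B D1 D2 : R) : D1 * D2 * (B * B) * expR x1 * expR x2 * expR x3 * expR x4 =
   D1 * D2 * (B * B) * expR (x1 + x2 + x3 + x4) by rewrite !expRD; ring.
rewrite E5 E6 ler_wpM2l ?ler_expR //.
by rewrite !mulr_ge0 ?exprn_ge0 ?(ltW E0) ?(ltW C10) //; lra.
Qed.
End Comb.

Lemma cabs_sqrC (R : realType) (z : R[i]) : (cabs z ^+ 2)%:C%C = z * conjc z.
Proof. by rewrite cabs_sqr; case: z => x y /=; apply/eqP; rewrite eq_complex /=; apply/andP; split; apply/eqP; ring. Qed.

(** * Averaging over horocycles *)

Section FiniteParseval.
Variables (R : realType) (N' : nat).
Local Notation N := N'.+1.

Lemma ec_sum (k : int) : \sum_(j < N) ec R N' (k * (j : nat)%:Z) = if (N%:Z %| k)%Z then N%:R else 0.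
Proof.
have E (j : nat) : ec R N' (k * j%:Z) = ec R N' k ^+ j.
  elim: j => [|j IH]; first by rewrite mulr0 ec0.
  by rewrite exprS -IH -ecD; congr ec; lia.
case: ifP => hk.
  rewrite (eq_bigr (fun=> 1)) ?sumr_const ?card_ord // => j _.
  by rewrite -[RHS](ec0 R N'); apply: ec_dvd; rewrite subr0 dvdz_mulr.
have x1 : ec R N' k != 1 by apply: contraFN hk => /eqP; exact: ec_eq1.
have x2 : ec R N' k - 1 != 0 by rewrite subr_eq0.
apply: (mulfI x2); rewrite mulr0; under eq_bigr do rewrite E.
by rewrite -subrX1 -E; apply/eqP; rewrite subr_eq0 -(ec0 R N'); apply/eqP; apply: ec_dvd; rewrite subr0 dvdz_mull.
Qed.

Lemma parseval (b : 'I_N -> R[i]) :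
  \sum_(j < N) cabs (\sum_(r < N) ec R N' ((r : nat)%:Z * (j : nat)%:Z) * b r) ^+ 2 = N%:R * \sum_r cabs (b r) ^+ 2.
Proof.
apply: (fmorph_inj (real_complex R)); rewrite /= rmorphM !rmorph_sum /= rmorph_nat.
under eq_bigr do rewrite cabs_sqrC rmorph_sum /= mulr_suml.
rewrite exchange_big /= mulr_sumr; apply: eq_bigr => r _.
under eq_bigr do rewrite mulr_sumr.
rewrite exchange_big /= (bigD1 r) //= [X in _ + X]big1 ?addr0 => [|t tr].
  have -> : N%:R = \sum_(j < N) ec R N' (0 * (j : nat)%:Z) by rewrite ec_sum dvdz0.
  rewrite cabs_sqrC mulr_suml.
  apply: eq_bigr => j _; rewrite mul0r ec0 rmorphM /= ec_conj mulrACA -ecD subrr ec0 //.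
have -> : \sum_(j < N) ec R N' ((r : nat)%:Z * (j : nat)%:Z) * b r * conjc (ec R N' ((t : nat)%:Z * (j : nat)%:Z) * b t) =
  (\sum_(j < N) ec R N' (((r : nat)%:Z - (t : nat)%:Z) * (j : nat)%:Z)) * (b r * conjc (b t)).
  by rewrite mulr_suml; apply: eq_bigr => j _; rewrite rmorphM /= ec_conj mulrACA -ecD mulrBl.
rewrite ec_sum ifF ?mul0r //; apply/negP => h.
case/eqP: tr; apply/val_inj => /=; have := ltn_ord t; have := ltn_ord r.
by case/dvdzP: h => q hq; move: hq; case: (q) => [[|[|k]]|[|k]]; nia.
Qed.
End FiniteParseval.

Section Avg.
Variables (R : realType) (m : nat) (N' : nat) (Q B : 'M[int]_m) (n : nat) (a : int).
Local Notation N := N'.+1.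
Local Notation cR := (map_mx (intr : int -> R)).
Hypothesis eQ : even_posdef R Q.
Hypothesis eB : evsym B.
Hypothesis QB : Q *m B = N%:Z%:M.
Hypothesis ca : coprimez a n.+1%:Z.

Lemma inv_level : invmx (cR Q) = N%:R^-1 *: cR B.
Proof.
have uQ := evpd_unit eQ.
have h : cR Q *m cR B = N%:R%:M by rewrite -map_mxM QB map_scalar_mx.
have N0 : N%:R != 0 :> R by rewrite pnatr_eq0.
by rewrite -[RHS](mulKmx uQ) -scalemxAr h scale_scalar_mx mulVf // mulmx1.
Qed.

Lemma qs_level y : qs R Q y = (qform B y)%:~R / N%:R.
Proof.
rewrite /qs inv_level qfE -scalemxAl dotpZr -qfE qf_cast -(qform2i _ eB) rmorphMn /= -[_%:~R *+ 2]mulr_natr.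
by rewrite [N%:R^-1 * _]mulrA mulfK ?pnatr_eq0 // mulrC.
Qed.

(** The class of [N * qs y] modulo [N]: translating [w] by an integer multiplies the term of [y] by
    a character of this class. *)
Definition rcl (y : 'cV[int]_m) : 'I_N := inord `|(qform B y %% N%:Z)%Z|.

Lemma rcl_mod y : (N%:Z %| qform B y - (rcl y : nat)%:Z)%Z.
Proof. by rewrite inord_mod {1}(divz_eq (qform B y) N%:Z) addrK dvdz_mull. Qed.

Variables (w : R[i]) (w0 : 0 < complex.Im w).
Let u y := Gs R n Q a y * ee ((qs R Q y)%:C * w)%C.
Let su : summ u := summ_Th eQ ca w0.
Let bt (r : 'I_N) := tsum (fun y => if (y != 0) && (rcl y == r) then u y else 0).

Lemma summ_cond (P : pred 'cV[int]_m) : summ (fun y => if P y then u y else 0).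
Proof.
case: su => M hM; apply: (summ_le _ hM) => y; case: ifP => // _.
by rewrite cabs0; exact: cabs_ge0.
Qed.

Lemma tsum_point (v : 'cV[int]_m -> R[i]) : tsum (fun y => if y == 0 then v y else 0) = v 0 /\
  summ (fun y => if y == 0 then v y else 0).
Proof.
have s : summ (fun y => if y == 0 then v y else 0).
  exists (cabs (v 0)); split=> [y|A]; first exact: cabs_ge0.
  have [h|h] := boolP (0 \in A).
    by rewrite (big_fsetD1 0) //= eqxx big_seq big1 ?addr0 // => y; rewrite !inE => /andP[/negbTE-> _]; rewrite cabs0.
  rewrite big_seq big1 ?cabs_ge0 // => y yA; case: eqP => [E|_]; last exact: cabs0.
  by move: h; rewrite -E yA.
split=> //.
rewrite (tsum_inj (h := fun _ : unit => 0)) //; first by rewrite (tsum_unit _ (i0 := tt)) /= ?eqxx // => -[].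
  by move=> [] [].
by move=> i hi; case: eqP => // E; case: (hi tt).
Qed.

Lemma Th_shift (j : nat) : Th n Q a (w + j%:R) = Gs R n Q a 0 + \sum_(r < N) ec R N' ((r : nat)%:Z * j%:Z) * bt r.
Proof.
have [t1 t2] := tsum_point u.
have qB0 : qform B (0 : 'cV[int]_m) = 0.
  by have := qformZ B 0 (0 : 'cV[int]_m); rewrite scale0r expr0n /= mul0r.
have u0 : u 0 = Gs R n Q a 0 by rewrite /u qs_level qB0 mul0r mul0r ee0 mulr1.
have E y : Gs R n Q a y * ee ((qs R Q y)%:C * (w + j%:R))%C =
   (if y == 0 then u y else 0) + \sum_(r < N) ec R N' ((r : nat)%:Z * j%:Z) * (if (y != 0) && (rcl y == r) then u y else 0).
  have -> : ee ((qs R Q y)%:C * (w + j%:R))%C = ee ((qs R Q y)%:C * w)%C * ec R N' ((rcl y : nat)%:Z * j%:Z).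
    rewrite mulrDr eeD; congr (_ * _).
    have <- : ec R N' (qform B y * j%:Z) = ec R N' ((rcl y : nat)%:Z * j%:Z).
      by apply: ec_dvd; rewrite -mulrBl dvdz_mulr // rcl_mod.
    rewrite /ec qs_level; congr ee; rewrite -[j%:R]/((j%:Z)%:~R) -(rmorph_int (real_complex R)) -rmorphM /=; congr (_%:C)%C.
    by rewrite intrM mulrAC.
  rewrite mulrA -/(u y); have [->|y0] /= := eqVneq y 0.
    rewrite big1 ?addr0 => [|r _]; last by rewrite mulr0.
    have -> : ec R N' ((rcl 0 : nat)%:Z * j%:Z) = 1.
      rewrite -[RHS](ec0 R N'); apply: ec_dvd; rewrite subr0 dvdz_mulr //.
      by have := rcl_mod 0; rewrite qB0 sub0r rpredN.
    by rewrite mulr1.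
  rewrite add0r (bigD1 (rcl y)) //= eqxx big1 ?addr0 => [|r /negbTE h]; last by rewrite eq_sym h mulr0.
  by rewrite mulrC.
rewrite /Th (tsum_eq E); have S (r : 'I_N) : summ (fun y => ec R N' ((r : nat)%:Z * j%:Z) * (if (y != 0) && (rcl y == r) then u y else 0)).
  by apply: summZ; exact: summ_cond.
have [s1 s2] := tsum_sum (index_enum 'I_N) S.
rewrite tsumD // t1 u0 s2; congr (_ + _); apply: eq_bigr => r _.
by rewrite tsumZ //; exact: summ_cond.
Qed.

Lemma avg_bound (mb sb : R) :
  (forall r, asum (fun y => if [&& y != 0, Gs R n Q a y != 0 & rcl y == r] then expR (- (2 * pi * qs R Q y * complex.Im w)) else 0) mb) ->
  asum (fun y => if (y != 0) && (Gs R n Q a y != 0) then expR (- (2 * pi * qs R Q y * complex.Im w)) else 0) sb ->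
  \sum_(0 <= j < N) cabs (Th n Q a (w + j%:R) - Gs R n Q a 0) ^+ 2 <=
  N%:R * ((n.+1 ^ m)%:R * #|Rad n Q|%:R * (mb * sb)).
Proof.
move=> hm hs; rewrite big_mkord; under eq_bigr do rewrite Th_shift addrAC subrr add0r.
rewrite parseval ler_wpM2l //; pose K : R := (n.+1 ^ m)%:R * #|Rad n Q|%:R; rewrite -/K.
have K0 : 0 <= K by rewrite mulr_ge0.
have sK : Num.sqrt K * Num.sqrt K = K by rewrite -expr2 sqr_sqrtr.
have uK y : cabs (u y) <= Num.sqrt K * (if Gs R n Q a y != 0 then expR (- (2 * pi * qs R Q y * complex.Im w)) else 0).
  rewrite /u cabsM cabs_ee_qs; case: eqP => [->|_]; first by rewrite cabs0 mul0r mulr0.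
  rewrite ler_wpM2r ?expR_ge0 // -[leLHS]ger0_norm ?cabs_ge0 // -sqrtr_sqr ler_wsqrtr //.
  exact: (Gs_bound R y (evpd_evsym eQ) ca).
have hb r : cabs (bt r) <= Num.sqrt K * mb.
  apply: tsum_le; apply: asum_le (asumZ (sqrtr_ge0 K) (hm r)) => y.
  rewrite cabs_ge0 /=; have := uK y; case: (y != 0) => /=; last by rewrite cabs0 mulr0.
  by case: (rcl y == r); rewrite ?andbT ?andbF // cabs0 mulr_ge0 ?sqrtr_ge0.
(* The phases [p r] merge $\sum_r |B_r|$ into one absolutely convergent sum over [y], where each [y]
   meets a single class; the class bounds are thus not added up. *)
pose p r : R[i] := if bt r == 0 then 0 else ((cabs (bt r))%:C / bt r)%C.
have pb r : p r * bt r = (cabs (bt r))%:C%C.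
  by rewrite /p; case: eqP => [->|/eqP h]; rewrite ?mul0r ?cabs0 // divfK.
have p1 r : cabs (p r) <= 1.
  rewrite /p; case: eqP => [_|/eqP h]; first by rewrite cabs0.
  by rewrite cabsM cabsV cabs_real ger0_norm ?cabs_ge0 // mulfV // gt_eqF // cabs_gt0.
have hsum : \sum_r cabs (bt r) <= Num.sqrt K * sb.
  have E : (\sum_r cabs (bt r))%:C%C = tsum (fun y => \sum_r p r * (if (y != 0) && (rcl y == r) then u y else 0)).
    have := tsum_sum (index_enum 'I_N) (fun r => summZ (p r) (summ_cond (fun y => (y != 0) && (rcl y == r)))).
    move=> [_ ->]; rewrite rmorph_sum /=; apply: eq_bigr => r _.
    by rewrite -pb tsumZ //; exact: summ_cond.
  rewrite -[leLHS]ger0_norm ?sumr_ge0 // => [|r _]; last exact: cabs_ge0.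
  rewrite -cabs_real E; apply: tsum_le; apply: asum_le (asumZ (sqrtr_ge0 K) hs) => y.
  rewrite cabs_ge0 /=; have [y0|y0] := boolP (y == 0).
    by rewrite big1 ?cabs0 ?mulr0 // => r _; rewrite mulr0.
  rewrite (bigD1 (rcl y)) //= eqxx big1 ?addr0 => [|r /negbTE h]; last by rewrite eq_sym h mulr0.
  by rewrite cabsM; apply: le_trans (uK y); rewrite ler_piMl ?cabs_ge0.
apply: (@le_trans _ _ (\sum_r (Num.sqrt K * mb) * cabs (bt r))).
  by apply: ler_sum => r _; rewrite expr2 ler_wpM2r ?cabs_ge0.
rewrite -mulr_sumr; have mb0 : 0 <= Num.sqrt K * mb by rewrite mulr_ge0 ?sqrtr_ge0 ?(asum_ge0 (hm ord0)).
apply: le_trans (ler_wpM2l mb0 hsum) _.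
by rewrite mulrACA sK.
Qed.
End Avg.

Lemma ff_lcm m (e : 'I_m -> nat) n i : (ff e n i * n.+1 = lcmn (e i) n.+1)%N.
Proof. by rewrite /ff /gg /lcmn divn_mulAC // dvdn_gcdl. Qed.

(** $f_i c = \operatorname{lcm}(e_i, c)$, and the least common multiple respects divisibility. *)
Lemma ff_chain m (e : 'I_m -> nat) n i j : (e i %| e j)%N -> (ff e n i %| ff e n j)%N.
Proof.
move=> h; rewrite -(@dvdn_pmul2r n.+1) // !ff_lcm dvdn_lcm dvdn_lcmr andbT.
exact: dvdn_trans h (dvdn_lcml _ _).
Qed.

Lemma prod_ge1 (R : realType) (I : Type) (r : seq I) (P : pred I) (F : I -> R) :
  (forall i, P i -> 1 <= F i) -> 1 <= \prod_(i <- r | P i) F i.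
Proof.
move=> h; elim/big_ind: _ => // x y x1 y1; by rewrite -[1]mulr1 ler_pM.
Qed.

(** Upper bounds for single pivots come from their product and a common lower bound; they make the
    height polynomial in [N]. *)
Lemma factor_le (R : realType) M (d : nat -> R) (l P : R) i0 : 0 < l <= 1 -> (forall i, (i < M)%N -> l <= d i) ->
  \prod_(0 <= i < M) d i <= P -> (i0 < M)%N -> d i0 <= P * l^-1 ^+ M.
Proof.
move=> /andP[l0 l1] hl hP iM.
have li : 0 <= l^-1 ^+ M by rewrite exprn_ge0 // invr_ge0 ltW.
apply: le_trans (ler_wpM2r li hP).
have -> : \prod_(0 <= i < M) d i * l^-1 ^+ M = \prod_(0 <= i < M) (d i / l).
  by rewrite big_split /= prodr_const_nat subn0.
rewrite big_mkord (bigD1 (Ordinal iM)) //=.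
have d0 : 0 <= d i0 by apply: le_trans (hl _ iM); exact: ltW.
apply: (@le_trans _ _ (d i0 / l)); first by rewrite ler_peMr // invf_ge1.
rewrite ler_peMr ?divr_ge0 ?(ltW l0) //; apply: prod_ge1 => i _.
by rewrite ler_pdivlMr // mul1r hl.
Qed.

Lemma gbound_le (R : realType) (Y k d : R) : 0 < Y -> Y / 4 <= k -> 0 < d ->
  gbound k d <= 4 * expR 1 * (1 + (Num.sqrt (Y * d))^-1).
Proof.
move=> Y0 Yk d0; have k0 : 0 < k by lra.
have h : (Num.sqrt (k * d))^-1 <= 2 * (Num.sqrt (Y * d))^-1.
  have s0 : 0 < Num.sqrt (Y * d) by rewrite sqrtr_gt0 mulr_gt0.
  rewrite -[2]invrK -invfM lef_pV2 ?posrE ?sqrtr_gt0 ?mulr_gt0 ?invr_gt0 //.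
  have -> : 2^-1 = Num.sqrt (4^-1) :> R.
    have -> : 4^-1 = 2^-1 ^+ 2 :> R by field.
    by rewrite sqrtr_sqr ger0_norm // invr_ge0.
  rewrite -sqrtrM ?invr_ge0 // ler_wsqrtr // mulrA ler_wpM2r ?(ltW d0) //; lra.
have e0 := expR_gt0 (1 : R).
have s0 : 0 <= (Num.sqrt (Y * d))^-1 by rewrite invr_ge0 sqrtr_ge0.
rewrite /gbound; move: (expR 1) e0 => E E0; move: (Num.sqrt (k * d))^-1 (Num.sqrt (Y * d))^-1 h s0 => u v h v0; nra.
Qed.

Lemma height_id (R : comRingType) (x k : R) M : 2 * x ^+ 4 * (x ^+ M * (x * k) ^+ M) ^+ 2 * (x ^+ M * (x * k) ^+ M) =
  2 * k ^+ (3 * M) * x ^+ (4 + 6 * M).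
Proof.
rewrite !exprMn exprD [(3 * M)%N]mulnC [(6 * M)%N]mulnC !(exprM _ M).
by move: (x ^+ M) (k ^+ M) => u v; ring.
Qed.

(** * The dual series at one cusp *)

Section Wrap.
Variables (R : realType) (m : nat).
Local Notation M := m.+2.
Local Notation cR := (map_mx (intr : int -> R)).

Lemma class_bounds (eps : R) : 0 < eps <= 1 -> exists2 C : R, 0 < C &
  forall (N' : nat) (Q B A P : 'M[int]_M) (e : 'I_M -> nat) (n : nat) (a : int) (w : R[i]),
  let N := N'.+1 in
  even_posdef R Q -> evsym B -> Q *m B = N%:Z%:M ->
  A \in unitmx -> P \in unitmx -> Q = A *m diagZ e *m P -> (forall i, (0 < e i)%N) ->
  (forall i j : 'I_M, (i <= j)%N -> (e i %| e j)%N) ->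
  (n.+1 %| N)%N -> coprimez a n.+1%:Z -> 4 / 5 <= complex.Im w ->
  let Y := complex.Im w in
  exists d : nat -> R, [/\ forall i, 0 < d i, forall i, (i.+1 < M)%N -> 3 / 4 * d i <= d i.+1,
    forall b, (b <= M)%N -> 1 <= (\prod_(i < M | (M - b <= i)%N) ff e n i)%N%:R * \prod_(0 <= i < b) d i &
    (forall r, asum (fun y => if [&& y != 0, Gs R n Q a y != 0 & rcl N' B y == r] then expR (- (2 * pi * qs R Q y * Y)) else 0)
       (C * N%:R `^ eps * expR (- (Y * d 0%N / 8)) * \prod_(2 <= i < M) (1 + (Num.sqrt (Y * d i))^-1))) /\
    asum (fun y => if (y != 0) && (Gs R n Q a y != 0) then expR (- (2 * pi * qs R Q y * Y)) else 0)
       (C * expR (- (Y / N%:R)) * \prod_(0 <= i < M) (1 + (Num.sqrt (Y * d i))^-1))].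
Proof.
move=> /andP[eps0 eps1].
(* The exponent of [N] in the height [H]; [eps] is divided by it before [binary_count] is
   applied. *)
pose q : R := (4 + 6 * M)%:R.
have q0 : 1 <= q by rewrite ler1n.
pose ep := eps / q.
have ep0 : 0 < ep by rewrite divr_gt0 //; lra.
have ep1 : ep <= 1 by rewrite ler_pdivrMr ?mul1r; lra.
have [C0 C00 hC0] := binary_count ep0.
have [K0 K0E] : exists K0 : R, K0 = (4 / 3) ^+ M by exists ((4 / 3) ^+ M).
have K01 : 1 <= K0 by rewrite K0E exprn_ege1 //; lra.
pose K1 : R := 2 * K0 ^+ (3 * M).
have K11 : 1 <= K1 by have : 1 <= K0 ^+ (3 * M) by [rewrite exprn_ege1]; rewrite /K1; lra.
pose g : R := 4 * expR 1.
have g1 : 1 <= g by have : 1 <= expR 1 :> R by [rewrite -[X in X <= _]expR0 ler_expR]; rewrite /g; lra.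
pose C := 16 * C0 * K1 `^ ep * g ^+ M + g ^+ M.
have gM : 0 < g ^+ M by rewrite exprn_gt0 //; lra.
have K10 : 0 < K1 by lra.
have CK : 0 < 16 * C0 * K1 `^ ep * g ^+ M.
  by apply: mulr_gt0 => //; apply: mulr_gt0; [rewrite mulr_gt0|exact: powR_gt0].
exists C => [|N' Q B A P e n a w N eQ eB QB uA uP QE e0 ch nN ca Y45 Y]; first by rewrite addr_gt0.
have Y0 : 0 < Y by rewrite /Y; lra.
have dQ := evpd_det eQ.
have dQ0 : \det Q != 0 by rewrite gt_eqF.
have uQ := evpd_unit eQ.
have N1 : 1 <= N%:R :> R by rewrite ler1n.
have N0 : 0 < N%:R :> R by lra.
pose La := Lam P e n.
have dLa : \det La != 0 by exact: (det_Lam e uP n).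
have cLa : cR La \in unitmx by rewrite unitmxE unitfE det_map_mx intr_eq0.
pose G0 := (cR La)^T *m invmx (cR Q) *m cR La.
have pG0 : pdef G0.
  by apply: pdef_cong (evpd_inv eQ) _ => x h; rewrite -[x](mulKmx cLa) h mulmx0.
have [Mx hMx] : exists Mx : 'M[int]_M, G0 = diag_mx (\row_i (ff e n i)%:R^-1) *m cR Mx.
  have [Mx hMx] := gram_Lam uA QE e0 n R dQ.
  by exists Mx; rewrite -hMx /G0 map_trmx.
have [U [V [UV VU hz hmin]]] := hkz_exists pG0.
set G := (cR U)^T *m G0 *m cR U in hz hmin.
have pG : pdef G by exact: pdef_unimod VU.
set dd := ldl G in hz hmin.
have sdd : size dd = M by exact: size_ldl.
have ddp : forall x, x \in dd -> 0 < x by exact: ldl_gt0.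
(* The default 1 keeps [d] positive at every index. *)
pose d i := nth 1 dd i.
have dE i : (i < M)%N -> d i = dd`_i by move=> iM; rewrite /d; apply: set_nth_default; rewrite sdd.
have d0 i : 0 < d i.
  by rewrite /d; have [h|h] := ltnP i (size dd); [exact/ddp/mem_nth|rewrite nth_default].
have dh i : (i.+1 < M)%N -> 3 / 4 * d i <= d i.+1.
  by move=> iM; rewrite !dE ?(ltnW iM) //; apply: hz; rewrite sdd.
pose L := La *m U.
have dU : \det U != 0.
  by apply/negP => /eqP h; have := congr1 determinant UV; rewrite det_mulmx h mul0r det1.
have uL : cR L \in unitmx by rewrite unitmxE unitfE det_map_mx intr_eq0 det_mulmx mulf_neq0.
have GE : N%:R^-1 *: ((cR L)^T *m cR B *m cR L) = G.
  rewrite /G /G0 (inv_level eQ QB) /L map_mxM trmx_mul !mulmxA.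
  by rewrite -!(scalemxAr, scalemxAl).
have pB : pdef (cR B).
  have -> : cR B = N%:R *: invmx (cR Q) by rewrite (inv_level eQ QB) scalerA mulfV ?scale1r // gt_eqF.
  case: (evpd_inv eQ) => s p; split; first by rewrite linearZ /= s.
  by move=> x x0; rewrite qfE -scalemxAl dotpZr -qfE mulr_gt0 // p.
have qsE := qs_level eQ eB QB.
(* [N * qs y] is a positive integer. This gives the decay $e^{-Y/N}$ and the lower bound for the
   pivots. *)
have qsN y : y != 0 -> N%:R^-1 <= qs R Q y.
  move=> y0; have : 0 < qs R Q y.
    by rewrite /qs divr_gt0 //; case: (evpd_inv eQ) => _; apply; rewrite cR_eq0.
  rewrite qsE pmulr_lgt0 ?invr_gt0 // ltr0z => h.
  by rewrite ler_peMl ?invr_ge0 // ler1z -gtz0_ge1.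
(* [y *+ 2] is a nonzero lattice vector, so $4y^TQ^{-1}y \ge d_0$, and [qs] is half of
   $y^TQ^{-1}y$. *)
have qsd y : y != 0 -> Gs R n Q a y != 0 -> d 0%N / 8 <= qs R Q y.
  move=> y0 Gy; have [k hk] := supp_double uP (evpd_evsym eQ) QE Gy.
  have k0 : k != 0.
    apply: contra y0 => /eqP E; have hz2 : y + y = 0 by rewrite -mulr2n hk E mulmx0.
    apply/eqP/matrixP => i j; have := congr1 (fun X : 'cV[int]_M => X i j) hz2.
    by rewrite !mxE -mulr2n => /eqP; rewrite mulrn_eq0 /= => /eqP.
  have := hmin k k0; rewrite -(dE 0%N) // -qf_mulmx -map_mxM -hk raddfMn /= -scaler_nat.
  rewrite qfE -scalemxAr dotpZl dotpZr -qfE /qs; clear; lra.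
have dl0 : N%:R^-1 <= d 0%N.
  have -> : d 0%N = qs R Q (L *m delta_mx 0 0) * 2.
    rewrite dE // (ldl_head G (i := 0)) // /qs divfK // map_mxM qf_mulmx cR_delta.
    rewrite -qf_delta /L map_mxM trmx_mul /G /G0 !mulmxA //.
  have h0 : L *m (delta_mx 0 0 : 'cV[int]_M) != 0.
    rewrite -(cR_eq0 R) map_mxM cR_delta; apply/eqP => h.
    have := congr1 (mulmx (invmx (cR L))) h; rewrite mulKmx // mulmx0 => /matrixP /(_ 0 0).
    by rewrite !mxE !eqxx => /eqP; rewrite oner_eq0.
  by have := qsN _ h0; have : 0 < N%:R^-1 :> R by [rewrite invr_gt0]; clear; lra.
have dl i : (i < M)%N -> (N%:R * K0)^-1 <= d i.
  move=> iM; apply: (@le_trans _ _ ((3 / 4) ^+ i * d 0%N)); last first.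
    elim: i iM => [|i IH] iM; first by rewrite expr0 mul1r.
    apply: le_trans (dh i iM); rewrite exprS -mulrA ler_wpM2l ?IH ?(ltnW iM) //; lra.
  rewrite invfM mulrC; apply: ler_pM; rewrite ?invr_ge0 ?(ltW N0) //; first by rewrite (le_trans ler01).
  rewrite K0E -exprVn (_ : (4 / 3)^-1 = 3 / 4); last by field.
  by apply: ler_wiXn2l; [clear; lra|clear; lra|exact: ltnW].
(* The determinant is $\prod g_i^2/\prod e_i = \prod g_i/\prod f_i$, with $g_i \le c \le N$. *)
have detG : \prod_(0 <= i < M) d i <= N%:R ^+ M.
  have -> : \prod_(0 <= i < M) d i = \det G.
    by rewrite (det_ldl pG) -/dd [RHS](big_nth 1) sdd.
  have du : \det U * \det V = 1 by rewrite -det_mulmx UV det1.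
  have dU2 : (\det (cR U)) ^+ 2 = 1.
    have h : `|\det U|%N = 1%N.
      by have := congr1 absz du; rewrite abszM => /eqP; rewrite muln_eq1 => /andP[/eqP].
    by rewrite det_map_mx -rmorphXn /= -[\det U ^+ 2]gez0_abs ?sqr_ge0 // abszX h.
  have -> : \det G = (\det La)%:~R ^+ 2 / (\det Q)%:~R.
    have E3 (X Z X' : 'M[R]_M) : \det (X'^T *m (X^T *m Z *m X) *m X') = \det X' ^+ 2 * \det X ^+ 2 * \det Z.
      by rewrite !det_mulmx !det_tr; ring.
    by rewrite /G /G0 E3 dU2 mul1r det_inv (det_map_mx _ La) (det_map_mx _ Q).
  have aLa : `|\det La|%N = (\prod_i gg e n i)%N.
    rewrite /La /Lam det_mulmx det_tr abszM (unit_absz uP) mul1n /diagZ det_diag.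
    by under eq_bigr do rewrite mxE; rewrite -(big_morph Posz PoszM (erefl _)).
  have La2 : (\det La)%:~R ^+ 2 = (\prod_i gg e n i)%N%:R ^+ 2 :> R.
    by rewrite -rmorphXn /= -[\det La ^+ 2]gez0_abs ?sqr_ge0 // abszX aLa -natrX.
  have dQE : (\det Q)%:~R = (\prod_i ff e n i)%N%:R * (\prod_i gg e n i)%N%:R :> R.
    rewrite (smith_det uA uP QE dQ) -(big_morph Posz PoszM (erefl _)) -natrM -big_split /=.
    by congr (_%:R); apply: eq_bigr => i _; rewrite ff_gg.
  have f1 : 1 <= (\prod_i ff e n i)%N%:R :> R by rewrite ler1n prodn_gt0 // => i; exact: ff_gt0.
  have g0 : 0 < (\prod_i gg e n i)%N%:R :> R by rewrite ltr0n prodn_gt0 // => i; exact: gg_gt0.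
  have gN : (\prod_i gg e n i)%N%:R <= N%:R ^+ M :> R.
    rewrite -natrX ler_nat -[X in (_ <= _ ^ X)%N]card_ord -prod_nat_const; apply: leq_prod => i _.
    by apply: dvdn_leq => //; exact: dvdn_trans (gg_dvdc _ _ _) nN.
  rewrite La2 dQE; apply: le_trans gN; rewrite ler_pdivrMr ?mulr_gt0 //; last exact: lt_le_trans f1.
  move: (_%:R) (_%:R) f1 g0 => x y; clear; nra.
pose Bd : R := N%:R ^+ M * (N%:R * K0) ^+ M.
have NK1 : 1 <= N%:R * K0 by exact: mulr_ege1.
have dB i : (i < M)%N -> d i <= Bd.
  move=> iM; rewrite /Bd -[N%:R * K0]invrK; apply: factor_le dl detG iM.
  by rewrite invr_gt0 (lt_le_trans ltr01 NK1) invf_le1 // (lt_le_trans ltr01).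
pose H := K1 * N%:R ^+ (4 + 6 * M).
have H1 : 1 <= H by rewrite -[1]mulr1 ler_pM // exprn_ege1.
have HH : 2 * N%:R ^+ 4 * d 0%N ^+ 2 * d 1%N <= H.
  apply: (@le_trans _ _ (2 * N%:R ^+ 4 * Bd ^+ 2 * Bd)).
    have B0 : 0 <= Bd by rewrite (le_trans (ltW (d0 0%N))) // dB.
    have h2 : d 0%N ^+ 2 <= Bd ^+ 2 by rewrite lerXn2r ?nnegrE ?(ltW (d0 _)) ?dB.
    have h3 : 2 * N%:R ^+ 4 * d 0%N ^+ 2 <= 2 * N%:R ^+ 4 * Bd ^+ 2.
      by rewrite ler_wpM2l // mulr_ge0 ?exprn_ge0 ?(ltW N0).
    have h4 : 0 <= 2 * N%:R ^+ 4 * d 0%N ^+ 2.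
      by rewrite mulr_ge0 ?sqr_ge0 // mulr_ge0 // exprn_ge0 // ltW.
    exact: (ler_pM h4 (ltW (d0 1%N)) h3 (dB 1%N _)).
  by rewrite /H /K1 /Bd height_id.
have Hep : H `^ ep = K1 `^ ep * N%:R `^ eps.
  rewrite /H powRM ?exprn_ge0 ?(ltW N0) //; last by apply: (le_trans ler01).
  by congr (_ * _); rewrite -powR_mulrn ?(ltW N0) // -powRrM -/q mulrC /ep divfK // gt_eqF //; lra.
(* A quarter of the exponent $2\pi Y$ is set aside; as $\pi \ge 2$, it pays for the decay factors in
   [E1] and [E2]. *)
pose kap := 3 / 2 * pi * Y.
have pi2 : 2 <= pi :> R by exact: pi_ge2.
have piY : 2 * Y <= pi * Y by rewrite ler_wpM2r // ltW.
have kap2 : 2 <= kap by rewrite /kap -mulrA; move: Y45 piY; rewrite -/Y; clear; lra.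
have kY1 : Y <= kap by rewrite /kap -mulrA; move: Y0 piY; clear; lra.
have gb k : Y / 4 <= k -> forall x, x \in dd -> 0 <= gbound k x <= g * (1 + (Num.sqrt (Y * x))^-1).
  by move=> Yk x xd; rewrite gbound_ge0 gbound_le // ddp.
have gprod k s : Y / 4 <= k -> {subset s <= dd} -> (size s <= M)%N ->
   \prod_(x <- s) gbound k x <= g ^+ M * \prod_(x <- s) (1 + (Num.sqrt (Y * x))^-1).
  move=> Yk sd sM; apply: (@le_trans _ _ (\prod_(x <- s) (g * (1 + (Num.sqrt (Y * x))^-1)))).
    by rewrite big_seq [leRHS]big_seq; apply: ler_prod => x /sd; exact: gb.
  rewrite big_split /= big_const_seq count_predT -Monoid.iteropE /= -/(g ^+ size s).
  apply: ler_wpM2r; last exact: ler_weXn2l.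
  by apply: prodr_ge0 => x _; rewrite addr_ge0 // invr_ge0 sqrtr_ge0.
have E1 y : y != 0 -> Gs R n Q a y != 0 -> expR (- (2 * pi * qs R Q y * Y)) <= expR (- (Y * d 0%N / 8)) * expR (- (kap * qs R Q y)).
  move=> y0 Gy; rewrite -expRD ler_expR /kap.
  have h1 := qsd y y0 Gy; have : 2 * (Y * (d 0%N / 8)) <= pi * (Y * qs R Q y).
    apply: ler_pM => //; rewrite ?mulr_ge0 ?divr_ge0 ?(ltW Y0) ?(ltW (d0 _)) //; by rewrite ler_wpM2l // ltW.
  clear; lra.
have E2 y : y != 0 -> expR (- (2 * pi * qs R Q y * Y)) <= expR (- (Y / N%:R)) * expR (- (kap * qs R Q y)).
  move=> y0; rewrite -expRD ler_expR /kap.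
  have h1 := qsN y y0; have : 2 * (Y * N%:R^-1) <= pi * (Y * qs R Q y).
    apply: ler_pM => //; rewrite ?mulr_ge0 ?invr_ge0 ?(ltW Y0) ?(ltW N0) //; by rewrite ler_wpM2l // ltW.
  clear; lra.
have dd2 : exists x0 x1 t, dd = [:: x0, x1 & t] by case: (dd) sdd => [|x0 [|x1 t]] //; exists x0, x1, t.
have prod0 : \prod_(x <- dd) (1 + (Num.sqrt (Y * x))^-1) = \prod_(0 <= i < M) (1 + (Num.sqrt (Y * d i))^-1).
  by rewrite [LHS](big_nth 1) sdd.
have prod2 : \prod_(x <- behead (behead dd)) (1 + (Num.sqrt (Y * x))^-1) = \prod_(2 <= i < M) (1 + (Num.sqrt (Y * d i))^-1).
  rewrite [LHS](big_nth 1) !size_behead sdd [RHS](big_addn 0 M 2) subn2; apply: eq_bigr => i _.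
  by rewrite /d !nth_behead addn2.
exists d; split=> //.
  move=> b bM; have := ldl_lower pG0 hMx VU (ff_gt0 e0 n) (fun i j ij => ff_chain n (ch i j ij)) bM.
  rewrite -/G -/dd; suff -> : \prod_(x <- take b dd) x = \prod_(0 <= i < b) d i by [].
  rewrite [LHS](big_nth 1) size_take sdd.
  have -> : (if (b < M)%N then b else M) = b by case: ltnP => // h; apply/eqP; rewrite eqn_leq h bM.
  by apply: eq_big_nat => i /andP[_ ib]; rewrite nth_take.
have P0 i1 : 0 <= \prod_(i1 <= i < M) (1 + (Num.sqrt (Y * d i))^-1).
  by apply: prodr_ge0 => x _; rewrite addr_ge0 // invr_ge0 sqrtr_ge0.
(* Without a vector in the support both families vanish; otherwise [y0] serves as the origin of the
   coset. *)
have [[y0 Gy0]|no] := pselect (exists y0, Gs R n Q a y0 != 0); last first.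
  have z y : (Gs R n Q a y != 0) = false by apply/negbTE/negP => h; apply: no; exists y.
  have c0 b : 0 <= b -> asum (fun=> 0 : R) b by move=> b0; split=> // s; rewrite big1.
  have C0' : 0 < C by rewrite addr_gt0.
  split=> [r|]; (under eq_fun do rewrite z ?andbF /=); apply: c0; rewrite !mulr_ge0 ?powR_ge0 ?expR_ge0 ?(ltW C0') //.
have supp y : Gs R n Q a y != 0 -> exists k, y0 + L *m k = y.
  move=> Gy; have [k hk] := supp_coset uP (evpd_evsym eQ) QE Gy Gy0.
  by exists (V *m k); rewrite /L -mulmxA (mulmxA U) UV mul1mx -hk addrC subrK.
split=> [r|]; last first.
  apply: (asum_image (h := fun k => y0 + L *m k)) => [y|y|].
  - by case: ifP => // _; exact: expR_ge0.
  - by case: ifP; rewrite ?eqxx // => /andP[_ /supp].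
  have k0 : 0 < kap by exact: lt_le_trans kap2.
  have := slice_total y0 eB pB (ltn0Sn N') uL k0; rewrite GE -/dd => hs.
  have := asumZ (expR_ge0 (- (Y / N%:R))) hs; rewrite -/N => hs2.
  apply: asum_leM; last apply: asum_le hs2; last first.
    move=> k /=; case: ifP => [/andP[yk Gk]|_]; rewrite ?expR_ge0 ?lexx /= ?mulr_ge0 ?expR_ge0 //.
    by rewrite -qsE E2.
  have kY : Y / 4 <= kap / 2 by move: Y0 kY1; clear; lra.
  have := gprod (kap / 2) dd kY (fun x h => h); rewrite sdd leqnn => /(_ isT); rewrite prod0 => h.
  rewrite [leRHS](_ : _ = expR (- (Y / N%:R)) * (C * \prod_(0 <= i < M) (1 + (Num.sqrt (Y * d i))^-1))); last by ring.
  rewrite ler_wpM2l ?expR_ge0 //; apply: le_trans h _.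
  by rewrite ler_wpM2r ?P0 // /C lerDr ltW.
apply: (asum_image (h := fun k => y0 + L *m k)) => [y|y|].
- by case: ifP => // _; exact: expR_ge0.
- by case: ifP; rewrite ?eqxx // => /and3P[_ /supp].
have e01 : 0 < ep <= 1 by rewrite ep0.
have rN : 0 <= (r : nat)%:Z < N%:Z by rewrite ltz_nat ltn_ord.
have := @slice_residue R m B L N y0 eB pB (ltn0Sn N') uL ep C0 H kap (r : nat)%:Z e01 C00 hC0 rN kap2 H1.
rewrite GE -/dd -!dE // => /(_ HH) hs.
have := asumZ (expR_ge0 (- (Y * d 0%N / 8))) hs => hs2.
apply: asum_leM; last apply: asum_le hs2; last first.
  move=> k /=; case: ifP => [/and3P[yk Gk /eqP rk]|_]; last first.
    by rewrite lexx /= mulr_ge0 ?expR_ge0 //; case: ifP => // _; exact: expR_ge0.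
  rewrite expR_ge0 /=; have := rcl_mod N' B (y0 + L *m k); rewrite rk => /dvdz_mod0P ->.
  by rewrite eqxx -qsE E1.
have kY : Y / 4 <= kap / 4 by move: kY1; clear; lra.
have := gprod (kap / 4) (behead (behead dd)) kY; rewrite !size_behead sdd prod2 => /(_ _ _) h.
have {}h := h (fun x hx => mem_behead (mem_behead hx)) (leq_trans (leqnSn _) (leqnSn _)).
have W0 : 0 <= 16 * C0 * H `^ ep by rewrite !mulr_ge0 ?powR_ge0 // ltW.
rewrite [leRHS](_ : _ = expR (- (Y * d 0%N / 8)) * (C * N%:R `^ eps * \prod_(2 <= i < M) (1 + (Num.sqrt (Y * d i))^-1))); last by ring.
rewrite ler_wpM2l ?expR_ge0 //; apply: le_trans (ler_wpM2l W0 h) _.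
rewrite mulrA ler_wpM2r ?P0 // Hep /C.
have := powR_ge0 N%:R eps; have := mulr_ge0 (ltW gM) (powR_ge0 N%:R eps); clear; lra.
Qed.
End Wrap.

(** * Integral two by two matrices *)

Definition mk2 (a b c d : int) : 'M[int]_2 :=
  \matrix_(i, j) (if i == 0 then if j == 0 then a else b else if j == 0 then c else d).

Lemma mk2E a b c d : [/\ mk2 a b c d 0 0 = a, mk2 a b c d 0 1 = b, mk2 a b c d 1 0 = c & mk2 a b c d 1 1 = d].
Proof. by rewrite !mxE. Qed.

Lemma mul2E (g h : 'M[int]_2) i j : (g *m h) i j = g i 0 * h 0 j + g i 1 * h 1 j.
Proof.
rewrite mxE !big_ord_recl big_ord0 addr0; have -> // : lift ord0 ord0 = 1 :> 'I_2 by exact/val_inj.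
Qed.

Lemma mx2P (g h : 'M[int]_2) : g 0 0 = h 0 0 -> g 0 1 = h 0 1 -> g 1 0 = h 1 0 -> g 1 1 = h 1 1 -> g = h.
Proof.
move=> e1 e2 e3 e4; apply/matrixP => i j.
have o (k : 'I_2) : k = 0 \/ k = 1 by case: k => [[|[|k]] hk]; [left|right|]; try exact/val_inj.
by case: (o i) => ->; case: (o j) => ->.
Qed.

Lemma det_mk2 a b c d : \det (mk2 a b c d) = a * d - b * c.
Proof. by rewrite det2; have [-> -> -> ->] := mk2E a b c d. Qed.

Definition inv2 (g : 'M[int]_2) := mk2 (g 1 1) (- g 0 1) (- g 1 0) (g 0 0).

Lemma det_inv2 g : \det g = 1 -> \det (inv2 g) = 1.
Proof. by rewrite det_mk2 det2 => <-; ring. Qed.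

Lemma inv2K g : \det g = 1 -> inv2 g *m g = 1%:M.
Proof.
rewrite det2 => h; have [e1 e2 e3 e4] := mk2E (g 1 1) (- g 0 1) (- g 1 0) (g 0 0).
by apply: mx2P; rewrite mul2E ?e1 ?e2 ?e3 ?e4 !mxE /= ?mulr1n ?mulr0n; first [rewrite -h; ring|ring].
Qed.

Lemma Gamma0M N g h : Gamma0 N g -> Gamma0 N h -> Gamma0 N (g *m h).
Proof.
move=> [d1 n1] [d2 n2]; split; first by rewrite det_mulmx d1 d2 mulr1.
by rewrite mul2E; apply: rpredD; [exact: dvdz_mulr|exact: dvdz_mull].
Qed.

Lemma Gamma0V N g : Gamma0 N g -> Gamma0 N (inv2 g).
Proof.
move=> [d1 n1]; split; first exact: det_inv2.
by have [_ _ -> _] := mk2E (g 1 1) (- g 0 1) (- g 1 0) (g 0 0); rewrite rpredN.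
Qed.

(** The lower left entry of $gh^{-1}$ is, up to sign conventions, this minor: a coset is known from
    its bottom row as a point of the projective line modulo [N]. *)
Lemma Gamma0_eq N (g h : 'M[int]_2) : \det g = 1 -> \det h = 1 ->
  (N%:Z %| g 1%R 0%R * h 1%R 1%R - g 1%R 1%R * h 1%R 0%R)%Z -> exists2 s, Gamma0 N s & g = s *m h.
Proof.
move=> dg dh hN; exists (g *m inv2 h); last by rewrite -mulmxA inv2K // mulmx1.
split; first by rewrite det_mulmx dg det_inv2 // mulr1.
by have [e1 _ e3 _] := mk2E (h 1 1) (- h 0 1) (- h 1 0) (h 0 0); rewrite mul2E e1 e3 mulrN.
Qed.

(** * Cosets of Gamma_0(N) *)

Section Moebius.
Variable R : realType.
Implicit Types z w : R[i].

Lemma cabs_conjM z : (cabs z ^+ 2)%:C%C = z * conjc z.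
Proof. by rewrite cabs_sqr; case: z => x y /=; apply/eqP; rewrite eq_complex /=; apply/andP; split; apply/eqP; ring. Qed.

Lemma moebius_den (c d : int) z : 0 < complex.Im z -> (c, d) != (0, 0) -> c%:~R * z + d%:~R != 0.
Proof.
move=> z0; apply: contra => /eqP h.
have hI : c%:~R * complex.Im z = 0.
  have := congr1 (@complex.Im R) h; case: (z) => x y; rewrite -!(rmorph_int (real_complex R)) /= => <-; ring.
move/eqP: hI; rewrite mulf_eq0 (gt_eqF z0) orbF intr_eq0 => /eqP c0.
by move: h; rewrite c0 mul0r add0r => /eqP; rewrite intr_eq0 => /eqP ->.
Qed.

Lemma sl2_row (g : 'M[int]_2) : \det g = 1 -> (g 1 0, g 1 1) != (0, 0).
Proof. by move=> h; apply/eqP => -[e1 e2]; move: h; rewrite det2 e1 e2 !mulr0 subr0. Qed.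

Lemma im_frac (a b c d : R) z :
  complex.Im ((a%:C%C * z + b%:C%C) * conjc (c%:C%C * z + d%:C%C)) = (a * d - b * c) * complex.Im z.
Proof. by case: z => x y /=; ring. Qed.

Lemma moebius_Im (g : 'M[int]_2) z : \det g = 1 -> 0 < complex.Im z ->
  complex.Im (moebius g z) = complex.Im z / cabs ((g 1 0)%:~R * z + (g 1 1)%:~R) ^+ 2.
Proof.
move=> dg z0; have D0 := moebius_den z0 (sl2_row dg).
rewrite /moebius; set D := _ * z + (g 1 1)%:~R in D0 *.
have -> : ((g 0 0)%:~R * z + (g 0 1)%:~R) / D = ((g 0 0)%:~R * z + (g 0 1)%:~R) * conjc D * ((cabs D ^+ 2)^-1)%:C%C.
  rewrite fmorphV /= cabs_conjM invfM -mulrA; congr (_ * _).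
  by rewrite mulrCA mulfV ?mulr1 // conjc_eq0.
have -> (u : R[i]) (r : R) : complex.Im (u * r%:C%C) = complex.Im u * r by case: u => x y /=; ring.
congr (_ * _); rewrite /D -!(rmorph_int (real_complex R)) im_frac.
by rewrite -!rmorphM -rmorphB -det2 dg mul1r.
Qed.

Lemma moebius_Im_gt0 (g : 'M[int]_2) z : \det g = 1 -> 0 < complex.Im z -> 0 < complex.Im (moebius g z).
Proof.
by move=> dg z0; rewrite moebius_Im // divr_gt0 // exprn_gt0 // cabs_gt0 // moebius_den // sl2_row.
Qed.

Lemma moebiusM (g h : 'M[int]_2) z : \det g = 1 -> \det h = 1 -> 0 < complex.Im z ->
  moebius (g *m h) z = moebius g (moebius h z).
Proof.
move=> dg dh z0; have D0 := moebius_den z0 (sl2_row dh).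
have w0 := moebius_Im_gt0 dh z0; have D1 := moebius_den w0 (sl2_row dg).
have wE : moebius h z * ((h 1 0)%:~R * z + (h 1 1)%:~R) = (h 0 0)%:~R * z + (h 0 1)%:~R by rewrite /moebius divfK.
rewrite [LHS]/moebius [RHS]/moebius; move: (moebius h z) wE D1 => w wE D1.
rewrite !mul2E !rmorphD !rmorphM /=.
have e (a b : R[i]) : (a * (h 0 0)%:~R + b * (h 1 0)%:~R) * z + (a * (h 0 1)%:~R + b * (h 1 1)%:~R) =
  (a * w + b) * ((h 1 0)%:~R * z + (h 1 1)%:~R).
  have -> : (a * w + b) * ((h 1 0)%:~R * z + (h 1 1)%:~R) = a * (w * ((h 1 0)%:~R * z + (h 1 1)%:~R)) + b * ((h 1 0)%:~R * z + (h 1 1)%:~R) by ring.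
  by rewrite wE; ring.
by rewrite !e -mulf_div divff // mulr1.
Qed.

Lemma moebius1 z : moebius 1%:M z = z.
Proof. by rewrite /moebius !mxE /= !mulr1n !mulr0n mul1r mul0r addr0 add0r divr1. Qed.
End Moebius.

Lemma dvdn_prod_primes p s (P : pred nat) : prime p -> all prime s ->
  (p %| \prod_(q <- s | P q) q)%N = (p \in s) && P p.
Proof.
move=> pp; elim: s => [|q s IH] /=; first by rewrite big_nil dvdn1 => _; case: p pp => [|[|]].
move=> /andP[pq /IH {}IH]; rewrite big_cons in_cons; have [pqE|pq'] := eqVneq p q.
  rewrite -pqE; by case: ifP => // h; rewrite ?dvdn_mulr ?IH ?h ?andbF.
by case: ifP => h; [rewrite Euclid_dvdM // dvdn_prime2 // (negbTE pq') /=|]; exact: IH.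
Qed.

(** [k] is the product of the primes of [c] that do not divide [d1], so every prime of [c] divides
    exactly one of [d1] and [n' * k]. Starting from [d1 = d0 + n'] keeps the number positive. *)
Lemma coprime_lift (d0 n' c : nat) : (0 < n')%N -> (0 < c)%N -> coprime (gcdn d0 n') c ->
  exists k, coprime (d0 + n' * k) c.
Proof.
move=> n0 c0 hc; pose d1 := (d0 + n')%N; pose k := (\prod_(q <- primes c | ~~ (q %| d1)) q)%N.
have ap : all prime (primes c) by apply/allP => p; rewrite mem_primes => /and3P[].
have d10 : (0 < d1)%N by rewrite addn_gt0 n0 orbT.
exists k.+1; rewrite mulnS addnA -/d1.
have pos : (0 < d1 + n' * k)%N by rewrite addn_gt0 d10.
rewrite coprime_has_primes //; apply/hasPn => p pC; have := pC; rewrite mem_primes => /and3P[pp _ pc].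
apply/negP => /=; rewrite mem_primes => /and3P[_ _ pd].
have [pd1|pd1] := boolP (p %| d1)%N.
  have : (p %| n' * k)%N by rewrite -(dvdn_addr _ pd1).
  rewrite Euclid_dvdM // => /orP[pn|].
    have pd0 : (p %| d0)%N by rewrite -(dvdn_addl _ pn).
    have : (p %| gcdn (gcdn d0 n') c)%N by rewrite !dvdn_gcd pd0 pn.
    by rewrite (eqP hc) dvdn1 => /eqP E; rewrite E in pp.
  by rewrite dvdn_prod_primes // pd1 andbF.
have pk : (p %| k)%N by rewrite dvdn_prod_primes // pC pd1.
by move: pd; rewrite dvdn_addl ?(negbTE pd1) // dvdn_mull.
Qed.

(** With $C = C'c$ and $N = n'c$, multiplication by the inverse [u] of $C'$ modulo $n'$ normalizes
    the row; then $d \equiv uD$ modulo $n'$ is adjusted by [coprime_lift] to be prime to [c]. *)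
Lemma coset_row (C D : int) (N : nat) : (0 < N)%N -> coprimez C D ->
  exists d : int, coprimez (gcdn `|C| N)%:Z d /\ (N%:Z %| C * d - D * (gcdn `|C| N)%:Z)%Z.
Proof.
move=> N0 cop; pose c := gcdn `|C| N; rewrite -/c.
have c0 : (0 < c)%N by rewrite gcdn_gt0 N0 orbT.
have cd1 : (c%:Z %| C)%Z by rewrite dvdzE /= dvdn_gcdl.
have cd2 : (c %| N)%N by rewrite dvdn_gcdr.
have [C' CE] := dvdzP cd1; have [n' NE] := dvdnP cd2.
have n0 : (0 < n')%N by move: N0; rewrite NE muln_gt0 => /andP[].
have cop' : coprimez C' n'%:Z.
  have h : gcdn (`|C'| * c) (n' * c) = c.
    have -> : (`|C'| * c)%N = `|C|%N by rewrite [in RHS]CE abszM.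
    by rewrite -NE.
  rewrite -muln_gcdl in h.
  have {}h : (gcdn `|C'| n' == 1)%N by rewrite -(eqn_pmul2r c0) h mul1n.
  by rewrite /coprimez /gcdz /= (eqP h).
have [[u v] uv] := coprimezP _ _ cop'; rewrite /= in uv.
have nz : n'%:Z != 0 by rewrite eqz_nat -lt0n.
pose q := ((u * D) %/ n'%:Z)%Z.
pose d0 : nat := `|((u * D) %% n'%:Z)%Z|%N.
have d0E : d0%:Z = u * D - q * n'%:Z.
  rewrite /d0 gez0_abs ?modz_ge0 // /q; apply/eqP; rewrite eq_sym subr_eq addrC; apply/eqP; exact: divz_eq.
have h0 : (n'%:Z %| C' * d0%:Z - D)%Z.
  have -> : C' * d0%:Z - D = (u * C' + v * n'%:Z - 1) * D + n'%:Z * (- (v * D) - C' * q) by rewrite d0E; ring.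
  by rewrite uv subrr mul0r add0r dvdz_mulr.
have hc : coprime (gcdn d0 n') c.
  set g := gcdn (gcdn d0 n') c; have gc : (g %| c)%N by rewrite dvdn_gcdr.
  have gd : (g %| d0)%N by rewrite (dvdn_trans (dvdn_gcdl _ _)) ?dvdn_gcdl.
  have gn : (g %| n')%N by rewrite (dvdn_trans (dvdn_gcdl _ _)) ?dvdn_gcdr.
  have gD : (g%:Z %| D)%Z.
    have -> : D = C' * d0%:Z - (C' * d0%:Z - D) by ring.
    apply: rpredB; first by rewrite dvdz_mull // dvdzE.
    apply: dvdz_trans h0; by rewrite dvdzE.
  have gC : (g%:Z %| C)%Z by rewrite CE dvdz_mull // dvdzE.
  have : (g%:Z %| gcdz C D)%Z by rewrite dvdz_gcd gC gD.
  by rewrite (eqP cop) dvdzE /= dvdn1.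
have [k hk] := coprime_lift n0 c0 hc.
exists (d0 + n' * k)%N%:Z; split; first by rewrite /coprimez /gcdz /= gcdnC (eqP hk).
have -> : C * (d0 + n' * k)%N%:Z - D * c%:Z = N%:Z * (C' * k%:Z) + c%:Z * (C' * d0%:Z - D).
  by rewrite NE CE PoszD !PoszM; ring.
apply: rpredD; first exact: dvdz_mulr.
by rewrite NE mulnC PoszM; apply: dvdz_mul.
Qed.

Lemma coset_rep (N : nat) (g : 'M[int]_2) : (0 < N)%N -> \det g = 1 ->
  exists s h, [/\ Gamma0 N s, g = s *m h, \det h = 1 & h 1 0 = (gcdn `|g 1%R 0%R| N)%:Z].
Proof.
move=> N0 dg.
have cop : coprimez (g 1 0) (g 1 1).
  apply/coprimezP; exists (- g 0 1, g 0 0) => /=; rewrite -dg det2; ring.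
have [d [cd hd]] := coset_row N0 cop; set c := gcdn _ _ in cd hd *.
have [[u v] uv] := coprimezP _ _ cd; rewrite /= in uv.
pose h := mk2 v (- u) c d; have [_ _ e3 e4] := mk2E v (- u) c d.
have dh : \det h = 1 by rewrite det_mk2 -uv; ring.
have hN : (N%:Z %| g 1%R 0%R * h 1%R 1%R - g 1%R 1%R * h 1%R 0%R)%Z by rewrite /h e3 e4.
have [s sN E] := Gamma0_eq dg dh hN.
by exists s, h; split=> //; rewrite /h e3.
Qed.

Section CosetSum.
Variables (R : realType) (N : nat) (phi : R[i] -> R).
Hypothesis N0 : (0 < N)%N.
Hypothesis phi0 : forall z, 0 <= phi z.
Hypothesis phiG : forall g z, Gamma0 N g -> 0 < complex.Im z -> phi (moebius g z) = phi z.

Lemma periodic_sum (H : nat -> R) n : (forall d, H (d + n)%N = H d) -> forall t,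
  \sum_(0 <= d < n) H (d + t)%N = \sum_(0 <= d < n) H d.
Proof.
move=> hp; elim=> [|t IH]; first by under eq_bigr do rewrite addn0.
rewrite -IH; case: n hp {IH} => [|n] hp; first by rewrite !big_geq.
rewrite big_nat_recr //= [RHS]big_nat_recl //= add0n addrC.
have -> : (n + t.+1 = t + n.+1)%N by lia.
by rewrite hp; congr (_ + _); apply: eq_bigr => i _; rewrite addSnnS.
Qed.

Section Cusp.
Variables (c n : nat).
Hypothesis NE : N = (n * c)%N.
Let n0 : (0 < n)%N. Proof. by move: N0; rewrite NE muln_gt0 => /andP[]. Qed.

Definition cusp_rep (d : nat) (h : 'M[int]_2) := [/\ \det h = 1, h 1 0 = c%:Z & (n%:Z %| h 1%R 1%R - d%:Z)%Z].
(** Independent of the matrix chosen since [phi] is invariant. Labels without a matrix get 0, so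
    sums may run over all residues [d]. *)
Definition cusp_val (d : nat) (w : R[i]) : R :=
  if pselect (exists h, cusp_rep d h) is left e then phi (moebius (projT1 (cid e)) w) else 0.

Lemma cusp_valE d h w : cusp_rep d h -> 0 < complex.Im w -> cusp_val d w = phi (moebius h w).
Proof.
move=> hd w0; rewrite /cusp_val; case: pselect => [e|[]]; last by exists h.
case: cid => k [dk k10 kd] /=; case: hd => dh h10 hd.
have hN : (N%:Z %| k 1%R 0%R * h 1%R 1%R - k 1%R 1%R * h 1%R 0%R)%Z.
  rewrite k10 h10 NE mulnC PoszM [k 1 1 * _]mulrC -mulrBr; apply: dvdz_mul => //.
  by have := rpredB hd kd; rewrite opprB addrA subrK.
have [s sN ->] := Gamma0_eq dk dh hN.
by case: (sN) => ds _; rewrite moebiusM // phiG // moebius_Im_gt0.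
Qed.

Lemma cusp_val_ge0 d w : 0 <= cusp_val d w.
Proof. by rewrite /cusp_val; case: pselect. Qed.

Lemma cusp_val0 d w : ~ (exists h, cusp_rep d h) -> cusp_val d w = 0.
Proof. by rewrite /cusp_val; case: pselect. Qed.

Lemma cusp_rep_shift d h (j : int) (d' : nat) : cusp_rep d h -> (n%:Z %| d'%:Z - d%:Z - c%:Z * j)%Z ->
  cusp_rep d' (h *m mk2 1 j 0 1).
Proof.
move=> [dh h10 hd] hj; have [e1 e2 e3 e4] := mk2E 1 j 0 1; split.
- by rewrite det_mulmx dh det_mk2; ring.
- by rewrite mul2E e1 e3 h10; ring.
rewrite mul2E e2 e4 h10 mulr1.
by have := rpredB hd hj; rewrite (_ : _ - _ = c%:Z * j + h 1 1 - d'%:Z) //; ring.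
Qed.

Lemma moebius_trans (j : int) (w : R[i]) : moebius (mk2 1 j 0 1) w = w + j%:~R.
Proof. by rewrite /moebius; have [-> -> -> ->] := mk2E 1 j 0 1; rewrite mul1r mul0r add0r divr1. Qed.

Lemma cusp_val_shift d (j : nat) w : 0 < complex.Im w -> cusp_val d (w + j%:R) = cusp_val (d + c * j) w.
Proof.
move=> w0; have wj : 0 < complex.Im (w + j%:R) by have := Im_int w j; rewrite -[j%:~R]/(j%:R) => ->.
have [[h hd]|no] := pselect (exists h, cusp_rep d h).
  have hd' : cusp_rep (d + c * j) (h *m mk2 1 j 0 1).
    by apply: (cusp_rep_shift hd); rewrite PoszD PoszM (_ : _ - _ = 0) ?dvdz0 //; ring.
  rewrite (cusp_valE hd) // (cusp_valE hd') // moebiusM ?moebius_trans //; [by case: hd|by rewrite det_mk2; ring].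
rewrite !cusp_val0 // => -[h hd]; apply: no; exists (h *m mk2 1 (- j%:Z) 0 1).
by apply: (cusp_rep_shift hd); rewrite PoszD PoszM (_ : _ - _ = 0) ?dvdz0 //; ring.
Qed.

Lemma cusp_val_per d w : cusp_val (d + n) w = cusp_val d w.
Proof.
have E h : cusp_rep (d + n) h <-> cusp_rep d h.
  have hn x : (n%:Z %| x - (d + n)%N%:Z)%Z = (n%:Z %| x - d%:Z)%Z.
    by rewrite PoszD opprD addrA rpredBr.
  by rewrite /cusp_rep hn.
by rewrite /cusp_val; have -> : cusp_rep (d + n) = cusp_rep d by apply/funext => h; exact/propext.
Qed.

(** Translating [w] by [j] permutes the labels by $d \mapsto d + cj$, so the sum over all labels
    equals its average over $j < N$, and that average is bounded label by label. *)
Lemma cusp_sum (s : seq 'M[int]_2) w A : 0 <= A -> 0 < complex.Im w -> uniq s ->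
  (forall g, g \in s -> \det g = 1 /\ gcdn `|g 1%R 0%R| N = c) ->
  (forall g g' t, g \in s -> g' \in s -> Gamma0 N t -> g = t *m g' -> g = g') ->
  (forall h, \det h = 1 -> h 1 0 = c%:Z -> \sum_(0 <= j < N) phi (moebius h (w + j%:R)) <= N%:R * A) ->
  \sum_(g <- s) phi (moebius g w) <= n%:R * A.
Proof.
move=> A0 w0 us hs hin hA.
have rep g : exists h, g \in s -> [/\ \det h = 1, h 1 0 = c%:Z & exists2 t, Gamma0 N t & g = t *m h].
  have [gs|] := boolP (g \in s); last by exists 1%:M.
  have [dg gc] := hs g gs; have [t [h [tN E dh h10]]] := coset_rep N0 dg.
  by exists h => _; split=> //; [rewrite h10 gc|exists t].
pose hh g := projT1 (cid (rep g)).
have hhP g : g \in s -> [/\ \det (hh g) = 1, hh g 1 0 = c%:Z & exists2 t, Gamma0 N t & g = t *m hh g].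
  by rewrite /hh; case: cid.
pose D g : nat := `|(hh g 1%R 1%R %% n%:Z)%Z|%N.
have nz : n%:Z != 0 by rewrite eqz_nat -lt0n.
have DE g : (D g)%:Z = (hh g 1%R 1%R %% n%:Z)%Z by rewrite /D gez0_abs // modz_ge0.
have Dn g : (D g < n)%N by rewrite -ltz_nat DE ltz_pmod // ltz_nat.
have Dc g : (n%:Z %| hh g 1%R 1%R - (D g)%:Z)%Z.
  by rewrite DE {1}(divz_eq (hh g 1 1) n%:Z) addrK dvdz_mull.
have Dinj : {in s &, injective D}.
  move=> g g' gs gs' E; have [d1 c1 [t tN Et]] := hhP g gs; have [d2 c2 [t' tN' Et']] := hhP g' gs'.
  have hN : (N%:Z %| hh g 1%R 0%R * hh g' 1%R 1%R - hh g 1%R 1%R * hh g' 1%R 0%R)%Z.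
    rewrite c1 c2 NE mulnC PoszM [hh g 1 1 * _]mulrC -mulrBr; apply: dvdz_mul => //.
    by have := rpredB (Dc g') (Dc g); rewrite E opprB addrA subrK.
  have [r rN Er] := Gamma0_eq d1 d2 hN.
  apply: (hin g g' (t *m r *m inv2 t')) => //.
    by apply: Gamma0M; [exact: Gamma0M|exact: Gamma0V].
  rewrite [in RHS]Et' -!mulmxA (mulmxA (inv2 t')) inv2K ?mul1mx -?Er //; by case: tN'.
have -> : \sum_(g <- s) phi (moebius g w) = \sum_(d <- map D s) cusp_val d w.
  rewrite big_map; apply: eq_big_seq => g gs; have [d1 c1 [t tN Et]] := hhP g gs.
  have dt : \det t = 1 by case: tN.
  have hw0 := moebius_Im_gt0 d1 w0.
  by rewrite (cusp_valE (h := hh g)) // {1}Et moebiusM // phiG.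
have uD : uniq (map D s) by rewrite map_inj_in_uniq.
apply: (@le_trans _ _ (\sum_(0 <= d < n) cusp_val d w)).
  rewrite [leRHS](bigID (fun d => d \in map D s)) /= -[leLHS]addr0; apply: lerD; last by apply: sumr_ge0 => d _; exact: cusp_val_ge0.
  rewrite -[leRHS]big_filter le_eqVlt; apply/orP; left; apply/eqP; apply: perm_big; apply: uniq_perm => //.
    by rewrite filter_uniq // iota_uniq.
  move=> d; rewrite mem_filter mem_index_iota /=; case: (boolP (d \in map D s)) => //= /mapP[g gs ->].
  by rewrite Dn.
have NR : 0 < N%:R :> R by rewrite ltr0n.
rewrite -(ler_pM2l NR).
have -> : N%:R * \sum_(0 <= d < n) cusp_val d w = \sum_(0 <= j < N) \sum_(0 <= d < n) cusp_val d (w + j%:R).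
  rewrite [RHS](eq_bigr (fun=> \sum_(0 <= d < n) cusp_val d w)) => [|j _].
    by rewrite sumr_const_nat subn0 mulr_natl.
  rewrite -(periodic_sum (fun d => cusp_val_per d w) (c * j)).
  by apply: eq_bigr => d _; rewrite cusp_val_shift.
rewrite exchange_big /= (_ : N%:R * (n%:R * A) = \sum_(0 <= d < n) N%:R * A); last first.
  by rewrite sumr_const_nat subn0 -[RHS]mulr_natl mulrCA.
apply: ler_sum => d _; have [[h hd]|no] := pselect (exists h, cusp_rep d h); last first.
  by rewrite big1 ?mulr_ge0 // => j _; rewrite cusp_val0.
have wj j : 0 < complex.Im (w + j%:R) by have := Im_int w j; rewrite -[j%:~R]/(j%:R) => ->.
by under eq_bigr do rewrite (cusp_valE hd) //; case: hd => h1 h2 _; exact: hA.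
Qed.
End Cusp.

Lemma coset_sum (s : seq 'M[int]_2) w (A : nat -> R) : 0 < complex.Im w -> uniq s ->
  (forall c, 0 <= A c) ->
  (forall g, g \in s -> \det g = 1) ->
  (forall g g' t, g \in s -> g' \in s -> Gamma0 N t -> g = t *m g' -> g = g') ->
  (forall c h, (c %| N)%N -> \det h = 1 -> h 1 0 = c%:Z -> \sum_(0 <= j < N) phi (moebius h (w + j%:R)) <= N%:R * A c) ->
  \sum_(g <- s) phi (moebius g w) <= \sum_(c <- divisors N) (N %/ c)%N%:R * A c.
Proof.
move=> w0 us A0 ds hin hA.
have -> : \sum_(g <- s) phi (moebius g w) = \sum_(c <- divisors N) \sum_(g <- s | gcdn `|g 1%R 0%R| N == c) phi (moebius g w).
  rewrite (exchange_big_dep xpredT) //=; apply: eq_bigr => g _.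
  have gd : gcdn `|g 1%R 0%R| N \in divisors N by rewrite -dvdn_divisors // dvdn_gcdr.
  rewrite big_mkcond (bigD1_seq _ gd) ?divisors_uniq //= eqxx big1 ?addr0 // => c /negbTE.
  by rewrite eq_sym => ->.
rewrite big_seq [leRHS]big_seq; apply: ler_sum => c; rewrite -dvdn_divisors // => cN.
rewrite -big_filter; apply: (@cusp_sum c (N %/ c)) => //.
- by rewrite divnK.
- exact: filter_uniq.
- by move=> g; rewrite mem_filter => /andP[/eqP-> /ds].
- by move=> g g' t; rewrite !mem_filter => /andP[_ gs] /andP[_ gs']; exact: hin.
- by move=> h dh h10; exact: hA.
Qed.
End CosetSum.

(** * Hyperbolic measure and unfolding *)

Section Leb1.
Variable R : realType.
Local Notation mu := (@lebesgue_measure R).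

Section Affine.
Variables (k a : R).
Hypothesis k0 : 0 < k.
Let phi0 (x : measurableTypeR R) : measurableTypeR R := k * x + a.
Let mphi : measurable_fun setT phi0.
Proof. by apply: measurable_funD => //; apply: measurable_funM. Qed.
Let PM : {measure set (measurableTypeR R) -> \bar R}.
Proof. unshelve refine (pushforward mu phi0 : {measure set (measurableTypeR R) -> \bar R}). exact mphi. Defined.
Let M := mscale (NngNum (ltW k0)) PM.

(** By uniqueness of Lebesgue measure it is enough to compare half-open intervals. *)
Lemma leb_affine_measure (A : set R) : measurable A -> mu A = M A.
Proof.
apply: lebesgue_measure_unique => _ [[b c]] _ <-.
change (mu `]b, c]%classic = (k%:E * mu (phi0 @^-1` `]b, c]%classic))%E).
have -> : phi0 @^-1` `]b, c]%classic = `](b - a) / k, (c - a) / k]%classic.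
  apply/seteqP; split => x /=; rewrite !in_itv /= /phi0 ltr_pdivrMr // ler_pdivlMr // ltrBlDr lerBrDr mulrC //.
rewrite !lebesgue_measure_itv /= !lte_fin ltr_pM2r ?invr_gt0 // ltrD2r; case: ifP => _; rewrite ?mule0 //.
by rewrite -!EFinB -EFinM; congr (_%:E); field; rewrite gt_eqF.
Qed.

Lemma leb_affine (f : R -> \bar R) : measurable_fun setT f -> (forall x, 0 <= f x)%E ->
  (\int[mu]_x f x = k%:E * \int[mu]_x f (k * x + a)%R)%E.
Proof.
move=> mf f0; rewrite (eq_measure_integral M); last by move=> A mA _; exact: leb_affine_measure.
by rewrite ge0_integral_mscale // ge0_integral_pushforward.
Qed.
End Affine.

Lemma leb_shift (a : R) (f : R -> \bar R) : measurable_fun setT f -> (forall x, 0 <= f x)%E ->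
  (\int[mu]_x f x = \int[mu]_x f (x + a)%R)%E.
Proof. by move=> mf f0; rewrite (leb_affine a ltr01 mf f0) mul1e; under eq_integral do rewrite mul1r. Qed.

Lemma leb_opp (f : R -> \bar R) : measurable_fun setT f -> (forall x, 0 <= f x)%E ->
  (\int[mu]_x f x = \int[mu]_x f (- x)%R)%E.
Proof.
move=> mf f0; rewrite (eq_measure_integral (pushforward mu (-%R : _ -> measurableTypeR R))); last first.
  by move=> A mA _; exact/esym/lebesgue_measureN.
by rewrite ge0_integral_pushforward.
Qed.

Lemma tonelli (K : R -> R -> \bar R) : measurable_fun setT (fun p : R * R => K p.1 p.2) -> (forall a b, 0 <= K a b)%E ->
  (\int[mu]_a \int[mu]_b K a b = \int[mu]_b \int[mu]_a K a b)%E.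
Proof.
by move=> mK K0; exact: (@fubini_tonelli _ _ _ _ _ mu mu (fun p : R * R => K p.1 p.2) mK (fun p => K0 p.1 p.2)).
Qed.

Section MInv.
Context d (T : measurableType d).
(** The power function supplies the inverse of a square; as $0^{-1} = 0$, the identity $1/f =
    f\,(f^2)^{-1}$ holds everywhere. *)
Lemma measurable_invf (f : T -> R) : measurable_fun setT f -> measurable_fun setT (fun z => (f z)^-1).
Proof.
move=> mf; have -> : (fun z => (f z)^-1) = (fun z => f z * (f z ^+ 2) `^ (-1)).
  apply/funext => z; rewrite powR_inv1 ?sqr_ge0 //.
  have [->|h] := eqVneq (f z) 0; first by rewrite invr0 mul0r.
  by rewrite expr2 invfM mulrA mulfV // mul1r.
apply: measurable_funM => //; exact: (measurableT_comp (measurable_powR (-1)) (measurable_funX 2 mf)).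
Qed.
End MInv.

(* the density of the multiplicative Haar measure, [0] outside the positive half line *)
Definition hv (y : R) : R := (Num.max y 0)^-1.
Lemma hv_pos y : 0 < y -> hv y = y^-1.
Proof. by move=> h; rewrite /hv maxEle ifF //; apply/negbTE; rewrite -ltNge. Qed.
Lemma hv_neg y : y <= 0 -> hv y = 0.
Proof. by move=> h; rewrite /hv maxEle h invr0. Qed.
Lemma hv_ge0 y : 0 <= hv y. Proof. by rewrite invr_ge0 le_max lexx orbT. Qed.
Lemma hv_scale k y : 0 < k -> hv (k * y) = k^-1 * hv y.
Proof.
move=> k0; have [h|h] := leP y 0; first by rewrite !hv_neg ?mulr0 ?pmulr_rle0.
by rewrite !hv_pos ?mulr_gt0 // invfM.
Qed.
Lemma hv_gt0 y : 0 < y -> 0 < hv y. Proof. by move=> h; rewrite hv_pos ?invr_gt0. Qed.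

Lemma measurable_hv : measurable_fun setT hv.
Proof. by apply: measurable_invf; apply: measurable_maxr => //; exact: measurable_cst. Qed.

(** Integration against $dy/y$ on the positive half line. *)
Definition J (f : R -> \bar R) : \bar R := (\int[mu]_y ((hv y)%:E * f y))%E.

Lemma mhvE d (T : measurableType d) (g : T -> R) : measurable_fun setT g -> measurable_fun setT (fun z => (hv (g z))%:E).
Proof. by move=> mg; apply/measurable_EFinP; apply: (measurableT_comp measurable_hv). Qed.

Lemma mhvM (f : R -> \bar R) : measurable_fun setT f -> measurable_fun setT (fun y => (hv y)%:E * f y)%E.
Proof. by move=> mf; apply: emeasurable_funM => //; apply: mhvE. Qed.

Lemma J_scale k (f : R -> \bar R) : 0 < k -> measurable_fun setT f -> (forall x, 0 <= f x)%E ->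
  J (fun y => f (k * y)) = J f.
Proof.
move=> k0 mf f0; rewrite /J [RHS](leb_affine 0 k0); [|exact: mhvM|by move=> x; rewrite mule_ge0 ?lee_fin ?hv_ge0].
have mk : measurable_fun setT (fun y : R => f (k * y)).
  by apply: (measurableT_comp mf); exact: measurable_funM.
rewrite -ge0_integralZl_EFin ?(ltW k0) //; first last.
- have -> : (fun y => (hv (k * y + 0))%:E * f (k * y + 0)%R)%E = (fun y => (hv (k * y))%:E * f (k * y)%R)%E.
    by apply/funext => y; rewrite addr0.
  apply: emeasurable_funM => //; apply: mhvE; exact: measurable_funM.
- by move=> x _; rewrite mule_ge0 ?lee_fin ?hv_ge0.
apply: eq_integral => y _; rewrite addr0 hv_scale // muleA -EFinM; congr (_%:E * _)%E.
by rewrite mulrA mulfV ?mul1r // gt_eqF.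
Qed.

(* uniqueness of Haar measure: pairing with the test function [y 1_[1,2]] *)
Lemma J_inv (g : R -> \bar R) : measurable_fun setT g -> (forall x, 0 <= g x)%E ->
  J (fun y => g (hv y)) = J g.
Proof.
move=> mg g0.
pose f (y : R) : R := Num.max y 0 * \1_(`[1, 2]%classic) y.
have f0 y : 0 <= f y by rewrite /f mulr_ge0 // le_max lexx orbT.
have mf : measurable_fun setT f.
  apply: measurable_funM; first by apply: measurable_maxr => //; exact: measurable_cst.
  exact: measurable_indic.
have mfE d (T : measurableType d) (u : T -> R) : measurable_fun setT u -> measurable_fun setT (fun z => (f (u z))%:E).
  by move=> mu'; apply/measurable_EFinP; exact: (measurableT_comp mf).
have Jf : J (fun y => (f y)%:E) = 1%E.
  rewrite /J (_ : (fun y => _) = (fun y => (\1_(`[1, 2]%classic : set R) y)%:E)); last first.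
    apply/funext => y; rewrite -EFinM /f /hv mulrA; congr (_%:E).
    have [h|h] := boolP (0 < y).
      by rewrite mulVf ?mul1r // gt_eqF // lt_max h.
    rewrite indicE memNset ?mulr0 //= in_itv /= => /andP[y1 _].
    by move: h; rewrite (lt_le_trans ltr01 y1).
  rewrite integral_indic // setIT /= lebesgue_measure_itv /= lte_fin ltr1n -EFinB; congr (_%:E); ring.
have fst_m : measurable_fun setT (@fst R R) by exact: measurable_fst.
have snd_m : measurable_fun setT (@snd R R) by exact: measurable_snd.
have hv0 y : (0 <= (hv y)%:E)%E by rewrite lee_fin hv_ge0.
have mgh : measurable_fun setT (fun b => g (hv b)) by exact: (measurableT_comp mg measurable_hv).
(* Integrated over [a] first, [K1] gives [J (g \o hv)] and [K2] gives [J g], by scaling and [Jf].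
   For fixed [a], replacing [b] by [b / a] turns one kernel into the other. *)
pose K1 (a b : R) : \bar R := ((hv b)%:E * (g (hv b) * ((hv a)%:E * (f (a * b))%:E)))%E.
pose K2 (a b : R) : \bar R := ((hv a)%:E * ((hv b)%:E * (g (a * hv b)%R * (f b)%:E)))%E.
have E1 : J (fun y => g (hv y)) = (\int[mu]_b \int[mu]_a K1 a b)%E.
  apply: eq_integral => b _; have [b0|b0] := leP b 0.
    by rewrite /K1 hv_neg // mul0e; under eq_integral do rewrite mul0e; rewrite integral0.
  rewrite /K1; under eq_integral do rewrite muleA.
  have mj : measurable_fun setT (fun a => (hv a)%:E * (f (a * b))%:E)%E.
    by apply: mhvM; apply: mfE; exact: measurable_funM.
  rewrite ge0_integralZl //; first last.
  - by rewrite mule_ge0.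
  - by move=> a _; rewrite mule_ge0 // lee_fin.
  have -> : (\int[mu]_x ((hv x)%:E * (f (x * b))%:E) = J (fun y => (f (b * y)%R)%:E))%E.
    by apply: eq_integral => x _; rewrite mulrC.
  have mfe : measurable_fun setT (fun y => (f y)%:E) by exact: mfE.
  have fe0 x : (0 <= (f x)%:E)%E by rewrite lee_fin.
  by rewrite (J_scale b0 mfe fe0) Jf mule1.
have E2 : (\int[mu]_b \int[mu]_a K2 a b)%E = J g.
  transitivity (\int[mu]_b ((hv b)%:E * (f b)%:E * J g))%E.
    apply: eq_integral => b _; have [b0|b0] := leP b 0.
      rewrite /K2 hv_neg // !mul0e; under eq_integral do rewrite mul0e mule0; by rewrite integral0.
    have -> : (\int[mu]_a K2 a b = \int[mu]_a (((hv b)%:E * (f b)%:E) * ((hv a)%:E * g (hv b * a)%R)))%E.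
      have AC (x y z w : \bar R) : (x * (y * (z * w)) = (y * w) * (x * z))%E.
        by rewrite [(z * w)%E]muleC [(y * (w * z))%E]muleA muleCA.
      by apply: eq_integral => a _; rewrite /K2 AC [(a * _)%R]mulrC.
    rewrite ge0_integralZl //; first last.
    - by rewrite mule_ge0 // lee_fin.
    - by move=> a _; rewrite mule_ge0.
    - apply: mhvM; apply: (measurableT_comp mg); exact: measurable_funM.
    by congr (_ * _)%E; exact: (J_scale (hv_gt0 b0) mg g0).
  have Jg0 : (0 <= J g)%E by apply: integral_ge0 => y _; rewrite mule_ge0.
  under eq_integral do rewrite muleC.
  rewrite ge0_integralZl //; first last.
  - by move=> y _; rewrite mule_ge0 // lee_fin.
  - by apply: mhvM; apply: mfE.
  by rewrite -/(J (fun y => (f y)%:E)) Jf mule1.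
rewrite E1 -E2 [LHS]tonelli; first last.
- by move=> a b; rewrite /K1 !mule_ge0 // lee_fin.
- apply: emeasurable_funM; first exact: mhvE.
  apply: emeasurable_funM; first exact: (measurableT_comp mgh).
  apply: emeasurable_funM; first exact: mhvE.
  by apply: mfE; exact: measurable_funM.
rewrite [RHS]tonelli; first last.
- by move=> a b; rewrite /K2 !mule_ge0 // lee_fin.
- apply: emeasurable_funM; first exact: mhvE.
  apply: emeasurable_funM; first exact: mhvE.
  apply: emeasurable_funM; last exact: mfE.
  apply: (measurableT_comp mg); apply: measurable_funM => //; exact: (measurableT_comp measurable_hv).
apply: eq_integral => a _; have [a0|a0] := leP a 0.
  rewrite /K1 /K2 hv_neg //; under eq_integral do rewrite mul0e !mule0; under [RHS]eq_integral do rewrite mul0e.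
  by [].
rewrite /K1 /K2.
have mG : measurable_fun setT (fun b => g (hv b) * (f (a * b))%:E)%E.
  by apply: emeasurable_funM => //; apply: mfE; exact: measurable_funM.
have -> : (\int[mu]_b ((hv b)%:E * (g (hv b) * ((hv a)%:E * (f (a * b)%R)%:E))) =
   (hv a)%:E * J (fun b => g (hv b) * (f (a * b)%R)%:E))%E.
  rewrite /J -ge0_integralZl //; first last.
  - by move=> y _; rewrite !mule_ge0 // lee_fin.
  - exact: mhvM.
  apply: eq_integral => b _; rewrite [RHS]muleCA; congr (_ * _)%E; by rewrite muleCA.
have a1 : 0 < a^-1 by rewrite invr_gt0.
rewrite -(J_scale a1 mG); last by move=> y; rewrite mule_ge0 // lee_fin.
rewrite /J -ge0_integralZl //; first last.
- by move=> y _; rewrite !mule_ge0 // lee_fin.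
- apply: mhvM; have -> : (fun y => g (hv (a^-1 * y)) * (f (a * (a^-1 * y)))%:E)%E =
    (fun b => g (hv b) * (f (a * b))%:E)%E \o (fun y => a^-1 * y) by [].
  by apply: (measurableT_comp mG); exact: measurable_funM.
apply: eq_integral => b _; rewrite (hv_scale _ a1) invrK mulrA mulfV ?mul1r // gt_eqF //.
Qed.

End Leb1.

Section Hyp.
Variable R : realType.
Local Notation mu := (@lebesgue_measure R).
Local Notation mu2 := (@lebesgue2 R).

(** The integral against $dx\,dy/y^2$ on the upper half plane; [hv] vanishes for $y \le 0$, so the
    domain can be the whole plane. *)
Definition hint (G : R * R -> \bar R) : \bar R := (\int[mu2]_z ((hv z.2 ^+ 2)%:E * G z))%E.

Lemma mhv2 : measurable_fun setT (fun z : R * R => (hv z.2 ^+ 2)%:E).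
Proof.
apply/measurable_EFinP; apply: measurable_funX; apply: (measurableT_comp (@measurable_hv R)); exact: measurable_snd.
Qed.

Lemma hint_iter (G : R * R -> \bar R) : measurable_fun setT G -> (forall z, 0 <= G z)%E ->
  hint G = (\int[mu]_y \int[mu]_x ((hv y ^+ 2)%:E * G (x, y)))%E.
Proof.
move=> mG G0; have mK : measurable_fun setT (fun z => (hv z.2 ^+ 2)%:E * G z)%E.
  by apply: emeasurable_funM => //; exact: mhv2.
have K0 z : (0 <= (hv z.2 ^+ 2)%:E * G z)%E by rewrite mule_ge0 // lee_fin sqr_ge0.
rewrite /hint /lebesgue2 (@fubini_tonelli1 _ _ _ _ _ mu mu _ mK K0).
exact: (@fubini_tonelli _ _ _ _ _ mu mu _ mK K0).
Qed.

Lemma hint_shift (a : R) (G : R * R -> \bar R) : measurable_fun setT G -> (forall z, 0 <= G z)%E ->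
  hint (fun z => G (z.1 + a, z.2)) = hint G.
Proof.
move=> mG G0.
have mm : measurable_fun setT (fun z : R * R => (z.1 + a, z.2)).
  apply: measurable_fun_pair; last exact: measurable_snd.
  by apply: measurable_funD => //; exact: measurable_fst.
have mGs : measurable_fun setT (fun z : R * R => G (z.1 + a, z.2)) := measurableT_comp mG mm.
rewrite (hint_iter mG G0) (hint_iter mGs (fun z => G0 _)).
apply: eq_integral => y _; rewrite [RHS](leb_shift a) //.
  apply: emeasurable_funM => //; apply: (measurableT_comp mG); apply: measurable_fun_pair => //; exact: measurable_cst.
by move=> x; rewrite mule_ge0 // lee_fin sqr_ge0.
Qed.

(** The substitution $x = yk$ turns $dx\,dy/y^2$ into $dk\,dy/y$: the half plane is fibred by rays
    carrying multiplicative Haar measure. *)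
Lemma hint_polar (G : R * R -> \bar R) : measurable_fun setT G -> (forall z, 0 <= G z)%E ->
  hint G = (\int[mu]_k J (fun y => G ((y * k)%R, y)))%E.
Proof.
move=> mG G0; rewrite (hint_iter mG G0) /J.
have mp : measurable_fun setT (fun z : R * R => (z.2 * z.1, z.2)).
  apply: measurable_fun_pair; last exact: measurable_snd.
  by apply: measurable_funM; [exact: measurable_snd|exact: measurable_fst].
rewrite [RHS](@tonelli _ (fun k y => (hv y)%:E * G ((y * k)%R, y))%E); first last.
- by move=> a b; rewrite mule_ge0 // lee_fin hv_ge0.
- apply: emeasurable_funM; first by apply: mhvE; exact: measurable_snd.
  exact: (measurableT_comp mG mp).
apply: eq_integral => y _; have [y0|y0] := leP y 0.
  by rewrite hv_neg // expr0n /=; under eq_integral do rewrite mul0e; under [RHS]eq_integral do rewrite mul0e.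
have mGy : measurable_fun setT (fun x => G (x, y)).
  by apply: (measurableT_comp mG); apply: measurable_fun_pair => //; exact: measurable_cst.
rewrite (leb_affine 0 y0); first last.
- by move=> x; rewrite mule_ge0 // lee_fin sqr_ge0.
- by apply: emeasurable_funM => //; exact: measurable_cst.
have mk : measurable_fun setT (fun k : R => G (y * k, y)).
  apply: (measurableT_comp mG); apply: measurable_fun_pair; last exact: measurable_cst.
  exact: measurable_funM.
rewrite -ge0_integralZl_EFin ?(ltW y0) //; first last.
- have -> : (fun x => (hv y ^+ 2)%:E * G ((y * x + 0)%R, y))%E = (fun x => (hv y ^+ 2)%:E * G ((y * x)%R, y))%E.
    by apply/funext => x; rewrite addr0.
  by apply: emeasurable_funM => //; exact: measurable_cst.
- by move=> x _; rewrite mule_ge0 // lee_fin sqr_ge0.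
apply: eq_integral => k _; rewrite addr0 muleA -EFinM hv_pos //; congr (_%:E * _)%E.
by field; rewrite gt_eqF.
Qed.

(** The map $z \mapsto -1/(cz)$ in real coordinates. *)
Definition SC (c : R) (z : R * R) : R * R :=
  (- z.1 / (c * (z.1 ^+ 2 + z.2 ^+ 2)), z.2 / (c * (z.1 ^+ 2 + z.2 ^+ 2))).

Lemma measurable_SC c : measurable_fun setT (SC c).
Proof.
have mi : measurable_fun setT (fun z : R * R => (c * (z.1 ^+ 2 + z.2 ^+ 2))^-1).
  apply: measurable_invf; apply: measurable_funM; first exact: measurable_cst.
  by apply: measurable_funD; apply: measurable_funX; [exact: measurable_fst|exact: measurable_snd].
have m1 : measurable_fun setT (fun z : R * R => - z.1).
  have -> : (fun x : R * R => - x.1) = (fun x => (-1) * x.1) by apply/funext => x; rewrite mulN1r.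
  by apply: measurable_funM; [exact: measurable_cst|exact: measurable_fst].
by apply: measurable_fun_pair; [exact: measurable_funM|apply: measurable_funM => //; exact: measurable_snd].
Qed.

(** The ray with parameter [k] goes to the ray [- k] by $y \mapsto 1/(c(k^2+1)y)$, so [J_scale],
    [J_inv] and [leb_opp] suffice and no two-dimensional Jacobian occurs. *)
Lemma hint_SC c (G : R * R -> \bar R) : 0 < c -> measurable_fun setT G -> (forall z, 0 <= G z)%E ->
  hint (G \o SC c) = hint G.
Proof.
move=> c0 mG G0.
have mGS : measurable_fun setT (G \o SC c) by exact: (measurableT_comp mG (measurable_SC c)).
rewrite (hint_polar mGS (fun z => G0 _)) (hint_polar mG G0).
have ml k : measurable_fun setT (fun y : R => G (y * k, y)).
  by apply: (measurableT_comp mG); apply: measurable_fun_pair => //; exact: measurable_funM.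
pose C (k : R) : R := (c * (k ^+ 2 + 1))^-1.
have C0 k : 0 < C k by rewrite invr_gt0 mulr_gt0 // ltr_wpDl ?sqr_ge0.
have E k : J (fun y => G (y * k, y)) = J (fun y => G (C k * hv y * k, C k * hv y)).
  rewrite -(J_scale (C0 k) (ml k)) // -J_inv //.
  have -> : (fun y => G (C k * y * k, C k * y)) = (fun y => G (y * k, y)) \o (fun y => C k * y) by [].
  apply: (measurableT_comp (ml k)); exact: measurable_funM.
have mk : measurable_fun setT (fun k => J (fun y => G (y * k, y))).
  have mp : measurable_fun setT (fun z : R * R => (z.2 * z.1, z.2)).
    apply: measurable_fun_pair; last exact: measurable_snd.
    by apply: measurable_funM; [exact: measurable_snd|exact: measurable_fst].
  apply: (@measurable_fun_fubini_tonelli_F _ _ _ _ _ mu (fun z : R * R => (hv z.2)%:E * G ((z.2 * z.1)%R, z.2))%E).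
    apply: emeasurable_funM; first by apply: mhvE; exact: measurable_snd.
    exact: (measurableT_comp mG mp).
  by move=> z; rewrite mule_ge0 // lee_fin hv_ge0.
rewrite [RHS](leb_opp mk); last by move=> k; apply: integral_ge0 => y _; rewrite mule_ge0 // lee_fin hv_ge0.
apply: eq_integral => k _; rewrite E; apply: eq_integral => y _.
have [y0|y0] := leP y 0; first by rewrite hv_neg // !mul0e.
congr (_ * _)%E; rewrite /= /SC /=; congr (G (_, _)); rewrite hv_pos // /C sqrrN; field.
  have k1 : k ^+ 2 + 1 != 0 by rewrite gt_eqF // ltr_wpDl ?sqr_ge0.
  have -> : (y * k) ^+ 2 + y ^+ 2 = y ^+ 2 * (k ^+ 2 + 1) by ring.
  by rewrite mulf_neq0 ?expf_neq0 ?k1 ?gt_eqF.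
have k1 : k ^+ 2 + 1 != 0 by rewrite gt_eqF // ltr_wpDl ?sqr_ge0.
have -> : (y * k) ^+ 2 + y ^+ 2 = y ^+ 2 * (k ^+ 2 + 1) by ring.
by rewrite mulf_neq0 ?expf_neq0 ?k1 ?gt_eqF.
Qed.

End Hyp.

(** * The Siegel set and the action of SL_2(Z) *)

Section Siegel.
Variable R : realType.
Implicit Types z w : R[i].

Lemma qf_two (f h X : 'cV[R]_2) : qf (f *m f^T + h *m h^T) X = dotp f X ^+ 2 + dotp h X ^+ 2.
Proof.
have E (g : 'cV[R]_2) : qf (g *m g^T) X = dotp g X ^+ 2.
  rewrite /qf mulmxA -mulmxA mxE big_ord1 expr2 /dotp; congr (_ * _).
  by rewrite -[LHS]/((X^T *m g) 0 0) -/(dotp X g) dotpC.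
by rewrite -!E /qf mulmxDr mulmxDl mxE.
Qed.

Lemma dotp2 (f X : 'cV[R]_2) : dotp f X = f 0 0 * X 0 0 + f 1 0 * X 1 0.
Proof.
rewrite dotpE !big_ord_recl big_ord0 addr0; have -> // : lift ord0 ord0 = 1 :> 'I_2 by exact/val_inj.
Qed.

(** $|az + b|^2$ is a positive definite form in [(a, b)], so [min_column] provides a shortest vector
    together with its unimodular completion. *)
Lemma min_row z : 0 < complex.Im z -> exists c d u v : int, c * v - u * d = 1 /\
  forall a b : int, (a, b) != (0, 0) -> cabs (c%:~R * z + d%:~R) <= cabs (a%:~R * z + b%:~R).
Proof.
move=> z0; pose f : 'cV[R]_2 := \col_i (if i == 0 then complex.Re z else 1).
pose h : 'cV[R]_2 := \col_i (if i == 0 then complex.Im z else 0).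
pose G := f *m f^T + h *m h^T.
have GE (X : 'cV[R]_2) : qf G X = (complex.Re z * X 0 0 + X 1 0) ^+ 2 + (complex.Im z * X 0 0) ^+ 2.
  by rewrite qf_two !dotp2 !mxE /= mul1r mul0r addr0.
have o (k : 'I_2) : k = 0 \/ k = 1 by case: k => [[|[|k]] hk]; [left|right|]; try exact/val_inj.
have pG : pdef G.
  split=> [|X X0]; first by rewrite /G linearD /= !trmx_mul !trmxK.
  rewrite GE; have [x0|x0] := eqVneq (X 0 0) 0.
    rewrite x0 !mulr0 add0r expr0n /= addr0 exprn_even_gt0 //=; apply: contra X0 => /eqP x1.
    apply/eqP/matrixP => i j; rewrite ord1 [RHS]mxE; by case: (o i) => ->.
  by rewrite ltr_wpDl ?sqr_ge0 // exprn_even_gt0 //= mulf_neq0 // gt_eqF.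
have [U [uU hU]] := min_column pG.
have dU : \det U = 1 \/ \det U = -1.
  have := unit_absz uU; lia.
have cE (a b : int) : cabs (a%:~R * z + b%:~R) ^+ 2 = qf G (\col_i (if i == 0 then a else b)%:~R).
  rewrite GE !mxE /= cabs_sqr -!(rmorph_int (real_complex R)); case: (z) => x y /=; ring.
have colE : map_mx intr (col 0 U) = \col_i (if i == 0 then U 0 0 else U 1 0)%:~R :> 'cV[R]_2.
  by apply/matrixP => i j; rewrite !mxE; case: (o i) => ->.
have key (s : int) : \det U * s = 1 -> exists c d u v : int, c * v - u * d = 1 /\
  forall a b : int, (a, b) != (0, 0) -> cabs (c%:~R * z + d%:~R) <= cabs (a%:~R * z + b%:~R).
  move=> hs; exists (U 0 0), (U 1 0), (U 0 1 * s), (U 1 1 * s); split.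
    by rewrite -hs det2; ring.
  move=> a b ab; rewrite -ler_sqr ?nnegrE ?cabs_ge0 // !cE -colE.
  have -> : \col_i (if i == 0 then a else b)%:~R = map_mx intr (\col_i (if i == 0 then a else b)) :> 'cV[R]_2.
    by apply/matrixP => i j; rewrite !mxE.
  apply: hU; apply: contra ab => /eqP /matrixP E.
  by have := E 0 0; have := E 1 0; rewrite !mxE /= => -> ->.
case: dU => dU; [apply: (key 1)|apply: (key (-1))]; by rewrite dU.
Qed.

(** The height 4/5 is a convenient rational number below $\sqrt 3/2$. *)
Definition siegel : set (R * R) := [set z | [/\ - (1 / 2) <= z.1, z.1 <= 1 / 2 & 4 / 5 <= z.2]].

Lemma siegel_reduction z : 0 < complex.Im z -> exists2 g : 'M[int]_2, \det g = 1 &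
  siegel (complex.Re (moebius g z), complex.Im (moebius g z)).
Proof.
move=> z0; have [c [d [u [v [duv hmin]]]]] := min_row z0.
have dh : \det (mk2 (- u) (- v) c d) = 1 by rewrite det_mk2 -duv; ring.
set h := mk2 _ _ _ _ in dh; have [e1 e2 e3 e4] := mk2E (- u) (- v) c d.
have [t ht] := round_half (complex.Re (moebius h z)).
have dt : \det (mk2 1 t 0 1) = 1 by rewrite det_mk2; ring.
exists (mk2 1 t 0 1 *m h); first by rewrite det_mulmx dt dh mulr1.
have wE := moebiusM dt dh z0; have h0 := moebius_Im_gt0 dh z0.
have {}wE : moebius (mk2 1 t 0 1 *m h) z = moebius h z + t%:~R.
  by rewrite wE [LHS]/moebius; have [-> -> -> ->] := mk2E 1 t 0 1; rewrite mul1r mul0r add0r divr1.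
have ReE : complex.Re (moebius h z + t%:~R) = t%:~R + complex.Re (moebius h z).
  by rewrite -(rmorph_int (real_complex R)); case: (moebius h z) => x y /=; rewrite addrC.
have [/= e1' e2'] : - (1 / 2) <= t%:~R + complex.Re (moebius h z) /\ t%:~R + complex.Re (moebius h z) <= 1 / 2.
  by move: ht; move: (_ + _) => x hx; split; nra.
have Im1 : complex.Im (moebius h z + t%:~R) = complex.Im (moebius h z) by exact: Im_int.
have D0 : c%:~R * z + d%:~R != 0.
  by have := moebius_den z0 (sl2_row dh); rewrite /h e3 e4.
have w1 : 1 <= cabs (moebius h z + t%:~R).
  have -> : moebius h z + t%:~R = ((- u + t * c)%:~R * z + (- v + t * d)%:~R) / (c%:~R * z + d%:~R).
    rewrite /moebius /h e1 e2 e3 e4 !rmorphD !rmorphM !rmorphN /=; field.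
    exact: D0.
  rewrite cabsM cabsV ler_pdivlMr ?cabs_gt0 // mul1r; apply: hmin.
  by apply/eqP => -[E1 E2]; move: duv; have -> : u = t * c by [lia]; have -> : v = t * d by [lia]; lia.
rewrite wE /siegel /= ReE Im1; split=> //.
have : 1 <= cabs (moebius h z + t%:~R) ^+ 2 by rewrite expr_ge1 // cabs_ge0.
rewrite cabs_sqr ReE Im1; move: ht h0; move: (complex.Im _) (_ + _) => y x hx y0; nra.
Qed.

(** Bruhat decomposition: translation, [SC], translation. Defined on the whole plane, so
    measurability needs no restriction. If the lower left entry is 0 and the determinant 1, the
    diagonal is $\pm 1$, whence the product in the shift. *)
Definition sl2act (g : 'M[int]_2) (z : R * R) : R * R :=
  if g 1 0 == 0 then (z.1 + (g 0 0 * g 0 1)%:~R, z.2)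
  else let u := SC ((g 1 0)%:~R ^+ 2) (z.1 + (g 1 1)%:~R / (g 1 0)%:~R, z.2) in
    (u.1 + (g 0 0)%:~R / (g 1 0)%:~R, u.2).

Lemma measurable_sl2act g : measurable_fun setT (sl2act g).
Proof.
have mT a : measurable_fun setT (fun z : R * R => (z.1 + a, z.2)).
  apply: measurable_fun_pair; last exact: measurable_snd.
  by apply: measurable_funD => //; exact: measurable_fst.
have [c0|c0] := eqVneq (g 1 0) 0.
  have -> : sl2act g = (fun z : R * R => (z.1 + (g 0 0 * g 0 1)%:~R, z.2)) by apply/funext => z; rewrite /sl2act c0 eqxx.
  exact: mT.
have -> : sl2act g = (fun z : R * R => let u := SC ((g 1 0)%:~R ^+ 2) (z.1 + (g 1 1)%:~R / (g 1 0)%:~R, z.2) in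
    (u.1 + (g 0 0)%:~R / (g 1 0)%:~R, u.2)) by apply/funext => z; rewrite /sl2act (negbTE c0).
have -> : (fun z : R * R => let u := SC ((g 1 0)%:~R ^+ 2) (z.1 + (g 1 1)%:~R / (g 1 0)%:~R, z.2) in
    (u.1 + (g 0 0)%:~R / (g 1 0)%:~R, u.2)) = (fun z : R * R => (z.1 + (g 0 0)%:~R / (g 1 0)%:~R, z.2)) \o SC ((g 1 0)%:~R ^+ 2) \o (fun z : R * R => (z.1 + (g 1 1)%:~R / (g 1 0)%:~R, z.2)) by [].
by apply: measurableT_comp => //; apply: measurableT_comp => //; exact: measurable_SC.
Qed.

Lemma hint_sl2act g (G : R * R -> \bar R) : measurable_fun setT G -> (forall z : R * R, 0 <= G z)%E ->
  hint (G \o sl2act g) = hint G.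
Proof.
move=> mG G0; have [c0|c0] := eqVneq (g 1 0) 0.
  have -> : G \o sl2act g = (fun z : R * R => G (z.1 + (g 0 0 * g 0 1)%:~R, z.2)).
    by apply/funext => z; rewrite /= /sl2act c0 eqxx.
  exact: hint_shift.
have c2 : 0 < (g 1 0)%:~R ^+ 2 :> R by rewrite exprn_even_gt0 //= intr_eq0.
have mT a : measurable_fun setT (fun z : R * R => (z.1 + a, z.2)).
  apply: measurable_fun_pair; last exact: measurable_snd.
  by apply: measurable_funD => //; exact: measurable_fst.
set al := (g 0 0)%:~R / (g 1 0)%:~R : R; set be := (g 1 1)%:~R / (g 1 0)%:~R : R.
have m1 : measurable_fun setT (fun z : R * R => G (z.1 + al, z.2)) := measurableT_comp mG (mT al).
have m2 := measurableT_comp m1 (measurable_SC ((g 1 0)%:~R ^+ 2)).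
have -> : G \o sl2act g = (fun z : R * R => ((fun z : R * R => G (z.1 + al, z.2)) \o SC ((g 1 0)%:~R ^+ 2)) (z.1 + be, z.2)).
  by apply/funext => z; rewrite /= /sl2act (negbTE c0).
by rewrite (hint_shift be m2 (fun p => G0 _)) (hint_SC c2 m1 (fun p => G0 _)) (hint_shift al mG G0).
Qed.

Lemma sl2actE g (z : R * R) : \det g = 1 -> 0 < z.2 -> to_complex (sl2act g z) = moebius g (to_complex z).
Proof.
move=> dg; case: z => x y /= y0; have z0 : 0 < complex.Im (to_complex (x, y)) by [].
have D0 := moebius_den z0 (sl2_row dg).
rewrite /sl2act; have [c0|c0] := eqVneq (g 1 0) 0.
  have ad : g 0 0 * g 1 1 = 1 by rewrite -dg det2 c0 mulr0 subr0.
  rewrite /moebius c0 mul0r add0r; rewrite c0 mul0r add0r in D0.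
  have adC : (g 0 0)%:~R * (g 1 1)%:~R = 1 :> R[i] by rewrite -rmorphM ad.
  apply: (mulIf D0); rewrite divfK //.
  have -> : to_complex ((x, y).1 + (g 0 0 * g 0 1)%:~R, (x, y).2) = to_complex (x, y) + (g 0 0)%:~R * (g 0 1)%:~R.
    have h (k : int) : to_complex (x + k%:~R, y) = to_complex (x, y) + k%:~R :> R[i].
      by rewrite -(rmorph_int (real_complex R) k) /to_complex /=; apply/eqP; rewrite eq_complex /= addr0 !eqxx.
    by rewrite h rmorphM.
  have d1 : (g 1 1)%:~R = (g 0 0)%:~R :> R[i].
    have aa : g 0 0 * g 0 0 = 1.
      have := congr1 absz ad; rewrite abszM => /eqP; rewrite muln_eq1 => /andP[/eqP ha _].
      by rewrite -expr2 -[g 0 0 ^+ 2]gez0_abs ?sqr_ge0 // abszX ha.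
    by rewrite -[g 1 1]mul1r -aa -mulrA ad mulr1.
  by rewrite mulrDl mulrAC adC mul1r d1 [_ * to_complex _]mulrC.
have cR0 : (g 1 0)%:~R != 0 :> R by rewrite intr_eq0.
have cC0 : (g 1 0)%:~R != 0 :> R[i] by rewrite intr_eq0.
set u := SC _ _; have uE : to_complex u * ((g 1 0)%:~R * ((g 1 0)%:~R * to_complex (x, y) + (g 1 1)%:~R)) = -1.
  rewrite /u /SC /to_complex -!(rmorph_int (real_complex R)) /=; set x' := x + _.
  have r0 : x' ^+ 2 + y ^+ 2 != 0 by rewrite gt_eqF // ltr_wpDl ?sqr_ge0 // exprn_gt0.
  have -> : (g 1 1)%:~R = (x' - x) * (g 1 0)%:~R by rewrite /x' addrAC subrr add0r divfK.
  move: x' r0 ((g 1 0)%:~R) cR0 => x' r0 c c1; clear -r0 c1.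
  by apply/eqP; rewrite eq_complex /=; apply/andP; split; apply/eqP; field; rewrite ?r0 ?c1.
have -> : to_complex (u.1 + (g 0 0)%:~R / (g 1 0)%:~R, u.2) = to_complex u + (g 0 0)%:~R / (g 1 0)%:~R.
  rewrite -!(rmorph_int (real_complex R)) -fmorphV -rmorphM /= /to_complex; apply/eqP; rewrite eq_complex /= addr0 !eqxx //.
have {}uE : to_complex u = - ((g 1 0)%:~R * ((g 1 0)%:~R * to_complex (x, y) + (g 1 1)%:~R))^-1.
  have n0 : (g 1 0)%:~R * ((g 1 0)%:~R * to_complex (x, y) + (g 1 1)%:~R) != 0 by rewrite mulf_neq0.
  by apply: (mulIf n0); rewrite uE mulNr mulVf.
have dC : (g 0 0)%:~R * (g 1 1)%:~R - (g 0 1)%:~R * (g 1 0)%:~R = 1 :> R[i].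
  by rewrite -!rmorphM -rmorphB -det2 dg.
rewrite uE /moebius; move: (to_complex (x, y)) D0 => z D0.
have -> : (g 0 1)%:~R = ((g 0 0)%:~R * (g 1 1)%:~R - 1) / (g 1 0)%:~R :> R[i].
  apply: (mulIf cC0); rewrite divfK //; rewrite -[X in _ = _ - X]dC opprB addrC subrK //.
by field; rewrite cC0 D0.
Qed.
End Siegel.

(** An enumeration of SL_2(Z) with repetitions; codes of other matrices, and codes of nothing, give
    the identity. *)
Definition sl2_enum (n : nat) : 'M[int]_2 :=
  if (pickle_inv n : option 'M[int]_2) is Some g then if \det g == 1 then g else 1%:M else 1%:M.
Lemma sl2_enum_det n : \det (sl2_enum n) = 1.
Proof. by rewrite /sl2_enum; case: pickle_inv => [g|]; [case: eqP|]; rewrite ?det1. Qed.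
Lemma sl2_enum_surj g : \det g = 1 -> exists n, sl2_enum n = g.
Proof. by move=> dg; exists (choice.pickle g); rewrite /sl2_enum pickleK_inv dg eqxx. Qed.

Section Fold.
Variables (R : realType) (N : nat) (phi : R[i] -> R) (D : set (R * R)) (bd : R -> R).
Local Notation mu := (@lebesgue2 R).
Local Notation H := (@upper_half_plane R).
Hypothesis phi0 : forall z, 0 <= phi z.
Hypothesis mphi : measurable_fun H (fun z : R * R => phi (to_complex z)).
Hypothesis fD : fundamental_domain N D.
Hypothesis bd0 : forall y, 0 <= bd y.
Hypothesis mbd : measurable_fun setT bd.
Hypothesis hbd : forall (w : R * R) (s : seq 'M[int]_2), siegel w -> uniq s ->
  (forall g, g \in s -> \det g = 1) ->
  (forall g g' t, g \in s -> g' \in s -> Gamma0 N t -> g = t *m g' -> g = g') ->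
  \sum_(g <- s) phi (moebius g (to_complex w)) <= bd w.2.

Lemma measurable_H : measurable H.
Proof.
have -> : H = @snd R R @^-1` `]0, +oo[%classic by apply/seteqP; split=> z /=; rewrite in_itv /= andbT.
by rewrite -[X in measurable X]setTI; apply: measurable_snd.
Qed.

Lemma measurable_siegel : measurable (@siegel R).
Proof.
have -> : @siegel R = (@fst R R @^-1` `[- (1 / 2), 1 / 2]%classic) `&` (@snd R R @^-1` `[4 / 5, +oo[%classic).
  apply/seteqP; split=> z /=; rewrite !in_itv /= ?andbT; first by move=> [-> ->].
  by move=> [/andP[]].
by apply: measurableI; rewrite -[X in measurable X]setTI; [apply: measurable_fst|apply: measurable_snd].
Qed.

(** The points of [D] that the n-th matrix carries into the Siegel set; [E] makes these pieces
    disjoint. *)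
Let A n := D `&` (sl2act (sl2_enum n) @^-1` @siegel R).
Let E := seqDU A.
Let mD : measurable D. Proof. by case: fD. Qed.
Let mA n : measurable (A n).
Proof.
apply: measurableI => //; rewrite -[X in measurable X]setTI.
by apply: measurable_sl2act => //; exact: measurable_siegel.
Qed.
Let mE n : measurable (E n).
Proof. by apply: measurableD => //; apply: bigsetU_measurable => i _; exact: mA. Qed.
Let DH z : D z -> 0 < z.2. Proof. by case: fD => _ h _ /h. Qed.

Lemma to_complex_inj : injective (@to_complex R).
Proof. by move=> [x y] [x' y'] [-> ->]. Qed.

Lemma fold_cover : D = \bigcup_n E n.
Proof.
rewrite -seqDU_bigcup_eq; apply/seteqP; split=> z; last by move=> [n _ []].
move=> Dz; have z0 : 0 < complex.Im (to_complex z) by exact: DH.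
have [g dg hg] := siegel_reduction z0; have [n hn] := sl2_enum_surj dg.
exists n => //; split=> //=; rewrite hn.
by have e := sl2actE dg (DH Dz); rewrite -e in hg; case: (sl2act g z) hg.
Qed.

Lemma fold_disjoint : trivIset setT E. Proof. exact: trivIset_seqDU. Qed.

Lemma fold_back n w : 0 < w.2 -> let g := inv2 (sl2_enum n) in
  [/\ \det g = 1, 0 < (sl2act g w).2 & E n (sl2act g w) -> siegel w].
Proof.
move=> w0 g; have dh := sl2_enum_det n; have dg : \det g = 1 by exact: det_inv2.
have e := sl2actE dg w0.
have g0 : 0 < (sl2act g w).2.
  have := moebius_Im_gt0 dg (w0 : 0 < complex.Im (to_complex w)); by rewrite -e.
split=> // -[[_ /=] + _].
suff -> : sl2act (sl2_enum n) (sl2act g w) = w by [].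
apply: to_complex_inj; rewrite sl2actE // e -moebiusM //.
have -> : sl2_enum n *m g = 1%:M by apply: mulmx1C; exact: inv2K.
by rewrite moebius1.
Qed.

Let f : R * R -> \bar R := (fun z => (phi (to_complex z))%:E) \_ H.
Let mf : measurable_fun setT f.
Proof.
apply/(measurable_restrict _ measurable_H measurableT); rewrite setTI.
exact/measurable_EFinP.
Qed.
Let f0 z : (0 <= f z)%E. Proof. by rewrite /f patchE; case: ifP; rewrite // lee_fin. Qed.
Let fE z : 0 < z.2 -> f z = (phi (to_complex z))%:E.
Proof. by move=> z0; rewrite /f patchE mem_set. Qed.

Let G n : R * R -> \bar R := fun w => ((\1_(E n) (sl2act (inv2 (sl2_enum n)) w))%:E * f (sl2act (inv2 (sl2_enum n)) w))%E.
Let mG n : measurable_fun setT (G n).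
Proof.
have mI : measurable_fun setT (fun z : R * R => ((\1_(E n) z)%:E * f z)%E).
  by apply: emeasurable_funM => //; apply/measurable_EFinP; exact: measurable_indic.
exact: (measurableT_comp mI (measurable_sl2act _)).
Qed.
Let G0 n w : (0 <= G n w)%E.
Proof. by rewrite /G mule_ge0 // lee_fin indicE. Qed.

(** [D] meets each orbit once and the pieces are disjoint, so the matrices taking [w] into their own
    pieces represent distinct cosets of $\Gamma_0(N)$, and [hbd] bounds their sum. *)
Lemma fold_pointwise w n : 0 < w.2 -> ((\sum_(0 <= i < n) G i w) <= (\1_(@siegel R) w * bd w.2)%:E)%E.
Proof.
move=> w0; pose g i := inv2 (sl2_enum i).
have b0 : 0 <= \1_(@siegel R) w * bd w.2 by rewrite mulr_ge0 // indicE.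
pose s := [seq i <- index_iota 0 n | sl2act (g i) w \in E i].
have -> : (\sum_(0 <= i < n) G i w = (\sum_(i <- s) phi (moebius (g i) (to_complex w)))%:E)%E.
  rewrite /s big_filter -sumEFin [RHS]big_mkcond; apply: eq_bigr => i _.
  have [dg g0 _] := fold_back i w0; rewrite -/(g i) in dg g0.
  rewrite /G -/(g i) indicE; case: ifP => _; last by rewrite mul0e.
  by rewrite mul1e fE // sl2actE.
rewrite lee_fin; have [sw|sw] := pselect (siegel w); last first.
  rewrite /s; have -> : [seq i <- index_iota 0 n | sl2act (g i) w \in E i] = [::].
    apply/eqP; rewrite -[_ == _]negbK -has_filter; apply/hasPn => i _.
    apply/negP; rewrite inE => Ei; apply: sw; by have [_ _] := fold_back i w0; apply.
  by rewrite big_nil.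
rewrite indicE mem_set // mul1r.
have Es i : i \in s -> E i (sl2act (g i) w) by rewrite mem_filter => /andP[h _]; exact: set_mem h.
have key i j t : i \in s -> j \in s -> Gamma0 N t -> g i = t *m g j -> i = j.
  move=> si sj tN gij; have [di i0 _] := fold_back i w0; have [dj j0 _] := fold_back j w0.
  have Ei := Es i si; have Ej := Es j sj.
  have [_ _ hu] := fD.
  have [v [_ hv]] := hu _ (j0 : upper_half_plane (sl2act (g j) w)).
  have dt : \det t = 1 by case: tN.
  have v1 : v = sl2act (g j) w.
    apply: hv; split; first by case: Ej => -[].
    exists 1%:M; last by rewrite moebius1.
    by split; rewrite ?det1 // mxE dvdz0.
  have v2 : v = sl2act (g i) w.
    apply: hv; split; first by case: Ei => -[].
    exists t; first exact: tN.
    have ei := sl2actE di w0; have ej := sl2actE dj w0.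
    have em := moebiusM dt dj (w0 : 0 < complex.Im (to_complex w)).
    exact: (etrans ei (etrans (congr1 (fun h => moebius h (to_complex w)) gij) (etrans em (congr1 (moebius t) (esym ej))))).
  apply: (fold_disjoint (i := i) (j := j)) => //.
  by exists v; split; [rewrite v2|rewrite v1].
rewrite -(big_map g xpredT (fun h => phi (moebius h (to_complex w)))).
have G1 : Gamma0 N 1%:M by split; rewrite ?det1 // mxE dvdz0.
apply: hbd => //.
- rewrite map_inj_in_uniq; first by apply: filter_uniq; exact: iota_uniq.
  by move=> i j si sj e; apply: (key i j 1%:M si sj G1); rewrite mul1mx.
- by move=> h /mapP[i _ ->]; apply: det_inv2; exact: sl2_enum_det.
by move=> h h' t /mapP[i si ->] /mapP[j sj ->] tN e; rewrite (key i j t si sj tN e).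
Qed.

(** Each piece is moved into the Siegel set by invariance of the measure; the series is then summed
    under the integral sign. *)
Lemma fold : (\int[mu]_(z in D) ((hv z.2 ^+ 2)%:E * (phi (to_complex z))%:E) <=
  hint (fun w => (\1_(@siegel R) w * bd w.2)%:E))%E.
Proof.
have mh := @mhv2 R.
have h0 z : (0 <= (hv z.2 ^+ 2)%:E :> \bar R)%E by rewrite lee_fin sqr_ge0.
have mhf : measurable_fun setT (fun z : R * R => (hv z.2 ^+ 2)%:E * f z)%E by exact: emeasurable_funM.
have -> : (\int[mu]_(z in D) ((hv z.2 ^+ 2)%:E * (phi (to_complex z))%:E) = \int[mu]_(z in D) ((hv z.2 ^+ 2)%:E * f z))%E.
  by apply: eq_integral => z /set_mem Dz; rewrite fE ?DH.
rewrite fold_cover ge0_integral_bigcup //; first last.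
- exact: fold_disjoint.
- by move=> z _; rewrite mule_ge0.
- exact: measurable_funTS.
have Eterm n : (\int[mu]_(z in E n) ((hv z.2 ^+ 2)%:E * f z) = \int[mu]_w ((hv w.2 ^+ 2)%:E * G n w))%E.
  have mI : measurable_fun setT (fun z : R * R => ((\1_(E n) z)%:E * f z)%E).
    by apply: emeasurable_funM => //; apply/measurable_EFinP; exact: measurable_indic.
  transitivity (hint (fun z => (\1_(E n) z)%:E * f z)%E).
    rewrite integral_mkcond; apply: eq_integral => z _; rewrite patchE indicE.
    by case: ifP; rewrite ?mul1e ?mul0e ?mule0.
  by rewrite -(hint_sl2act (inv2 (sl2_enum n)) mI) // => z; rewrite mule_ge0 // lee_fin indicE.
rewrite (eq_eseriesr (fun n _ => Eterm n)) -integral_nneseries //; first last.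
- by move=> n w _; rewrite mule_ge0.
- by move=> n; exact: (emeasurable_funM mh (mG n)).
rewrite /hint; apply: ge0_le_integral => //.
- by move=> w _; apply: nneseries_ge0 => n _ _; rewrite mule_ge0.
- apply: ge0_emeasurable_sum => [n w _ _|n _]; first by rewrite mule_ge0.
  exact: (emeasurable_funM mh (mG n)).
- apply: emeasurable_funM => //; apply/measurable_EFinP; apply: measurable_funM.
    exact: measurable_indic measurable_siegel.
  by apply: (measurableT_comp mbd); exact: measurable_snd.
move=> w _; apply: lime_le; first by apply: is_cvg_nneseries => n _ _; rewrite mule_ge0.
apply: nearW => n /=; rewrite -ge0_sume_distrr; last by move=> i _.
have [w0|w0] := leP w.2 0; first by rewrite hv_neg // expr0n /= !mul0e.
by apply: lee_wpmul2l => //; exact: fold_pointwise.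
Qed.
End Fold.

Section SiegelIntegral.
Variable R : realType.
Local Notation mu := (@lebesgue_measure R).

Lemma powR_tail (K p a : R) : 0 <= K -> 0 < p -> 0 < a ->
  (\int[mu]_(y in `[a, +oo[) (K * y `^ (- p - 1))%:E <= (K / p * a `^ (- p))%:E)%E.
Proof.
move=> K0 p0 a0; pose F : R -> R := (- (K / p)) \*: (fun y : R => y `^ (- p)).
have dF (y : R) : 0 < y -> is_derive y 1 F (K * y `^ (- p - 1)).
  move=> y0; have h := is_derive1_powR (- p) y0.
  have := is_deriveZ (- (K / p)) h; rewrite -/F => h2.
  apply: is_derive_eq h2 _; rewrite /GRing.scale /=; move: (y `^ _) => t; field; rewrite gt_eqF //.
have cp (q y : R) : 0 < y -> (fun y : R => y `^ q) x @[x --> y] --> y `^ q.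
  move=> y0; have [d _] := is_derive1_powR q y0.
  have h : {for y, continuous (fun y : R => y `^ q)} by apply: differentiable_continuous; exact/derivable1_diffP.
  exact: h.
have h1 (y : R) : a <= y -> 0 <= K * y `^ (- p - 1) by rewrite mulr_ge0 ?powR_ge0.
have h2 : {within `[a, +oo[, continuous (fun y : R => K * y `^ (- p - 1))}.
  apply: continuous_in_subspaceT => y; rewrite inE /= in_itv /= andbT => ay.
  apply: cvgM; [exact: cvg_cst|apply: cp; exact: lt_le_trans ay].
have h3 : F x @[x --> +oo] --> (0 : R).
  apply/cvgrPdist_le => e e0; exists ((K / p / e + 1) `^ p^-1); split; first exact: num_real.
  move=> y hy; rewrite sub0r normrN /F /= /GRing.scale /= normrM normrN !ger0_norm ?powR_ge0 ?divr_ge0 ?(ltW p0) //.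
  have t0 : 0 < K / p / e + 1 by rewrite ltr_wpDl // !divr_ge0 ?(ltW p0) ?(ltW e0).
  have y0 : 0 < y by apply: lt_trans hy; exact: powR_gt0.
  have h : K / p / e + 1 <= y `^ p.
    have -> : K / p / e + 1 = ((K / p / e + 1) `^ p^-1) `^ p.
      by rewrite -powRrM mulVf ?gt_eqF // powRr1 // ltW.
    by rewrite ge0_ler_powR ?nnegrE ?(ltW p0) ?powR_ge0 ?(ltW y0) ?(ltW hy).
  have yp : 0 < y `^ p by exact: powR_gt0.
  rewrite powRN ler_pdivrMr // -ler_pdivrMl // mulrC; apply: le_trans h; lra.
have h4 (y : R) : a < y -> derivable F y 1 by move=> ay; case: (dF y (lt_trans a0 ay)).
have h5 : F x @[x --> a^'+] --> F a.
  by apply: cvg_at_right_filter; apply: cvgM; [exact: cvg_cst|exact: cp].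
have h6 : {in `]a, +oo[%R, derive1 F =1 (fun y : R => K * y `^ (- p - 1))}.
  by move=> y; rewrite in_itv /= andbT => ay; case: (dF y (lt_trans a0 ay)) => _ <-; rewrite derive1E.
rewrite (ge0_continuous_FTC2y h1 h2 h3 h4 h5 h6).
by rewrite -EFinB lee_fin sub0r /F /= /GRing.scale /= mulNr opprK.
Qed.

(** The integrand is $y^{-1-\eta}$, so convergence at infinity rests on the saved power $\eta$. *)
Lemma siegel_integral (K eta : R) : 0 <= K -> 0 < eta ->
  (hint (fun w => (\1_(@siegel R) w * (K * w.2 `^ (1 - eta)))%:E) <= (K / eta * (4 / 5) `^ (- eta))%:E)%E.
Proof.
move=> K0 eta0.
pose c (y : R) := hv y ^+ 2 * (\1_(`[4 / 5, +oo[%classic : set R) y * (K * y `^ (1 - eta))).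
have c0 y : 0 <= c y.
  have i0 : 0 <= \1_(`[4 / 5, +oo[%classic : set R) y :> R by rewrite indicE.
  by rewrite /c mulr_ge0 ?sqr_ge0 // mulr_ge0 // mulr_ge0 ?powR_ge0.
have sE (x y : R) : \1_(@siegel R) (x, y) = \1_(`[- (1 / 2), 1 / 2]%classic : set R) x * \1_(`[4 / 5, +oo[%classic : set R) y :> R.
  rewrite !indicE -natrM mulnb; congr ((nat_of_bool _)%:R); apply/idP/andP.
    by rewrite !inE /= => -[h1 h2 h3]; rewrite !in_itv /= h1 h2 h3.
  by rewrite !inE /= !in_itv /= andbT => -[/andP[h1 h2] h3]; split.
rewrite hint_iter; first last.
- by move=> w; rewrite lee_fin !mulr_ge0 ?powR_ge0 // indicE.
- apply/measurable_EFinP; apply: measurable_funM; first exact: measurable_indic (@measurable_siegel R).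
  apply: measurable_funM => //; apply: (measurableT_comp (measurable_powR _)); exact: measurable_snd.
have hI : (\int[mu]_x (\1_(`[- (1 / 2), 1 / 2]%classic : set R) x)%:E)%E = 1%E.
  rewrite integral_indic // setIT /= lebesgue_measure_itv /= lte_fin ifT; last lra.
  rewrite -EFinB; congr (_%:E); lra.
have inner y : (\int[mu]_x ((hv y ^+ 2)%:E * (\1_(@siegel R) (x, y) * (K * y `^ (1 - eta)))%:E))%E = (c y)%:E.
  transitivity (\int[mu]_x ((c y)%:E * (\1_(`[- (1 / 2), 1 / 2]%classic : set R) x)%:E))%E.
    by apply: eq_integral => x _; rewrite sE -!EFinM; congr (_%:E); rewrite /c; ring.
  rewrite ge0_integralZl_EFin //; first by rewrite hI mule1.
  by apply/measurable_EFinP; exact: measurable_indic.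
apply: (@le_trans _ _ (\int[mu]_y (c y)%:E)%E).
  by rewrite le_eqVlt; apply/orP; left; apply/eqP; apply: eq_integral => y _; exact: inner.
have a0 : 0 < 4 / 5 :> R by lra.
apply: le_trans (powR_tail K0 eta0 a0); rewrite [leRHS]integral_mkcond le_eqVlt; apply/orP; left; apply/eqP.
apply: eq_integral => y _; rewrite patchE /c indicE; case: ifPn => [|_]; last by rewrite mul0r mulr0.
rewrite inE /= in_itv /= andbT => ay; have y0 : 0 < y by apply: lt_le_trans ay.
congr (_%:E); rewrite hv_pos // mul1r mulrCA; congr (_ * _).
have -> : - eta - 1 = (1 - eta) - 2%:R by ring.
have E : y `^ 2%:R = y ^+ 2 by rewrite powR_mulrn ?(ltW y0).
rewrite [RHS]powRB; last by apply/implyP => _; rewrite gt_eqF.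
by rewrite E mulrC exprVn.
Qed.
End SiegelIntegral.

(** * Measurability of theta series *)

Section ThetaMeasurable.
Variable R : realType.
Local Notation H := (@upper_half_plane R).

(** Measurability passes to limits of sequences rather than of nets; the countable index set is
    exhausted by the indices with code below [n]. *)
Lemma hsum_seq (I : countType) (u : I -> R[i]) l (P : R[i] -> R) :
  (forall z w, `|P z - P w| <= cabs (z - w)) -> hsum u l ->
  (fun n => P (\sum_(i <- pmap (@pickle_inv I) (iota 0 n)) u i)) @ \oo --> P l.
Proof.
move=> hP hu; apply/cvgrPdist_le => e e0; have [A hA] := hu e e0.
exists (\max_(i <- A) choice.pickle i).+1 => // n /= hn.
have us : uniq (pmap (@pickle_inv I) (iota 0 n)).
  apply: (pmap_uniq (g := choice.pickle)); last exact: iota_uniq.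
  by move=> k /=; rewrite /pickle_inv /obind /oapp; case E: (choice.unpickle k) => [x|] //=; case: eqP.
rewrite distrC (uniq_fset_sum _ us); apply: le_trans (hP _ _) _; apply: hA.
apply/fsubsetP => i iA; rewrite !inE mem_pmap; apply/mapP; exists (choice.pickle i); last by rewrite pickleK_inv.
rewrite mem_iota /= add0n; apply: leq_ltn_trans hn; by rewrite (leq_bigmax_seq i).
Qed.

Definition mC (F : R[i] -> R[i]) := measurable_fun H (fun z : R * R => complex.Re (F (to_complex z))) /\
  measurable_fun H (fun z : R * R => complex.Im (F (to_complex z))).

Lemma mC_D F G : mC F -> mC G -> mC (fun z => F z + G z).
Proof.
move=> [f1 f2] [g1 g2]; split.
  by rewrite (_ : (fun _ => _) = (fun z => complex.Re (F (to_complex z)) + complex.Re (G (to_complex z)))) //;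
    [exact: measurable_funD|apply/funext => z; case: (F _) => ? ?; case: (G _)].
by rewrite (_ : (fun _ => _) = (fun z => complex.Im (F (to_complex z)) + complex.Im (G (to_complex z)))) //;
    [exact: measurable_funD|apply/funext => z; case: (F _) => ? ?; case: (G _)].
Qed.

Lemma mC_Z c F : mC F -> mC (fun z => c * F z).
Proof.
move=> [f1 f2]; have mc (k : R) g : measurable_fun H g -> measurable_fun H (fun z : R * R => k * g z).
  by move=> mg; apply: measurable_funM => //; exact: measurable_cst.
case: c => a b; split.
  rewrite (_ : (fun _ => _) = (fun z => a * complex.Re (F (to_complex z)) - b * complex.Im (F (to_complex z)))).
    by apply: measurable_funB; exact: mc.
  by apply/funext => z; case: (F _).
rewrite (_ : (fun _ => _) = (fun z => a * complex.Im (F (to_complex z)) + b * complex.Re (F (to_complex z)))).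
  by apply: measurable_funD; exact: mc.
by apply/funext => z; case: (F _).
Qed.

Lemma mC_B F G : mC F -> mC G -> mC (fun z => F z - G z).
Proof.
move=> f g; have := mC_D f (mC_Z (-1) g).
by rewrite (_ : (fun z => F z - G z) = (fun z => F z + -1 * G z)) //; apply/funext => z; rewrite mulN1r.
Qed.

Lemma mC_0 : mC (fun=> 0). Proof. by split; exact: measurable_cst. Qed.

Lemma mC_sum (I : eqType) (s : seq I) (F : I -> R[i] -> R[i]) : (forall i, i \in s -> mC (F i)) -> mC (fun z => \sum_(i <- s) F i z).
Proof.
elim: s => [|i s IH] h.
  by rewrite (_ : (fun _ => _) = fun=> 0); [exact: mC_0|apply/funext => z; rewrite big_nil].
rewrite (_ : (fun _ => _) = (fun z => F i z + \sum_(j <- s) F j z)).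
  by apply: mC_D; [apply: h|apply: IH => j js; apply: h]; rewrite in_cons ?eqxx // js orbT.
by apply/funext => z; rewrite big_cons.
Qed.

Lemma mC_ee (q : int) : mC (fun z => ee (q%:~R * z)).
Proof.
have m1 (k : R) : measurable_fun H (fun z : R * R => k * z.1).
  by apply: measurable_funTS; apply: measurable_funM; [exact: measurable_cst|exact: measurable_fst].
have m2 (k : R) : measurable_fun H (fun z : R * R => expR (k * z.2)).
  apply: measurable_funTS; apply: (measurableT_comp (@measurable_expR R)).
  by apply: measurable_funM; [exact: measurable_cst|exact: measurable_snd].
have mc : measurable_fun setT (@cos R) := continuous_measurable_fun (@continuous_cos R).
have ms : measurable_fun setT (@sin R) := continuous_measurable_fun (@continuous_sin R).
have E (z : R * R) : ee (q%:~R * to_complex z) = (expR (- (2 * pi * q%:~R) * z.2))%:C%C *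
    Complex (cos (2 * pi * q%:~R * z.1)) (sin (2 * pi * q%:~R * z.1)).
  rewrite -(rmorph_int (real_complex R)) ee.unlock /expi; case: z => x y /=.
  by rewrite !mul0r subr0 addr0 !mulrA !mulNr.
split.
  rewrite (_ : (fun _ => _) = (fun z : R * R => expR (- (2 * pi * q%:~R) * z.2) * cos (2 * pi * q%:~R * z.1))).
    by apply: measurable_funM; [exact: m2|exact: (measurableT_comp mc (m1 _))].
  by apply/funext => z; rewrite E /= mul0r subr0.
rewrite (_ : (fun _ => _) = (fun z : R * R => expR (- (2 * pi * q%:~R) * z.2) * sin (2 * pi * q%:~R * z.1))).
  by apply: measurable_funM; [exact: m2|exact: (measurableT_comp ms (m1 _))].
by apply/funext => z; rewrite E /= mul0r addr0.
Qed.

Lemma mC_theta m (S : 'M[int]_m) : even_posdef R S -> mC (theta S).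
Proof.
move=> eS; pose u (z : R[i]) (x : 'cV[int]_m) := ee ((qform S x)%:~R * z).
have hs (z : R * R) : H z -> hsum (u (to_complex z)) (theta S (to_complex z)).
  by move=> z0; rewrite theta_tsum; apply: summ_hsum; apply: summ_theta.
have mp n : mC (fun z => \sum_(x <- pmap (@pickle_inv 'cV[int]_m) (iota 0 n)) u z x).
  by apply: mC_sum => x _; exact: mC_ee.
split.
  apply: (@measurable_fun_cvg _ _ R H (fun n z => complex.Re (\sum_(x <- pmap (@pickle_inv 'cV[int]_m) (iota 0 n)) u (to_complex z) x))).
    by move=> n; case: (mp n).
  move=> z /hs h; apply: (hsum_seq (P := @complex.Re R)) h => a b.
  by apply: le_trans (cabs_Re _); case: a => ? ?; case: b.
apply: (@measurable_fun_cvg _ _ R H (fun n z => complex.Im (\sum_(x <- pmap (@pickle_inv 'cV[int]_m) (iota 0 n)) u (to_complex z) x))).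
  by move=> n; case: (mp n).
move=> z /hs h; apply: (hsum_seq (P := @complex.Im R)) h => a b.
by apply: le_trans (cabs_Im _); case: a => ? ?; case: b.
Qed.

Lemma mC_abs F (k : R) : mC F -> measurable_fun H (fun z : R * R => cabs (F (to_complex z)) ^+ 2 * z.2 `^ k).
Proof.
move=> [f1 f2].
rewrite (_ : (fun _ => _) = (fun z : R * R => (complex.Re (F (to_complex z)) ^+ 2 + complex.Im (F (to_complex z)) ^+ 2) * z.2 `^ k)).
  apply: measurable_funM; first by apply: measurable_funD; exact: measurable_funX.
  apply: measurable_funTS; apply: (measurableT_comp (measurable_powR _)); exact: measurable_snd.
by apply/funext => z; rewrite cabs_sqr.
Qed.
End ThetaMeasurable.

(** * The bound for a pair of forms *)

Section PairBound.
Variables (R : realType) (m : nat).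
Hypothesis m1 : (1 <= m)%N.
Local Notation M := m.+2.

Lemma powR_prod (I : Type) (r : seq I) (P : pred I) (F : I -> R) k : (forall i, 0 <= F i) ->
  (\prod_(i <- r | P i) F i) `^ k = \prod_(i <- r | P i) F i `^ k.
Proof.
move=> F0; elim: r => [|i r IH]; first by rewrite !big_nil powR1.
rewrite !big_cons; case: ifP => // _; rewrite powRM ?IH //.
by apply: prodr_ge0.
Qed.

Lemma Ffactor_ge0 nu r2 N (s : R) : 0 <= @Ffactor M R nu r2 N s.
Proof. by rewrite /Ffactor mulr_ge0 ?powR_ge0 //; apply: prodr_ge0 => p _; exact: powR_ge0. Qed.

Lemma norm_bound_ge0 N (d : R) (F : R -> R) eps : 0 <= d -> (forall s, 0 <= F s) -> 0 <= norm_bound M N d F eps.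
Proof.
move=> d0 F0; rewrite /norm_bound; case: ifP => _; first by rewrite divr_ge0 ?powR_ge0.
by case: ifP => _; rewrite ?addr_ge0 ?divr_ge0 ?powR_ge0.
Qed.

Lemma norm_boundE N (d : R) (F : R -> R) eps : (0 < N)%N ->
  norm_bound M N d F eps = N%:R `^ eps * norm_bound M N d F 0.
Proof.
move=> N0; have E x : N%:R `^ (x + eps) = N%:R `^ eps * N%:R `^ (x + 0) :> R.
  rewrite addr0 addrC powRD //; apply/implyP => _; by rewrite pnatr_eq0 -lt0n.
by rewrite /norm_bound !E; case: ifP => _; [|case: ifP => _]; rewrite ?mulrDr !mulrA.
Qed.

Lemma card_top a : (a <= M)%N -> \sum_(i < M | (M - a <= i)%N) (1 : R) = a%:R.
Proof.
move=> aM; rewrite (reindex_inj rev_ord_inj) /= (eq_bigl (fun i : 'I_M => (i < a)%N)).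
  by rewrite -(big_ord_widen M (fun=> 1) aM) sumr_const card_ord.
by move=> i; apply/idP/idP => /=; have := ltn_ord i; lia.
Qed.

(** Two choices in [weight_ineq]. Equal weights $1/M$ with [sg = 0] give $N/(\det Q)^{1/M}$ when
    $\kappa \le 1 - 1/M$; the weights [wgt s] give $N^{M/2}/F(Q,s)$. For $M = 3$ the first always
    applies; for $M = 4$ the case $a = 1$ needs the second, whence two terms; for $M \ge 5$ the
    second is used throughout. *)
Lemma main_arith N n (e : 'I_M -> nat) nu r2 a : (0 < N)%N -> (forall i, (0 < e i)%N) ->
  (forall i, (e i %| N)%N) -> (forall i j : 'I_M, (i <= j)%N -> (e i %| e j)%N) ->
  (forall p j, prime p -> (0 < j)%N -> (vcount M nu p j <= #|[set k : 'I_M | (p ^ j %| e k)%N]%SET|)%N) ->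
  (n.+1 %| N)%N -> (0 < a <= M)%N ->
  (N %/ n.+1)%N%:R * \prod_i (ff e n i)%:R^-1 * ((\prod_(i < M | (M - a <= i)%N) ff e n i)%N%:R) `^ kappa R M a
   <= 2 ^+ M * norm_bound M N (\prod_i (e i)%:R) (@Ffactor M R nu r2 N) 0.
Proof.
move=> N0 e0 eN ch hv nN /andP[a0 aM]; have M3 : 3 <= M%:R :> R by rewrite ler_nat.
pose X : R := (N %/ n.+1)%N%:R; pose c : R := n.+1%:R; set k := kappa R M a; rewrite -/X.
have XcE : X * c = N%:R by rewrite -natrM divnK.
have Nc0 : (0 < N %/ n.+1)%N by rewrite divn_gt0 // dvdn_leq.
have X1 : 1 <= X by rewrite ler1n.
have c1 : 1 <= c by rewrite ler1n.
pose x i : R := (ff e n i)%:R; pose g i : R := (gg e n i)%:R.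
have hx i : 1 <= x i <= X.
  rewrite /x /X ler1n ff_gt0 //= ler_nat; apply: dvdn_leq => //.
  rewrite -(@dvdn_pmul2r n.+1) // divnK // ff_lcm dvdn_lcm eN nN //.
have hg i : 1 <= g i <= c.
  by rewrite /g /c ler1n gg_gt0 /= ler_nat dvdn_leq // gg_dvdc.
have xg i : x i * g i = (e i)%:R by rewrite -natrM ff_gg.
pose t (i : 'I_M) := if (M - a <= i)%N then k else 0.
have aR : 1 <= a%:R :> R by rewrite ler1n.
have aMR : a%:R <= M%:R :> R by rewrite ler_nat.
have kE : a%:R * k = Num.max a%:R (M%:R / 2) - 1.
  by rewrite /k /kappa mulrC divfK // gt_eqF //; lra.
have k0 : 0 <= k.
  have : 0 <= a%:R * k by rewrite kE subr_ge0 le_max; apply/orP; right; lra.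
  by rewrite pmulr_rge0 //; lra.
have t0 i : 0 <= t i by rewrite /t; case: ifP.
have tk i : t i <= k by rewrite /t; case: ifP.
have st : \sum_i t i = a%:R * k.
  by rewrite -big_mkcond /= -(card_top aM) mulr_suml; apply: eq_bigr => i _; rewrite mul1r.
have tE : \prod_i (x i) `^ t i = ((\prod_(i < M | (M - a <= i)%N) ff e n i)%N%:R) `^ k.
  rewrite natr_prod powR_prod // [RHS]big_mkcond; apply: eq_bigr => i _; rewrite /t.
  by case: ifP => _ //; rewrite powRr0.
rewrite -tE; set base := X * _ * _.
have ep i : 0 < (e i)%:R :> R by rewrite ltr0n.
have core (w sg : 'I_M -> R) h : (forall i, 0 <= w i) -> (forall i, 0 <= sg i) ->
   (forall i, w i - 1 + t i <= sg i) -> \sum_i sg i <= h - 1 -> \sum_i w i <= h ->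
   base <= N%:R `^ h / \prod_i (e i)%:R `^ w i.
  move=> w0 s0 ws hs hw; have := weight_ineq X1 c1 hx hg w0 s0 ws hs hw.
  rewrite XcE -/base; under eq_bigr do rewrite xg; rewrite ler_pdivlMr //.
  by apply: prodr_gt0 => i _; exact: powR_gt0.
have Mi : 0 < 1 / M%:R :> R by rewrite divr_gt0.
have Mu : M%:R * (1 / M%:R) = 1 :> R by rewrite mulrA mulr1 divff // pnatr_eq0.
have q0 : 0 <= 1 - 1 / M%:R :> R by rewrite subr_ge0 mul1r invf_le1 //; lra.
have two1 : 1 <= 2 ^+ M :> R by rewrite exprn_ege1 // ler1n.
have caseA : k <= 1 - 1 / M%:R -> base <= N%:R `^ 1 / (\prod_i (e i)%:R) `^ (1 / M%:R).
  move=> hk; rewrite powR_prod //; apply: (core (fun=> 1 / M%:R) (fun=> 0)) => //.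
  - by move=> i; move: (tk i) hk; move: (1 / M%:R : R) => u; lra.
  - by rewrite big1 // subrr.
  - by rewrite sumr_const card_ord -[(1 / M%:R) *+ M]mulr_natl Mu.
(* Either the [t i] have sum $M/2 - 1$ and serve as [sg], or $\kappa \le 1 - 1/M$ and [sg] is taken
   proportional to the weights. *)
have caseB s : 0 <= s -> s <= M%:R / 2 ->
   (a%:R * k = M%:R / 2 - 1 \/ (k <= 1 - 1 / M%:R /\ s * (1 - 1 / M%:R) <= M%:R / 2 - 1)) ->
   base <= 2 ^+ M * (N%:R `^ (M%:R / 2) / @Ffactor M R nu r2 N s).
  move=> s0 s2 hk; have sw := wgt_sum M s0.
  have w0 (i : 'I_M) : 0 <= wgt s i by exact: clip_ge0.
  have w1 (i : 'I_M) : wgt s i <= 1 by exact: clip_le1.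
  have hb : base <= N%:R `^ (M%:R / 2) / \prod_i (e i)%:R `^ wgt s i.
    case: hk => [hk|[hk hs]].
      apply: (core (wgt s) t) => //; [by move=> i; have := w1 i; lra|by rewrite st hk|by apply: le_trans sw _].
    apply: (core (wgt s) (fun i => wgt s i * (1 - 1 / M%:R))) => //.
    - by move=> i; rewrite mulr_ge0.
    - move=> i; have := tk i; have := w1 i; have : wgt s i * (1 / M%:R) <= 1 * (1 / M%:R) by rewrite ler_wpM2r // ltW.
      by move: hk; move: (1 / M%:R : R) => u; lra.
    - by rewrite -mulr_suml; apply: le_trans hs; rewrite ler_wpM2r.
    - exact: le_trans sw _.
  have /andP[F0 F1] := Ffactor_le N0 e0 eN ch r2 s0 hv.
  apply: (le_trans hb); rewrite mulrCA ler_wpM2l ?powR_ge0 //.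
  have P0 : 0 < \prod_i (e i)%:R `^ wgt s i by apply: prodr_gt0 => i _; exact: powR_gt0.
  by rewrite -[leLHS]mul1r ler_pdivrMr // mulrAC ler_pdivlMr // mul1r.
have kl : a%:R < M%:R / 2 :> R -> a%:R * k = M%:R / 2 - 1 by move=> h; rewrite kE max_r // ltW.
have kr : M%:R / 2 <= a%:R :> R -> k <= 1 - 1 / M%:R.
  move=> h; have E : a%:R * k = a%:R - 1 by rewrite kE max_l.
  have ai : 0 < a%:R :> R by lra.
  rewrite -(ler_pM2l ai) E mulrBr mulr1 lerB // mulrA mulr1 ler_pdivrMr ?mul1r //; lra.
have grow (y : R) : 0 <= y -> y <= 2 ^+ M * y by move=> y0; rewrite ler_peMl.
have Aend : k <= 1 - 1 / M%:R -> base <= 2 ^+ M * (N%:R `^ 1 / (\prod_i (e i)%:R) `^ (1 / M%:R)).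
  by move=> h; apply: le_trans (caseA h) _; apply: grow; rewrite divr_ge0 ?powR_ge0.
rewrite /norm_bound; case: ifP => [/eqP E|E3].
  have M3' : M%:R = 3 :> R by rewrite E.
  (* For $a = 1$ one has $\kappa = 1/2$, still below $1 - 1/3$. *)
  rewrite addr0 -M3'; apply: Aend; have [h|h] := ltP (a%:R : R) (M%:R / 2); last exact: kr.
  have := kl h; have : k <= a%:R * k by rewrite ler_peMl.
  rewrite M3'; lra.
case: ifP => [/eqP E|E4].
  have M4 : M%:R = 4 :> R by rewrite E.
  have [h|h] := ltP (a%:R : R) (M%:R / 2).
    have h2 : 2 <= M%:R / 2 :> R by rewrite M4; clear - M4; lra.
    have := caseB 2 (ler0n _ _) h2 (or_introl (kl h)).
    have -> : M%:R / 2 = 2 + 0 :> R by rewrite M4; clear - M4; lra.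
    move=> hb; apply: le_trans hb _; rewrite ler_wpM2l ?exprn_ge0 // lerDl divr_ge0 ?powR_ge0 //.
  have := Aend (kr h); rewrite M4 => hb; apply: le_trans hb _.
  by rewrite ler_wpM2l ?exprn_ge0 // !addr0 lerDr divr_ge0 ?powR_ge0 ?Ffactor_ge0.
have M5 : 5 <= M%:R :> R by rewrite ler_nat; move: E3 E4 m1; case: (m) => [|[|[|k']]].
have u5 : 1 / M%:R <= 1 / 5 :> R by rewrite !mul1r lef_pV2 ?posrE //; lra.
rewrite addr0; apply: caseB.
- by move: M5 u5; move: (1 / M%:R : R) => u; clear; lra.
- by move: Mi; move: (1 / M%:R : R) => u; clear; lra.
have [h|h] := ltP (a%:R : R) (M%:R / 2); [by left; exact: kl|right; split; first exact: kr].
(* This product differs from $M/2 - 1$ by $-1/(2M) + 1/M^2$, which is negative here. *)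
have -> : ((M%:R - 1) / 2 - 1 / M%:R) * (1 - 1 / M%:R) = M%:R / 2 - 1 - (1 / M%:R) / 2 + (1 / M%:R) * (1 / M%:R) :> R.
  have Mn : M%:R != 0 :> R by rewrite pnatr_eq0.
  by move: (M%:R : R) Mn => z zn; field.
have : (1 / M%:R) * (1 / M%:R) <= 1 / M%:R * (1 / 5) :> R by rewrite ler_wpM2l // ltW.
by move: Mi; move: (1 / M%:R : R) => u; clear; lra.
Qed.

(** In [2 * eps] one [eps] comes from counting representations and one from trading $e^{-Y/N}$. The
    prefactor is matched by $\prod f_i^{-1} = \#\mathrm{Rad}/\det Q$. *)
Lemma one_form (eps : R) : 0 < eps <= 1 -> exists2 C : R, 0 < C &
  forall (N' : nat) (Q : 'M[int]_M) nu r2 (n : nat) (a b d : int) (w : R[i]),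
  let N := N'.+1 in
  even_posdef R Q -> level_multiple Q N -> local_exponents Q nu r2 ->
  (n.+1 %| N)%N -> a * d - b * n.+1%:Z = 1 -> 4 / 5 <= complex.Im w ->
  (N %/ n.+1)%N%:R * \sum_(0 <= j < N) ((\det Q)%:~R^-1 / n.+1%:R ^+ M * complex.Im w `^ (M%:R / 2) *
     cabs (Th n Q a (w + (d%:~R / n.+1%:R)%:C%C + j%:R) - Gs R n Q a 0) ^+ 2) <=
  N%:R * (C * N%:R `^ (2 * eps) * complex.Im w `^ (1 - eps) *
     norm_bound M N (\det Q)%:~R (@Ffactor M R nu r2 N) 0).
Proof.
move=> he; have /andP[e0 e1] := he; have M3 : 3 <= M%:R :> R by rewrite ler_nat.
have [C1 C10 hC1] := class_bounds m he.
have [C2 C20 hC2] := combine (M := M) (m1 : (3 <= M)%N) e0.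
exists (C1 * C1 * C2 * 2 ^+ M) => [|N' Q nu r2 n a b d w N eQ lQ hJ nN det1 Y45]; first by apply: mulr_gt0; [rewrite !mulr_gt0|exact: exprn_gt0].
set Y := complex.Im w in Y45 *; have Y0 : 0 < Y by lra.
have dQ := evpd_det eQ; have dQ0 : \det Q != 0 by rewrite gt_eqF.
have [B [eB QB BQ]] := level_inverse dQ0 (evpd_evsym eQ).1 lQ.
have [A [P [e [uA uP QE ep ch]]]] := smith_exists dQ0.
have ca : coprimez a n.+1%:Z.
  by apply/coprimezP; exists (d, - b) => /=; rewrite -det1; ring.
pose w' := w + (d%:~R / n.+1%:R)%:C%C.
have Iw : complex.Im w' = Y by rewrite /w' Im_addint.
have w0 : 0 < complex.Im w' by rewrite Iw.
have Y45' : 4 / 5 <= complex.Im w' by rewrite Iw.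
have [dd [d0 dh dprod [hr hs]]] := hC1 N' Q B A P e n a w' eQ eB QB uA uP QE ep ch nN ca Y45'.
rewrite Iw in hr hs.
have := avg_bound eQ eB QB ca w0; rewrite Iw => /(_ _ _ hr hs); rewrite -/w' => havg.
have N0 : 0 < N%:R :> R by rewrite ltr0n.
have Y12 : 1 / 2 <= Y by lra.
have [a0 [ha hcomb]] := hC2 dd Y N%:R d0 dh Y12 N0.
have eN := smith_level uA QE QB.
have harith := main_arith (nu := nu) r2 (ltn0Sn N') ep eN ch (fun p j pp j0 => vcount_le (evpd_evsym eQ) hJ uA uP QE pp j0) nN ha.
have dE : (\det Q)%:~R = \prod_i (e i)%:R :> R.
  by rewrite (smith_det uA uP QE dQ) rmorph_prod.
rewrite -dE in harith.
have RadE := Rad_card uA uP QE ep n.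
have dP := dprod a0 (proj2 (andP ha)).
set Fa : R := (\prod_(i < M | (M - a0 <= i)%N) ff e n i)%N%:R in harith dP.
have Pd : 0 < \prod_(0 <= i < a0) dd i by apply: prodr_gt0.
have kap0 : 0 <= kappa R M a0.
  rewrite /kappa divr_ge0 // subr_ge0 le_max; apply/orP; right; move: M3; clear; lra.
have Fd : ((\prod_(0 <= i < a0) dd i)^-1) `^ kappa R M a0 <= Fa `^ kappa R M a0.
  rewrite ge0_ler_powR ?nnegrE ?invr_ge0 ?(ltW Pd) // -[leLHS]mul1r ler_pdivrMr //.
set T := norm_bound _ _ _ _ _ in harith *.
rewrite -mulr_sumr; set S := \sum_(0 <= j < N) _ in havg *.
set mbsb := (_ * _ * _ * \prod_(2 <= i < M) _) * _ in havg.
have hm : Y `^ (M%:R / 2) * mbsb <= C1 * C1 * N%:R `^ eps * (C2 * N%:R `^ eps * Y `^ (1 - eps) * Fa `^ kappa R M a0).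
  have h1 : 0 <= C1 * C1 * N%:R `^ eps by rewrite !mulr_ge0 ?powR_ge0 // ltW.
  have h2 : 0 <= C2 * N%:R `^ eps * Y `^ (1 - eps) by rewrite !mulr_ge0 ?powR_ge0 // ltW.
  apply: le_trans (ler_wpM2l h1 (le_trans hcomb (ler_wpM2l h2 Fd))).
  by rewrite le_eqVlt; apply/orP; left; apply/eqP; rewrite /mbsb; ring.
have K0 : 0 <= (\det Q)%:~R^-1 / n.+1%:R ^+ M * Y `^ (M%:R / 2) :> R.
  by rewrite !mulr_ge0 ?powR_ge0 ?invr_ge0 ?exprn_ge0 // ler0z ltW.
have X0 : 0 <= (N %/ n.+1)%N%:R :> R by [].
apply: le_trans (ler_wpM2l X0 (ler_wpM2l K0 havg)) _.
have pf : \prod_i (ff e n i)%:R^-1 = (\det Q)%:~R^-1 * #|Rad n Q|%:R :> R.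
  rewrite dE RadE natr_prod -prodfV -big_split /=; apply: eq_bigr => i _.
  have g0 : (gg e n i)%:R != 0 :> R by rewrite pnatr_eq0 -lt0n gg_gt0.
  by rewrite -(ff_gg e n i) natrM invfM mulfVK.
have cn : (n.+1 ^ M)%:R = n.+1%:R ^+ M :> R by rewrite natrX.
have c0 : n.+1%:R ^+ M != 0 :> R by rewrite expf_neq0 // pnatr_eq0.
have D0 : (\det Q)%:~R != 0 :> R by rewrite intr_eq0.
have -> : (N %/ n.+1)%N%:R * ((\det Q)%:~R^-1 / n.+1%:R ^+ M * Y `^ (M%:R / 2) * (N%:R * ((n.+1 ^ M)%:R * #|Rad n Q|%:R * mbsb))) =
   N%:R * ((N %/ n.+1)%N%:R * \prod_i (ff e n i)%:R^-1 * (Y `^ (M%:R / 2) * mbsb)) :> R.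
  rewrite pf cn; move: (n.+1%:R ^+ M) c0 ((\det Q)%:~R) D0 => x x0 y y0; move: (N%:R) (N %/ _)%N%:R => u v; field.
  by rewrite x0 y0.
rewrite ler_wpM2l ?(ltW N0) //.
have L0 : 0 <= (N %/ n.+1)%N%:R * \prod_i (ff e n i)%:R^-1 :> R.
  by rewrite mulr_ge0 //; apply: prodr_ge0 => i _; rewrite invr_ge0.
apply: le_trans (ler_wpM2l L0 hm) _.
have Z0 : 0 <= C1 * C1 * C2 * (N%:R `^ eps * N%:R `^ eps) * Y `^ (1 - eps) :> R.
  by rewrite !mulr_ge0 ?powR_ge0 // ltW.
have := ler_wpM2l Z0 harith.
have -> : N%:R `^ (2 * eps) = N%:R `^ eps * N%:R `^ eps :> R.
  rewrite -powRD; last by apply/implyP => _; rewrite gt_eqF.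
  by congr (_ `^ _); ring.
move=> h; apply: le_trans (le_trans _ h) _; rewrite le_eqVlt; apply/orP; left; apply/eqP; ring.
Qed.
End PairBound.

Section Petersson.
Variable R : realType.
Local Notation mu := (@lebesgue2 R).

(** With equal arguments the integrand is real and nonnegative, so a finite Lebesgue integral gives
    integrability and the value at once. *)
Lemma petersson_of_integral (D : set (R * R)) (k : R) (F : R[i] -> R[i]) (B : R) : measurable D ->
  D `<=` @upper_half_plane R -> mC F ->
  (\int[mu]_(z in D) (cabs (F (to_complex z)) ^+ 2 * z.2 `^ (k - 2))%:E <= B%:E)%E ->
  petersson_norm_le D k F B.
Proof.
move=> mD DH mF hB; pose g (z : R * R) := cabs (F (to_complex z)) ^+ 2 * z.2 `^ (k - 2).
have g0 z : 0 <= g z by rewrite mulr_ge0 ?sqr_ge0 ?powR_ge0.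
have E z : petersson_integrand k F F z = (g z)%:C%C.
  by rewrite /petersson_integrand -cabs_conjM -rmorphM.
have ReE : (fun z => complex.Re (petersson_integrand k F F z)) = g by apply/funext => z; rewrite E.
have ImE : (fun z => complex.Im (petersson_integrand k F F z)) = (fun=> 0) by apply/funext => z; rewrite E.
have mg : measurable_fun D (fun z => (g z)%:E).
  by apply/measurable_EFinP; apply: measurable_funS (mC_abs (k - 2) mF); [exact: measurable_H|].
have gfin : (\int[mu]_(z in D) (g z)%:E < +oo)%E by apply: le_lt_trans hB _; rewrite ltry.
have ig0 : (0 <= \int[mu]_(z in D) (g z)%:E)%E by apply: integral_ge0 => z _; rewrite lee_fin.
split.
  split.
    rewrite (_ : (fun z => _) = (fun z => (g z)%:E)); last by apply/funext => z; rewrite E.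
    apply/integrableP; split => //; apply: le_lt_trans gfin; rewrite le_eqVlt; apply/orP; left; apply/eqP.
    by apply: eq_integral => z _; rewrite gee0_abs // lee_fin.
  rewrite (_ : (fun z => _) = cst 0%E); first exact: integrable0.
  by apply/funext => z; rewrite E.
rewrite /petersson ReE ImE /Rintegral integral0 lecE /= eqxx /=.
by rewrite -lee_fin fineK // ge0_fin_numE.
Qed.
End Petersson.

Section PairIntegral.
Variables (R : realType) (m : nat).
Hypothesis m1 : (1 <= m)%N.
Local Notation M := m.+2.
Local Notation mu := (@lebesgue2 R).

Lemma pair_bound (eps : R) : 0 < eps -> exists2 C : R, 0 < C &
  forall (Q S : 'M[int]_M) N nu r2 (D : set (R * R)),
  even_posdef R Q -> genus R Q S -> level_multiple Q N -> (0 < N)%N -> local_exponents Q nu r2 ->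
  fundamental_domain N D ->
  (\int[mu]_(z in D) (cabs (theta Q (to_complex z) - theta S (to_complex z)) ^+ 2 * z.2 `^ (M%:R / 2 - 2))%:E
    <= (C * norm_bound M N (\det Q)%:~R (@Ffactor M R nu r2 N) eps)%:E)%E.
Proof.
(* Three copies of [e1] are spent, two in [one_form] and one on the divisors of [N]; the minimum
   with 1 keeps [e1] in the range of [one_form]. *)
move=> eps0; pose e1 : R := Num.min eps 1 / 4.
have mn0 : 0 < Num.min eps 1 by rewrite lt_min eps0 ltr01.
have mn1 : Num.min eps 1 <= 1 by rewrite ge_min lexx orbT.
have mn2 : Num.min eps 1 <= eps by rewrite ge_min lexx.
have e10 : 0 < e1 by rewrite divr_gt0.
have e11 : 0 < e1 <= 1 by rewrite e10 /e1; lra.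
have e3 : 3 * e1 <= eps by rewrite /e1; lra.
have [C1 C10 hC1] := one_form m1 e11.
have [C2 C20 hC2] := ndiv_bound e10.
exists (C2 * (4 * C1) / e1 * (4 / 5) `^ (- e1)) => [|Q S N nu r2 D eQ gS lQ N0 hJ fD].
  by rewrite !mulr_gt0 ?invr_gt0 ?powR_gt0 // divr_gt0.
have eS : even_posdef R S by case: gS.
have dS := genus_det eQ gS.
have lS := genus_level eQ gS lQ.
have hJS := genus_local eQ gS hJ.
pose T := norm_bound M N (\det Q)%:~R (@Ffactor M R nu r2 N) 0.
have dQ := evpd_det eQ.
have T0 : 0 <= T.
  by apply: norm_bound_ge0 => [|s]; [rewrite ler0z ltW|exact: Ffactor_ge0].
have NR : 0 < N%:R :> R by rewrite ltr0n.
have NR1 : 1 <= N%:R :> R by rewrite ler1n.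
pose Kc := C2 * N%:R `^ e1 * (4 * C1 * N%:R `^ (2 * e1) * T).
have Kc0 : 0 <= Kc by rewrite /Kc !mulr_ge0 ?powR_ge0 // ltW.
pose F (z : R[i]) := theta Q z - theta S z.
pose phi := Phi (R := R) M F.
have phi0 z : 0 <= phi z by rewrite /phi /Phi mulr_ge0 ?sqr_ge0 ?powR_ge0.
have mF : mC F by apply: mC_B; exact: mC_theta.
have mphi : measurable_fun (@upper_half_plane R) (fun z : R * R => phi (to_complex z)).
  exact: mC_abs.
pose bd (y : R) := Kc * y `^ (1 - e1).
have bd0 y : 0 <= bd y by rewrite mulr_ge0 ?powR_ge0.
have mbd : measurable_fun setT bd.
  by apply: measurable_funM; [exact: measurable_cst|exact: measurable_powR].
have hbd (w : R * R) (s : seq 'M[int]_2) : siegel w -> uniq s ->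
  (forall g, g \in s -> \det g = 1) ->
  (forall g g' t, g \in s -> g' \in s -> Gamma0 N t -> g = t *m g' -> g = g') ->
  \sum_(g <- s) phi (moebius g (to_complex w)) <= bd w.2.
  move=> [_ _ Y45] us ds hin; have Y0 : 0 < w.2 by lra.
  have w0 : 0 < complex.Im (to_complex w) by [].
  pose Z := C1 * N%:R `^ (2 * e1) * w.2 `^ (1 - e1) * T.
  have Z0 : 0 <= Z by rewrite /Z !mulr_ge0 ?powR_ge0 // ltW.
  (* The denominator cancels the width [N %/ c] in [coset_sum], so all divisors contribute the same
     amount [4 * Z]. *)
  pose A c : R := 4 * Z / (N %/ c)%N%:R.
  have A0 c : 0 <= A c by rewrite /A divr_ge0 // mulr_ge0.
  have phiG g z : Gamma0 N g -> 0 < complex.Im z -> phi (moebius g z) = phi z.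
    by move=> gN z0; exact: (Phi_inv eQ gS lQ N0 gN z0).
  have hA c h : (c %| N)%N -> \det h = 1 -> h 1 0 = c%:Z ->
      \sum_(0 <= j < N) phi (moebius h (to_complex w + j%:R)) <= N%:R * A c.
    case: c => [|n] cN dh h10; first by move: cN; rewrite dvd0n => /eqP E; move: N0; rewrite E.
    have Xp : 0 < (N %/ n.+1)%N%:R :> R by rewrite ltr0n divn_gt0 // dvdn_leq.
    have det1 : h 0 0 * h 1 1 - h 0 1 * n.+1%:Z = 1 by rewrite -h10 -det2.
    have ca : coprimez (h 0 0) n.+1%:Z.
      by apply/coprimezP; exists (h 1 1, - h 0 1) => /=; rewrite -det1; ring.
    have [N' NE] : exists N', N = N'.+1 by exists N.-1; rewrite prednK.
    have oQ := hC1 N' Q nu r2 n (h 0 0) (h 0 1) (h 1 1) (to_complex w).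
    have oS := hC1 N' S nu r2 n (h 0 0) (h 0 1) (h 1 1) (to_complex w).
    rewrite /= -NE in oQ oS.
    have {}oQ := oQ eQ lQ hJ cN det1 Y45; have {}oS := oS eS lS hJS cN det1 Y45.
    rewrite dS -/T -/Z in oS; rewrite -/T -/Z in oQ.
    have GE := Gs_genus n (h 0 0) eQ gS; rewrite -GE in oS.
    set K := (\det Q)%:~R^-1 / _ * _ in oQ oS.
    have K0 : 0 <= K by rewrite /K !mulr_ge0 ?powR_ge0 ?invr_ge0 ?exprn_ge0 // ler0z ltW.
    set SQ := \sum_(0 <= j < N) _ in oQ; set SS := \sum_(0 <= j < N) _ in oS.
    (* By [GE] the two dual series share the constant term [g], so $|x-y|^2 \le 2|x-g|^2 + 2|y-g|^2$
       reduces the pair to [one_form] for each form. *)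
    have hs : \sum_(0 <= j < N) phi (moebius h (to_complex w + j%:R)) <= 2 * SQ + 2 * SS.
      rewrite /SQ /SS !mulr_sumr -big_split /=; apply: ler_sum => j _.
      have Ij : complex.Im (to_complex w + j%:R) = w.2 by have := Im_int (to_complex w) j; rewrite -[(j%:Z)%:~R]/(j%:R).
      have wj : 0 < complex.Im (to_complex w + j%:R) by rewrite Ij.
      rewrite moebius_actf h10 /phi (Phi_transform eQ eS dS det1 wj) Ij -/K addrAC.
      move: (Th n Q _ _) (Th n S _ _) (Gs R n Q _ _) => x y g.
      have : cabs (x - y) <= cabs (x - g) + cabs (y - g).
        have -> : x - y = (x - g) - (y - g) by ring.
        exact: cabsB.
      move: (cabs_ge0 (x - y)) (cabs_ge0 (x - g)) (cabs_ge0 (y - g)).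
      move: (cabs (x - y)) (cabs (x - g)) (cabs (y - g)) => p q r p0 q0 r0 pqr.
      have h2 : p ^+ 2 <= 2 * q ^+ 2 + 2 * r ^+ 2 by have := sqr_ge0 (q - r); move: p0 q0 r0 pqr; clear; nra.
      by have := ler_wpM2l K0 h2; clear; lra.
    apply: le_trans hs _; rewrite -(ler_pM2l Xp) /A.
    have -> : (N %/ n.+1)%N%:R * (N%:R * (4 * Z / (N %/ n.+1)%N%:R)) = 4 * (N%:R * Z) :> R.
      by move: ((N %/ n.+1)%N%:R : R) Xp => x xp; field; rewrite gt_eqF.
    by move: oQ oS; clear; lra.
  have hsum := coset_sum N0 phi0 phiG w0 us A0 ds hin hA.
  apply: le_trans hsum _.
  have qp c : (c %| N)%N -> (N %/ c)%N%:R != 0 :> R.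
    move=> cN; rewrite pnatr_eq0 -lt0n divn_gt0; [exact: dvdn_leq N0 cN|exact: dvdn_gt0 N0 cN].
  have -> : \sum_(c <- divisors N) (N %/ c)%N%:R * A c = (ndiv N)%:R * (4 * Z).
    rewrite (eq_big_seq (fun=> 4 * Z)) => [|c].
      by move: (4 * Z) => z4; rewrite big_const_seq count_predT iter_addr_0 mulr_natl.
    rewrite -dvdn_divisors; last exact: N0.
    by move=> cN; rewrite /A mulrC; exact: (divfK (qp c cN)).
  rewrite /bd /Kc -/(Z) [leRHS](_ : _ = C2 * N%:R `^ e1 * (4 * Z)); last by rewrite /Z; ring.
  have Z4 : 0 <= 4 * Z by apply: mulr_ge0.
  exact: (ler_wpM2r Z4 (hC2 _ N0)).
have hfold := fold phi0 mphi fD bd0 mbd hbd.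
have hsi := siegel_integral Kc0 e10.
have [mD DH _] := fD.
apply: (@le_trans _ _ (Kc / e1 * (4 / 5) `^ (- e1))%:E).
  apply: le_trans (le_trans hfold hsi); rewrite le_eqVlt; apply/orP; left; apply/eqP.
  apply: eq_integral => z /set_mem /DH z0; rewrite -EFinM; congr (_%:E).
  rewrite /phi /Phi /F /= hv_pos // mulrCA; congr (_ * _).
  rewrite powRB; last by apply/implyP => _; rewrite gt_eqF.
  by rewrite -[2 : R]/(2%:R) powR_mulrn ?(ltW z0) // mulrC exprVn.
rewrite lee_fin norm_boundE // -/T /Kc.
have hN : N%:R `^ e1 * N%:R `^ (2 * e1) <= N%:R `^ eps :> R.
  rewrite -powRD; last by apply/implyP => _; rewrite gt_eqF.
  by rewrite ler_powR //; lra.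
have L0 : 0 <= C2 * (4 * C1) / e1 * (4 / 5) `^ (- e1) * T.
  by rewrite !mulr_ge0 ?invr_ge0 ?powR_ge0 // ltW.
have := ler_wpM2l L0 hN; move=> h; rewrite [leLHS](_ : _ = C2 * (4 * C1) / e1 * (4 / 5) `^ (- e1) * T * (N%:R `^ e1 * N%:R `^ (2 * e1))); last by ring.
apply: le_trans h _; rewrite le_eqVlt; apply/orP; left; apply/eqP; ring.
Qed.

Lemma jensen_sqr (I : Type) (s : seq I) (om x : I -> R) : (forall i, 0 <= om i) -> \sum_(i <- s) om i = 1 ->
  (\sum_(i <- s) om i * x i) ^+ 2 <= \sum_(i <- s) om i * x i ^+ 2.
Proof.
move=> o0 o1; set X := \sum_(i <- s) om i * x i.
have : 0 <= \sum_(i <- s) om i * (x i - X) ^+ 2 by apply: sumr_ge0 => i _; rewrite mulr_ge0 ?sqr_ge0.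
have key Y : \sum_(i <- s) om i * (x i - Y) ^+ 2 =
    \sum_(i <- s) om i * x i ^+ 2 - 2 * Y * (\sum_(i <- s) om i * x i) + Y ^+ 2 * \sum_(i <- s) om i.
  by rewrite !mulr_sumr -sumrB -big_split /=; apply: eq_bigr => i _; ring.
rewrite key -/X o1 => h; rewrite -subr_ge0; apply: le_trans h _; rewrite le_eqVlt; apply/orP; left; apply/eqP; ring.
Qed.

Lemma genus_average (Q : 'M[int]_M) (s : {fset 'M[int]_M}) (D : set (R * R)) (k B : R) : 0 <= B ->
  even_posdef R Q -> genus_representatives R Q s -> measurable D -> D `<=` @upper_half_plane R ->
  (forall S, genus R Q S ->
    (\int[mu]_(z in D) (cabs (theta Q (to_complex z) - theta S (to_complex z)) ^+ 2 * z.2 `^ (k - 2))%:E <= B%:E)%E) ->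
  petersson_norm_le D k (fun z => theta Q z - theta_genus s z) B.
Proof.
move=> B0 eQ [sg sr] mD DH hS.
have es S : S \in s -> even_posdef R S by move=> /sg[].
have gQ : genus R Q Q.
  have h (A : comPzRingType) : equiv_over A Q Q.
    exists 1%:M; split; first by exists 1%:M; rewrite mulmx1.
    by rewrite trmx1 mul1mx mulmx1.
  by split.
have [T [[Ts _] _]] := sr Q gQ.
pose o (S : 'M[int]_M) : R := (#|` automorphs S|)%:R^-1.
have o0 (S : 'M[int]_M) : 0 <= o S by rewrite invr_ge0.
pose W := \sum_(S <- s) o S.
have W0 : 0 < W.
  rewrite /W (big_fsetD1 T) //= ltr_pwDl ?sumr_ge0 // invr_gt0 ltr0n.
  exact: automorphs_gt0 (es T Ts).
pose om (S : 'M[int]_M) : R := W^-1 * o S.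
have om0 (S : 'M[int]_M) : 0 <= om S by rewrite mulr_ge0 // invr_ge0 ltW.
have om1 : \sum_(S <- s) om S = 1 by rewrite -mulr_sumr mulVf // gt_eqF.
have gE (z : R[i]) : theta_genus s z = \sum_(S <- s) (om S)%:C%C * theta S z.
  have oC (S : 'M[int]_M) : ((#|` automorphs S|)%:R^-1 : R[i]) = (o S)%:C%C by rewrite fmorphV rmorph_nat.
  rewrite /theta_genus (eq_bigr (fun S => (o S)%:C%C)) // -rmorph_sum -/W mulr_sumr.
  have omC (S : 'M[int]_M) : (om S)%:C%C = (W%:C%C)^-1 * (o S)%:C%C by rewrite /om rmorphM fmorphV.
  apply: eq_bigr => S _; rewrite omC -oC -[RHS]mulrA; congr (_^-1 * _); rewrite mulrC.
  by [].
have dE (z : R[i]) : theta Q z - theta_genus s z = \sum_(S <- s) (om S)%:C%C * (theta Q z - theta S z).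
  rewrite gE; under [RHS]eq_bigr do rewrite mulrBr.
  by rewrite sumrB -mulr_suml -rmorph_sum om1 mul1r.
apply: petersson_of_integral => //.
  apply: mC_B; first exact: mC_theta.
  have -> : theta_genus s = fun z : R[i] => \sum_(S <- s) (om S)%:C%C * theta S z by apply/funext => z; exact: gE.
  by apply: mC_sum => S /es eS; apply: mC_Z; exact: mC_theta.
(* Extended by 0 outside [s], so that measurability and nonnegativity hold for every index [S]. *)
pose f (S : 'M[int]_M) (z : R * R) : \bar R := if S \in s then (om S * (cabs (theta Q (to_complex z) - theta S (to_complex z)) ^+ 2 * z.2 `^ (k - 2)))%:E else 0%E.
have mB S : S \in s -> measurable_fun D (fun z : R * R => cabs (theta Q (to_complex z) - theta S (to_complex z)) ^+ 2 * z.2 `^ (k - 2)).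
  move=> /es eS; apply: (measurable_funS (@measurable_H R) DH).
  by apply: (@mC_abs R (fun z => theta Q z - theta S z)); apply: mC_B; exact: mC_theta.
have mf (S : 'M[int]_M) : measurable_fun D (f S).
  rewrite /f; case: (boolP (S \in s)) => Ss; last exact: measurable_cst.
  apply/measurable_EFinP; apply: measurable_funM; [exact: measurable_cst|exact: mB].
have g0 (S : 'M[int]_M) (z : R * R) : 0 <= cabs (theta Q (to_complex z) - theta S (to_complex z)) ^+ 2 * z.2 `^ (k - 2).
  by rewrite mulr_ge0 ?sqr_ge0 ?powR_ge0.
have f0 (S : 'M[int]_M) (z : R * R) : (0 <= f S z)%E by rewrite /f; case: ifP => _ //; rewrite lee_fin mulr_ge0.
apply: (@le_trans _ _ (\int[mu]_(z in D) \sum_(S <- s) f S z)%E).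
  apply: ge0_le_integral => //.
  - by move=> z _; rewrite lee_fin mulr_ge0 ?sqr_ge0 ?powR_ge0.
  - apply/measurable_EFinP; apply: (measurable_funS (@measurable_H R) DH).
    apply: (@mC_abs R (fun z => theta Q z - theta_genus s z)).
    apply: mC_B; first exact: mC_theta.
    have -> : theta_genus s = fun z : R[i] => \sum_(S <- s) (om S)%:C%C * theta S z by apply/funext => z; exact: gE.
    by apply: mC_sum => S /es eS; apply: mC_Z; exact: mC_theta.
  - by apply: emeasurable_sum => S _; exact: mf.
  move=> z _; have -> : (\sum_(S <- s) f S z = (\sum_(S <- s) om S * cabs (theta Q (to_complex z) - theta S (to_complex z)) ^+ 2)%:E * (z.2 `^ (k - 2))%:E)%E.
    rewrite -EFinM mulr_suml -sumEFin; apply: eq_big_seq => S Ss; rewrite /f Ss.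
    by rewrite mulrA.
  rewrite -EFinM lee_fin ler_wpM2r ?powR_ge0 //.
  apply: le_trans (jensen_sqr (fun S => cabs (theta Q (to_complex z) - theta S (to_complex z))) om0 om1).
  rewrite lerXn2r ?nnegrE ?cabs_ge0 ?sumr_ge0 // => [S _|]; first by rewrite mulr_ge0 ?cabs_ge0.
  rewrite dE; apply: le_trans (cabs_sum _ _ _) _; apply: ler_sum => S _.
  by rewrite cabsM cabs_real ger0_norm.
rewrite ge0_integral_sum //.
have -> : B%:E = (\sum_(S <- s) (om S * B)%:E)%E by rewrite sumEFin -mulr_suml om1 mul1r.
rewrite big_seq [leRHS]big_seq; apply: lee_sum => S Ss.
have -> : (\int[mu]_(z in D) f S z = (om S)%:E * \int[mu]_(z in D) (cabs (theta Q (to_complex z) - theta S (to_complex z)) ^+ 2 * z.2 `^ (k - 2))%:E)%E.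
  rewrite -ge0_integralZl_EFin //.
  - by apply: eq_integral => z _; rewrite /f Ss EFinM.
  - by move=> z _; rewrite lee_fin.
  - by apply/measurable_EFinP; exact: mB.
by rewrite EFinM; exact: (lee_wpmul2l (om0 S : (0 <= (om S)%:E)%E) (hS S (sg S Ss))).
Qed.
End PairIntegral.

Theorem theorem1 (R : realType) (m : nat) (hm : (3 <= m)%N)
  (eps : R) (heps : 0 < eps) :
  exists2 C : R, 0 < C &
  forall (Q : 'M[int]_m) (N : nat) (nu : nat -> nat -> nat) (r2 : nat)
    (D : set (R * R)),
  even_posdef R Q -> primitive_form Q -> is_level Q N ->
  local_exponents Q nu r2 -> fundamental_domain N D ->
  let B := C * norm_bound m N (\det Q)%:~R (@Ffactor m R nu r2 N) eps in
  (forall s : {fset 'M[int]_m}, genus_representatives R Q s ->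
     petersson_norm_le D (m%:R / 2)
       (fun z => theta Q z - theta_genus s z) B) /\
  (forall Q' : 'M[int]_m, genus R Q Q' ->
     petersson_norm_le D (m%:R / 2)
       (fun z => theta Q z - theta Q' z) B).
Proof.
case: m hm => [|[|m]] // m1; have [C C0 hC] := pair_bound (m1 : (1 <= m)%N) heps.
exists C => // Q N nu r2 D eQ _ [N0 lQ _] hJ fD B.
have [mD DH _] := fD.
have B0 : 0 <= B.
  rewrite mulr_ge0 ?(ltW C0) //; apply: norm_bound_ge0 => [|s]; last exact: Ffactor_ge0.
  by rewrite ler0z ltW // (evpd_det eQ).
split=> [s hs|S gS].
  by apply: genus_average => // S gS; exact: hC.
apply: petersson_of_integral => //; last exact: hC.
by apply: mC_B; apply: mC_theta => //; case: gS.
Qed.
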